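(* Let $\sigma>0$, let $F:\mathcal P_2(\mathbb R^d)\to\mathbb R$ be $\mathcal C^1$, convex and such that $F(p)\ge\lambda\int|x|^2p(dx)$ for all $p$, for some $\lambda>0$, and assume that $\frac{\delta F}{\delta p}(p,x)=g(x)+G(p,x)$ with $g$ and $G(p,\cdot)$ of class $C^2$ such that: (i) $\underline\kappa I_d\le\nabla^2 g\le\overline\kappa I_d$ for some $\overline\kappa\ge\underline\kappa>0$; (ii) $G$ is $\mathcal W_1$-continuous in $p$ and $|G(p,x)-G(p,y)|\le L_G|x-y|$ for all $x,y,p$; (iii) $|\nabla G(p,x)-\nabla G(q,y)|\le L_G(|x-y|+\mathcal W_1(p,q))$ for all $x,y,p,q$ (gradients in $x$). Let $p_0=e^{-(v_0+w_0)}$ be a probability density, with $v_0,w_0$ of class $C^1$ such that for all $x,y\in\mathbb R^d$: $|\nabla v_0(x)-\nabla v_0(y)|\le\overline\eta_0|x-y|$ and $(\nabla v_0(x)-\nabla v_0(y))\cdot(x-y)\ge\underline\eta_0|x-y|^2$, with $\underline\eta_0>0$; and $|w_0(x)-w_0(y)|+|\nabla w_0(x)-\nabla w_0(y)|\le L_0|x-y|$. For $h>0$ set $p^h_0:=p_0$ and $$p^h_i:=\operatorname*{arg\,min}_{p\in\mathcal P_H}\big\{\mathfrak F^\sigma(p)+h^{-1}H(p|p^h_{i-1})\big\},\qquad i\ge1,$$ and define $p^h_t:=p^h_i$ for $t\in[hi,h(i+1))$. Then, as $h\to0$, the functions $(p^h)_{h>0}$ converge, uniformly on $[0,T]\times\mathbb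 R^d$ for any $T>0$, to the solution $p$ of the mean field Schrödinger dynamics $\partial_tp_t=-\frac{\delta\mathfrak F^\sigma}{\delta p}(p_t,\cdot)\,p_t$ started from $p_0$.
   Context: Notation: $\mathcal P_2(\mathbb R^d)$ is the set of probability measures on $\mathbb R^d$ with finite second moment; $\mathcal W_p$ is the Wasserstein distance of order $p$; a probability measure is identified with its Lebesgue density when it has one. $\mathcal P_H=\{p\in\mathcal P_2(\mathbb R^d):p\text{ has a density and }\sqrt p\in H^1(\mathbb R^d)\}$. $H(p|\tilde p)=\int p\log(p/\tilde p)\,dx$ is the relative entropy. $Q=(0,\infty)\times\mathbb R^d$, $\bar Q=[0,\infty)\times\mathbb R^d$; $C^n(Q)$ is the set of functions $f$ such that $\partial_t^k\nabla^mf$ is continuous on $Q$ for all $2k+m\le n$. Linear derivative: $F:\mathcal P_2(\mathbb R^d)\to\mathbb R$ is $\mathcal C^1$ if there is a function $\frac{\delta F}{\delta p}:\mathcal P_2(\mathbb R^d)\times\mathbb R^d\to\mathbb R$, continuous and with quadratic growth in the second variable, such that for all $p,q\in\mathcal P_2(\mathbb R^d)$, $F(q)-F(p)=\int_0^1\int_{\mathbb R^d}\frac{\delta F}{\delta p}(tq+(1-t)p,x)\,(q-p)(dx)\,dt$. Free energy: for $p\in\mathcal P_H$, $\mathfrak F^{\sigma}(p)=F(p)+\sigma^2I(p)$ with $I(p)=\int|\nabla\sqrt p|^2dx$. By definition, $$\frac{\delta\mathfrak F^{\sigma}}{\delta p}(p,\cdot):=\frac{\delta F}{\delta p}(p,\cdot)-\frac{\sigma^2}{2}\Delta\log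 p-\frac{\sigma^2}{4}|\nabla\log p|^2-\lambda(p),$$ where $\lambda(p)\in\mathbb R$ is chosen so that $\int\frac{\delta\mathfrak F^{\sigma}}{\delta p}(p,x)p(x)dx=0$. Under the hypotheses on $F$ and $p_0$ made in the claim, each of the variational problems defining $p^h_i$ has a unique minimizer, which again satisfies the conditions imposed on $p_0$ in the claim (with different constants), so the sequence is well defined; and the dynamics has a unique positive classical solution $p\in C^3(Q)\cap C(\bar Q)$ with initial value $p_0$. *)

(* Defs.v *)
From HB Require Import structures.
From mathcomp Require Import all_boot all_order all_algebra.
From mathcomp Require Import all_classical all_reals all_analysis.
From mathcomp Require Import measurable_realfun.
From mathcomp Require Import ring lra.
Set Implicit Arguments.
Unset Strict Implicit.
Unset Printing Implicit Defensive.
Import Order.TTheory GRing.Theory Num.Theory.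
Import numFieldTopology.Exports numFieldNormedType.Exports.
Local Open Scope classical_set_scope.
Local Open Scope ring_scope.

(* The Borel sigma-algebra on matrices, hence on 'rV[R]_d. *)
Definition borel_mx_display : measure_display.
Proof. exact: default_measure_display. Qed.

Section borel_mx.
Context {R : realType} {m n : nat}.

Definition borel_mx : set (set 'M[R]_(m, n)) := <<s open >>.

Let borel_mx0 : borel_mx set0.
Proof. exact: sigma_algebra0. Qed.

Let borel_mxC A : borel_mx A -> borel_mx (~` A).
Proof. exact: sigma_algebraC. Qed.

Let borel_mx_bigcup (F : (set 'M[R]_(m, n))^nat) :
  (forall i, borel_mx (F i)) -> borel_mx (\bigcup_i F i).
Proof. exact: sigma_algebra_bigcup. Qed.

HB.instance Definition _ := @isMeasurable.Build borel_mx_display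
  'M[R]_(m, n) borel_mx borel_mx0 borel_mxC borel_mx_bigcup.

End borel_mx.

Lemma open_measurable_mx (R : realType) m n (A : set 'M[R]_(m, n)) :
  open A -> measurable A.
Proof. exact: sub_sigma_algebra. Qed.

Lemma continuous_measurable_mx (R : realType) m n p q
  (f : 'M[R]_(m, n) -> 'M[R]_(p, q)) : continuous f -> measurable_fun setT f.
Proof.
move=> cf; apply: (@measurability _ _ _ _ _ _ (@open 'M[R]_(p, q)) erefl).
move=> _ [A oA <-]; rewrite setTI; apply: open_measurable_mx.
by apply: open_comp => // x _; exact: cf.
Qed.

Lemma measurable_coord_mx (R : realType) m n (i : 'I_m) (j : 'I_n) :
  measurable_fun setT (fun A : 'M[R]_(m, n) => A i j).
Proof.
apply: (measurability _ (RGenOInfty.measurableE R)).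
move=> _ [_ [a ->] <-]; rewrite setTI; apply: open_measurable_mx.
by apply: open_comp => [A _|]; [exact: coord_continuous|exact: rray_open].
Qed.

Section lebesgue_rV.
Context {R : realType}.

Definition cons_rV n (z : R * 'rV[R]_n) : 'rV[R]_(1 + n) :=
  row_mx (const_mx z.1) z.2.

Lemma measurable_cons_rV n : measurable_fun setT (@cons_rV n).
Proof.
apply: (@measurability _ _ _ _ _ _ (@open 'rV[R]_(1 + n)) erefl).
move=> _ [U oU <-]; rewrite setTI.
pose e k : R := k.+1%:R^-1.
pose box (u : rat * 'rV[rat]_n * nat) : set (R * 'rV[R]_n) :=
  ball (ratr u.1.1 : R) (e u.2) `*` ball (map_mx ratr u.1.2 : 'rV[R]_n) (e u.2).
pose F u := if pselect (box u `<=` @cons_rV n @^-1` U) then box u else set0.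
rewrite (_ : _ @^-1` U = \bigcup_u F u); last first.
  apply/seteqP; split => [z Uz|z [u _]]; last first.
    by rewrite /F; case: pselect => // boxU /boxU.
  have /nbhs_ballP[r /= r0 rU] : nbhs (cons_rV z) U by apply: open_nbhs_nbhs.
  have [k kr] : exists k, e k < r / 2.
    have r2 : 0 < r / 2 by rewrite divr_gt0.
    by have [k _ /(_ k (leqnn k)) /= ?] := near_infty_natSinv_lt (PosNum r2); exists k.
  have ek : 0 < e k by rewrite /e invr_gt0.
  have approx (x : R) : {q : rat | ball (ratr q : R) (e k) x}.
    apply: cid; have [|q] := @rat_in_itvoo R (x - e k) (x + e k).
      by rewrite ltrBlDr -addrA ltrDl addr_gt0.
    rewrite in_itv/= => /andP[q1 q2]; exists q.
    by rewrite /ball/= ltr_distl -ltrBlDr q1/=  -ltrBrDr; lra.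
  exists (sval (approx z.1), \row_j sval (approx (z.2 ord0 j)), k) => //.
  have bz : box (sval (approx z.1), \row_j sval (approx (z.2 ord0 j)), k) z.
    split; first exact: (svalP (approx z.1)).
    split=> // i j; rewrite !mxE (ord1 i); exact: (svalP (approx (z.2 ord0 j))).
  rewrite /F; case: pselect => // -[] w [/= w1 [_ w2]]; apply: rU.
  have [/= z1 [_ z2]] := bz.
  split=> // i j; rewrite /cons_rV !mxE; case: (fintype.split j) => j'.
    rewrite !mxE; apply: (@ball_splitr R R (ratr (sval (approx z.1)) : R)).
      exact: (le_ball (ltW kr) z1).
    exact: (le_ball (ltW kr) w1).
  apply: (@ball_splitr R R (map_mx ratr (\row_j sval (approx (z.2 ord0 j))) i j' : R)).
    exact: (le_ball (ltW kr) (z2 i j')).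
  exact: (le_ball (ltW kr) (w2 i j')).
apply: countable_bigcupT_measurable; first exact: (@countableP _ setT).
move=> u.
rewrite /F; case: pselect => //= _.
apply: measurableX.
  exact: measurable_ball.
by apply: open_measurable_mx; exact: ball_open.
Qed.

Section cons_measure.
Variables (n : nat) (mu : {sigma_finite_measure set 'rV[R]_n -> \bar R}).

Definition cons_measure : set 'rV[R]_(1 + n) -> \bar R :=
  pushforward (@lebesgue_measure R \x mu)%E (@cons_rV n).

Let cons_measure0 : cons_measure set0 = 0%E.
Proof. by rewrite /cons_measure /pushforward preimage_set0 measure0. Qed.

Let cons_measure_ge0 A : (0 <= cons_measure A)%E.
Proof. by rewrite /cons_measure /pushforward measure_ge0. Qed.

Let cons_measure_sigma_additive : semi_sigma_additive cons_measure.
Proof.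
move=> F mF tF mUF; rewrite /cons_measure /pushforward preimage_bigcup.
have mc A : measurable A -> measurable (@cons_rV n @^-1` A).
  by move=> mA; rewrite -[X in measurable X]setTI; exact: measurable_cons_rV.
apply: measure_semi_sigma_additive.
- by move=> i; exact: mc.
- apply/trivIsetP => /= i j _ _ ij; rewrite -preimage_setI.
  by move/trivIsetP : tF => /(_ _ _ _ _ ij) ->//; rewrite preimage_set0.
- by rewrite -preimage_bigcup; exact: mc.
Qed.

HB.instance Definition _ := isMeasure.Build _ _ _ cons_measure
  cons_measure0 cons_measure_ge0 cons_measure_sigma_additive.

Let uncons_rV (v : 'rV[R]_(1 + n)) : R * 'rV[R]_n :=
  (v ord0 (lshift n ord0), rsubmx v).

Let measurable_uncons_rV : measurable_fun setT uncons_rV.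
Proof.
apply/measurable_fun_pairP; split; first exact: measurable_coord_mx.
apply: continuous_measurable_mx => v U /nbhs_ballP[e /= e0 eU].
apply/nbhs_ballP; exists e => //= w [_ vw]; apply: eU; split=> // i j.
by rewrite !mxE; exact: vw.
Qed.

Let cons_measure_sigma_finite : sigma_finite setT cons_measure.
Proof.
have /sigma_finiteP[F [TF ndF Foo]] := sigma_finiteT (@lebesgue_measure R).
have /sigma_finiteP[G [TG ndG Goo]] := sigma_finiteT mu.
exists (fun k => uncons_rV @^-1` (F k `*` G k)).
  apply/seteqP; split => // v _.
  have [k _ Fk] : (\bigcup_k F k) (uncons_rV v).1 by rewrite -TF.
  have [l _ Gl] : (\bigcup_k G k) (uncons_rV v).2 by rewrite -TG.
  exists (maxn k l) => //; split.
    by move: Fk; exact/subsetPset/ndF/leq_maxl.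
  by move: Gl; exact/subsetPset/ndG/leq_maxr.
move=> k; have [mF Fk] := Foo k; have [mG Gk] := Goo k; split.
  rewrite -[X in measurable X]setTI; apply: measurable_uncons_rV => //.
  exact: measurableX.
rewrite /cons_measure /pushforward (_ : _ @^-1` _ = F k `*` G k).
  by rewrite product_measure1E// lte_mul_pinfty// ge0_fin_numE.
by apply/seteqP; split => -[x v];
  rewrite /= /uncons_rV /cons_rV row_mxKr row_mxEl mxE.
Qed.

HB.instance Definition _ := @Measure_isSigmaFinite.Build _ _ _ cons_measure
  cons_measure_sigma_finite.

End cons_measure.

(* d-dimensional Lebesgue measure, as the d-fold product of lebesgue_measure. *)
Fixpoint lebesgue_rV (d : nat) : {sigma_finite_measure set 'rV[R]_d -> \bar R} :=
  match d with
  | 0 => \d_(0 : 'rV[R]_0)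
  | d'.+1 => cons_measure (lebesgue_rV d')
  end.

End lebesgue_rV.
Arguments lebesgue_rV R d : clear implicits.

(* The norm of 'rV[R]_d in the library is the sup norm; quantitative estimates
   below use the Euclidean one. *)
Section euclidean.
Context {R : realType} {d : nat}.
Implicit Types x y : 'rV[R]_d.

Definition dot x y : R := \sum_i x ord0 i * y ord0 i.

Definition enorm x : R := Num.sqrt (dot x x).

End euclidean.

Section calculus.
Context {R : realType} {d : nat}.
Implicit Types (f : 'rV[R]_d -> R) (x : 'rV[R]_d).

Definition partial (i : 'I_d) f x : R := 'D_(delta_mx ord0 i) f x.

Definition grad f x : 'rV[R]_d := \row_i partial i f x.

Definition hess f x : 'M[R]_d := \matrix_(i, j) partial j (partial i f) x.

Definition laplacian f x : R := \sum_i partial i (partial i f) x.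

Fixpoint class_C (k : nat) f : Prop :=
  continuous f /\
  if k is k'.+1 then
    forall i : 'I_d, (forall x, derivable f x (delta_mx ord0 i)) /\
                     class_C k' (partial i f)
  else True.

(* Functions u on Q = ]0, +oo[ * R^d; a time derivative counts for two space
   derivatives. *)
Fixpoint parabolic_C (n : nat) (u : R -> 'rV[R]_d -> R) : Prop :=
  {within [set z : R * 'rV[R]_d | 0 < z.1], continuous (fun z => u z.1 z.2)} /\
  if n is n'.+1 then
    (forall i : 'I_d,
       (forall t x, 0 < t -> derivable (u t) x (delta_mx ord0 i)) /\
       parabolic_C n' (fun t => partial i (u t))) /\
    if n' is n''.+1 then
      (forall t x, 0 < t -> derivable (fun s => u s x) t 1) /\
      parabolic_C n'' (fun t x => derive1 (fun s => u s x) t)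
    else True
  else True.

End calculus.

Section sobolev.
Context {R : realType} {d : nat}.
Implicit Types (f u v : 'rV[R]_d -> R).
Local Notation leb := (lebesgue_rV R d).

Definition test_function f : Prop :=
  (forall k, class_C k f) /\ exists M, forall x, M < enorm x -> f x = 0.

Definition square_integrable u : Prop :=
  measurable_fun setT u /\ (\int[leb]_x (u x ^+ 2)%:E < +oo)%E.

Definition weak_partial (i : 'I_d) u v : Prop :=
  forall f, test_function f ->
    \int[leb]_x (u x * partial i f x) = - \int[leb]_x (v x * f x).

Definition weak_grad u (w : 'rV[R]_d -> 'rV[R]_d) : Prop :=
  forall i, square_integrable (fun x => w x ord0 i) /\
            weak_partial i u (fun x => w x ord0 i).

Definition sobolev_H1 u : Prop :=
  square_integrable u /\ exists w, weak_grad u w.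

(* Meant for sqrt f in H^1: a weak gradient is then unique up to a negligible
   set, and the integral does not depend on the choice made by xget. *)
Definition fisher_information f : \bar R :=
  let w := xget (fun=> 0) [set w | weak_grad (fun x => Num.sqrt (f x)) w] in
  \int[leb]_x (enorm (w x) ^+ 2)%:E.

(* int f log (f / g), with 0 log (0 / g x) = 0, and a log (a / 0) = +oo for
   a > 0. *)
Definition relative_entropy f (g : 'rV[R]_d -> R) : \bar R :=
  \int[leb]_x (if (f x == 0)%R then 0%E
               else if (g x == 0)%R then +oo%E
               else (f x * ln (f x / g x))%:E).

End sobolev.

Lemma measurable_enorm (R : realType) d :
  measurable_fun setT (@enorm R d).
Proof.
apply: measurableT_comp.
  by apply: continuous_measurable_fun; exact: sqrt_continuous.
apply: measurable_sum => i.
by apply: measurable_funM; exact: measurable_coord_mx.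
Qed.

Section P2.
Context {R : realType} {d : nat}.

Record P2 := mkP2 {
  P2_law :> probability 'rV[R]_d R ;
  P2_moment : (\int[P2_law]_x (enorm x ^+ 2)%:E < +oo)%E }.

Definition second_moment (m : P2) : R := \int[m]_x (enorm x ^+ 2).

Section mixture.
Variables (m0 m1 : P2) (t : R).

(* The weight t is truncated to [0, 1] so that the mixture is defined for
   every t. *)
Definition weight : R := Num.max 0 (Num.min t 1).

Let weight_ge0 : 0 <= weight.
Proof. by rewrite /weight le_max lexx. Qed.

Let weight_le1 : weight <= 1.
Proof. by rewrite /weight ge_max ler01 ge_min lexx orbT. Qed.

Let weightC_ge0 : 0 <= 1 - weight.
Proof. by rewrite subr_ge0. Qed.

Definition mixture : set 'rV[R]_d -> \bar R :=
  measure_add (mscale (NngNum weightC_ge0) m0) (mscale (NngNum weight_ge0) m1).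

HB.instance Definition _ := Measure.on mixture.

Let mixture_setT : mixture setT = 1%E.
Proof.
have mT (m : P2) : m setT = 1%E by exact: probability_setT.
rewrite /mixture measure_addE.
transitivity ((1 - weight)%:E * m0 setT + weight%:E * m1 setT)%E => //.
by rewrite !mT !mule1 -EFinD subrK.
Qed.

HB.instance Definition _ := @Measure_isProbability.Build _ _ _ mixture mixture_setT.

Let mixture_moment : (\int[mixture]_x (enorm x ^+ 2)%:E < +oo)%E.
Proof.
have mf : measurable_fun setT (fun x : 'rV[R]_d => (enorm x ^+ 2)%:E).
  by apply/measurable_EFinP; apply: measurable_funX; exact: measurable_enorm.
rewrite ge0_integral_measure_add//; last by move=> x _; rewrite lee_fin sqr_ge0.
rewrite !ge0_integral_mscale//; try by move=> x _; rewrite lee_fin sqr_ge0.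
by apply: lte_add_pinfty; apply: lte_mul_pinfty => //; exact: P2_moment.
Qed.

(* (1 - t) m0 + t m1 *)
Definition P2_mix : P2 := mkP2 mixture_moment.

End mixture.

Definition coupling (m0 m1 : P2)
    (pi : probability ('rV[R]_d * 'rV[R]_d)%type R) : Prop :=
  forall A : set 'rV[R]_d, measurable A ->
    pi (A `*` setT) = m0 A /\ pi (setT `*` A) = m1 A.

Definition wasserstein (r : R) (m0 m1 : P2) : \bar R :=
  ((ereal_inf [set \int[pi]_z ((enorm (z.1 - z.2) `^ r)%:E) |
               pi in coupling m0 m1]) `^ r^-1)%E.

Definition wasserstein_continuous (r : R) (H : P2 -> R) : Prop :=
  forall (m : P2) (e : R), 0 < e -> exists2 dlt : R, 0 < dlt &
    forall m' : P2, (wasserstein r m m' < dlt%:E)%E -> `|H m' - H m| < e.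

(* dF is a linear derivative of F: jointly continuous for W_2 and the usual
   topology of R^d, and with quadratic growth in x. *)
Definition linear_derivative (F : P2 -> R) (dF : P2 -> 'rV[R]_d -> R) : Prop :=
  [/\ forall (m : P2) (x : 'rV[R]_d) (e : R), 0 < e ->
        exists2 dlt : R, 0 < dlt & forall (m' : P2) (y : 'rV[R]_d),
          (wasserstein 2 m m' < dlt%:E)%E -> enorm (x - y) < dlt ->
          `|dF m' y - dF m x| < e,
      forall m : P2, exists C : R, forall x,
        `|dF m x| <= C * (1 + enorm x ^+ 2) &
      forall m0 m1 : P2,
        let slope t := \int[m1]_x dF (P2_mix m0 m1 t) x -
                       \int[m0]_x dF (P2_mix m0 m1 t) x in
        (@lebesgue_measure R).-integrable `[0, 1] (EFin \o slope) /\
        F m1 - F m0 = \int[@lebesgue_measure R]_(t in `[0, 1]) slope t].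

Definition P2_convex (F : P2 -> R) : Prop :=
  forall (m0 m1 : P2) (t : R), 0 <= t <= 1 ->
    F (P2_mix m0 m1 t) <= (1 - t) * F m0 + t * F m1.

Definition has_density (m : P2) (f : 'rV[R]_d -> R) : Prop :=
  [/\ measurable_fun setT f, forall x, 0 <= f x &
      forall A, measurable A -> m A = (\int[lebesgue_rV R d]_(x in A) (f x)%:E)%E].

(* m belongs to P_H and f is (a version of) its density. *)
Definition PH_density (m : P2) (f : 'rV[R]_d -> R) : Prop :=
  has_density m f /\ sobolev_H1 (fun x => Num.sqrt (f x)).

Section scheme.
Variables (F : P2 -> R) (sigma h : R).

Definition free_energy (m : P2) (f : 'rV[R]_d -> R) : \bar R :=
  ((F m)%:E + (sigma ^+ 2)%:E * fisher_information f)%E.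

Definition entropic_step (g : 'rV[R]_d -> R) (m : P2) (f : 'rV[R]_d -> R) : Prop :=
  PH_density m f /\
  forall (m' : P2) (f' : 'rV[R]_d -> R), PH_density m' f' ->
    (free_energy m f + h^-1%:E * relative_entropy f g <=
     free_energy m' f' + h^-1%:E * relative_entropy f' g)%E.

(* The minimizing measures are represented by their continuous densities, so
   that their values at points are well defined. *)
Definition minimizing_movement (p0 : 'rV[R]_d -> R) (q : nat -> 'rV[R]_d -> R) : Prop :=
  q 0%N = p0 /\
  forall i, continuous (q i.+1) /\ exists m, entropic_step (q i) m (q i.+1).

End scheme.

(* t |-> q i for t in [h i, h (i + 1)[ *)
Definition step_interpolation (h : R) (q : nat -> 'rV[R]_d -> R) (t : R) :
  'rV[R]_d -> R := q (Num.truncn (t / h)).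

Section dynamics.
Variables (dF : P2 -> 'rV[R]_d -> R) (sigma : R).

Definition free_energy_derivative (m : P2) (f : 'rV[R]_d -> R) (lam : R)
    (x : 'rV[R]_d) : R :=
  let logf y := ln (f y) in
  dF m x - sigma ^+ 2 / 2 * laplacian logf x
         - sigma ^+ 2 / 4 * enorm (grad logf x) ^+ 2 - lam.

(* lam normalizes the derivative to have mean zero under f. *)
Definition normalizes (m : P2) (f : 'rV[R]_d -> R) (lam : R) : Prop :=
  let D x := free_energy_derivative m f lam x * f x in
  (lebesgue_rV R d).-integrable setT (EFin \o D) /\
  \int[lebesgue_rV R d]_x D x = 0.

Definition mean_field_schrodinger (p0 : 'rV[R]_d -> R) (p : R -> 'rV[R]_d -> R) : Prop :=
  [/\ parabolic_C 3 p,
      {within [set z : R * 'rV[R]_d | 0 <= z.1], continuous (fun z => p z.1 z.2)},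
      p 0 = p0 &
      forall t, 0 < t ->
        (forall x, 0 < p t x) /\
        exists (m : P2) (lam : R),
          [/\ PH_density m (p t), normalizes m (p t) lam &
              forall x, derive1 (fun s => p s x) t =
                        - free_energy_derivative m (p t) lam x * p t x]].

End dynamics.

End P2.
Arguments P2 R d : clear implicits.

(* Main.v *)
(** Proof by the maximum principle. Put c = sigma^2 / 2 and work with the square
    roots phi_i of p^h_i and psi_t of p_t. Perturbing phi_i by bump functions
    gives, in the sense of distributions,
      c Laplacian phi_i = phi_i (ln (phi_i / phi_(i-1)) / h + (dF(p^h_i, .) - l_i) / 2),
    and the dynamics becomes
      d/dt psi = c Laplacian psi - (dF(p_t, .) - l_t) / 2 psi.
    Multiplying phi_i and psi_t by suitable constants removes the multipliers l,
    and replaces dF(p, x) by g(x) + G(p, x) - G(p, 0). The normalized functions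
    lie, uniformly in h, below a multiple of (1 + |x|^2)^-(d+1) and above a
    Gaussian. Since dF(p, .) enters only through increments of G, the difference
    of the coefficients of the two equations is at most C |x| times the W_1
    distance of the densities, hence C' |x| times the distance of the normalized
    functions in the norm weighted by (1 + |x|^2)^d; the confinement of g absorbs
    the factor |x|. A doubling of the time variable, in which the discrete
    logarithmic derivative is compared with the derivative of a quadratic penalty,
    then bounds this weighted distance by induction on the time step. *)

Require Import Defs.
From HB Require Import structures.
From mathcomp Require Import all_boot all_order all_algebra.
From mathcomp Require Import all_classical all_reals all_analysis.
From mathcomp Require Import measurable_realfun ring lra.
Set Implicit Arguments.
Unset Strict Implicit.
Unset Printing Implicit Defensive.
Import Order.TTheory GRing.Theory Num.Theory.
Import numFieldTopology.Exports numFieldNormedType.Exports.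
Local Open Scope classical_set_scope.
Local Open Scope ring_scope.

(** * Directional derivatives *)

(** A minimizer is only known to be continuous with a square root in [H^1], so its equation is never
    differentiated: it is tested against one family of radial bumps, whose weighted means are
    monotone in the radius. This yields touching inequalities of viscosity type, positivity and a
    sup bound. Two weights occur: the solutions lie below a multiple of [decay d.+1] and distances
    are measured against [decay d], so that quotients are small at infinity and maxima are attained
    in a cube, while differences of densities carry the product of both weights, integrable against
    [|x|]. The doubling maximizes the quotients [(psi - z W) / phi] and [phi / (psi + z W)] times
    [exp (- penalty)]: comparing consecutive indices then produces exactly the discrete logarithmic
    derivative. The difference of the coefficients depends on the distance of the whole functions at
    the index of the maximum. The induction bounds it at all indices but the last; there only a
    crude bound is available, and an extra penalty of order [h] pays for it. The shift [tau] in the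
    penalty keeps the continuous time after the discrete one, hence positive. *)

Section derive_pointwise.
Context {R : realType} {V : normedModType R}.
Implicit Types (f g : V -> R) (x v : V).

Lemma is_derive_addf f g x v (df dg : R) : is_derive x v f df ->
  is_derive x v g dg -> is_derive x v (fun y => f y + g y) (df + dg).
Proof. by move=> fd gd; exact: is_deriveD. Qed.

Lemma is_derive_oppf f x v (df : R) : is_derive x v f df ->
  is_derive x v (fun y => - f y) (- df).
Proof. by move=> fd; exact: is_deriveN. Qed.

Lemma is_derive_subf f g x v (df dg : R) : is_derive x v f df ->
  is_derive x v g dg -> is_derive x v (fun y => f y - g y) (df - dg).
Proof. by move=> fd gd; exact: is_deriveB. Qed.

Lemma is_derive_mulf f g x v (df dg : R) : is_derive x v f df ->
  is_derive x v g dg -> is_derive x v (fun y => f y * g y) (f x * dg + g x * df).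
Proof. by move=> fd gd; exact: is_deriveM. Qed.

Lemma is_derive_scalef k f x v (df : R) : is_derive x v f df ->
  is_derive x v (fun y => k * f y) (k * df).
Proof. by move=> fd; exact: (@is_deriveZ _ _ _ f k x v df). Qed.

Lemma is_derive_cstf (k : R) x v : is_derive x v (fun _ : V => k) 0.
Proof. exact: is_derive_cst. Qed.

Lemma is_derive_sumf (I : Type) (s : seq I) (F : I -> V -> R) x v (dF : I -> R) :
  (forall i, is_derive x v (F i) (dF i)) ->
  is_derive x v (fun y => \sum_(i <- s) F i y) (\sum_(i <- s) dF i).
Proof.
move=> FdF; elim: s => [|i s IHs].
  rewrite big_nil; under eq_fun do rewrite big_nil.
  exact: is_derive_cstf.
rewrite big_cons; under eq_fun do rewrite big_cons.
exact: is_derive_addf.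
Qed.

(** Reduces directional derivatives to derivatives of one variable along a line, where the chain
    rule and the mean value theorem apply. *)
Lemma is_derive_lineP f x v (s df : R) :
  is_derive s 1 (fun h : R => f (x + h *: v)) df <->
  is_derive (x + s *: v) v f df.
Proof.
have E : (fun h : R => h^-1 *: (((fun h : R => f (x + h *: v)) \o shift s) (h *: 1)
     - (fun h : R => f (x + h *: v)) s)) =
  (fun h : R => h^-1 *: ((f \o shift (x + s *: v)) (h *: v) - f (x + s *: v))).
  apply/funext => h /=; congr (_ *: (f _ - _)).
  by rewrite [h%:A]mulr1 scalerDl addrCA.
split=> [] [d1 d2].
- split; first by move: d1; rewrite /derivable E.
  by move: d2; rewrite /derive E.
- split; first by move: d1; rewrite /derivable E.
  by move: d2; rewrite /derive E.
Qed.

Lemma is_derive_line f x v (df : R) :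
  is_derive (0 : R) 1 (fun h : R => f (x + h *: v)) df <-> is_derive x v f df.
Proof. by have := is_derive_lineP f x v 0 df; rewrite scale0r addr0. Qed.

Lemma is_derive_compf (g : R -> R) f x v (df dg : R) : is_derive (f x) 1 g dg ->
  is_derive x v f df -> is_derive x v (fun y => g (f y)) (dg * df).
Proof.
move=> gd /is_derive_line fd; apply/is_derive_line.
apply: (@is_derive1_comp _ g (fun h : R => f (x + h *: v)) 0) => //.
by rewrite scale0r addr0.
Qed.

Lemma is_derive_expf f x v (df : R) : is_derive x v f df ->
  is_derive x v (fun y => expR (f y)) (expR (f x) * df).
Proof. by move=> fd; exact: is_derive_compf. Qed.

Lemma is_derive_lnf f x v (df : R) : 0 < f x -> is_derive x v f df ->
  is_derive x v (fun y => ln (f y)) (df / f x).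
Proof.
by move=> f0 fd; rewrite mulrC; apply: is_derive_compf; exact: is_derive1_ln.
Qed.

Lemma is_derive_sqrtf f x v (df : R) : 0 < f x -> is_derive x v f df ->
  is_derive x v (fun y => Num.sqrt (f y)) (df / (2 * Num.sqrt (f x))).
Proof.
by move=> f0 fd; rewrite mulrC; apply: is_derive_compf; exact: is_derive1_sqrt.
Qed.

Lemma is_derive_invf f x v (df : R) : f x != 0 -> is_derive x v f df ->
  is_derive x v (fun y => (f y)^-1) (- (df / f x ^+ 2)).
Proof.
move=> f0 [fd <-]; split; first exact: derivableV.
rewrite (_ : (fun y => _) = (fun y => (f y)^-1)) // deriveV//.
by rewrite /GRing.scale/= mulNr mulrC.
Qed.

Lemma is_derive_powf f x v (df : R) n : is_derive x v f df ->
  is_derive x v (fun y => f y ^+ n) (n%:R * f x ^+ n.-1 * df).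
Proof.
move=> fd; apply: (@is_derive_compf (fun y => y ^+ n)) => //.
apply: DeriveDef; first exact: exprn_derivable.
by rewrite exp_derive [LHS]mulr1.
Qed.

Lemma is_derive_ext f g x v (df dg : R) : f =1 g -> df = dg ->
  is_derive x v f df -> is_derive x v g dg.
Proof. by move=> /funext -> ->. Qed.

Lemma is_derive_unique f x v (d1 d2 : R) : is_derive x v f d1 ->
  is_derive x v f d2 -> d1 = d2.
Proof. by move=> [_ <-] [_ <-]. Qed.

Lemma is_derive_continuous1 (f : R -> R) (x df : R) : is_derive x 1 f df ->
  {for x, continuous f}.
Proof. by case=> /derivable1_diffP/differentiable_continuous. Qed.

End derive_pointwise.

(** * Monotonicity and extrema of functions of one variable *)

Section one_variable.
Context {R : realType}.
Implicit Types f : R -> R.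

Lemma ge0_is_derive_le f (df : R -> R) (a b : R) : a <= b ->
  (forall s, s \in `]a, b[ -> is_derive s 1 f (df s)) ->
  (forall s, s \in `]a, b[ -> 0 <= df s) ->
  {within `[a, b], continuous f} -> f a <= f b.
Proof.
rewrite le_eqVlt => /predU1P[-> //|ab fd df0 fc].
have [c cab E] := MVT ab fd fc.
by rewrite -subr_ge0 E mulr_ge0 ?df0// subr_ge0 ltW.
Qed.

Lemma norm_is_derive_le f (df : R -> R) (a b M : R) : a <= b ->
  (forall s, s \in `]a, b[ -> is_derive s 1 f (df s)) ->
  (forall s, s \in `]a, b[ -> `|df s| <= M) ->
  {within `[a, b], continuous f} -> `|f b - f a| <= M * (b - a).
Proof.
rewrite le_eqVlt => /predU1P[->|ab] fd dfM fc; first by rewrite !subrr normr0 mulr0.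
have [c cab ->] := MVT ab fd fc.
rewrite normrM (ger0_norm (_ : 0 <= b - a)) ?subr_ge0 ?(ltW ab)//.
by rewrite ler_wpM2r ?subr_ge0 ?(ltW ab)// dfM.
Qed.

Lemma is_derive_within_continuous f (df : R -> R) (a b : R) :
  (forall s, s \in `[a, b] -> is_derive s 1 f (df s)) ->
  {within `[a, b], continuous f}.
Proof.
by move=> fd; apply: derivable_within_continuous => s /fd[].
Qed.

(** Only earlier times are compared, so that the lemma applies at a maximum over a closed time
    interval even when it is attained at the right endpoint. *)
Lemma is_derive_max_left f (t e df : R) : 0 < e -> is_derive t 1 f df ->
  (forall s, t - e < s -> s <= t -> f s <= f t) -> 0 <= df.
Proof.
move=> e0 fd fmax; rewrite leNgt; apply/negP => df0.
have [fdr fdE] := fd; move: fdr => /cvg_ex[/= l fl].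
have lE : l = df by rewrite -fdE; apply/esym/cvg_lim.
move: fl; rewrite {}lE => /cvgrPdist_lt/(_ (- df / 2)).
rewrite divr_gt0 ?oppr_gt0// => /(_ isT).
rewrite /prop_near1 /= => -[r /= r0 rP].
have m0 : 0 < Num.min e r by rewrite lt_min e0 r0.
have me : Num.min e r <= e by rewrite ge_min lexx.
have mr : Num.min e r <= r by rewrite ge_min lexx orbT.
move: m0 me mr; set m := Num.min e r => m0 me mr.
pose h := - (m / 2).
have hlt : h < 0 by rewrite /h; lra.
have := rP h; rewrite /ball_/= sub0r normrN (ltr0_norm hlt) => /(_ _ _).
have -> : - h < r by rewrite /h; lra.
rewrite lt_eqF// => /(_ isT isT).
rewrite [h%:A]mulr1 => H.
have fh : f (h + t) <= f t by apply: fmax; rewrite /h; lra.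
have : 0 <= h^-1 *: (f (h + t) - f t).
  by rewrite /GRing.scale/= mulr_le0// ?invr_le0 ?(ltW hlt)// subr_le0.
move=> q0; move: H; rewrite ltr_norml => /andP[H _].
move: H q0; set q := _ *: _; lra.
Qed.

Lemma ge1_expR (x : R) : 0 <= x -> 1 <= expR x.
Proof. by move=> x0; rewrite (le_trans _ (expR_ge1Dx x))// lerDl. Qed.

End one_variable.

(** * Smooth bump functions *)

(* [flat k u = u^-k exp (-1/u)] for [u > 0]: a family stable under derivation. *)
Definition flat {R : realType} (k : nat) (u : R) : R :=
  if 0 < u then u^-1 ^+ k * expR (- u^-1) else 0.

Section flat.
Context {R : realType}.
Implicit Types (u : R) (k : nat).

Lemma flat_ge0 k u : 0 <= flat k u.
Proof.
rewrite /flat; case: ifPn => // u0.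
by rewrite mulr_ge0 ?expR_ge0// exprn_ge0// invr_ge0 ltW.
Qed.

Lemma flat_gt0 k u : 0 < u -> 0 < flat k u.
Proof.
by move=> u0; rewrite /flat u0 mulr_gt0 ?expR_gt0// exprn_gt0// invr_gt0.
Qed.

Lemma flat_le0 k u : u <= 0 -> flat k u = 0.
Proof. by move=> u0; rewrite /flat ltNge u0. Qed.

Lemma flatS k u : flat k u = u * flat k.+1 u.
Proof.
rewrite /flat; case: ifPn => [u0|_]; last by rewrite mulr0.
by rewrite exprS !mulrA divff ?mul1r// gt_eqF.
Qed.

(** With [y = u^-1], the Taylor bound of order [k.+1] for the exponential dominates [y ^+ k] when
    [y > 1]; for [y <= 1] the bound 1 suffices. *)
Lemma flat_bounded k : exists M : R, forall u, flat k u <= M.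
Proof.
exists (k.+1`!%:R + 1) => u; rewrite /flat; case: ifPn => [u0|_]; last first.
  by rewrite addr_ge0.
have y0 : 0 < u^-1 by rewrite invr_gt0.
rewrite expRN ler_pdivrMr ?expR_gt0//.
have h : 1 + u^-1 ^+ k.+1 / k.+1`!%:R <= expR (u^-1) := expR_ge1Dxn k (ltW y0).
have f0 : 0 < k.+1`!%:R :> R by rewrite ltr0n fact_gt0.
have [y1|y1] := leP u^-1 1.
  rewrite (@le_trans _ _ 1)//; first by rewrite exprn_ile1// ltW.
  have e1 : 1 <= expR u^-1.
    by rewrite (le_trans _ h)// lerDl divr_ge0// ?exprn_ge0// ltW.
  by rewrite mulrDl mul1r (le_trans e1)// lerDr mulr_ge0// ?ltW// expR_gt0.
rewrite (@le_trans _ _ (k.+1`!%:R * expR u^-1))//; last first.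
  by rewrite ler_wpM2r ?expR_ge0// lerDl.
rewrite -ler_pdivrMl// mulrC (le_trans _ h)//.
rewrite (@le_trans _ _ (u^-1 ^+ k.+1 / k.+1`!%:R))//; last by rewrite lerDr.
by rewrite ler_pM2r ?invr_gt0// ler_eXn2l// leqnSn.
Qed.

Lemma is_derive_flat k u :
  is_derive u 1 (flat k) (flat k.+2 u - k%:R * flat k.+1 u).
Proof.
have [u0|u0|<-] := ltgtP 0 u.
- have ne : \forall z \near u, z^-1 ^+ k * expR (- z^-1) = flat k z.
    near=> z; rewrite /flat ifT//; near: z; exact: lt_nbhsr.
  apply: (near_eq_is_derive ne).
  have dV : is_derive u 1 (fun z : R => z^-1) (- (1 / u ^+ 2)).
    by apply: is_derive_invf; rewrite gt_eqF.
  have := is_derive_mulf (is_derive_powf k dV) (is_derive_expf (is_derive_oppf dV)).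
  move/is_derive_eq; apply; rewrite /flat u0.
  have un0 : u != 0 by rewrite gt_eqF.
  case: k {ne} => [|k] /=; rewrite ?exprS ?expr0 ?mul0r ?mulr0 ?subr0.
    by rewrite mulr1; field.
  by move: (expR _) (u^-1 ^+ k) => a b; field.
- have ne : \forall z \near u, 0 = flat k z.
    by near=> z; rewrite flat_le0//; apply/ltW; near: z; exact: lt_nbhsl.
  apply: (near_eq_is_derive ne).
  rewrite !flat_le0 ?(ltW u0)// mulr0 subr0; exact: is_derive_cstf.
- have [M Mf] := flat_bounded k.+2.
  have M0 : 0 <= M by rewrite (le_trans (flat_ge0 k.+2 0)).
  have cv : h^-1 *: ((flat k \o shift 0) (h *: 1) - flat k 0) @[h --> 0^'] --> (0 : R).
    apply/cvgrPdist_lt => e e0.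
    have eM : 0 < e / (M + 1) by rewrite divr_gt0// ltr_wpDl.
    near=> h; rewrite sub0r normrN /= addr0 [h%:A]mulr1 (flat_le0 _ (lexx 0)) subr0.
    have h0 : h != 0 by near: h; exact: nbhs_dnbhs_neq.
    (* At 0 the difference quotient [flat k h / h] equals [h * flat k.+2 h], which tends to 0 by
       boundedness. *)
    rewrite /GRing.scale/= flatS mulKf// flatS normrM.
    rewrite (@le_lt_trans _ _ (`|h| * M))//.
      by rewrite ler_wpM2l// ger0_norm ?flat_ge0.
    have hs : `|h| < e / (M + 1).
      by near: h; apply: dnbhs0_lt.
    rewrite (@le_lt_trans _ _ (`|h| * (M + 1)))//.
      by rewrite ler_wpM2l// lerDl.
    by rewrite -ltr_pdivlMr// ltr_wpDl.
  rewrite !flat_le0// mulr0 subr0.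
  by split; [apply/cvg_ex; exists 0|apply/cvg_lim].
Unshelve. all: end_near. Qed.

Lemma flat_continuous k : continuous (@flat R k).
Proof. by move=> u; apply: is_derive_continuous1; exact: is_derive_flat. Qed.

Lemma flat_leS2 k u : u <= 1 -> flat k u <= flat k.+2 u.
Proof.
move=> u1; have [u0|u0] := leP u 0; first by rewrite !flat_le0.
rewrite flatS [in leLHS]flatS mulrA ler_piMl ?flat_ge0// mulr_ile1// ltW//.
Qed.

End flat.

(** * Stability of the classes C^k *)

Section class_C.
Context {R : realType} {d : nat}.
Implicit Types (f g : 'rV[R]_d -> R) (x : 'rV[R]_d).

Lemma class_C_continuous k f : class_C k f -> continuous f.
Proof. by case: k => [|k] []. Qed.

Lemma class_C_is_derive k f i x : class_C k.+1 f ->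
  is_derive x (delta_mx ord0 i) f (partial i f x).
Proof. by case=> _ /(_ i)[/(_ x) fd _]; exact: derivableP. Qed.

Lemma class_C_partial k f i : class_C k.+1 f -> class_C k (partial i f).
Proof. by case=> _ /(_ i)[]. Qed.

Lemma class_CS k f (df : 'I_d -> 'rV[R]_d -> R) : continuous f ->
  (forall i x, is_derive x (delta_mx ord0 i) f (df i x)) ->
  (forall i, class_C k (df i)) -> class_C k.+1 f.
Proof.
move=> fc fd dfC; split=> // i; split=> [x|]; first by case: (fd i x).
by rewrite (_ : partial i f = df i)//; apply/funext => x; case: (fd i x).
Qed.

Lemma class_CW k f : class_C k.+1 f -> class_C k f.
Proof.
elim: k f => [|k IHk] f fC; first by split=> //; exact: class_C_continuous fC.
apply: (class_CS (class_C_continuous fC) (fun i x => class_C_is_derive i x fC)).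
by move=> i; apply: IHk; exact: class_C_partial.
Qed.

Lemma class_C_cst k (c : R) : class_C k (fun _ : 'rV[R]_d => c).
Proof.
elim: k c => [|k IHk] c; first by split=> //; exact: cst_continuous.
apply: (@class_CS k _ (fun _ _ => 0) _ (fun i x => is_derive_cstf c x _)).
  exact: cst_continuous.
by move=> _; exact: IHk.
Qed.

Lemma is_derive_coord i j x :
  is_derive x (delta_mx ord0 i) (fun y : 'rV[R]_d => y ord0 j) (i == j)%:R.
Proof.
apply/is_derive_line.
have E : (fun h : R => x ord0 j + h * (i == j)%:R) =1
         (fun h => (x + h *: delta_mx ord0 i) ord0 j).
  by move=> h; rewrite !mxE eqxx /= eq_sym.
apply: (is_derive_ext E erefl).
have := is_derive_addf (is_derive_cstf (x ord0 j) (0:R) 1)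
  (is_derive_mulf (is_derive_id (0:R) 1) (is_derive_cstf (i == j)%:R (0:R) 1)).
by move/is_derive_eq; apply; rewrite mul0r !add0r mulr1.
Qed.

Lemma class_C_coord k j : class_C k (fun y : 'rV[R]_d => y ord0 j).
Proof.
case: k => [|k]; first by split=> //; exact: coord_continuous.
apply: (@class_CS k _ (fun i _ => (i == j)%:R)); first exact: coord_continuous.
  by move=> i x; exact: is_derive_coord.
by move=> i; exact: class_C_cst.
Qed.

Lemma class_C_add k f g : class_C k f -> class_C k g ->
  class_C k (fun x => f x + g x).
Proof.
elim: k f g => [|k IHk] f g fC gC.
  by split=> // x; apply: continuousD; [exact: (@class_C_continuous 0 f fC)|exact: (@class_C_continuous 0 g gC)].
apply: (@class_CS k _ (fun i x => partial i f x + partial i g x)).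
- by move=> x; apply: continuousD; [exact: (class_C_continuous fC)|exact: (class_C_continuous gC)].
- by move=> i x; exact: (is_derive_addf (class_C_is_derive i x fC) (class_C_is_derive i x gC)).
- by move=> i; apply: IHk; exact: class_C_partial.
Qed.

Lemma class_C_mul k f g : class_C k f -> class_C k g ->
  class_C k (fun x => f x * g x).
Proof.
elim: k f g => [|k IHk] f g fC gC.
  by split=> // x; apply: continuousM; [exact: (@class_C_continuous 0 f fC)|exact: (@class_C_continuous 0 g gC)].
apply: (@class_CS k _ (fun i x => f x * partial i g x + g x * partial i f x)).
- by move=> x; apply: continuousM; [exact: (class_C_continuous fC)|exact: (class_C_continuous gC)].
- by move=> i x; exact: (is_derive_mulf (class_C_is_derive i x fC) (class_C_is_derive i x gC)).
- by move=> i; apply: class_C_add; apply: IHk; first [exact: class_C_partial|exact: class_CW].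
Qed.

Lemma class_C_scale k (c : R) f : class_C k f -> class_C k (fun x => c * f x).
Proof. by move=> fC; apply: class_C_mul => //; exact: class_C_cst. Qed.

Lemma class_C_opp k f : class_C k f -> class_C k (fun x => - f x).
Proof.
move=> fC; rewrite (_ : (fun _ => _) = (fun x => -1 * f x)); first exact: class_C_scale.
by apply/funext => x; rewrite mulN1r.
Qed.

Lemma class_C_sub k f g : class_C k f -> class_C k g ->
  class_C k (fun x => f x - g x).
Proof. by move=> fC gC; apply: class_C_add => //; exact: class_C_opp. Qed.

Lemma class_C_sum k (I : Type) (s : seq I) (F : I -> 'rV[R]_d -> R) :
  (forall i, class_C k (F i)) -> class_C k (fun x => \sum_(i <- s) F i x).
Proof.
move=> FC; elim: s => [|i s IHs].
  by under eq_fun do rewrite big_nil; exact: class_C_cst.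
by under eq_fun do rewrite big_cons; exact: class_C_add.
Qed.

Lemma class_C_prod k (I : Type) (s : seq I) (F : I -> 'rV[R]_d -> R) :
  (forall i, class_C k (F i)) -> class_C k (fun x => \prod_(i <- s) F i x).
Proof.
move=> FC; elim: s => [|i s IHs].
  by under eq_fun do rewrite big_nil; exact: class_C_cst.
by under eq_fun do rewrite big_cons; exact: class_C_mul.
Qed.

Lemma class_C_exp k n f : class_C k f -> class_C k (fun x => f x ^+ n).
Proof.
move=> fC; elim: n => [|n IHn].
  by under eq_fun do rewrite expr0; exact: class_C_cst.
by under eq_fun do rewrite exprS; exact: class_C_mul.
Qed.

(** The induction on the order of smoothness runs over all [m] at once, since differentiating
    [flat m] produces [flat m.+1] and [flat m.+2]. *)
Lemma class_C_flat k m f : (forall n, class_C n f) ->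
  class_C k (fun x => flat m (f x)).
Proof.
move=> fC; elim: k m => [|k IHk] m.
  split=> // x; apply: continuous_comp; last exact: flat_continuous.
  exact: (class_C_continuous (fC 0)).
apply: (@class_CS k _ (fun i x => (flat m.+2 (f x) - m%:R * flat m.+1 (f x)) *
    partial i f x)).
- move=> x; apply: continuous_comp; last exact: flat_continuous.
  exact: (class_C_continuous (fC 0)).
- move=> i x.
  exact: (is_derive_compf (is_derive_flat m (f x)) (class_C_is_derive i x (fC 1%N))).
- move=> i; apply: class_C_mul; last exact: class_C_partial (fC k.+1).
  by apply: class_C_sub => //; exact: class_C_scale.
Qed.

Lemma class_C_sqdist k (a : 'rV[R]_d) : class_C k (fun x => dot (x - a) (x - a)).
Proof.
have E : (fun x => dot (x - a) (x - a)) =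
    (fun x : 'rV[R]_d => \sum_i (x ord0 i - a ord0 i) * (x ord0 i - a ord0 i)).
  by apply/funext => x; apply: eq_bigr => i _; rewrite !mxE.
rewrite E; apply: class_C_sum => i.
by apply: class_C_mul; apply: class_C_sub; first [exact: class_C_coord|exact: class_C_cst].
Qed.

Lemma is_derive_sqdist i (a x : 'rV[R]_d) :
  is_derive x (delta_mx ord0 i) (fun y => dot (y - a) (y - a))
    (2 * (x ord0 i - a ord0 i)).
Proof.
have E : (fun x : 'rV[R]_d => \sum_j (x ord0 j - a ord0 j) * (x ord0 j - a ord0 j))
    =1 (fun x => dot (x - a) (x - a)).
  by move=> y; apply: eq_bigr => j _; rewrite !mxE.
have dj j := is_derive_subf (is_derive_coord i j x) (is_derive_cstf (a ord0 j) x (delta_mx ord0 i)).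
have := is_derive_sumf (index_enum 'I_d) (fun j => is_derive_mulf (dj j) (dj j)).
move/(is_derive_ext E); apply.
rewrite (bigD1 i)//= big1 ?addr0; last first.
  by move=> j ji; rewrite eq_sym (negbTE ji) subr0 mulr0 addr0.
by rewrite eqxx subr0 mulr1 mulr2n mulrDl mul1r.
Qed.

End class_C.

(** * Lebesgue integration of continuous functions on row vectors *)

Section cube.
Context {R : realType}.

Lemma continuous_mfun d (f : 'rV[R]_d -> R) : continuous f -> measurable_fun setT f.
Proof.
move=> fc; apply: (measurability _ (RGenOInfty.measurableE R)).
move=> _ [_ [a ->] <-]; rewrite setTI; apply: open_measurable_mx.
by apply: open_comp => [x _|]; [exact: fc|exact: rray_open].
Qed.

(** Closed sup-norm balls centred at 0: they are compact, and [cons_rV] splits them into an interval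
    and a cube of lower dimension, which suits induction on the dimension. *)
Definition cube d (M : R) : set 'rV[R]_d := [set x | forall i, `|x ord0 i| <= M].

Lemma cube_le d (M N : R) : M <= N -> @cube d M `<=` cube N.
Proof. by move=> MN x xM i; rewrite (le_trans (xM i)). Qed.

Lemma compact_cube d (M : R) : compact (@cube d M).
Proof.
rewrite (_ : cube M = [set x : 'rV[R]_d | forall i, `[- M, M]%classic (x ord0 i)]).
  by apply: (@rV_compact _ _ (fun=> `[- M, M]%classic)) => i; exact: segment_compact.
apply/seteqP; split=> x /= xM i; have := xM i; first by rewrite in_itv/= -ler_norml.
by rewrite in_itv/= -ler_norml.
Qed.

Lemma closed_cube d (M : R) : closed (@cube d M).
Proof. by apply: compact_closed; [exact: norm_hausdorff|exact: compact_cube]. Qed.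

Lemma measurable_cube d (M : R) : measurable (@cube d M).
Proof.
rewrite -(setCK (cube M)); apply: measurableC; apply: open_measurable_mx.
by rewrite openC; exact: closed_cube.
Qed.

Lemma cons_rV0 n (z : R * 'rV[R]_n) j : cons_rV z ord0 (lshift n j) = z.1.
Proof. by rewrite /cons_rV row_mxEl mxE. Qed.

Lemma cons_rVr n (z : R * 'rV[R]_n) j : cons_rV z ord0 (rshift 1 j) = z.2 ord0 j.
Proof. by rewrite /cons_rV row_mxEr. Qed.

Lemma cube_cons n (M : R) (z : R * 'rV[R]_n) :
  @cube (1 + n) M (cons_rV z) <-> `|z.1| <= M /\ cube M z.2.
Proof.
split=> [c|[z1 z2] i].
  split=> [|j]; first by have := c (lshift n ord0); rewrite cons_rV0.
  by have := c (rshift 1 j); rewrite cons_rVr.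
by case: (split_ordP i) => j ->; rewrite ?cons_rV0 ?cons_rVr.
Qed.

Lemma cube_lty d (M : R) : (lebesgue_rV R d (@cube d M) < +oo)%E.
Proof.
elim: d => [|n IHn]; first by rewrite /= diracE ltry.
change ((lebesgue_measure \x lebesgue_rV R n)%E (@cons_rV R n @^-1` @cube (1 + n) M) < +oo)%E.
rewrite (_ : _ @^-1` _ = `[- M, M]%classic `*` cube M); last first.
  apply/seteqP; split=> [z /cube_cons[z1 z2]|z [z1 z2]].
    by split=> //; rewrite /= in_itv/= -ler_norml.
  by apply/cube_cons; split=> //; move: z1; rewrite /= in_itv/= -ler_norml.
rewrite product_measure1E//; last exact: measurable_cube.
apply: lte_mul_pinfty => //.
have h : (lebesgue_measure ([set` `[- M, M]%R] : set R) < +oo)%E.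
  by rewrite lebesgue_measure_itv/=; case: ifP => // _; rewrite -EFinD ltry.
by rewrite ge0_fin_numE.
Qed.

Definition supp_in d (M : R) (f : 'rV[R]_d -> R) : Prop :=
  forall x, ~ cube M x -> f x = 0.

Lemma supp_in_mull d (M : R) (f g : 'rV[R]_d -> R) : supp_in M f ->
  supp_in M (fun x => f x * g x).
Proof. by move=> fM x /fM ->; rewrite mul0r. Qed.

Lemma supp_in_mulr d (M : R) (f g : 'rV[R]_d -> R) : supp_in M g ->
  supp_in M (fun x => f x * g x).
Proof. by move=> fM x /fM ->; rewrite mulr0. Qed.

Lemma continuous_bounded_cube d (M : R) (f : 'rV[R]_d -> R) : continuous f ->
  exists2 C : R, 0 < C & forall x, cube M x -> `|f x| <= C.
Proof.
move=> fc; have /ex_strict_bound_gt0[C C0 /= H] : bounded_set (f @` cube M).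
  apply: compact_bounded; apply: continuous_compact.
    by apply: continuous_subspaceT => x; exact: fc.
  exact: compact_cube.
by exists C => // x xM; apply/ltW/H; exists x.
Qed.

Lemma integrable_supp d (M C : R) (f : 'rV[R]_d -> R) : measurable_fun setT f ->
  supp_in M f -> (forall x, cube M x -> `|f x| <= C) ->
  (lebesgue_rV R d).-integrable setT (EFin \o f).
Proof.
move=> mf fM fC.
have : (lebesgue_rV R d).-integrable (cube M) (EFin \o f).
  apply: measurable_bounded_integrable; first exact: measurable_cube.
  - exact: cube_lty.
  - exact: measurable_funTS.
  - by exists C; split; [exact: num_real|move=> D CD x /fC h; exact: (le_trans h (ltW CD))].
rewrite integrable_mkcond; last exact: measurable_cube.
rewrite (_ : _ \_ _ = EFin \o f)//; apply/funext => x; rewrite patchE/=.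
case: ifPn => // /negP; rewrite in_setE => /fM h; by rewrite h.
Qed.

Lemma integrable_csupp d (M : R) (f : 'rV[R]_d -> R) : continuous f ->
  supp_in M f -> (lebesgue_rV R d).-integrable setT (EFin \o f).
Proof.
move=> fc fM; have [C _ fC] := continuous_bounded_cube M fc.
exact: integrable_supp (continuous_mfun fc) fM fC.
Qed.

End cube.

(** * Fubini's theorem for the first coordinate *)

Section fubini_rV.
Context {R : realType} (n : nat).
Local Notation mu := (@lebesgue_measure R).
Local Notation leb := (lebesgue_rV R n).
Implicit Types f : 'rV[R]_(1 + n) -> \bar R.

(* [cons_rV] on the measurable type carrying [lebesgue_measure]. *)
Definition cons_rV_leb (z : measurableTypeR R * 'rV[R]_n) : 'rV[R]_(1 + n) :=
  cons_rV z.

Lemma measurable_cons_rV_leb : measurable_fun setT cons_rV_leb.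
Proof. exact: measurable_cons_rV. Qed.

Lemma ge0_integral_rVS f : measurable_fun setT f -> (forall x, 0 <= f x)%E ->
  (\int[lebesgue_rV R n.+1]_x f x = \int[mu \x leb]_z f (cons_rV_leb z))%E.
Proof.
move=> mf f0.
have := ge0_integral_pushforward measurable_cons_rV_leb (mu \x leb)%E
  measurableT mf (fun y _ => f0 y).
rewrite preimage_setT => <-.
by apply: eq_measure_integral => [|//]; exact: measurable_cons_rV_leb.
Qed.

Lemma measurable_rVS f : measurable_fun setT f ->
  measurable_fun setT (fun z => f (cons_rV_leb z)).
Proof. by move=> mf; apply: measurableT_comp => //; exact: measurable_cons_rV_leb. Qed.

Lemma integrable_rVS f : (lebesgue_rV R n.+1).-integrable setT f ->
  (mu \x leb)%E.-integrable setT (fun z => f (cons_rV_leb z)).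
Proof.
move=> /integrableP[mf fi]; apply/integrableP; split; first exact: measurable_rVS.
by rewrite -(ge0_integral_rVS (f := fun x => `|f x|%E)) //; apply: measurableT_comp.
Qed.

Lemma integral_rVS f : (lebesgue_rV R n.+1).-integrable setT f ->
  (\int[lebesgue_rV R n.+1]_x f x = \int[mu \x leb]_z f (cons_rV_leb z))%E.
Proof.
move=> fi; have mf := measurable_int _ fi.
have := integral_pushforward measurable_cons_rV_leb mf (integrable_rVS fi) measurableT.
rewrite preimage_setT => <-.
by apply: eq_measure_integral => [|//]; exact: measurable_cons_rV_leb.
Qed.

End fubini_rV.

(** * Integrals of partial derivatives with compact support *)

Section integration_by_parts_rV.
Context {R : realType}.

Lemma integral_derive_csupp (f df : R -> R) (M : R) :
  (forall s : R, is_derive s 1 f (df s)) -> continuous df ->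
  (forall s, M < `|s| -> f s = 0) -> (forall s, M < `|s| -> df s = 0) ->
  (\int[@lebesgue_measure R]_s (df s)%:E = 0)%E.
Proof.
move=> fd dfc fM dfM.
pose N : R := `|M| + 1.
have N0 : - N < N by rewrite -subr_gt0 opprK addr_gt0// ltr_wpDl.
have MN : M < N by rewrite (le_lt_trans (ler_norm M))// ltrDl.
have -> : (\int[@lebesgue_measure R]_s (df s)%:E =
           \int[@lebesgue_measure R]_(s in [set` `[- N, N]%R]) (df s)%:E)%E.
  rewrite [in RHS]integral_mkcond; apply: eq_integral => s _; rewrite patchE.
  case: ifPn => // /negP; rewrite in_setE/= in_itv/= -ler_norml => /negP.
  by rewrite -ltNge => Ns; rewrite dfM// (lt_trans MN).
have fc : continuous f by move=> s; exact: is_derive_continuous1 (fd s).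
rewrite (continuous_FTC2 (F := f)) //.
- rewrite !fM ?subee//; last by rewrite (lt_le_trans MN)// ler_norm.
  by rewrite normrN (lt_le_trans MN)// ler_norm.
- by apply: continuous_subspaceT => s; exact: dfc.
- split; first by move=> s _; case: (fd s).
  + by apply: cvg_at_right_filter; exact: fc.
  + by apply: cvg_at_left_filter; exact: fc.
- by move=> s _; rewrite derive1E; case: (fd s).
Qed.

Lemma cons_rV_continuous n : continuous (@cons_rV R n).
Proof.
move=> z U /nbhs_ballP[e /= e0 eU]; apply/nbhs_ballP; exists e => //= w [zw1 [_ zw2]].
apply: eU; split=> // i j; rewrite (ord1 i) => {i}.
by case: (split_ordP j) => k ->; rewrite ?cons_rV0 ?cons_rVr.
Qed.

Lemma continuous_pairl (U V : pseudoMetricType R) (v : V) :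
  continuous (fun u : U => (u, v)).
Proof.
move=> u A /nbhs_ballP[e /= e0 eA]; apply/nbhs_ballP; exists e => //= w uw.
by apply: eA; split=> //=; exact: ballxx.
Qed.

Lemma continuous_pairr (U V : pseudoMetricType R) (u : U) :
  continuous (fun v : V => (u, v)).
Proof.
move=> v A /nbhs_ballP[e /= e0 eA]; apply/nbhs_ballP; exists e => //= w vw.
by apply: eA; split=> //=; exact: ballxx.
Qed.

Lemma continuous_cons1 n (f : 'rV[R]_(1 + n) -> R) (y : 'rV[R]_n) :
  continuous f -> continuous (fun s => f (cons_rV (s, y))).
Proof.
move=> fc s; apply: (continuous_comp (f := fun s => cons_rV (s, y))); last exact: fc.
apply: (continuous_comp (f := fun s => (s, y))); last exact: cons_rV_continuous.
exact: continuous_pairl.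
Qed.

Lemma continuous_cons2 n (f : 'rV[R]_(1 + n) -> R) (s : R) :
  continuous f -> continuous (fun y => f (cons_rV (s, y))).
Proof.
move=> fc y; apply: (continuous_comp (f := fun y => cons_rV (s, y))); last exact: fc.
apply: (continuous_comp (f := fun y => (s, y))); last exact: cons_rV_continuous.
exact: continuous_pairr.
Qed.

Lemma rV_addZE d (u v : 'rV[R]_d) (c : R) k :
  (u + c *: v) ord0 k = u ord0 k + c * v ord0 k.
Proof. by rewrite !mxE. Qed.

(** Induction on the dimension. If [i] is the first coordinate, the inner integral is taken in that
    variable and vanishes by the fundamental theorem of calculus; otherwise the first variable is
    frozen and the inner integral vanishes by induction. *)
Lemma integral_partial0 d (i : 'I_d) (f df : 'rV[R]_d -> R) (M : R) :
  (forall x, is_derive x (delta_mx ord0 i) f (df x)) ->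
  continuous df -> supp_in M f -> supp_in M df ->
  (\int[lebesgue_rV R d]_x (df x)%:E = 0)%E.
Proof.
elim: d i f df => [[]//|n IHn] i f df fd dfc fM dfM.
have dfi := integrable_csupp dfc dfM.
rewrite (integral_rVS dfi) /=.
have zi := integrable_rVS dfi.
case: (split_ordP (i : 'I_(1 + n))) => j ij.
- rewrite -(integral21_prod_meas1 zi) /fubini_G.
  rewrite integral0_eq// => y _ /=.
  apply: (@integral_derive_csupp (fun s => f (cons_rV (s, y))) _ M).
  + move=> s; have := fd (cons_rV (s, y)); rewrite ij => /is_derive_line H.
    have E t : cons_rV (t, y) = cons_rV (s, y) + (t - s) *: delta_mx ord0 (lshift n j).
      apply/rowP => k; rewrite rV_addZE [delta_mx _ _ _ _]mxE eqxx /=.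
      case: (split_ordP k) => l ->.
        by rewrite !cons_rV0 (ord1 l) (ord1 j) eqxx mulr1 addrC subrK.
      by rewrite !cons_rVr eq_rlshift mulr0 addr0.
    have H0 : is_derive (s - s) 1 (fun h => f (cons_rV (s, y) + h *: delta_mx ord0 (lshift n j))) (df (cons_rV (s, y))).
      by rewrite subrr.
    have dsh : is_derive s 1 (fun t : R => t - s) 1.
      have := is_derive_subf (is_derive_id s (1:R)) (is_derive_cstf s s (1:R)).
      by rewrite subr0.
    have Hc := @is_derive_compf R R _ (fun t => t - s) s 1 1 _ H0 dsh.
    apply: (is_derive_ext (f := fun t => f (cons_rV (s, y) + (t - s) *: delta_mx ord0 (lshift n j))) _ _ Hc).
      by move=> t; rewrite (E t).
    by rewrite mulr1.
  + exact: continuous_cons1.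
  + move=> s Ms; apply: fM => /cube_cons[/= sM _].
    by move: Ms; rewrite ltNge sM.
  + move=> s Ms; apply: dfM => /cube_cons[/= sM _].
    by move: Ms; rewrite ltNge sM.
- rewrite -(integral12_prod_meas1 zi) /fubini_F.
  rewrite integral0_eq// => s _ /=.
  apply: (IHn j (fun y => f (cons_rV (s, y)))).
  + move=> y; have := fd (cons_rV (s, y)); rewrite ij => /is_derive_line H.
    apply/is_derive_line; apply: is_derive_ext H => // h.
    congr f; apply/rowP => k; rewrite rV_addZE [delta_mx _ _ _ _]mxE eqxx /=.
    case: (split_ordP (k : 'I_(1 + n))) => l ->.
      by rewrite !cons_rV0 -val_eqE /= (ord1 l) mulr0 addr0.
    by rewrite !cons_rVr /= rV_addZE [delta_mx _ _ _ _]mxE eqxx -!val_eqE /= eqSS.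
  + exact: continuous_cons2.
  + by move=> y yM; apply: fM => /cube_cons[].
  + by move=> y yM; apply: dfM => /cube_cons[].
Qed.

End integration_by_parts_rV.

(** * Integrals of real-valued functions *)

Section real_integrals.
Context d {T : measurableType d} {R : realType} (mu : {measure set T -> \bar R}).
Implicit Types f g : T -> R.
Local Notation itg f := (mu.-integrable setT (EFin \o f)).
Local Notation Int f := (\int[mu]_x f x).

Lemma itgD f g : itg f -> itg g -> itg (fun x => f x + g x).
Proof. by move=> fi gi; exact: (integrableD measurableT fi gi). Qed.

Lemma itgB f g : itg f -> itg g -> itg (fun x => f x - g x).
Proof. by move=> fi gi; exact: (integrableB measurableT fi gi). Qed.

Lemma itgZ (c : R) f : itg f -> itg (fun x => c * f x).
Proof. by move=> fi; exact: (integrableZl measurableT c fi). Qed.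

Lemma itgN f : itg f -> itg (fun x => - f x).
Proof. by move=> fi; have := integrableN fi. Qed.

Lemma itg_sum (I : Type) (s : seq I) (F : I -> T -> R) :
  (forall i, itg (F i)) -> itg (fun x => \sum_(i <- s) F i x).
Proof.
move=> Fi; rewrite (_ : _ \o _ = (fun x => \sum_(i <- s) (EFin \o F i) x)%E).
  by apply: integrable_sum => // i _; exact: Fi.
by apply/funext => x /=; rewrite sumEFin.
Qed.

Lemma itg_le f g : measurable_fun setT f -> (forall x, `|f x| <= g x) -> itg g -> itg f.
Proof.
move=> mf fg gi; apply: le_integrable gi => //; first exact/measurable_EFinP.
by move=> x _; rewrite /= lee_fin (le_trans (fg x))// ler_norm.
Qed.

Lemma itg_norm f : itg f -> itg (fun x => `|f x|).
Proof. by move=> fi; exact: integrable_norm. Qed.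

Lemma itg_measurable f : itg f -> measurable_fun setT f.
Proof. by move=> /measurable_int /measurable_EFinP. Qed.

Lemma IntD f g : itg f -> itg g -> Int (fun x => f x + g x) = Int f + Int g.
Proof. by move=> fi gi; rewrite RintegralD. Qed.

Lemma IntB f g : itg f -> itg g -> Int (fun x => f x - g x) = Int f - Int g.
Proof. by move=> fi gi; rewrite RintegralB. Qed.

Lemma IntZ (c : R) f : itg f -> Int (fun x => c * f x) = c * Int f.
Proof. by move=> fi; rewrite RintegralZl. Qed.

Lemma IntN f : itg f -> Int (fun x => - f x) = - Int f.
Proof.
move=> fi; rewrite -[RHS]mulN1r -IntZ//.
by congr (Rintegral _ _ _); apply/funext => x; rewrite mulN1r.
Qed.

Lemma Int_eq f g : f =1 g -> Int f = Int g.
Proof. by move=> /funext ->. Qed.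

Lemma Int_le f g : itg f -> itg g -> (forall x, f x <= g x) -> Int f <= Int g.
Proof. by move=> fi gi fg; apply: le_Rintegral => // x _; exact: fg. Qed.

Lemma Int_ge0 f : (forall x, 0 <= f x) -> 0 <= Int f.
Proof. by move=> f0; apply: Rintegral_ge0. Qed.

Lemma Int0 : Int (fun=> 0) = 0.
Proof. by rewrite /Rintegral integral0. Qed.

Lemma Int_norm f : itg f -> `|Int f| <= Int (fun x => `|f x|).
Proof. by move=> fi; exact: le_normr_Rintegral. Qed.

Lemma Int_sum (I : Type) (s : seq I) (F : I -> T -> R) :
  (forall i, itg (F i)) -> Int (fun x => \sum_(i <- s) F i x) = \sum_(i <- s) Int (F i).
Proof.
move=> Fi; elim: s => [|i s IHs].
  by rewrite big_nil -[RHS]Int0; apply: Int_eq => x; rewrite big_nil.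
rewrite big_cons -IHs -IntD//; last exact: itg_sum.
by apply: Int_eq => x; rewrite big_cons.
Qed.

Lemma EFin_Int f : itg f -> ((Int f)%:E = \int[mu]_x (f x)%:E)%E.
Proof. by move=> fi; rewrite /Rintegral fineK//; exact: integrable_fin_num. Qed.

Lemma ge0_itg_lty f : (forall x, 0 <= f x) -> measurable_fun setT f ->
  (\int[mu]_x (f x)%:E < +oo)%E -> itg f.
Proof.
move=> f0 mf fi; apply/integrableP; split; first exact/measurable_EFinP.
by under eq_integral => x _ do rewrite /= ger0_norm//.
Qed.

Lemma itg_lty f : (forall x, 0 <= f x) -> itg f -> (\int[mu]_x (f x)%:E < +oo)%E.
Proof. by move=> f0 fi; rewrite -EFin_Int// ltry. Qed.

End real_integrals.

Lemma cst_in_ball (R : realType) d (x : 'rV[R]_d) (e : R) (y : 'rV[R]_d) : 0 < e ->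
  (forall i, `|x ord0 i - y ord0 i| < e) -> ball x e y.
Proof. by move=> e0 xy; split=> // i j; rewrite (ord1 i); exact: xy. Qed.

Lemma ball_coord (R : realType) d (x : 'rV[R]_d) (e : R) (y : 'rV[R]_d) :
  ball x e y -> forall i, `|x ord0 i - y ord0 i| < e.
Proof. by move=> [_ xy] i; exact: xy. Qed.

(** * Differentiation under the integral sign and Green's identity *)

Section under_integral.
Context {R : realType} {d : nat}.
Local Notation leb := (lebesgue_rV R d).
Local Notation Int f := (\int[leb]_x f x).

Lemma bounded_strip (u : R -> 'rV[R]_d -> R) (a b M : R) : a <= b ->
  (forall s y, a <= s <= b -> {for (s, y), continuous (fun z => u z.1 z.2)}) ->
  exists2 C : R, 0 < C & forall s y, a <= s <= b -> cube M y -> `|u s y| <= C.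
Proof.
move=> ab uc.
have /ex_strict_bound_gt0[C C0 /= H] :
    bounded_set ((fun z : R * 'rV[R]_d => u z.1 z.2) @` (`[a, b]%classic `*` cube M)).
  apply: compact_bounded; apply: continuous_compact; last first.
    by apply: compact_setX; [exact: segment_compact|exact: compact_cube].
  apply: continuous_in_subspaceT => -[s y]; rewrite inE => -[/= ]; rewrite in_itv/= => sab _.
  exact: uc.
by exists C => // s y sab yM; apply/ltW/H; exists (s, y).
Qed.

Lemma is_derive_Int (u du : R -> 'rV[R]_d -> R) (a b t M C : R) :
  t \in `]a, b[ ->
  (forall s y, s \in `]a, b[ -> is_derive s 1 (u ^~ y) (du s y)) ->
  (forall s, s \in `]a, b[ -> continuous (u s)) ->
  (forall s, s \in `]a, b[ -> supp_in M (u s)) ->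
  (forall s y, s \in `]a, b[ -> `|du s y| <= C * \1_(cube M) y) ->
  is_derive t 1 (fun s => Int (u s)) (Int (du t)).
Proof.
move=> tab ud uc uM duC.
have I1 : `]a, b[%classic t by [].
have I2 s : `]a, b[%classic s -> leb.-integrable setT (EFin \o u s).
  by move=> /= sab; exact: integrable_csupp (uc _ sab) (uM _ sab).
have I3 s y : `]a, b[%classic s -> setT y -> derivable (u^~ y) s 1.
  by move=> /= sab _; case: (ud s y sab).
have C0 (y : 'rV[R]_d) : 0 <= C * \1_(cube M) y.
  exact: le_trans (normr_ge0 _) (duC t y tab).
have I5 : leb.-integrable setT (EFin \o (fun y : 'rV[R]_d => C * \1_(cube M) y)).
  apply: itgZ; apply: (@integrable_supp _ _ M 1).
  - by apply: measurable_indic; exact: measurable_cube.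
  - by move=> y yM; rewrite indicE memNset.
  - by move=> y yM; rewrite indicE mem_set// normr1.
have I6 s y : `]a, b[%classic s -> setT y -> `|partial1of2 u s y| <= C * \1_(cube M) y.
  by move=> /= sab _; rewrite partial1of2E; case: (ud s y sab) => _ ->; exact: duC.
split; first exact: (derivable_under_integral measurableT I1 I2 I3 C0 I5 I6).
rewrite -derive1E (differentiation_under_integral measurableT I1 I2 I3 C0 I5 I6).
by apply: Int_eq => y; rewrite partial1of2E; case: (ud t y tab).
Qed.

Lemma supp_in_derive (M : R) i (f df : 'rV[R]_d -> R) :
  (forall x, is_derive x (delta_mx ord0 i) f (df x)) -> supp_in M f -> supp_in M df.
Proof.
move=> fd fM x xM.
have ne : \forall y \near x, cst 0 y = f y.
  have : nbhs x (~` cube M) by apply: open_nbhs_nbhs; split=> //; rewrite openC; exact: closed_cube.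
  by apply: filterS => y yM; rewrite fM.
exact: is_derive_unique (fd x) (near_eq_is_derive ne (is_derive_cst _ _ _)).
Qed.

Lemma class_C2_laplacian_continuous (f : 'rV[R]_d -> R) : class_C 2 f ->
  continuous (laplacian f).
Proof.
move=> fC; rewrite /laplacian; apply: (@class_C_continuous _ _ 0).
by apply: class_C_sum => i; exact: class_C_partial i (class_C_partial i fC).
Qed.

Lemma supp_in_partial (M : R) i (f : 'rV[R]_d -> R) : class_C 1 f ->
  supp_in M f -> supp_in M (partial i f).
Proof. move=> fC; exact: (supp_in_derive (fun x => class_C_is_derive i x fC)). Qed.

Lemma supp_in_laplacian (M : R) (f : 'rV[R]_d -> R) : class_C 2 f ->
  supp_in M f -> supp_in M (laplacian f).
Proof.
move=> fC fM x xM; rewrite /laplacian big1// => i _.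
exact (@supp_in_partial M i _ (class_C_partial i fC) (@supp_in_partial M i _ (class_CW fC) fM) x xM).
Qed.

(** The difference of the integrands is the divergence of the compactly supported field
    [S grad P - P grad S]. *)
Lemma green (S P : 'rV[R]_d -> R) (M : R) : class_C 2 S -> class_C 2 P ->
  supp_in M P -> Int (fun x => S x * laplacian P x) = Int (fun x => laplacian S x * P x).
Proof.
move=> SC PC PM; apply/eqP; rewrite -subr_eq0.
have SC1 := class_CW SC; have PC1 := class_CW PC.
have Sc := class_C_continuous SC; have Pc := class_C_continuous PC.
have cM (f g : 'rV[R]_d -> R) : continuous f -> continuous g -> continuous (fun x => f x * g x).
  by move=> fc gc x; apply: continuousM; [exact: fc|exact: gc].
rewrite -IntB; [|by apply: (@integrable_csupp _ _ M); [apply: cM => //; exact: class_C2_laplacian_continuous|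
  apply: supp_in_mulr; exact: supp_in_laplacian]|
  by apply: (@integrable_csupp _ _ M); [apply: cM => //; exact: class_C2_laplacian_continuous|
  exact: supp_in_mulr]].
rewrite /laplacian.
have -> : (fun x => S x * (\sum_i partial i (partial i P) x) - (\sum_i partial i (partial i S) x) * P x) =
   (fun x => \sum_i (S x * partial i (partial i P) x - partial i (partial i S) x * P x)).
  by apply/funext => x; rewrite mulr_sumr mulr_suml -sumrB.
have c2 (f : 'rV[R]_d -> R) i : class_C 2 f -> class_C 0 (partial i (partial i f)).
  by move=> fC; exact: class_C_partial i (class_C_partial i fC).
have s2 i : supp_in M (partial i (partial i P)).
  exact (@supp_in_partial M i _ (class_C_partial i PC) (@supp_in_partial M i _ PC1 PM)).
have cc i : continuous (fun x => S x * partial i (partial i P) x - partial i (partial i S) x * P x).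
  by apply: class_C_continuous; apply: class_C_sub; apply: class_C_mul;
    [exact: (@class_CW _ _ 0 _ SC1)|exact: c2|exact: c2|exact: (@class_CW _ _ 0 _ PC1)].
have ss i : supp_in M (fun x => S x * partial i (partial i P) x - partial i (partial i S) x * P x).
  by move=> x xM; rewrite (PM _ xM) (s2 i _ xM) !mulr0 subrr.
rewrite Int_sum; last by move=> i; exact: integrable_csupp (cc i) (ss i).
rewrite big1// => i _; rewrite /Rintegral.
have sF : supp_in M (fun x => S x * partial i P x - P x * partial i S x).
  by move=> x xM; rewrite (PM _ xM) (@supp_in_partial M i _ PC1 PM x xM) mulr0 mul0r subrr.
have dF x : is_derive x (delta_mx ord0 i) (fun x => S x * partial i P x - P x * partial i S x)
    (S x * partial i (partial i P) x - partial i (partial i S) x * P x).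
  have dS := class_C_is_derive i x SC; have dP := class_C_is_derive i x PC.
  have dS2 := class_C_is_derive i x (class_C_partial i SC).
  have dP2 := class_C_is_derive i x (class_C_partial i PC).
  apply: (is_derive_eq (is_derive_subf (is_derive_mulf dS dP2) (is_derive_mulf dP dS2))).
  move: (S x) (P x) (partial i S x) (partial i P x) (partial i (partial i S) x)
    (partial i (partial i P) x) => *; ring.
by rewrite (integral_partial0 dF (cc i) sF (ss i)).
Qed.

(** Balls are those of the sup norm, hence products of intervals of length [2 * e]. *)
Lemma lebesgue_ball n (x : 'rV[R]_n) (e : R) : 0 < e ->
  lebesgue_rV R n (ball x e) = ((2 * e) ^+ n)%:E.
Proof.
move=> e0; elim: n x => [|n IHn] x.
  rewrite expr0 /= diracE mem_set//.
  by apply: cst_in_ball => // -[].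
change ((lebesgue_measure \x lebesgue_rV R n)%E (@cons_rV R n @^-1` ball x e) =
  ((2 * e) ^+ n.+1)%:E).
pose x' : 'rV[R]_(1 + n) := x.
rewrite (_ : _ @^-1` _ = ball (x' ord0 (@lshift 1 n ord0)) e `*`
    ball (\row_j x' ord0 (rshift 1 j)) e); last first.
  apply/seteqP; split=> [z /ball_coord zx|z [z1 z2]].
    split; first by have := zx (@lshift 1 n ord0); rewrite cons_rV0.
    apply: cst_in_ball => // j; have := zx (@rshift 1 n j).
    by rewrite cons_rVr mxE.
  apply: cst_in_ball => // i; case: (split_ordP (i : 'I_(1 + n))) => j ->.
    by rewrite cons_rV0 (ord1 j).
  by rewrite cons_rVr; have := ball_coord z2 j; rewrite mxE.
rewrite product_measure1E; last 2 first.
- exact: measurable_ball.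
- by apply: open_measurable_mx; exact: ball_open.
rewrite IHn exprS EFinM; congr (_ * _)%E.
have h := @lebesgue_measure_ball R (x' ord0 (@lshift 1 n ord0)) e (ltW e0).
by rewrite mulr_natl; exact: h.
Qed.

Lemma Int_ball_ge (f : 'rV[R]_d -> R) (x : 'rV[R]_d) (e c : R) : 0 < e -> 0 <= c ->
  leb.-integrable setT (EFin \o f) -> (forall y, 0 <= f y) ->
  (forall y, ball x e y -> c <= f y) -> c * (2 * e) ^+ d <= Int f.
Proof.
move=> e0 c0 fi f0 fc.
have mb : measurable (ball x e) by apply: open_measurable_mx; exact: ball_open.
rewrite -lee_fin EFin_Int// EFinM -(lebesgue_ball x e0) -integral_cst//.
apply: (@le_trans _ _ (\int[leb]_(y in ball x e) (f y)%:E)%E).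
  apply: ge0_le_integral => //; try by move=> y *; rewrite lee_fin ?fc.
  by apply: measurable_funTS; exact: measurable_int fi.
apply: ge0_subset_integral => //; first exact: measurable_int fi.
by move=> y _; rewrite lee_fin.
Qed.

Lemma Int_continuous_eq0 (f : 'rV[R]_d -> R) : continuous f -> (forall y, 0 <= f y) ->
  leb.-integrable setT (EFin \o f) -> Int f <= 0 -> f =1 (fun=> 0).
Proof.
move=> fc f0 fi I0 x; apply/eqP; rewrite eq_le f0 andbT leNgt; apply/negP => fx.
have : \forall y \near x, f x / 2 < f y.
  by apply: (cvgr_gt _ (fc x)); rewrite ltr_pdivrMr// mulr2n mulrDr mulr1 ltrDl.
move=> /nbhs_ballP[e /= e0 ef].
have IH : f x / 2 * (2 * e) ^+ d <= Int f.
  apply: (@Int_ball_ge _ x) => //; first by rewrite divr_ge0// ltW.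
  by move=> y /ef /ltW.
move: (le_trans IH I0); apply/negP; rewrite -ltNge.
by rewrite mulr_gt0 ?divr_gt0// exprn_gt0// mulr_gt0.
Qed.

End under_integral.

(** * Weighted means and pointwise consequences of distributional inequalities *)

Section bump.
Context {R : realType} {d : nat}.
Local Notation leb := (lebesgue_rV R d).
Local Notation Int f := (\int[leb]_x f x).
Local Notation itg f := (leb.-integrable setT (EFin \o f)).
Implicit Types (x y : 'rV[R]_d) (r : R).

Definition bump_arg x0 r y : R := 1 - r^-1 ^+ 2 * dot (y - x0) (y - x0).

Definition bump x0 r y : R := r^-1 ^+ d * flat 0 (bump_arg x0 r y).

(* The kernel of the means: its derivative in [r] is [r] times the Laplacian of
   [bump], which makes the means of a function monotone in [r] when the function
   is subharmonic. *)
Definition bumpw x0 r y : R := 2 * r^-1 ^+ d * flat 2 (bump_arg x0 r y).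

(** The Laplacian of [bump] in closed form, from which its joint continuity in the radius and the
    point can be read off. *)
Definition lap_bump x0 r y : R :=
  r^-1 ^+ d * ((flat 4 (bump_arg x0 r y) - 2 * flat 3 (bump_arg x0 r y)) *
     (4 * r^-1 ^+ 4 * dot (y - x0) (y - x0))
   - 2 * d%:R * r^-1 ^+ 2 * flat 2 (bump_arg x0 r y)).

Lemma dot_ge0 x : 0 <= dot x x.
Proof. by apply: sumr_ge0 => i _; rewrite -expr2 sqr_ge0. Qed.

Lemma coord_le_dot x i : x ord0 i ^+ 2 <= dot x x.
Proof.
rewrite /dot (bigD1 i)//= -expr2 lerDl.
by apply: sumr_ge0 => j _; rewrite -expr2 sqr_ge0.
Qed.

Lemma bump_arg_le1 x0 r y : bump_arg x0 r y <= 1.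
Proof. by rewrite /bump_arg gerBl mulr_ge0 ?dot_ge0// sqr_ge0. Qed.

Lemma class_C_bump_arg k x0 r : class_C k (bump_arg x0 r).
Proof.
apply: class_C_sub; first exact: class_C_cst.
by apply: class_C_scale; exact: class_C_sqdist.
Qed.

Lemma class_C_bump k x0 r : class_C k (bump x0 r).
Proof.
by apply: class_C_scale; apply: class_C_flat => n; exact: class_C_bump_arg.
Qed.

Lemma class_C_bumpw k x0 r : class_C k (bumpw x0 r).
Proof.
by apply: class_C_scale; apply: class_C_flat => n; exact: class_C_bump_arg.
Qed.

Lemma is_derive_bump_arg i x0 r y : is_derive y (delta_mx ord0 i) (bump_arg x0 r)
  (- (2 * r^-1 ^+ 2 * (y ord0 i - x0 ord0 i))).
Proof.
have := is_derive_subf (is_derive_cstf 1 y (delta_mx ord0 i))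
  (is_derive_scalef (r^-1 ^+ 2) (is_derive_sqdist i x0 y)).
by move/is_derive_eq; apply; ring.
Qed.

Lemma partial_bump i x0 r : partial i (bump x0 r) =
  (fun y => r^-1 ^+ d * (flat 2 (bump_arg x0 r y) *
     (- (2 * r^-1 ^+ 2 * (y ord0 i - x0 ord0 i))))).
Proof.
apply/funext => y.
have := is_derive_scalef (r^-1 ^+ d)
  (is_derive_compf (is_derive_flat 0 (bump_arg x0 r y)) (is_derive_bump_arg i x0 r y)).
by case=> _; rewrite /partial => ->; rewrite mul0r subr0.
Qed.

Lemma laplacian_bump x0 r y : laplacian (bump x0 r) y = lap_bump x0 r y.
Proof.
rewrite /laplacian.
have E i : partial i (partial i (bump x0 r)) y =
    r^-1 ^+ d * ((flat 4 (bump_arg x0 r y) - 2 * flat 3 (bump_arg x0 r y)) *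
     (4 * r^-1 ^+ 4 * (y ord0 i - x0 ord0 i) ^+ 2)
     - 2 * r^-1 ^+ 2 * flat 2 (bump_arg x0 r y)).
  rewrite partial_bump.
  have dl := is_derive_oppf (is_derive_scalef (2 * r^-1 ^+ 2)
    (is_derive_subf (is_derive_coord i i y) (is_derive_cstf (x0 ord0 i) y (delta_mx ord0 i)))).
  have := is_derive_scalef (r^-1 ^+ d) (is_derive_mulf
    (is_derive_compf (is_derive_flat 2 (bump_arg x0 r y)) (is_derive_bump_arg i x0 r y)) dl).
  by case=> _; rewrite /partial => ->; rewrite eqxx (_ : true%:R = 1 :> R)//; ring.
under eq_bigr do rewrite E.
rewrite -mulr_sumr /lap_bump; congr (_ * _).
rewrite sumrB; congr (_ - _).
  rewrite -!mulr_sumr; congr (_ * (_ * _)).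
  by apply: eq_bigr => i _; rewrite !mxE expr2.
by rewrite sumr_const card_ord -[LHS]mulr_natl; ring.
Qed.

(** Both sides are the same divergence: the dilation structure of the kernel makes its derivative in
    [r] equal to [- r^-1 div ((y - x0) bumpw)], while the gradient of [bump] is
    [- r^-2 (y - x0) bumpw]. The proof checks the identity by direct computation. *)
Lemma is_derive_bumpw x0 r y : 0 < r ->
  is_derive r 1 (fun s => bumpw x0 s y) (r * lap_bump x0 r y).
Proof.
move=> r0; have rn0 : r != 0 by rewrite gt_eqF.
have dV : is_derive r 1 (fun z : R => z^-1) (- (1 / r ^+ 2)).
  exact: (is_derive_invf rn0 (is_derive_id r (1 : R))).
have dA : is_derive r 1 (fun s => bump_arg x0 s y)
    (2 * r^-1 ^+ 3 * dot (y - x0) (y - x0)).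
  have := is_derive_subf (is_derive_cstf 1 r (1 : R))
    (is_derive_mulf (is_derive_powf 2 dV) (is_derive_cstf (dot (y - x0) (y - x0)) r (1 : R))).
  by move/is_derive_eq; apply; rewrite /= expr1; field.
have := is_derive_mulf (is_derive_scalef 2 (is_derive_powf d dV))
  (@is_derive_compf R _ (flat 2) (fun s => bump_arg x0 s y) r 1 _ _
     (is_derive_flat 2 (bump_arg x0 r y)) dA).
move/is_derive_eq; apply; rewrite /lap_bump.
move: (flat 2 _) (flat 3 _) (flat 4 _) (dot _ _) => f2 f3 f4 D.
case: (d) => [|n] /=; first by rewrite !expr0; field.
by rewrite ![r^-1 ^+ n.+1]exprS; move: (r^-1 ^+ n) => a; field.
Qed.

Lemma bump_ge0 x0 r y : 0 < r -> 0 <= bump x0 r y.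
Proof.
by move=> r0; rewrite mulr_ge0 ?flat_ge0// exprn_ge0// invr_ge0 ltW.
Qed.

Lemma bumpw_ge0 x0 r y : 0 < r -> 0 <= bumpw x0 r y.
Proof.
by move=> r0; rewrite !mulr_ge0 ?flat_ge0// exprn_ge0// invr_ge0 ltW.
Qed.

Lemma bump_le_bumpw x0 r y : 0 < r -> bump x0 r y <= 2^-1 * bumpw x0 r y.
Proof.
move=> r0; rewrite /bumpw !mulrA mulVf// mul1r ler_wpM2l//.
  by rewrite exprn_ge0// invr_ge0 ltW.
by apply: flat_leS2; exact: bump_arg_le1.
Qed.

Lemma bump_arg_le0 x0 r y : 0 < r -> r ^+ 2 <= dot (y - x0) (y - x0) ->
  bump_arg x0 r y <= 0.
Proof.
move=> r0 D; rewrite /bump_arg subr_le0 exprVn.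
by rewrite -(@divff _ (r ^+ 2)) ?expf_neq0 ?gt_eqF// mulrC ler_wpM2l// invr_ge0 sqr_ge0.
Qed.

Lemma bump_arg_gt0 x0 r y : 0 < r -> dot (y - x0) (y - x0) < r ^+ 2 ->
  0 < bump_arg x0 r y.
Proof.
move=> r0 D; rewrite /bump_arg subr_gt0 exprVn.
by rewrite mulrC ltr_pdivrMr ?exprn_gt0// mul1r.
Qed.

Definition bump_radius x0 r : R := \sum_i `|x0 ord0 i| + r.

Lemma bump_arg_out x0 r s y : 0 < s -> s <= r -> ~ cube (bump_radius x0 r) y ->
  bump_arg x0 s y <= 0.
Proof.
move=> s0 sr /existsNP[i /negP]; rewrite -ltNge => yi.
apply: bump_arg_le0 => //; apply: le_trans (coord_le_dot _ i).
rewrite !mxE -[leRHS]real_normK ?num_real// ler_sqr ?nnegrE ?normr_ge0 ?(ltW s0)//.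
have xi : `|x0 ord0 i| <= \sum_j `|x0 ord0 j|.
  by rewrite (bigD1 i)//= lerDl sumr_ge0.
have := ler_normB (y ord0 i - x0 ord0 i) (- x0 ord0 i).
rewrite opprK subrK normrN => h.
by move: yi xi h; rewrite /bump_radius; set S := \sum_j _; lra.
Qed.

Lemma supp_in_bump x0 r s : 0 < s -> s <= r -> supp_in (bump_radius x0 r) (bump x0 s).
Proof.
by move=> s0 sr y yM; rewrite /bump flat_le0 ?mulr0//; exact: bump_arg_out yM.
Qed.

Lemma supp_in_bumpw x0 r s : 0 < s -> s <= r -> supp_in (bump_radius x0 r) (bumpw x0 s).
Proof.
by move=> s0 sr y yM; rewrite /bumpw flat_le0 ?mulr0//; exact: bump_arg_out yM.
Qed.

Lemma supp_in_lap_bump x0 r s : 0 < s -> s <= r ->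
  supp_in (bump_radius x0 r) (lap_bump x0 s).
Proof.
move=> s0 sr y yM; have h := bump_arg_out s0 sr yM.
by rewrite /lap_bump !flat_le0// !mulr0 !subrr mul0r subr0 mulr0.
Qed.

Lemma continuous_bump x0 r : continuous (bump x0 r).
Proof. exact: (@class_C_continuous _ _ 0 _ (class_C_bump 0 x0 r)). Qed.

Lemma continuous_bumpw x0 r : continuous (bumpw x0 r).
Proof. exact: (@class_C_continuous _ _ 0 _ (class_C_bumpw 0 x0 r)). Qed.

Lemma continuous_mulf (f g : 'rV[R]_d -> R) : continuous f -> continuous g ->
  continuous (fun x => f x * g x).
Proof. by move=> fc gc x; apply: continuousM; [exact: fc|exact: gc]. Qed.

Lemma itg_bump (u : 'rV[R]_d -> R) x0 r : continuous u -> 0 < r ->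
  itg (fun y => u y * bump x0 r y).
Proof.
move=> uc r0; apply: (@integrable_csupp _ _ (bump_radius x0 r)).
  by apply: continuous_mulf => //; exact: continuous_bump.
by apply: supp_in_mulr; exact: supp_in_bump.
Qed.

Lemma itg_bumpw (u : 'rV[R]_d -> R) x0 r : continuous u -> 0 < r ->
  itg (fun y => u y * bumpw x0 r y).
Proof.
move=> uc r0; apply: (@integrable_csupp _ _ (bump_radius x0 r)).
  by apply: continuous_mulf => //; exact: continuous_bumpw.
by apply: supp_in_mulr; exact: supp_in_bumpw.
Qed.

Lemma itg_lap_bump (u : 'rV[R]_d -> R) x0 r : continuous u -> 0 < r ->
  itg (fun y => u y * laplacian (bump x0 r) y).
Proof.
move=> uc r0; apply: (@integrable_csupp _ _ (bump_radius x0 r)).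
  apply: continuous_mulf => //; apply: class_C2_laplacian_continuous.
  exact: class_C_bump.
apply: supp_in_mulr; apply: supp_in_laplacian; first exact: class_C_bump.
exact: supp_in_bump.
Qed.

Lemma continuous_lap_bump2 x0 (u : 'rV[R]_d -> R) s y : continuous u -> 0 < s ->
  {for (s, y), continuous (fun z : R * 'rV[R]_d => u z.2 * (z.1 * lap_bump x0 z.1 z.2))}.
Proof.
move=> uc s0.
have c1 : {for (s, y), continuous (fun z : R * 'rV[R]_d => z.1)} by exact: cvg_fst.
have c2 : {for (s, y), continuous (fun z : R * 'rV[R]_d => z.2)} by exact: cvg_snd.
have cV : {for (s, y), continuous (fun z : R * 'rV[R]_d => z.1^-1)}.
  by apply: cvgV => //; rewrite gt_eqF.
have cM (f g : R * 'rV[R]_d -> R) : {for (s, y), continuous f} ->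
    {for (s, y), continuous g} -> {for (s, y), continuous (fun z => f z * g z)}.
  by move=> fc gc; apply: cvgM.
have cB (f g : R * 'rV[R]_d -> R) : {for (s, y), continuous f} ->
    {for (s, y), continuous g} -> {for (s, y), continuous (fun z => f z - g z)}.
  by move=> fc gc; apply: cvgB.
have cK (c : R) : {for (s, y), continuous (fun _ : R * 'rV[R]_d => c)} by exact: cvg_cst.
have cX n : {for (s, y), continuous (fun z : R * 'rV[R]_d => z.1^-1 ^+ n)}.
  by apply: (@continuous_comp _ _ _ (fun z : R * 'rV[R]_d => z.1^-1) (fun t => t ^+ n) (s, y));
    [exact: cV|exact: exprn_continuous].
have cC (f : 'rV[R]_d -> R) : continuous f ->
    {for (s, y), continuous (fun z : R * 'rV[R]_d => f z.2)}.
  by move=> fc; apply: (@continuous_comp _ _ _ (fun z : R * 'rV[R]_d => z.2) f (s, y));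
    [exact: c2|exact: fc].
have cD := cC _ (@class_C_continuous _ _ 0 _ (class_C_sqdist 0 x0)).
have cA : {for (s, y), continuous (fun z : R * 'rV[R]_d => bump_arg x0 z.1 z.2)}.
  by rewrite /bump_arg; apply: (cB); [exact: cK|apply: (cM)].
have cF k : {for (s, y), continuous (fun z : R * 'rV[R]_d => flat k (bump_arg x0 z.1 z.2))}.
  by apply: (@continuous_comp _ _ _ (fun z : R * 'rV[R]_d => bump_arg x0 z.1 z.2) (flat k) (s, y));
    [exact: cA|exact: flat_continuous].
apply: (cM); first exact: cC.
apply: (cM); first exact: c1.
apply: (cM); first exact: cX.
apply: (cB); apply: (cM).
- by apply: (cB); [exact: cF|apply: (cM); [exact: cK|exact: cF]].
- by apply: (cM); [apply: (cM); [exact: cK|exact: cX]|exact: cD].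
- by apply: (cM); [exact: cK|exact: cX].
- exact: cF.
Qed.

(** The domination required under the integral comes from compactness of the strip of radii between
    [r / 2] and [2 * r]. *)
Lemma is_derive_mean (u : 'rV[R]_d -> R) x0 r : continuous u -> 0 < r ->
  is_derive r 1 (fun s => Int (fun y => u y * bumpw x0 s y))
    (r * Int (fun y => u y * laplacian (bump x0 r) y)).
Proof.
move=> uc r0.
have r20 : 0 < r / 2 by rewrite divr_gt0.
have r2 : r / 2 < 2 * r by lra.
set M := bump_radius x0 (2 * r).
have [C C0 HC] := @bounded_strip _ _
  (fun s y => u y * (s * lap_bump x0 s y)) (r / 2) (2 * r) M (ltW r2)
  (fun s y h => @continuous_lap_bump2 x0 u s y uc (lt_le_trans r20 (proj1 (andP h)))).
have sin s : s \in `](r / 2), (2 * r)[ -> 0 < s /\ s <= 2 * r.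
  by rewrite in_itv/= => /andP[s1 s2]; split; [exact: lt_trans s1|exact: ltW].
have := @is_derive_Int _ _ (fun s y => u y * bumpw x0 s y)
  (fun s y => u y * (s * lap_bump x0 s y)) (r / 2) (2 * r) r M C.
have rin : r \in `](r / 2), (2 * r)[ by rewrite in_itv/=; apply/andP; split; lra.
move=> /(_ rin) H.
have {}H : is_derive r 1 (fun s => Int (fun y => u y * bumpw x0 s y))
   (Int (fun y => u y * (r * lap_bump x0 r y))).
  apply: H.
  - move=> s y /sin[s0 _]; exact: is_derive_scalef (is_derive_bumpw x0 y s0).
  - by move=> s _; apply: continuous_mulf => //; exact: continuous_bumpw.
  - by move=> s /sin[s0 s2]; apply: supp_in_mulr; exact: supp_in_bumpw.
  - move=> s y sab; have [s0 s2] := sin _ sab; have [yM|yM] := pselect (cube M y).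
      rewrite indicE mem_set// mulr1; apply: HC => //.
      by move: sab; rewrite in_itv/= => /andP[/ltW-> /ltW->].
    by rewrite (supp_in_lap_bump s0 s2 yM) !mulr0 normr0 indicE memNset// mulr0.
apply: is_derive_eq H _; rewrite -IntZ; last exact: itg_lap_bump.
by apply: Int_eq => y; rewrite laplacian_bump; ring.
Qed.

Lemma itg_bumpw1 x0 r : 0 < r -> itg (bumpw x0 r).
Proof.
move=> r0; apply: (@integrable_csupp _ _ (bump_radius x0 r)); last exact: supp_in_bumpw.
exact: continuous_bumpw.
Qed.

(** The means of the constant 1 have as derivative [r] times the integral of the Laplacian of a
    compactly supported function, which vanishes by Green's identity. *)
Lemma Int_bumpw_cst x0 r : 0 < r -> Int (bumpw x0 r) = Int (bumpw x0 1).
Proof.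
have D (s : R) : 0 < s -> is_derive s 1 (fun s => Int (bumpw x0 s)) 0.
  move=> s0; have := is_derive_mean x0 (@cst_continuous _ _ (1 : R)) s0.
  have -> : Int (fun y => 1 * laplacian (bump x0 s) y) = 0.
    rewrite (green (S := fun=> 1) (class_C_cst 2 1) (class_C_bump 2 x0 s)
      (supp_in_bump (x0 := x0) s0 (lexx s))).
    rewrite -[RHS](@Int0 _ _ _ leb); apply: Int_eq => y.
    rewrite /laplacian big1 ?mul0r// => i _.
    have -> : partial i (fun _ : 'rV[R]_d => (1 : R)) = (fun=> 0).
      by apply/funext => z; case: (is_derive_cstf (1 : R) z (delta_mx ord0 i)).
    by case: (is_derive_cstf (0 : R) y (delta_mx ord0 i)).
  rewrite mulr0; apply: is_derive_ext => // t.
  by apply: Int_eq => y; rewrite mul1r.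
have E (a b : R) : 0 < a -> a <= b -> Int (bumpw x0 b) = Int (bumpw x0 a).
  move=> a0 ab; apply/eqP; rewrite -subr_eq0 -normr_eq0 eq_le normr_ge0 andbT.
  rewrite (le_trans (@norm_is_derive_le _ (fun s => Int (bumpw x0 s)) (fun=> 0) a b 0 ab _ _ _))//.
  - by move=> s; rewrite in_itv/= => /andP[as_ _]; apply: D; exact: lt_trans as_.
  - by move=> s _; rewrite normr0.
  - apply: (@is_derive_within_continuous _ _ (fun=> 0)) => s.
    by rewrite in_itv/= => /andP[as_ _]; apply: D; exact: lt_le_trans as_.
  - by rewrite mul0r.
move=> r0; have [r1|r1] := leP r 1; first by rewrite (E _ _ r0 r1).
by rewrite (E _ _ ltr01 (ltW r1)).
Qed.

(** The point is uniformity in the centre; it is read off from a small ball around [x0], without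
    invoking translation invariance of the measure. *)
Lemma Int_bumpw_lower : exists2 c : R, 0 < c & forall x0, c <= Int (bumpw x0 1).
Proof.
(* On the sup-norm ball of this radius the squared Euclidean distance to [x0] is at most
   [d * e ^+ 2 <= 1 / 2], hence [bump_arg x0 1] is at least 1/2 and the kernel at least
   [2 * expR (- 2)]. *)
pose e : R := (2 * d.+1%:R)^-1.
have e0 : 0 < e by rewrite invr_gt0 mulr_gt0.
exists (2 * expR (- 2) * (2 * e) ^+ d).
  by rewrite mulr_gt0 ?mulr_gt0 ?expR_gt0// exprn_gt0// mulr_gt0.
move=> x0; apply: (@Int_ball_ge _ _ _ x0) => //.
- exact: itg_bumpw1.
- by move=> y; exact: bumpw_ge0.
move=> y yx; have D2 : dot (y - x0) (y - x0) <= 2^-1.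
  rewrite /dot (@le_trans _ _ (\sum_(i < d) e ^+ 2))//.
    apply: ler_sum => i _; rewrite !mxE -expr2 -[leLHS]real_normK ?num_real//.
    rewrite ler_sqr ?nnegrE ?normr_ge0 ?(ltW e0)// distrC.
    by apply/ltW; exact: ball_coord yx i.
  rewrite sumr_const card_ord -[leLHS]mulr_natl.
  have d1 : d%:R <= d.+1%:R :> R by rewrite ler_nat.
  have dp : 0 < d.+1%:R :> R by [].
  have dd : 1 <= d.+1%:R :> R by rewrite ler1n.
  rewrite /e exprVn ler_pdivrMr ?exprn_gt0 ?mulr_gt0//.
  move: d1 dp dd; set a := d%:R; set b := d.+1%:R => d1 dp dd; nra.
have v2 : 2^-1 <= bump_arg x0 1 y.
  by rewrite /bump_arg invr1 expr1n mul1r; lra.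
have v0 : 0 < bump_arg x0 1 y by rewrite (lt_le_trans _ v2)// invr_gt0.
rewrite /bumpw invr1 expr1n mulr1 ler_wpM2l// /flat v0.
rewrite -[leLHS]mul1r ler_pM ?expR_ge0//.
  by rewrite exprVn invf_ge1 ?exprn_gt0// exprn_ile1 ?(ltW v0) ?bump_arg_le1.
by rewrite ler_expR lerN2 -[leRHS]invrK lef_pV2 ?posrE ?invr_gt0.
Qed.

Lemma mean_cvg (u : 'rV[R]_d -> R) x0 e : continuous u -> 0 < e ->
  exists2 r0 : R, 0 < r0 & forall r, 0 < r -> r < r0 ->
    `|Int (fun y => u y * bumpw x0 r y) - u x0 * Int (bumpw x0 1)| <= e * Int (bumpw x0 1).
Proof.
move=> uc e0.
have : \forall y \near x0, `|u x0 - u y| < e by move/cvgrPdist_lt : (uc x0) => /(_ e e0).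
move=> /nbhs_ballP[r1 /= r10 H]; exists r1 => // r r0 rr1.
have I0 := itg_bumpw1 x0 r0.
rewrite -(Int_bumpw_cst x0 r0) -!IntZ// -IntB//; last 2 first.
- exact: itg_bumpw.
- exact: itgZ.
have I1 : itg (fun y => u y * bumpw x0 r y - u x0 * bumpw x0 r y).
  by apply: itgB; [exact: itg_bumpw|exact: itgZ].
apply: (le_trans (Int_norm I1)); apply: Int_le.
- exact: itg_norm.
- exact: itgZ.
move=> y; rewrite -mulrBl normrM (ger0_norm (bumpw_ge0 x0 y r0)).
have [D|D] := ltP (dot (y - x0) (y - x0)) (r ^+ 2); last first.
  by rewrite /bumpw flat_le0 ?mulr0//; exact: bump_arg_le0.
rewrite ler_wpM2r ?bumpw_ge0// distrC; apply/ltW/H/cst_in_ball => // i.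
have := le_lt_trans (coord_le_dot (y - x0) i) D.
rewrite !mxE -[ltLHS]real_normK ?num_real// ltr_sqr ?nnegrE ?normr_ge0 ?(ltW r0)// distrC => h.
exact: lt_trans rr1.
Qed.

End bump.

(** * Maximum principles from the monotonicity of weighted means *)

Section mean_monotonicity.
Context {R : realType} {d : nat}.
Local Notation leb := (lebesgue_rV R d).
Local Notation Int f := (\int[leb]_x f x).
Local Notation itg f := (leb.-integrable setT (EFin \o f)).
Implicit Types (x y : 'rV[R]_d) (r : R) (u k : 'rV[R]_d -> R).

Lemma half_lt r : 0 < r -> r / 2 < r.
Proof. by move=> r0; lra. Qed.

Lemma bumpw_ball x0 r e y : 0 < r -> r <= e -> ~ ball x0 e y -> bump_arg x0 r y <= 0.
Proof.
move=> r0 re yx; apply: bump_arg_le0 => //; rewrite leNgt; apply/negP => D; apply: yx.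
have e0 : 0 < e by exact: lt_le_trans re.
apply: cst_in_ball => // i; have := le_lt_trans (coord_le_dot (y - x0) i) D.
rewrite !mxE -[ltLHS]real_normK ?num_real// ltr_sqr ?nnegrE ?normr_ge0 ?(ltW r0)//.
by rewrite distrC => h; exact: lt_le_trans re.
Qed.

Lemma ge0_derive_mono (f df : R -> R) (a b c : R) :
  (forall s, s \in `]0, c[ -> is_derive s 1 f (df s)) ->
  (forall s, s \in `]0, c[ -> 0 <= df s) -> 0 < a -> a <= b -> b < c -> f a <= f b.
Proof.
move=> fd df0 a0 ab bc.
have sub s : a <= s -> s <= b -> s \in `]0, c[.
  by move=> as_ sb; rewrite in_itv/= (lt_le_trans a0 as_) (le_lt_trans sb bc).
have h1 s : s \in `]a, b[ -> is_derive s 1 f (df s).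
  by rewrite in_itv/= => /andP[/ltW as_ /ltW sb]; exact: fd (sub _ as_ sb).
have h2 s : s \in `]a, b[ -> 0 <= df s.
  by rewrite in_itv/= => /andP[/ltW as_ /ltW sb]; exact: df0 (sub _ as_ sb).
have h3 s : s \in `[a, b] -> is_derive s 1 f (df s).
  by rewrite in_itv/= => /andP[as_ sb]; exact: fd (sub _ as_ sb).
exact: (ge0_is_derive_le ab h1 h2 (is_derive_within_continuous h3)).
Qed.

(** If [k x0 > 0], then [k > 0] near [x0] and the means of [u] increase strictly with the radius.
    They tend to [u x0 * c1] as the radius vanishes, with [c1] the mass of the kernel, but cannot
    exceed this value because [u] is maximal at [x0]. *)
Lemma viscosity_max u k x0 (rho : R) : continuous u -> continuous k -> 0 < rho ->
  (forall r, 0 < r -> r < rho -> Int (fun y => k y * bump x0 r y) <=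
     Int (fun y => u y * laplacian (bump x0 r) y)) ->
  (forall y, ball x0 rho y -> u y <= u x0) -> k x0 <= 0.
Proof.
move=> uc kc rho0 H umax; rewrite leNgt; apply/negP => k0.
have : \forall y \near x0, 0 < k y by apply: (cvgr_gt _ (kc x0)).
move=> /nbhs_ballP[r1 /= r10 Hk].
set r2 := Num.min rho r1.
have r20 : 0 < r2 by rewrite lt_min rho0 r10.
have r2r : r2 <= rho by rewrite ge_min lexx.
have r2r1 : r2 <= r1 by rewrite ge_min lexx orbT.
pose M r := Int (fun y => u y * bumpw x0 r y).
pose dM r := r * Int (fun y => u y * laplacian (bump x0 r) y).
have Md s : s \in `]0, r2[ -> is_derive s 1 M (dM s).
  by rewrite in_itv/= => /andP[s0 _]; exact: is_derive_mean.
have dM0 s : s \in `]0, r2[ -> 0 < dM s.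
  rewrite in_itv/= => /andP[s0 s2]; rewrite mulr_gt0//.
  apply: lt_le_trans (H _ s0 (lt_le_trans s2 r2r)).
  rewrite ltNge; apply/negP => I0.
  have kb y : 0 <= k y * bump x0 s y.
    have [yb|yb] := pselect (ball x0 r1 y).
      by rewrite mulr_ge0 ?bump_ge0// ltW//; exact: Hk.
    rewrite /bump flat_le0 ?mulr0//.
    exact: bumpw_ball s0 (le_trans (ltW s2) r2r1) yb.
  have := Int_continuous_eq0 (continuous_mulf kc (@continuous_bump R d x0 s)) kb
    (itg_bump x0 kc s0) I0 x0.
  apply/eqP; rewrite gt_eqF// mulr_gt0// mulr_gt0 ?exprn_gt0 ?invr_gt0//.
  apply: flat_gt0; apply: bump_arg_gt0 => //.
  by rewrite subrr /dot big1 ?exprn_gt0// => i _; rewrite mxE mul0r.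
have [c c0 Hc] := @Int_bumpw_lower R d.
set c1 := Int (bumpw x0 1); have c10 : 0 < c1 := lt_le_trans c0 (Hc x0).
have Mle s : 0 < s -> s < r2 -> M s <= u x0 * c1.
  move=> s0 s2; rewrite /c1 -(Int_bumpw_cst x0 s0) -IntZ; last exact: itg_bumpw1.
  apply: Int_le; [exact: itg_bumpw|by apply: itgZ; exact: itg_bumpw1|].
  move=> y; have [yb|yb] := pselect (ball x0 rho y).
    by rewrite ler_wpM2r ?bumpw_ge0// umax.
  rewrite /bumpw flat_le0 ?mulr0//.
  exact: bumpw_ball s0 (le_trans (ltW s2) r2r) yb.
pose b := r2 / 2; pose a := r2 / 4.
have [a0 ab br] : [/\ 0 < a, a < b & b < r2].
  by rewrite /a /b; move: r20; clear; move: r2 => r; split; lra.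
have gap : M a < M b.
  have [z zab E] := @MVT _ M dM a b ab
    (fun s h => Md s (ltac:(by move: h; rewrite !in_itv/= => /andP[h1 h2];
      rewrite (lt_trans a0 h1) (lt_trans h2 br))))
    (@is_derive_within_continuous _ M dM a b (fun s h => Md s
      (ltac:(by move: h; rewrite !in_itv/= => /andP[h1 h2];
      rewrite (lt_le_trans a0 h1) (le_lt_trans h2 br))))).
  rewrite -subr_gt0 E mulr_gt0 ?subr_gt0// dM0//.
  by move: zab; rewrite !in_itv/= => /andP[h1 h2]; rewrite (lt_trans a0 h1) (lt_trans h2 br).
pose e := (M b - M a) / (2 * c1).
have e0 : 0 < e by rewrite divr_gt0 ?subr_gt0// mulr_gt0.
have [r0 r00 Hr] := mean_cvg x0 uc e0.
pose s := Num.min (r0 / 2) a.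
have s0 : 0 < s by rewrite lt_min a0 andbT divr_gt0.
have sr0 : s < r0 by rewrite gt_min half_lt.
have sa : s <= a by rewrite ge_min lexx orbT.
have := Hr s s0 sr0; rewrite -/c1 -/(M s) ler_norml => /andP[h1 _].
have h2 : M s <= M a.
  exact: (@ge0_derive_mono M dM s a r2 Md (fun s h => ltW (dM0 s h)) s0 sa (lt_trans ab br)).
have h3 := Mle b (lt_trans a0 ab) br.
have h4 : e * c1 = (M b - M a) / 2.
  by rewrite /e invfM mulrA mulfVK// gt_eqF.
move: h1 h2 h3 gap; rewrite h4; move: (M s) (M a) (M b) (u x0 * c1); clear.
by move=> p q r t; lra.
Qed.

(** By Gronwall, [expR (- (C / 4 * r ^+ 2))] times the mean of [u] is nonincreasing in the radius.
    It tends to 0 with the radius since [u x0 = 0], so the means of the nonnegative function [u]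
    vanish. *)
Lemma strong_minimum u x0 (C rho : R) : continuous u -> (forall y, 0 <= u y) ->
  u x0 = 0 -> 0 < C -> 0 < rho ->
  (forall r, 0 < r -> r < rho -> Int (fun y => u y * laplacian (bump x0 r) y) <=
     C * Int (fun y => u y * bump x0 r y)) ->
  forall y, dot (y - x0) (y - x0) < (rho / 2) ^+ 2 -> u y = 0.
Proof.
move=> uc u0 ux0 C0 rho0 H.
pose M r := Int (fun y => u y * bumpw x0 r y).
pose f r := - (expR (- (C / 4 * r ^+ 2)) * M r).
have Mge0 s : 0 < s -> 0 <= M s.
  by move=> s0; apply: Int_ge0 => y; rewrite mulr_ge0 ?bumpw_ge0.
pose df r := - (expR (- (C / 4 * r ^+ 2)) * (r * Int (fun y => u y * laplacian (bump x0 r) y))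
   + M r * (expR (- (C / 4 * r ^+ 2)) * - (C / 4 * (2 * r)))).
have fd s : s \in `]0, rho[ -> is_derive s 1 f (df s).
  rewrite in_itv/= => /andP[s0 _].
  have dX := is_derive_expf (is_derive_oppf (is_derive_scalef (C / 4)
    (is_derive_powf 2 (is_derive_id s (1 : R))))).
  have := is_derive_oppf (is_derive_mulf dX (is_derive_mean x0 uc s0)).
  by move/is_derive_eq; apply; rewrite /df /= expr1 mulr1.
have df0 s : s \in `]0, rho[ -> 0 <= df s.
  rewrite in_itv/= => /andP[s0 sr].
  have h1 : Int (fun y => u y * laplacian (bump x0 s) y) <= C / 2 * M s.
    apply: (le_trans (H _ s0 sr)); rewrite -mulrA ler_pM2l// -IntZ; last exact: itg_bumpw.
    apply: Int_le; [exact: itg_bump|by apply: itgZ; exact: itg_bumpw|].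
    by move=> y; rewrite [leRHS]mulrCA ler_wpM2l// bump_le_bumpw.
  have h2 : s * Int (fun y => u y * laplacian (bump x0 s) y) <= s * (C / 2 * M s).
    by rewrite ler_pM2l.
  have -> : df s = expR (- (C / 4 * s ^+ 2)) *
      (s * (C / 2 * M s) - s * Int (fun y => u y * laplacian (bump x0 s) y)).
    by rewrite /df; move: (expR _) (s * Rintegral _ _ _) (M s); clear => *; field.
  by rewrite mulr_ge0 ?expR_ge0// subr_ge0.
have M0 r : 0 < r -> r < rho -> M r <= 0.
  move=> r0 rr; apply/ler_addgt0Pl => e e0; rewrite addr0.
  have [c c0 Hc] := @Int_bumpw_lower R d.
  set c1 := Int (bumpw x0 1); have c10 : 0 < c1 := lt_le_trans c0 (Hc x0).
  pose e1 := e / (expR (C / 4 * r ^+ 2) * c1).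
  have e10 : 0 < e1 by rewrite divr_gt0// mulr_gt0 ?expR_gt0.
  have [r1 r10 Hr] := mean_cvg x0 uc e10.
  pose s := Num.min (r1 / 2) r.
  have s0 : 0 < s by rewrite lt_min r0 andbT divr_gt0.
  have sr1 : s < r1 by rewrite gt_min half_lt.
  have sr : s <= r by rewrite ge_min lexx orbT.
  have := Hr s s0 sr1; rewrite ux0 mul0r subr0 -/c1 -/(M s) => /(le_trans (ler_norm _)) h1.
  have := @ge0_derive_mono f df s r rho fd df0 s0 sr rr.
  rewrite /f lerN2 => h2.
  have h3 : expR (- (C / 4 * s ^+ 2)) * M s <= e1 * c1.
    apply: le_trans h1; rewrite ler_piMl ?Mge0// -expR0 ler_expR oppr_le0.
    by rewrite mulr_ge0 ?sqr_ge0// divr_ge0// ltW.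
  have h4 := le_trans h2 h3.
  rewrite -(@ler_pM2l _ (expR (- (C / 4 * r ^+ 2)))) ?expR_gt0// (le_trans h4)//.
  rewrite expRN /e1 invfM mulrA -mulrA mulVf ?gt_eqF// mulr1 mulrC//.
move=> y Dy.
have r20 : 0 < rho / 2 by rewrite divr_gt0.
have ub z : 0 <= u z * bumpw x0 (rho / 2) z by rewrite mulr_ge0 ?bumpw_ge0.
have r2r : rho / 2 < rho by rewrite half_lt.
have := Int_continuous_eq0 (continuous_mulf uc (@continuous_bumpw R d x0 (rho / 2))) ub
  (itg_bumpw x0 uc r20) (M0 _ r20 r2r) y.
move/eqP; rewrite mulf_eq0 => /orP[/eqP//|].
rewrite gt_eqF// !mulr_gt0 ?exprn_gt0 ?invr_gt0//.
by apply: flat_gt0; exact: bump_arg_gt0.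
Qed.

Lemma bumpw1_bounded : exists2 B : R, 0 < B & forall x0 y, bumpw x0 1 y <= B.
Proof.
have [B HB] := @flat_bounded R 2.
exists (2 * B + 1).
  by rewrite ltr_wpDl// mulr_ge0// (le_trans (flat_ge0 2 0)).
move=> x0 y; rewrite /bumpw invr1 expr1n mulr1 (@le_trans _ _ (2 * B))//.
  by rewrite ler_pM2l.
by rewrite lerDl.
Qed.

(** Under this one-sided bound on the weak Laplacian, [expR (K / 4 * r ^+ 2) * (M r + c1)] is
    nondecreasing, where [M r] is the mean of [u] and [c1] the mass of the kernel. The limit at
    radius 0 is [(u x0 + 1) * c1], and the value at radius 1 is controlled by the integral of
    [u ^+ 2]. *)
Lemma sup_bound (K A : R) : 0 < K -> exists2 B : R, 0 < B & forall u,
  continuous u -> (forall y, 0 <= u y) -> itg (fun y => u y ^+ 2) ->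
  Int (fun y => u y ^+ 2) <= A ->
  (forall x0 r, 0 < r -> r < 2 -> - (K * Int (fun y => (1 + u y) * bump x0 r y)) <=
     Int (fun y => u y * laplacian (bump x0 r) y)) ->
  forall x, u x <= B.
Proof.
move=> K0.
have [c c0 Hc] := @Int_bumpw_lower R d.
have [Bw Bw0 HB] := bumpw1_bounded.
exists (Num.max 1 (expR (K / 4) * (A / c + Bw + 1))); first by rewrite lt_max ltr01.
move=> u uc u0 u2i u2A H x0; rewrite le_max; apply/orP; right.
set c1 := Int (bumpw x0 1); have c1c : c <= c1 := Hc x0.
have c10 : 0 < c1 := lt_le_trans c0 c1c.
pose M r := Int (fun y => u y * bumpw x0 r y).
have Mge0 s : 0 < s -> 0 <= M s.
  by move=> s0; apply: Int_ge0 => y; rewrite mulr_ge0 ?bumpw_ge0.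
pose f r := expR (K / 4 * r ^+ 2) * (M r + c1).
pose df r := expR (K / 4 * r ^+ 2) * (r * Int (fun y => u y * laplacian (bump x0 r) y) + 0)
   + (M r + c1) * (expR (K / 4 * r ^+ 2) * (K / 4 * (2 * r))).
have fd (s : R) : s \in `]0, 2[ -> is_derive s 1 f (df s).
  rewrite in_itv/= => /andP[s0 _].
  have dX := is_derive_expf (is_derive_scalef (K / 4)
    (is_derive_powf 2 (is_derive_id s (1 : R)))).
  have := is_derive_mulf dX (is_derive_addf (is_derive_mean x0 uc s0)
    (is_derive_cstf c1 s (1 : R))).
  by move/is_derive_eq; apply; rewrite /df /= expr1 mulr1.
have df0 (s : R) : s \in `]0, 2[ -> 0 <= df s.
  rewrite in_itv/= => /andP[s0 sr].
  have h1 : - (K / 2 * (M s + c1)) <= Int (fun y => u y * laplacian (bump x0 s) y).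
    apply: le_trans (H _ _ s0 sr); rewrite lerN2 -mulrA ler_pM2l//.
    have E : M s + c1 = Int (fun y => (1 + u y) * bumpw x0 s y).
      rewrite /c1 -(Int_bumpw_cst x0 s0) addrC -IntD; last 2 first.
      - exact: itg_bumpw1.
      - exact: itg_bumpw.
      by apply: Int_eq => y; rewrite mulrDl mul1r.
    have c1u : continuous (fun y => 1 + u y).
      by move=> y; apply: continuousD; [exact: cst_continuous|exact: uc].
    rewrite E -IntZ; last exact: itg_bumpw.
    apply: Int_le; [exact: itg_bump|by apply: itgZ; exact: itg_bumpw|].
    by move=> y; rewrite [leRHS]mulrCA ler_wpM2l ?bump_le_bumpw// addr_ge0.
  have h2 : s * - (K / 2 * (M s + c1)) <= s * Int (fun y => u y * laplacian (bump x0 s) y).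
    by rewrite ler_pM2l.
  have -> : df s = expR (K / 4 * s ^+ 2) *
      (s * Int (fun y => u y * laplacian (bump x0 s) y) - s * - (K / 2 * (M s + c1))).
    by rewrite /df; move: (expR _) (s * Rintegral _ _ _) (M s) (c1); clear => *; field.
  by rewrite mulr_ge0 ?expR_ge0// subr_ge0.
have f1 : f 1 <= expR (K / 4) * (A + Bw * c1 + c1).
  rewrite /f expr1n mulr1 ler_wpM2l ?expR_ge0// lerD2r.
  have ib := itg_bumpw1 x0 (ltr01 : 0 < (1 : R)).
  rewrite (le_trans _ (_ : Int (fun y => u y ^+ 2) + Bw * c1 <= _)) ?lerD2r//.
  rewrite -IntZ// -IntD//; last exact: itgZ.
  apply: Int_le; [exact: itg_bumpw|by apply: itgD => //; exact: itgZ|].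
  move=> y; have b0 := bumpw_ge0 x0 y (ltr01 : 0 < (1 : R)).
  have bB : bumpw x0 1 y ^+ 2 <= Bw * bumpw x0 1 y by rewrite expr2 ler_wpM2r.
  by move: bB; move: (u y) (bumpw _ _ _) b0; clear => a b b0 bB; nra.
have : u x0 + 1 <= expR (K / 4) * (A / c1 + Bw + 1).
  apply/ler_addgt0Pl => e e0.
  have [r1 r10 Hr] := mean_cvg x0 uc e0.
  pose s := Num.min (r1 / 2) 1.
  have s0 : 0 < s by rewrite lt_min ltr01 andbT divr_gt0.
  have sr1 : s < r1 by rewrite gt_min half_lt.
  have s1 : s <= 1 by rewrite ge_min lexx orbT.
  have := Hr s s0 sr1; rewrite -/c1 -/(M s) ler_norml => /andP[h1 _].
  have h2 := le_trans (@ge0_derive_mono f df s 1 2 fd df0 s0 s1 (ltr_nat R 1 2)) f1.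
  have h3 : M s + c1 <= f s.
    rewrite /f ler_peMl ?addr_ge0 ?Mge0// ?(ltW c10)//.
    by apply: ge1_expR; rewrite mulr_ge0 ?sqr_ge0// divr_ge0// ltW.
  have h4 := le_trans h3 h2.
  have E : expR (K / 4) * (A + Bw * c1 + c1) = expR (K / 4) * (A / c1 + Bw + 1) * c1.
    by field; rewrite gt_eqF.
  rewrite -(ler_pM2r c10) !mulrDl mul1r -E.
  by move: h1 h4; move: (u x0 * c1) (M s) (expR _ * _) (e * c1); clear => p q r t; lra.
move=> h; rewrite (le_trans _ (le_trans h _)) ?lerDl//.
have A0 : 0 <= A by apply: le_trans u2A; apply: Int_ge0 => y; rewrite sqr_ge0.
by rewrite ler_wpM2l ?expR_ge0// !lerD2r ler_wpM2l// lef_pV2.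
Qed.

End mean_monotonicity.

(** * Measures with a density *)

Section density.
Context d {T : measurableType d} {R : realType} (mu : {measure set T -> \bar R}).

Section measure.
Variable f : T -> R.

(* The proofs are arguments so that the measure structure can be inferred. *)
Definition dens (f0 : forall x, 0 <= f x) (mf : measurable_fun setT f) (A : set T) :
  \bar R := (\int[mu]_(x in A) (f x)%:E)%E.

Hypotheses (f0 : forall x, 0 <= f x) (mf : measurable_fun setT f).

Let dens0 : dens f0 mf set0 = 0%E.
Proof. exact: integral_set0. Qed.

Let dens_ge0 A : (0 <= dens f0 mf A)%E.
Proof. by apply: integral_ge0 => x _; rewrite lee_fin. Qed.

Let dens_sigma_additive : semi_sigma_additive (dens f0 mf).
Proof.
move=> F mF tF mUF; rewrite /dens.
rewrite ge0_integral_bigcup//.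
- by apply: is_cvg_ereal_nneg_natsum => n _; exact: dens_ge0.
- by apply/measurable_EFinP; exact: measurable_funTS.
- by move=> x _; rewrite lee_fin.
Qed.

HB.instance Definition _ := isMeasure.Build _ _ _ (dens f0 mf)
  dens0 dens_ge0 dens_sigma_additive.

End measure.

Variables (nu : {measure set T -> \bar R}) (f : T -> R).
Hypotheses (f0 : forall x, 0 <= f x) (mf : measurable_fun setT f).
Hypothesis nuE : forall A, measurable A -> nu A = (\int[mu]_(x in A) (f x)%:E)%E.

Import HBNNSimple.

(** Both integrals are monotone limits along the simple functions approximating [k]; for indicator
    functions the equality is [nuE]. *)
Lemma ge0_integral_density (k : T -> \bar R) : measurable_fun setT k ->
  (forall x, 0 <= k x)%E ->
  (\int[nu]_x k x = \int[mu]_x (k x * (f x)%:E))%E.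
Proof.
move=> mk k0; have mE := @measurableT _ T.
pose h := nnsfun_approx mE mk.
have mfE : measurable_fun setT (EFin \o f) by exact/measurable_EFinP.
have -> : (\int[nu]_x k x = lim (\int[nu]_x (EFin \o h n) x @[n --> \oo]))%E.
  have fE x : setT x -> k x = lim ((EFin \o h n) x @[n --> \oo]).
    by move=> Ex; apply/esym/cvg_lim => //; exact: cvg_nnsfun_approx.
  under eq_integral => x /[!inE] /fE -> //.
  apply: monotone_convergence => //.
  - move=> n; apply/measurable_EFinP.
    by apply: (measurable_funS measurableT) => //; exact/measurable_funP.
  - by move=> n x Ex //=; rewrite lee_fin.
  - by move=> x Ex a b ab; rewrite lee_fin; exact/lefP/nd_nnsfun_approx.
have -> : (\int[mu]_x (k x * (f x)%:E) =
    lim (\int[mu]_x ((EFin \o h n) x * (f x)%:E) @[n --> \oo]))%E.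
  have fg x : setT x -> (k x * (f x)%:E)%E = lim (((EFin \o h n) x * (f x)%:E)%E @[n --> \oo]).
    by move=> Ex; apply/esym/cvg_lim => //; apply: cvgeZr => //; exact: cvg_nnsfun_approx.
  under eq_integral => x /[!inE] /fg -> //.
  apply: monotone_convergence => [//| | |].
  - by move=> n; apply: emeasurable_funM => //; exact/measurable_EFinP.
  - by move=> n x Ex /=; rewrite mule_ge0 ?lee_fin.
  - by move=> x Ex a b ab/=; rewrite lee_wpmul2r ?lee_fin//; exact/lefP/nd_nnsfun_approx.
suff suf n : (\int[mu]_x ((EFin \o h n) x * (f x)%:E) = \int[nu]_x (EFin \o h n) x)%E.
  have E : (fun n => \int[nu]_x (EFin \o h n) x)%E =
      (fun n => \int[mu]_x ((EFin \o h n) x * (f x)%:E))%E.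
    by apply/funext => n; rewrite suf.
  by rewrite E.
transitivity (\int[nu]_x
   (\sum_(y \in range (h n)) (y * \1_(h n @^-1` [set y]) x)%:E))%E; last first.
  by apply: eq_integral => t tE; rewrite /= fimfunE -fsumEFin.
have indich m r : measurable_fun setT (fun x => (r * \1_(h m @^-1` [set r]) x)%:E).
  by apply: (measurable_comp measurableT) => //; exact: measurable_funM.
rewrite ge0_integral_fsum//; last by move=> m y Ey; exact: nnfun_muleindic_ge0.
transitivity (\int[mu]_x (\sum_(y \in range (h n))
    (y * \1_(h n @^-1` [set y]) x)%:E * (f x)%:E))%E.
  under [RHS]eq_integral => x xE.
    rewrite -ge0_mule_fsuml => [|y]; last exact: nnfun_muleindic_ge0.
    rewrite fsumEFin // -(fimfunE _ x); over.
  by [].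
rewrite ge0_integral_fsum//; last 2 first.
  - by move=> y; apply: emeasurable_funM.
  - by move=> m y Ey; apply: mule_ge0; [exact: nnfun_muleindic_ge0|rewrite lee_fin].
apply: eq_fsbigr => r rhn.
under [RHS]eq_integral do rewrite EFinM.
rewrite integralZl_indic_nnsfun => //.
under eq_integral do rewrite EFinM -muleA.
rewrite ge0_integralZl//.
- under eq_integral do rewrite muleC.
  rewrite (eq_integral ((EFin \o f) \_ (h n @^-1` [set r]))); last first.
    by move=> x xE; rewrite epatch_indic.
  by rewrite -integral_mkcond -nuE// integral_indic// setIT.
- by apply: emeasurable_funM => //; exact/measurable_EFinP.
- by move=> t Et; rewrite mule_ge0 ?lee_fin.
- by move: rhn; rewrite inE => -[t _ <-]; rewrite lee_fin.
Qed.

Lemma itg_densityP (k : T -> R) : measurable_fun setT k ->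
  nu.-integrable setT (EFin \o k) <-> mu.-integrable setT (EFin \o (fun x => k x * f x)).
Proof.
move=> mk.
have E : (\int[nu]_x `|(k x)%:E| = \int[mu]_x `|(k x * f x)%:E|)%E.
  rewrite (@ge0_integral_density (fun x => `|(k x)%:E|%E)) //; last first.
    by apply/measurable_EFinP; apply: measurableT_comp.
  by apply: eq_integral => x _; rewrite /= -EFinM normrM (ger0_norm (f0 x)).
split=> /integrableP[_ ki]; apply/integrableP; split.
- by apply/measurable_EFinP; exact: measurable_funM.
- by move: ki; rewrite E.
- exact/measurable_EFinP.
- by rewrite E.
Qed.

Lemma Int_density (k : T -> R) : nu.-integrable setT (EFin \o k) ->
  \int[nu]_x k x = \int[mu]_x (k x * f x).
Proof.
move=> ki; have mk : measurable_fun setT k by exact: itg_measurable ki.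
rewrite /Rintegral; congr fine.
have mk' : measurable_fun setT (fun x => (k x)%:E) by exact/measurable_EFinP.
rewrite [LHS]integralE [RHS]integralE; congr (_ - _)%E.
  rewrite ge0_integral_density//; last exact: measurable_funepos.
  apply: eq_integral => x _; rewrite !funeposE /= -!EFin_max -EFinM; congr EFin.
  by rewrite maxr_pMl// mul0r.
rewrite ge0_integral_density//; last exact: measurable_funeneg.
apply: eq_integral => x _; rewrite !funenegE /= -!EFin_max -EFinM; congr EFin.
by rewrite maxr_pMl// mul0r mulNr.
Qed.

End density.

(** * Uniqueness of weak gradients *)

Section boxes.
Context {R : realType} {d : nat}.
Local Notation leb := (lebesgue_rV R d).
Local Notation Int f := (\int[leb]_x f x).
Local Notation itg f := (leb.-integrable setT (EFin \o f)).
Implicit Types (a b x : 'rV[R]_d).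

Definition box a b : set 'rV[R]_d := [set x | forall i, a ord0 i < x ord0 i < b ord0 i].

Definition boxes : set (set 'rV[R]_d) := [set A | exists a b, A = box a b].

Lemma open_box a b : open (box a b).
Proof.
rewrite openE => x xab.
pose e := \big[Num.min/1]_(i < d) Num.min (x ord0 i - a ord0 i) (b ord0 i - x ord0 i).
have e0 : 0 < e.
  apply: (big_ind (fun z : R => 0 < z)) => // [u v u0 v0|i _].
    by rewrite lt_min u0 v0.
  by have /andP[h1 h2] := xab i; rewrite lt_min !subr_gt0 h1 h2.
apply/nbhs_ballP; exists e => //= y /ball_coord xy i.
have : e <= Num.min (x ord0 i - a ord0 i) (b ord0 i - x ord0 i) by exact: bigmin_le.
rewrite le_min => /andP[h1 h2].
have := xy i; rewrite ltr_distl => /andP[h3 h4].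
by move: h1 h2 h3 h4; clear; lra.
Qed.

Lemma boxesI : setI_closed boxes.
Proof.
move=> _ _ [a [b ->]] [a' [b' ->]].
exists (\row_i Num.max (a ord0 i) (a' ord0 i)), (\row_i Num.min (b ord0 i) (b' ord0 i)).
apply/seteqP; split=> [x [xab xab'] i|x xm].
  by rewrite !mxE gt_max lt_min; have /andP[-> ->] := xab i; have /andP[-> ->] := xab' i.
by split=> i; have := xm i; rewrite !mxE gt_max lt_min => /andP[/andP[h1 h2] /andP[h3 h4]]; apply/andP.
Qed.

Lemma boxes_measurable : boxes `<=` measurable.
Proof. by move=> _ [a [b ->]]; apply: open_measurable_mx; exact: open_box. Qed.

(** An open set is the countable union of the boxes with rational centre and half-side [k.+1%:R^-1]
    that it contains. *)
Lemma open_sigma_boxes (U : set 'rV[R]_d) : open U -> <<s boxes >> U.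
Proof.
move=> oU.
pose e k : R := k.+1%:R^-1.
pose bx (u : 'rV[rat]_d * nat) : set 'rV[R]_d :=
  box (\row_i (ratr (u.1 ord0 i) - e u.2)) (\row_i (ratr (u.1 ord0 i) + e u.2)).
pose F u := if pselect (bx u `<=` U) then bx u else set0.
rewrite (_ : U = \bigcup_u F u); last first.
  apply/seteqP; split => [x Ux|x [u _]]; last first.
    by rewrite /F; case: pselect => // boxU /boxU.
  have /nbhs_ballP[r /= r0 rU] : nbhs x U by apply: open_nbhs_nbhs.
  have r2 : 0 < r / 2 by rewrite divr_gt0.
  have [k kr] : exists k, e k < r / 2.
    by have [k _ /(_ k (leqnn k)) /= ?] := near_infty_natSinv_lt (PosNum r2); exists k.
  have ek : 0 < e k by rewrite /e invr_gt0.
  have approx (t : R) : {q : rat | `|ratr q - t| < e k}.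
    apply: cid; have [|q] := @rat_in_itvoo R (t - e k) (t + e k).
      by rewrite ltrBlDr -addrA ltrDl addr_gt0.
    by rewrite in_itv/= => /andP[q1 q2]; exists q; rewrite ltr_distl q1 q2.
  exists (\row_i sval (approx (x ord0 i)), k) => //.
  have bxx : bx (\row_i sval (approx (x ord0 i)), k) x.
    move=> i; rewrite !mxE; have := svalP (approx (x ord0 i)).
    by rewrite ltr_distl; move: (e k) (x ord0 i) (ratr _); clear => p q t; lra.
  rewrite /F; case: pselect => // -[] w wb; apply: rU.
  apply: cst_in_ball => // i.
  have := wb i; have := bxx i; rewrite !mxE ltr_distl.
  by move: kr; move: (e k) (x ord0 i) (w ord0 i) (ratr _); clear => p q t s; lra.
pose GT := g_sigma_algebraType boxes.
apply: (@countable_bigcupT_measurable _ GT); first exact: (@countableP _ setT).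
move=> u; rewrite /F; case: pselect => [Hu|Hu] /=; last exact: (@measurable0 _ GT).
have bu : boxes (bx u) by eexists; eexists; reflexivity.
exact: (@sub_sigma_algebra _ setT boxes _ bu).
Qed.

Lemma measurable_sigma_boxes (A : set 'rV[R]_d) : measurable A -> <<s boxes >> A.
Proof.
move=> mA; apply: (@smallest_sub _ (sigma_algebra setT) (@open _) <<s boxes >>) mA.
  exact: smallest_sigma_algebra.
by move=> U; exact: open_sigma_boxes.
Qed.

Definition box_bump a b x : R :=
  \prod_i (flat 0 (x ord0 i - a ord0 i) * flat 0 (b ord0 i - x ord0 i)).

Lemma class_C_box_bump k a b : class_C k (box_bump a b).
Proof.
apply: class_C_prod => i; apply: class_C_mul; apply: class_C_flat => n;
  by apply: class_C_sub; first [exact: class_C_coord|exact: class_C_cst].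
Qed.

Lemma flat0_le1 (u : R) : flat 0 u <= 1.
Proof.
rewrite /flat; case: ifPn => // u0; rewrite expr0 mul1r -expR0 ler_expR.
by rewrite oppr_le0 invr_ge0 ltW.
Qed.

Lemma box_bump_itv a b x : 0 <= box_bump a b x <= 1.
Proof.
apply/andP; split; first by apply: prodr_ge0 => i _; rewrite mulr_ge0 ?flat_ge0.
by apply: prodr_ile1 => i _; rewrite mulr_ge0 ?flat_ge0//= mulr_ile1 ?flat_ge0 ?flat0_le1.
Qed.

Lemma box_bump_gt0 a b x : box a b x -> 0 < box_bump a b x.
Proof.
move=> xab; apply: prodr_gt0 => i _; have /andP[h1 h2] := xab i.
by rewrite mulr_gt0 ?flat_gt0 ?subr_gt0.
Qed.

Lemma box_bump_out a b x : ~ box a b x -> box_bump a b x = 0.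
Proof.
move=> /existsNP[i /negP xi]; rewrite /box_bump (bigD1 i)//=.
move: xi; rewrite negb_and -!leNgt => /orP[h|h].
  by rewrite flat_le0 ?mul0r// subr_le0.
by rewrite (flat_le0 0 (_ : b ord0 i - _ <= 0)) ?mulr0 ?mul0r// subr_le0.
Qed.

Lemma box_cube a b : exists2 M : R, 0 < M & box a b `<=` cube M.
Proof.
exists (\sum_i (`|a ord0 i| + `|b ord0 i|) + 1).
  by rewrite ltr_wpDl// sumr_ge0// => i _; rewrite addr_ge0.
move=> x xab i; have /andP[h1 h2] := xab i.
have : `|a ord0 i| + `|b ord0 i| <= \sum_i (`|a ord0 i| + `|b ord0 i|).
  by rewrite (bigD1 i)//= lerDl sumr_ge0// => j _; rewrite addr_ge0.
have := ler_norm (b ord0 i); have := ler_norm (- a ord0 i); rewrite normrN.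
have := normr_ge0 (a ord0 i); have := normr_ge0 (b ord0 i).
rewrite ler_norml; move: h1 h2.
move: (\sum_i _) `|a ord0 i| `|b ord0 i| (a ord0 i) (b ord0 i) (x ord0 i); clear.
by move=> s A B p q t; lra.
Qed.

Lemma enorm_cube (M : R) x : 0 <= M -> cube M x -> enorm x <= Num.sqrt (d%:R * M ^+ 2).
Proof.
move=> M0 xM; rewrite /enorm ler_sqrt ?mulr_ge0 ?sqr_ge0//.
rewrite /dot (@le_trans _ _ (\sum_(i < d) M ^+ 2))//.
  by apply: ler_sum => i _; rewrite -expr2 -real_normK ?num_real// ler_sqr ?nnegrE.
by rewrite sumr_const card_ord mulr_natl.
Qed.

Lemma supp_test_function (M : R) (f : 'rV[R]_d -> R) : 0 <= M ->
  (forall k, class_C k f) -> supp_in M f -> test_function f.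
Proof.
move=> M0 fC fM; split=> //; exists (Num.sqrt (d%:R * M ^+ 2)) => x Mx; apply: fM => xM.
by move: Mx; apply/negP; rewrite -leNgt enorm_cube.
Qed.

Lemma enorm_ge0 x : 0 <= enorm x. Proof. exact: sqrtr_ge0. Qed.

Lemma sqr_enorm x : enorm x ^+ 2 = dot x x.
Proof. by rewrite sqr_sqrtr// dot_ge0. Qed.

Lemma test_function_supp (f : 'rV[R]_d -> R) : test_function f ->
  exists2 M : R, 0 < M & supp_in M f.
Proof.
move=> [_ [M HM]]; exists (Num.max 1 M); first by rewrite lt_max ltr01.
move=> x /existsNP[i /negP]; rewrite -ltNge gt_max => /andP[x1 xM].
apply: HM; apply: (lt_le_trans xM).
rewrite -ler_sqr ?nnegrE ?normr_ge0 ?enorm_ge0// real_normK ?num_real// sqr_enorm.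
exact: coord_le_dot.
Qed.

Lemma itg_sq_mul (u v : 'rV[R]_d -> R) : measurable_fun setT u -> measurable_fun setT v ->
  itg (fun x => u x ^+ 2) -> itg (fun x => v x ^+ 2) -> itg (fun x => u x * v x).
Proof.
move=> mu mv u2 v2; apply: (@itg_le _ _ _ _ _ (fun x => u x ^+ 2 + v x ^+ 2)).
- exact: measurable_funM.
- move=> x; rewrite normrM -(real_normK (num_real (u x))) -(real_normK (num_real (v x))).
  by move: `|u x| `|v x| (normr_ge0 (u x)) (normr_ge0 (v x)); clear => p q p0 q0; nra.
- exact: itgD.
Qed.

Lemma square_integrable_itg (u : 'rV[R]_d -> R) : square_integrable u <->
  measurable_fun setT u /\ itg (fun x => u x ^+ 2).
Proof.
split=> -[mu ui]; split=> //.
  by apply: ge0_itg_lty => //; [move=> x; rewrite sqr_ge0|exact: measurable_funX].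
by apply: itg_lty => // x; rewrite sqr_ge0.
Qed.

Lemma square_integrable_csupp (M : R) (f : 'rV[R]_d -> R) : continuous f ->
  supp_in M f -> square_integrable f.
Proof.
move=> fc fM; apply/square_integrable_itg; split; first exact: continuous_mfun.
apply: (@integrable_csupp _ _ M); first by under eq_fun do rewrite expr2; exact: continuous_mulf.
by move=> x xM; rewrite fM// expr0n.
Qed.

Lemma itg_sq_indic (v : 'rV[R]_d -> R) (A : set 'rV[R]_d) (M : R) :
  square_integrable v -> measurable A -> A `<=` cube M -> itg (fun x => v x * \1_A x).
Proof.
move=> /square_integrable_itg[mv v2] mA AM.
have mi : measurable_fun setT (\1_A : 'rV[R]_d -> R) by exact: measurable_indic.
apply: (itg_sq_mul mv mi v2); apply: (@integrable_supp _ _ M 1).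
- exact: measurable_funX.
- by move=> x xM; rewrite indicE memNset ?expr0n// => /AM.
- by move=> x _; rewrite indicE; case: (x \in A); rewrite ?expr1n ?expr0n ?normr1 ?normr0.
Qed.

(** The test functions [1 - (1 - box_bump a b) ^+ n] increase to the indicator of the box, and
    dominated convergence applies with [|v|] restricted to the box as integrable bound. *)
Lemma Int_box_eq0 (v : 'rV[R]_d -> R) a b : square_integrable v ->
  (forall f, test_function f -> Int (fun x => v x * f x) = 0) ->
  Int (fun x => v x * \1_(box a b) x) = 0.
Proof.
move=> v2 vf; have [mv v2i] := (square_integrable_itg v).1 v2.
have [M M0 abM] := box_cube a b.
have mb : measurable (box a b) by apply: open_measurable_mx; exact: open_box.
pose f n x : R := 1 - (1 - box_bump a b x) ^+ n.
have fC n k : class_C k (f n).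
  apply: class_C_sub; first exact: class_C_cst.
  apply: class_C_exp; apply: class_C_sub; first exact: class_C_cst.
  exact: class_C_box_bump.
have fout n x : ~ box a b x -> f n x = 0.
  by move=> xab; rewrite /f box_bump_out// subr0 expr1n subrr.
have ft n : test_function (f n).
  by apply: (supp_test_function (ltW M0)) => // x xM; apply: fout => /abM.
have f01 n x : 0 <= f n x <= 1.
  have /andP[h1 h2] := box_bump_itv a b x.
  rewrite /f subr_ge0 gerBl exprn_ge0 ?subr_ge0// andbT.
  by rewrite exprn_ile1 ?subr_ge0// gerBl.
have mf n : measurable_fun setT (fun x => v x * f n x).
  apply: measurable_funM => //; apply: continuous_mfun.
  exact: (@class_C_continuous _ _ 0 _ (fC n 0)).
have mvb : measurable_fun setT (fun x => v x * \1_(box a b) x).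
  by apply: measurable_funM => //; exact: measurable_indic.
have cvf x : (v x * f n x)%:E @[n --> \oo] --> (v x * \1_(box a b) x)%:E.
  apply: cvg_EFin; first exact: nearW.
  rewrite /=; apply: cvgMl_tmp.
  have [xb|xb] := pselect (box a b x).
    rewrite indicE mem_set//= -[X in _ --> X]subr0; apply: cvgB; first exact: cvg_cst.
    have /andP[h1 h2] := box_bump_itv a b x; have h3 := box_bump_gt0 xb.
    apply: cvg_expr; rewrite ger0_norm ?subr_ge0// ltrBlDr ltrDl//.
  by rewrite indicE memNset//; under eq_fun do rewrite fout//; exact: cvg_cst.
have gi := itg_norm (itg_sq_indic v2 mb abM).
have mf' n : measurable_fun setT (fun x => (v x * f n x)%:E) by exact/measurable_EFinP.
have mvb' : measurable_fun setT (fun x => (v x * \1_(box a b) x)%:E) by exact/measurable_EFinP.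
have dom : {ae leb, forall x n, setT x ->
    (`|(v x * f n x)%:E| <= `|v x * \1_(box a b) x|%:E)%E}.
  apply: aeW => x n _; rewrite lee_fin.
  have [xb|xb] := pselect (box a b x); last by rewrite fout// mulr0 normr0.
  rewrite indicE mem_set// mulr1 normrM ler_piMr//.
  by have /andP[h1 h2] := f01 n x; rewrite ger0_norm.
have [_ _ H] := dominated_convergence measurableT mf' mvb' (aeW _ (fun x _ => cvf x)) gi dom.
have E n : (\int[leb]_x (v x * f n x)%:E = 0)%E.
  rewrite -EFin_Int ?vf//.
  apply: (itg_le (mf n)) gi => x.
  have [xb|xb] := pselect (box a b x); last by rewrite fout// mulr0 normr0.
  rewrite indicE mem_set// mulr1 normrM ler_piMr//.
  by have /andP[h1 h2] := f01 n x; rewrite ger0_norm.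
have E2 : (fun n => \int[leb]_x (v x * f n x)%:E)%E = (fun=> 0%E) by apply/funext.
have {}H : (fun n => \int[leb]_x (v x * f n x)%:E)%E @ \oo -->
  (\int[leb]_x (v x * \1_(box a b) x)%:E)%E := H.
move: H; rewrite E2 => /cvg_lim H; rewrite /Rintegral -H//.
by rewrite lim_cst.
Qed.

(** The positive and negative parts of [v] are densities of two measures that agree on boxes, hence
    on all Borel sets, boxes being a generating class stable under intersection. Evaluating both
    measures on the set where [v] is positive and on its complement shows that the two parts
    vanish. *)
Lemma square_integrable_ae0 (v : 'rV[R]_d -> R) : square_integrable v ->
  (forall f, test_function f -> Int (fun x => v x * f x) = 0) ->
  {ae leb, forall x, v x = 0}.
Proof.
move=> v2 vf; have [mv v2i] := (square_integrable_itg v).1 v2.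
pose vp x : R := Num.max (v x) 0; pose vn x : R := Num.max (- v x) 0.
have vp0 x : 0 <= vp x by rewrite le_max lexx orbT.
have vn0 x : 0 <= vn x by rewrite le_max lexx orbT.
have mp : measurable_fun setT vp by apply: measurable_maxr.
have mn : measurable_fun setT vn.
  by apply: measurable_maxr => //; exact: measurableT_comp.
have vE x : v x = vp x - vn x.
  by rewrite /vp /vn !maxEle; case: ifP; case: ifP; move: (v x); clear => t; lra.
have vp_le x : `|vp x| <= `|v x|.
  by rewrite ger0_norm// /vp ge_max ler_norm normr_ge0.
have vn_le x : `|vn x| <= `|v x|.
  by rewrite ger0_norm// /vn ge_max -normrN ler_norm normr_ge0.
have sq (u : 'rV[R]_d -> R) : measurable_fun setT u -> (forall x, `|u x| <= `|v x|) -> square_integrable u.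
  move=> mu uv; apply/square_integrable_itg; split=> //.
  apply: itg_le v2i; first exact: measurable_funX.
  move=> x /=.
  by rewrite normrX -(real_normK (num_real (v x))) ler_sqr ?nnegrE.
have vp2 := sq _ mp vp_le; have vn2 := sq _ mn vn_le.
pose m1 := dens leb vp0 mp; pose m2 := dens leb vn0 mn.
have mE (u : 'rV[R]_d -> R) (A : set 'rV[R]_d) : measurable A ->
    (\int[leb]_(x in A) (u x)%:E = \int[leb]_x (u x * \1_A x)%:E)%E.
  move=> mA; rewrite integral_mkcond; apply: eq_integral => x _.
  by rewrite patchE indicE; case: ifPn => _; rewrite ?mulr1 ?mulr0.
have m12 A : measurable A -> m1 A = m2 A.
  move=> /measurable_sigma_boxes.
  pose g (k : nat) : set 'rV[R]_d := box (\row_i (- k%:R)) (\row_i k%:R).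
  apply: (@g_sigma_algebra_measure_unique _ R _ boxes boxes_measurable g).
  - by move=> k; eexists; eexists; reflexivity.
  - apply/seteqP; split=> // x _.
    pose M := \sum_i `|x ord0 i| + 1.
    exists (Num.truncn M).+1 => // i; rewrite !mxE -ltr_norml.
    have : M < (Num.truncn M).+1%:R by exact: truncnS_gt.
    apply: le_lt_trans; rewrite /M (bigD1 i)//= -addrA lerDl addr_ge0//.
    by apply: sumr_ge0.
  - exact: boxesI.
  - move=> _ [a [b ->]].
    have mb : measurable (box a b) by apply: open_measurable_mx; exact: open_box.
    have [M M0 abM] := box_cube a b.
    have ip := itg_sq_indic vp2 mb abM; have ineg := itg_sq_indic vn2 mb abM.
    have e1 : m1 (box a b) = (Int (fun x => vp x * \1_(box a b) x))%:E.
      by rewrite EFin_Int; [exact: mE|].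
    have e2 : m2 (box a b) = (Int (fun x => vn x * \1_(box a b) x))%:E.
      by rewrite EFin_Int; [exact: mE|].
    rewrite [LHS]e1 [RHS]e2; congr EFin.
    apply/eqP; rewrite -subr_eq0 -IntB//; apply/eqP.
    rewrite -[RHS](Int_box_eq0 a b v2 vf); apply: Int_eq => x.
    by rewrite -mulrBl -vE.
  - move=> k; have [M M0 abM] := box_cube (\row_i (- k%:R)) (\row_i k%:R).
    have mb : measurable (g k) by apply: open_measurable_mx; exact: open_box.
    have ip := itg_sq_indic vp2 mb abM.
    have e1 : m1 (g k) = (Int (fun x => vp x * \1_(g k) x))%:E.
      by rewrite EFin_Int; [exact: mE|].
    by apply: (@eq_ind_r _ _ (fun z => z < +oo)%E _ _ e1); rewrite ltry.
have zero (u : 'rV[R]_d -> R) : (forall x, 0 <= u x) -> measurable_fun setT u ->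
    (\int[leb]_x (u x)%:E = 0)%E -> {ae leb, forall x, u x = 0}.
  move=> u0 mu I0.
  have : ae_eq leb setT (EFin \o u) (cst 0%E).
    apply/(ae_eq_integral_abs leb measurableT); first exact/measurable_EFinP.
    by rewrite -[RHS]I0; apply: eq_integral => x _; rewrite /= ger0_norm.
  by apply: filterS => x /(_ I) []. 
pose P : set 'rV[R]_d := [set x | 0 < v x].
have mpos : measurable P.
  rewrite (_ : P = v @^-1` `]0, +oo[); last first.
    by apply/seteqP; split=> x /=; rewrite in_itv/= andbT.
  by rewrite -[X in measurable X]setTI; exact: mv.
have E1 : (\int[leb]_x (vp x)%:E = 0)%E.
  have -> : (\int[leb]_x (vp x)%:E = m1 P)%E.
    rewrite /m1 /dens integral_mkcond; apply: eq_integral => x _.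
    rewrite patchE; case: ifPn => //; rewrite notin_setE /= => /negP.
    by rewrite -leNgt => vx; rewrite /vp max_r.
  rewrite m12// /m2 /dens integral0_eq// => x /= vx.
  by rewrite /vn max_r// oppr_le0 ltW.
have E2' : (\int[leb]_x (vn x)%:E = 0)%E.
  have -> : (\int[leb]_x (vn x)%:E = m2 (~` P))%E.
    rewrite /m2 /dens integral_mkcond; apply: eq_integral => x _.
    rewrite patchE; case: ifPn => //; rewrite notin_setE /= => /contrapT vx.
    by rewrite /vn max_r// oppr_le0 ltW.
  rewrite -m12; last exact: measurableC.
  rewrite /m1 /dens integral0_eq// => x /= /negP; rewrite -leNgt => vx.
  by rewrite /vp max_r.
have := zero _ vp0 mp E1; have := zero _ vn0 mn E2'.
apply: filterS2 => x h1 h2; by rewrite vE h1 h2 subrr.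
Qed.

Lemma itg_sq_test (u f : 'rV[R]_d -> R) : square_integrable u -> test_function f ->
  itg (fun x => u x * f x).
Proof.
move=> u2 ft; have [M M0 fM] := test_function_supp ft.
have fc : continuous f by have [fC _] := ft; exact: (@class_C_continuous _ _ 0 _ (fC 0)).
have [mu ui] := (square_integrable_itg u).1 u2.
have [mf fi] := (square_integrable_itg f).1 (square_integrable_csupp fc fM).
exact: itg_sq_mul.
Qed.

Lemma weak_grad_integral_unique (u : 'rV[R]_d -> R) (w1 w2 : 'rV[R]_d -> 'rV[R]_d) :
  weak_grad u w1 -> weak_grad u w2 ->
  (\int[leb]_x (enorm (w1 x) ^+ 2)%:E = \int[leb]_x (enorm (w2 x) ^+ 2)%:E)%E.
Proof.
move=> g1 g2.
have ae i : {ae leb, forall x, w1 x ord0 i - w2 x ord0 i = 0}.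
  have [s1 p1] := g1 i; have [s2 p2] := g2 i.
  have [m1 i1] := (square_integrable_itg _).1 s1.
  have [m2 i2] := (square_integrable_itg _).1 s2.
  apply: square_integrable_ae0.
    apply/square_integrable_itg; split; first exact: measurable_funB.
    apply: (@itg_le _ _ _ _ _ (fun x => 2 * (w1 x ord0 i ^+ 2 + w2 x ord0 i ^+ 2))).
    - by apply: measurable_funX; exact: measurable_funB.
    - move=> x; rewrite ger0_norm ?sqr_ge0//.
      move: (w1 x ord0 i) (w2 x ord0 i) => a b.
      by rewrite -subr_ge0 (_ : _ - _ = (a + b) ^+ 2) ?sqr_ge0//; ring.
    - by apply: itgZ; exact: itgD.
  move=> f ft; under eq_Rintegral do rewrite mulrBl.
  rewrite IntB; [|exact: itg_sq_test|exact: itg_sq_test].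
  by have := p1 f ft; rewrite (p2 f ft) => /oppr_inj ->; rewrite subrr.
have me (w : 'rV[R]_d -> 'rV[R]_d) : weak_grad u w ->
    measurable_fun setT (fun x => (enorm (w x) ^+ 2)%:E).
  move=> g; apply/measurable_EFinP.
  under eq_fun do rewrite sqr_enorm.
  apply: measurable_sum => i; have [[mi _] _] := g i.
  exact: measurable_funM.
apply: ge0_ae_eq_integral => //; try by [exact: me|move=> x _; rewrite lee_fin sqr_ge0].
have : {ae leb, forall x i, w1 x ord0 i - w2 x ord0 i = 0}.
  by apply: filter_forall => i; exact: ae.
apply: filterS => x h _; congr (enorm _ ^+ 2)%:E.
by apply/rowP => i; apply/eqP; rewrite -subr_eq0 h.
Qed.

(** The value does not depend on the weak gradient selected by [xget], any two of them being equal
    almost everywhere. *)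
Lemma fisher_informationE (f : 'rV[R]_d -> R) w : weak_grad (fun x => Num.sqrt (f x)) w ->
  fisher_information f = (\int[leb]_x (enorm (w x) ^+ 2)%:E)%E.
Proof.
move=> fw; rewrite /fisher_information; apply: (weak_grad_integral_unique _ fw).
exact: (xgetPex (fun=> 0) (ex_intro [set w | weak_grad (fun x => Num.sqrt (f x)) w] w fw)).
Qed.

End boxes.

(** * Couplings of measures with densities *)

Section dot.
Context {R : realType} {d : nat}.
Implicit Types x y z : 'rV[R]_d.

Lemma dotC x y : dot x y = dot y x.
Proof. by apply: eq_bigr => i _; rewrite mulrC. Qed.

Lemma dotDl x y z : dot (x + y) z = dot x z + dot y z.
Proof. by rewrite /dot -big_split; apply: eq_bigr => i _; rewrite mxE mulrDl. Qed.

Lemma dotZl (c : R) x y : dot (c *: x) y = c * dot x y.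
Proof. by rewrite /dot mulr_sumr; apply: eq_bigr => i _; rewrite mxE mulrA. Qed.

Lemma dotNl x y : dot (- x) y = - dot x y.
Proof. by rewrite -scaleN1r dotZl mulN1r. Qed.

Lemma dotDr x y z : dot x (y + z) = dot x y + dot x z.
Proof. by rewrite dotC dotDl !(dotC x). Qed.

Lemma dotZr (c : R) x y : dot x (c *: y) = c * dot x y.
Proof. by rewrite dotC dotZl dotC. Qed.

Lemma dotNr x y : dot x (- y) = - dot x y.
Proof. by rewrite dotC dotNl dotC. Qed.

Lemma dot_eq0 x : dot x x = 0 -> x = 0.
Proof.
move=> x0; apply/rowP => i; rewrite mxE; apply/eqP; rewrite -sqrf_eq0.
by rewrite eq_le sqr_ge0 andbT -x0 coord_le_dot.
Qed.

Lemma cauchy_schwarz x y : dot x y <= enorm x * enorm y.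
Proof.
have [x0|x0] := eqVneq (enorm x) 0.
  have -> : x = 0 by apply: dot_eq0; rewrite -sqr_enorm x0 expr0n.
  by rewrite /dot big1 ?mulr_ge0 ?enorm_ge0// => i _; rewrite mxE mul0r.
have [y0|y0] := eqVneq (enorm y) 0.
  have -> : y = 0 by apply: dot_eq0; rewrite -sqr_enorm y0 expr0n.
  by rewrite /dot big1 ?mulr_ge0 ?enorm_ge0// => i _; rewrite mxE mulr0.
have xp : 0 < enorm x by rewrite lt_def x0 enorm_ge0.
have yp : 0 < enorm y by rewrite lt_def y0 enorm_ge0.
have := dot_ge0 (enorm y *: x - enorm x *: y).
rewrite dotDl !dotDr !dotNl !dotNr !dotZl !dotZr -!sqr_enorm (dotC y x) => h.
rewrite -(@ler_pM2l _ (enorm x * enorm y)) ?mulr_gt0//.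
move: h; move: (dot x y) (enorm x) (enorm y); clear => q a b; nra.
Qed.

Lemma enormN x : enorm (- x) = enorm x.
Proof. by rewrite /enorm dotNl dotNr opprK. Qed.

Lemma enormD x y : enorm (x + y) <= enorm x + enorm y.
Proof.
rewrite -ler_sqr ?nnegrE ?addr_ge0 ?enorm_ge0// sqr_enorm dotDl !dotDr -!sqr_enorm (dotC y x).
have := cauchy_schwarz x y; move: (dot x y) (enorm x) (enorm y); clear => q a b; nra.
Qed.

Lemma enormB x y : enorm (x - y) <= enorm x + enorm y.
Proof. by rewrite -(enormN y) enormD. Qed.

Lemma enorm0 : enorm (0 : 'rV[R]_d) = 0.
Proof. by rewrite /enorm /dot big1 ?sqrtr0// => i _; rewrite mxE mul0r. Qed.

Lemma coord_le_enorm x i : `|x ord0 i| <= enorm x.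
Proof.
rewrite -ler_sqr ?nnegrE ?normr_ge0 ?enorm_ge0// real_normK ?num_real// sqr_enorm.
exact: coord_le_dot.
Qed.

End dot.

Lemma continuous_enorm (R : realType) d : continuous (@enorm R d).
Proof.
move=> x; apply: (@continuous_comp _ _ _ (fun x => dot x x) Num.sqrt).
  have := @class_C_continuous _ _ 0 _ (@class_C_sqdist R d 0 0).
  by under eq_fun do rewrite subr0; exact.
exact: sqrt_continuous.
Qed.

(** * Probability densities and their laws *)

Section probability_density.
Context {R : realType} {d : nat}.
Local Notation leb := (lebesgue_rV R d).
Local Notation Int f := (\int[leb]_x f x).
Local Notation itg f := (leb.-integrable setT (EFin \o f)).
Implicit Types f : 'rV[R]_d -> R.

Record is_density f : Prop := IsDensity {
  density_ge0 : forall x, 0 <= f x;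
  density_measurable : measurable_fun setT f;
  density_mass : (\int[leb]_x (f x)%:E = 1)%E }.

Lemma density_itg f : is_density f -> itg f.
Proof. by move=> [f0 mf f1]; apply: ge0_itg_lty => //; rewrite f1 ltry. Qed.

Lemma density_Int f : is_density f -> Int f = 1.
Proof. by move=> [f0 mf f1]; rewrite /Rintegral f1. Qed.

Lemma Int_density1 f : (forall x, 0 <= f x) -> itg f -> Int f = 1 -> is_density f.
Proof.
move=> f0 fi f1; split=> //; first exact: itg_measurable fi.
by rewrite -EFin_Int// f1.
Qed.

Lemma has_density_is_density (m : P2 R d) f : has_density m f -> is_density f.
Proof.
move=> [mf f0 mE]; split=> //.
have mT : m setT = 1%E by exact: probability_setT.
by rewrite -mT mE.
Qed.

Section law.
Variables (f : 'rV[R]_d -> R) (fP : is_density f).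

Definition density_law : set 'rV[R]_d -> \bar R :=
  dens leb (density_ge0 fP) (density_measurable fP).

HB.instance Definition _ := Measure.on density_law.

Let density_law_setT : density_law setT = 1%E.
Proof. exact: density_mass fP. Qed.

HB.instance Definition _ :=
  @Measure_isProbability.Build _ _ _ density_law density_law_setT.

Lemma density_law_moment : itg (fun x => enorm x ^+ 2 * f x) ->
  (\int[density_law]_x (enorm x ^+ 2)%:E < +oo)%E.
Proof.
move=> fi.
rewrite (@ge0_integral_density _ _ _ leb density_law f (density_ge0 fP)
  (density_measurable fP) (fun A mA => erefl)) //.
- apply: le_lt_trans (itg_lty _ fi); last first.
    by move=> x; rewrite mulr_ge0 ?sqr_ge0//; exact: density_ge0.
  by under eq_integral do rewrite -EFinM.
- by apply/measurable_EFinP; apply: measurable_funX; exact: measurable_enorm.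
- by move=> x; rewrite lee_fin sqr_ge0.
Qed.

Definition density_P2 (fi : itg (fun x => enorm x ^+ 2 * f x)) : P2 R d :=
  mkP2 (density_law_moment fi).

Lemma density_P2P fi : has_density (density_P2 fi) f.
Proof. by split; [exact: density_measurable|exact: density_ge0|]. Qed.

End law.

Lemma has_density_moment (m : P2 R d) f : has_density m f ->
  itg (fun x => enorm x ^+ 2 * f x).
Proof.
move=> [mf f0 mE].
have me : measurable_fun setT (fun x : 'rV[R]_d => enorm x ^+ 2).
  by apply: measurable_funX; exact: measurable_enorm.
apply/(itg_densityP f0 mf mE me); apply: ge0_itg_lty => //; last exact: P2_moment.
by move=> x; rewrite sqr_ge0.
Qed.

Lemma has_density_mix (m0 m1 : P2 R d) f0 f1 (t : R) : 0 <= t <= 1 ->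
  has_density m0 f0 -> has_density m1 f1 ->
  has_density (P2_mix m0 m1 t) (fun x => (1 - t) * f0 x + t * f1 x).
Proof.
move=> /andP[t0 t1] [mf0 f00 m0E] [mf1 f10 m1E]; split.
- by apply: measurable_funD; exact: measurable_funM.
- by move=> x; rewrite addr_ge0// mulr_ge0// subr_ge0.
move=> A mA.
have wt : weight t = t by rewrite /weight (min_l t1) (max_r t0).
change (mixture m0 m1 t A = (\int[leb]_(x in A) ((1 - t) * f0 x + t * f1 x)%:E)%E).
rewrite /mixture measure_addE.
change (((1 - weight t)%:E * m0 A + (weight t)%:E * m1 A)%E =
  (\int[leb]_(x in A) ((1 - t) * f0 x + t * f1 x)%:E)%E).
rewrite wt m0E// m1E//.
under [RHS]eq_integral do rewrite EFinD !EFinM.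
have mE (g : 'rV[R]_d -> R) : measurable_fun setT g -> measurable_fun A (fun x => (g x)%:E).
  by move=> mg; apply/measurable_EFinP; exact: measurable_funTS.
have t10 : 0 <= 1 - t by rewrite subr_ge0.
rewrite ge0_integralD//.
- by rewrite !ge0_integralZl//; try exact: mE; move=> x _; rewrite lee_fin.
- by move=> x _; rewrite mule_ge0// lee_fin.
- by apply: emeasurable_funM => //; exact: mE.
- by move=> x _; rewrite mule_ge0// lee_fin.
- by apply: emeasurable_funM => //; exact: mE.
Qed.

End probability_density.

(** * The overlap coupling and its transport cost *)

Section coupling.
Context {R : realType} {d : nat}.
Local Notation leb := (lebesgue_rV R d).
Local Notation Int f := (\int[leb]_x f x).
Local Notation itg f := (leb.-integrable setT (EFin \o f)).
Local Notation V := 'rV[R]_d.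
Variables (f g : V -> R) (fP : is_density f) (gP : is_density g).

Let lo x : R := Num.min (f x) (g x).
Let ex x : R := f x - lo x.
Let de x : R := g x - lo x.

Let lo0 x : 0 <= lo x.
Proof. by rewrite le_min (density_ge0 fP) (density_ge0 gP). Qed.
Let ex0 x : 0 <= ex x. Proof. by rewrite subr_ge0 ge_min lexx. Qed.
Let de0 x : 0 <= de x. Proof. by rewrite subr_ge0 ge_min lexx orbT. Qed.
Let mf := density_measurable fP.
Let mg := density_measurable gP.
Let mlo : measurable_fun setT lo. Proof. exact: measurable_minr. Qed.
Let mex : measurable_fun setT ex. Proof. exact: measurable_funB. Qed.
Let mde : measurable_fun setT de. Proof. exact: measurable_funB. Qed.
Let ilo : itg lo.
Proof.
by apply: itg_le (density_itg fP) => // x; rewrite ger0_norm// ge_min lexx.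
Qed.
Let iex : itg ex. Proof. exact: itgB (density_itg fP) ilo. Qed.
Let ide : itg de. Proof. exact: itgB (density_itg gP) ilo. Qed.

Let tau : R := Int ex.

Let tau_de : Int de = tau.
Proof. by rewrite /tau !IntB ?(density_Int fP) ?(density_Int gP)//; exact: density_itg. Qed.

Let tau0 : 0 <= tau. Proof. exact: Int_ge0. Qed.

Let mdiag : measurable_fun setT (fun x : V => (x, x)).
Proof. by apply/measurable_fun_pairP; split; exact: measurable_id. Qed.

Let dg : {measure set (V * V) -> \bar R} :=
  measure_function_pushforward__canonical__measure_function_Measure
    (dens leb lo0 mlo) mdiag.

Let off z : R := tau^-1 * (ex z.1 * de z.2).

Let off0 z : 0 <= off z.
Proof. by rewrite !mulr_ge0// invr_ge0. Qed.

Let moff : measurable_fun setT off.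
Proof.
apply: measurable_funM => //; apply: measurable_funM.
  by apply: measurableT_comp => //; exact: measurable_fst.
by apply: measurableT_comp => //; exact: measurable_snd.
Qed.

(* The common part of the two densities stays on the diagonal, and the
   remainders are coupled independently. *)
Definition overlap_coupling (fgP : is_density f /\ is_density g) : set (V * V) -> \bar R :=
  measure_add dg (dens (leb \x leb)%E off0 moff).

Variable fgP : is_density f /\ is_density g.

HB.instance Definition _ := Measure.on (overlap_coupling fgP).

Let couplingE A : overlap_coupling fgP A =
  (\int[leb]_(x in [set x | A (x, x)]) (lo x)%:E +
   dens (leb \x leb)%E off0 moff A)%E.
Proof. by rewrite /overlap_coupling measure_addE. Qed.

Let integral_off (k l : V -> R) : (forall x, 0 <= k x) -> (forall x, 0 <= l x) ->
  measurable_fun setT k -> measurable_fun setT l ->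
  (\int[leb \x leb]_z ((tau^-1 * (k z.1 * l z.2))%:E) =
   (tau^-1)%:E * (\int[leb]_x (k x)%:E * \int[leb]_y (l y)%:E))%E.
Proof.
move=> k0 l0 mk ml.
have mkE : measurable_fun setT (fun x => (k x)%:E) by exact/measurable_EFinP.
have mlE : measurable_fun setT (fun x => (l x)%:E) by exact/measurable_EFinP.
have tV0 : (0 <= (tau^-1)%:E)%E by rewrite lee_fin invr_ge0.
have L0 : (0 <= \int[leb]_y (l y)%:E)%E.
  by apply: integral_ge0 => y _; rewrite lee_fin.
rewrite fubini_tonelli1; last 2 first.
- apply/measurable_EFinP; apply: measurable_funM => //; apply: measurable_funM.
    by apply: measurableT_comp => //; exact: measurable_fst.
  by apply: measurableT_comp => //; exact: measurable_snd.
- by move=> z; rewrite lee_fin mulr_ge0 ?invr_ge0// mulr_ge0.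
rewrite /fubini_F /=.
transitivity (\int[leb]_x ((tau^-1)%:E * ((k x)%:E * \int[leb]_y (l y)%:E)))%E.
  apply: eq_integral => x _.
  under eq_integral do rewrite !EFinM.
  have kx0 : (0 <= (k x)%:E)%E by rewrite lee_fin.
  rewrite (@ge0_integralZl _ _ _ leb _ measurableT (fun y => ((k x)%:E * (l y)%:E)%E))//.
  - rewrite ge0_integralZl// => y _; rewrite lee_fin; exact: l0.
  - exact: emeasurable_funM.
  - by move=> y _; rewrite mule_ge0// lee_fin.
have mkL : measurable_fun setT (fun x => ((k x)%:E * \int[leb]_y (l y)%:E)%E).
  exact: emeasurable_funM.
rewrite ge0_integralZl//; last by move=> x _; rewrite mule_ge0// lee_fin.
by rewrite ge0_integralZr// => x _; rewrite lee_fin.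
Qed.

(** If [tau = 0], the two densities agree almost everywhere. The inverse [tau^-1] is then 0 by
    convention, and the identity survives because [c <= tau%:E] forces [c = 0]. *)
Let cancel_tau (c : \bar R) : (0 <= c)%E -> (c <= tau%:E)%E ->
  ((tau^-1)%:E * (c * tau%:E) = c)%E.
Proof.
move=> c0 ct; have [t0|t0] := eqVneq tau 0.
  have -> : c = 0%E by apply/eqP; rewrite eq_le c0 andbT; move: ct; rewrite t0.
  by rewrite mul0e mule0.
have cf : c \is a fin_num by rewrite ge0_fin_numE// (le_lt_trans ct)// ltry.
by rewrite -(fineK cf) -!EFinM mulrCA mulVf// mulr1.
Qed.

Let setX_indic (A B : set V) z : \1_(A `*` B) z = \1_A z.1 * \1_B z.2 :> R.
Proof. by rewrite !indicE -natrM mulnb in_setX. Qed.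

Let dens_offE (A B : set V) : measurable A -> measurable B ->
  (dens (leb \x leb) off0 moff (A `*` B) = (tau^-1)%:E *
    (\int[leb]_x (ex x * \1_A x)%:E * \int[leb]_y (de y * \1_B y)%:E))%E.
Proof.
move=> mA mB.
rewrite -integral_off; first last.
- by apply: measurable_funM => //; exact: measurable_indic.
- by apply: measurable_funM => //; exact: measurable_indic.
- by move=> x; rewrite mulr_ge0.
- by move=> x; rewrite mulr_ge0.
rewrite /dens integral_mkcond; apply: eq_integral => z _.
rewrite patchE; have := setX_indic A B z; rewrite indicE /off.
case: ifP => zAB /= h.
  by congr EFin; rewrite -[LHS]mulr1 [X in _ * X]h; ring.
by congr EFin; rewrite -(mulr0 (tau^-1 * (ex z.1 * de z.2))) [X in _ * X]h; ring.
Qed.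

Let mul_indic (u : V -> R) (A : set V) : measurable A ->
  (\int[leb]_(x in A) (u x)%:E = \int[leb]_x (u x * \1_A x)%:E)%E.
Proof.
move=> mA; rewrite integral_mkcond; apply: eq_integral => x _.
by rewrite patchE indicE; case: ifPn => _; rewrite ?mulr1 ?mulr0.
Qed.

Lemma overlap_coupling_fst A : measurable A ->
  overlap_coupling fgP (A `*` setT) = (\int[leb]_(x in A) (f x)%:E)%E.
Proof.
move=> mA; rewrite couplingE dens_offE//.
have -> : [set x | (A `*` setT) (x, x)] = A by apply/seteqP; split=> x //= [].
have -> : (\int[leb]_y (de y * \1_[set: V] y)%:E = tau%:E)%E.
  rewrite -tau_de EFin_Int//; apply: eq_integral => y _.
  by rewrite indicE in_setT mulr1.
rewrite cancel_tau; last 2 first.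
- by apply: integral_ge0 => x _; rewrite lee_fin mulr_ge0.
- rewrite /tau EFin_Int//; apply: ge0_le_integral => //.
  + by move=> x _; rewrite lee_fin mulr_ge0.
  + apply/measurable_EFinP; apply: measurable_funM => //; exact: measurable_indic.
  + exact/measurable_EFinP.
  + move=> x _; rewrite lee_fin ler_piMr// indicE; by case: (_ \in _).
rewrite -mul_indic// -ge0_integralD//.
- by apply: eq_integral => x _; rewrite -EFinD addrC subrK.
- by move=> x _; rewrite lee_fin.
- by apply/measurable_EFinP; exact: measurable_funTS.
- by move=> x _; rewrite lee_fin.
- by apply/measurable_EFinP; exact: measurable_funTS.
Qed.

Lemma overlap_coupling_snd A : measurable A ->
  overlap_coupling fgP (setT `*` A) = (\int[leb]_(x in A) (g x)%:E)%E.
Proof.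
move=> mA; rewrite couplingE dens_offE//.
have -> : [set x | (setT `*` A) (x, x)] = A by apply/seteqP; split=> x //= [].
have -> : (\int[leb]_y (ex y * \1_[set: V] y)%:E = tau%:E)%E.
  rewrite /tau EFin_Int//; apply: eq_integral => y _.
  by rewrite indicE in_setT mulr1.
rewrite [X in (_ * X)%E]muleC cancel_tau; last 2 first.
- by apply: integral_ge0 => x _; rewrite lee_fin mulr_ge0.
- rewrite -tau_de EFin_Int//; apply: ge0_le_integral => //.
  + by move=> x _; rewrite lee_fin mulr_ge0.
  + apply/measurable_EFinP; apply: measurable_funM => //; exact: measurable_indic.
  + exact/measurable_EFinP.
  + move=> x _; rewrite lee_fin ler_piMr// indicE; by case: (_ \in _).
rewrite -mul_indic// -ge0_integralD//.
- by apply: eq_integral => x _; rewrite -EFinD addrC subrK.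
- by move=> x _; rewrite lee_fin.
- by apply/measurable_EFinP; exact: measurable_funTS.
- by move=> x _; rewrite lee_fin.
- by apply/measurable_EFinP; exact: measurable_funTS.
Qed.

Let overlap_coupling_setT : overlap_coupling fgP setT = 1%E.
Proof. by rewrite -setXTT overlap_coupling_fst// (density_mass fP). Qed.

HB.instance Definition _ := @Measure_isProbability.Build _ _ _
  (overlap_coupling fgP) overlap_coupling_setT.

(** The diagonal part costs nothing. On the product part [|x - y| <= |x| + |y|], and in each of the
    two resulting products one factor has mass [tau], which cancels the normalization. *)
Lemma overlap_coupling_cost :
  (\int[overlap_coupling fgP]_z (enorm (z.1 - z.2))%:E <=
   \int[leb]_x (enorm x * `|f x - g x|)%:E)%E.
Proof.
have mB : measurable_fun setT (fun z : V * V => (enorm (z.1 - z.2))%:E).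
  apply/measurable_EFinP.
  suff mdot : measurable_fun setT (fun z : V * V => dot (z.1 - z.2) (z.1 - z.2)).
    have msqrt : measurable_fun setT (@Num.sqrt R).
      by apply: continuous_measurable_fun; exact: sqrt_continuous.
    exact: (measurableT_comp msqrt mdot).
  apply: measurable_sum => i.
  have mi : measurable_fun setT (fun z : V * V => (z.1 - z.2) ord0 i).
    rewrite (_ : (fun z => _) = (fun z : V * V => z.1 ord0 i - z.2 ord0 i)); last first.
      by apply/funext => z; rewrite !mxE.
    apply: measurable_funB.
      exact: (measurableT_comp (@measurable_coord_mx R 1 d ord0 i) (@measurable_fst _ _ V V)).
    exact: (measurableT_comp (@measurable_coord_mx R 1 d ord0 i) (@measurable_snd _ _ V V)).
  exact: measurable_funM.
have B0 (z : V * V) : (0 <= (enorm (z.1 - z.2))%:E)%E by rewrite lee_fin enorm_ge0.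
have -> : (\int[overlap_coupling fgP]_z (enorm (z.1 - z.2))%:E =
    \int[dg]_z (enorm (z.1 - z.2))%:E +
    \int[dens (leb \x leb)%E off0 moff]_z (enorm (z.1 - z.2))%:E)%E.
  exact: (ge0_integral_measure_add _ _ measurableT (fun z _ => B0 z) mB).
have -> : (\int[dg]_z (enorm (z.1 - z.2))%:E = 0)%E.
  have := ge0_integral_pushforward mdiag (dens leb lo0 mlo) measurableT mB
    (fun z _ => B0 z).
  rewrite preimage_setT => H; rewrite [LHS]H.
  by rewrite integral0_eq// => x _ /=; rewrite subrr enorm0.
rewrite add0e (@ge0_integral_density _ _ _ (leb \x leb)%E (dens (leb \x leb)%E off0 moff)
  off off0 moff (fun A mA => erefl) _ mB B0).
have men : measurable_fun setT (@enorm R d) by exact: measurable_enorm.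
apply: (@le_trans _ _ (\int[leb \x leb]_z ((tau^-1 * ((enorm z.1 * ex z.1) * de z.2))%:E +
   (tau^-1 * (ex z.1 * (enorm z.2 * de z.2)))%:E))%E).
  have mm (k l : V -> R) : measurable_fun setT k -> measurable_fun setT l ->
      measurable_fun setT (fun z : V * V => tau^-1 * (k z.1 * l z.2)).
    move=> mk ml; apply: measurable_funM => //; apply: measurable_funM.
      by apply: measurableT_comp => //; exact: measurable_fst.
    by apply: measurableT_comp => //; exact: measurable_snd.
  apply: ge0_le_integral => //.
  - by move=> z _; rewrite mule_ge0// lee_fin.
  - by apply: emeasurable_funM => //; exact/measurable_EFinP.
  - apply: emeasurable_funD; apply/measurable_EFinP.
      exact: (mm (fun x => enorm x * ex x) de (measurable_funM men mex) mde).
    exact: (mm ex (fun x => enorm x * de x) mex (measurable_funM men mde)).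
  - move=> z _; rewrite -EFinM -EFinD lee_fin /off.
    have := enormB z.1 z.2; have := ex0 z.1; have := de0 z.2.
    have : 0 <= tau^-1 by rewrite invr_ge0.
    move: (tau^-1) (enorm (z.1 - z.2)) (enorm z.1) (enorm z.2) (ex z.1) (de z.2).
    clear => t n n1 n2 a b t0 b0 a0 h.
    rewrite (_ : _ + _ = (n1 + n2) * (t * (a * b))); last by ring.
    by rewrite ler_wpM2r// !mulr_ge0.
have iE (k l : V -> R) : (forall x, 0 <= k x) -> (forall x, 0 <= l x) ->
    measurable_fun setT k -> measurable_fun setT l ->
    measurable_fun setT (fun z : V * V => (tau^-1 * (k z.1 * l z.2))%:E).
  move=> k0 l0 mk ml; apply/measurable_EFinP; apply: measurable_funM => //.
  apply: measurable_funM.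
    by apply: measurableT_comp => //; exact: measurable_fst.
  by apply: measurableT_comp => //; exact: measurable_snd.
have en0 (k : V -> R) : (forall x, 0 <= k x) -> forall x, 0 <= enorm x * k x.
  by move=> k0 x; rewrite mulr_ge0 ?enorm_ge0.
have mne (k : V -> R) : measurable_fun setT k -> measurable_fun setT (fun x => enorm x * k x).
  by move=> mk; exact: measurable_funM.
rewrite ge0_integralD//; last 4 first.
- by move=> z _; rewrite lee_fin !mulr_ge0 ?invr_ge0 ?enorm_ge0.
- exact: (iE _ _ (en0 _ ex0) de0 (mne _ mex) mde).
- by move=> z _; rewrite lee_fin !mulr_ge0 ?invr_ge0 ?enorm_ge0.
- exact: (iE _ _ ex0 (en0 _ de0) mex (mne _ mde)).
rewrite (integral_off (en0 _ ex0) de0 (mne _ mex) mde).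
rewrite (integral_off ex0 (en0 _ de0) mex (mne _ mde)).
have Ed : (\int[leb]_y (de y)%:E = tau%:E)%E by rewrite -tau_de EFin_Int.
have Ee : (\int[leb]_y (ex y)%:E = tau%:E)%E by rewrite /tau EFin_Int.
(* Here only an inequality is claimed, so [c] may be infinite; for [tau = 0] the left-hand side is
   0. *)
have cancel_le (c : \bar R) : (0 <= c)%E -> ((tau^-1)%:E * (c * tau%:E) <= c)%E.
  move=> c0; have [t0|t0] := eqVneq tau 0.
    by rewrite t0 mule0 mule0.
  by rewrite muleCA -EFinM mulVf// mule1.
have I0 (k : V -> R) : (forall x, 0 <= k x) -> (0 <= \int[leb]_x (k x)%:E)%E.
  by move=> k0; apply: integral_ge0 => x _; rewrite lee_fin.
rewrite Ed Ee [X in (_ + _ * X)%E]muleC.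
apply: (@le_trans _ _ (\int[leb]_x (enorm x * ex x)%:E + \int[leb]_x (enorm x * de x)%:E)%E).
  by apply: leeD; apply: cancel_le; apply: I0; exact: en0.
rewrite -ge0_integralD//; first last.
- by apply/measurable_EFinP; exact: mne.
- by move=> x _; rewrite lee_fin en0.
- by apply/measurable_EFinP; exact: mne.
- by move=> x _; rewrite lee_fin en0.
apply: ge0_le_integral => //.
- by move=> x _; rewrite -EFinD lee_fin addr_ge0 ?en0.
- by apply: emeasurable_funD; apply/measurable_EFinP; exact: mne.
- apply/measurable_EFinP; apply: mne; apply: measurableT_comp => //.
  exact: measurable_funB.
- move=> x _; rewrite -EFinD lee_fin -mulrDr ler_wpM2l ?enorm_ge0//.
  (* At each point one of the two remainders vanishes, so their sum is [|f x - g x|]. *)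
  rewrite /ex /de /lo minEle; case: ifP => h; last first.
    by rewrite subrr addr0 ler_norm.
  by rewrite subrr add0r distrC ler_norm.
Qed.

End coupling.

Lemma wasserstein1_le_density (R : realType) d (m m' : P2 R d) (f g : 'rV[R]_d -> R) :
  has_density m f -> has_density m' g ->
  (wasserstein 1 m m' <= \int[lebesgue_rV R d]_x (enorm x * `|f x - g x|)%:E)%E.
Proof.
move=> mf mg; have fP := has_density_is_density mf; have gP := has_density_is_density mg.
have fgP := conj fP gP.
rewrite /wasserstein invr1 poweRe1; last first.
  apply: le_ereal_inf_tmp => _ [pi _ <-]; apply: integral_ge0 => z _.
  by rewrite lee_fin powR_ge0.
apply: (@le_trans _ _ (\int[overlap_coupling fP gP fgP]_z (enorm (z.1 - z.2))%:E)%E);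
  last exact: overlap_coupling_cost.
apply: ereal_inf_le; exists (\int[overlap_coupling fP gP fgP]_z (enorm (z.1 - z.2))%:E)%E => //.
exists (overlap_coupling fP gP fgP); last first.
  by apply: eq_integral => z _; rewrite powRr1// enorm_ge0.
move=> A mA; split.
  by have [_ _ mE] := mf; rewrite mE//; exact: overlap_coupling_fst.
by have [_ _ mE] := mg; rewrite mE//; exact: overlap_coupling_snd.
Qed.

(** * First-order expansion of the energy *)

Section directional.
Context {R : realType}.

Lemma is_deriveP (V : normedModType R) (f : V -> R) (x v : V) (l : R) :
  is_derive x v f l <->
  forall e : R, 0 < e -> exists2 r : R, 0 < r & forall h : R, `|h| < r ->
    `|f (x + h *: v) - f x - h * l| <= e * `|h|.
Proof.
split=> [[fdr fdE] e e0|H].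
  move: fdr => /cvg_ex[/= l' fl].
  have lE : l' = l by rewrite -fdE; apply/esym/cvg_lim.
  move: fl; rewrite {}lE => /cvgrPdist_le/(_ e e0).
  rewrite /prop_near1 /= => -[r /= r0 rP]; exists r => // h hr.
  have [->|h0] := eqVneq h 0.
    by rewrite scale0r addr0 subrr mul0r subr0 normr0 mulr0.
  have := rP h; rewrite /ball_/= sub0r normrN => /(_ hr h0).
  rewrite distrC [h *: v + x]addrC /GRing.scale/= => le.
  have -> : f (x + h *: v) - f x - h * l = (h^-1 * (f (x + h *: v) - f x) - l) * h.
    by rewrite mulrBl mulrAC mulVf// mul1r [l * h]mulrC.
  by rewrite normrM ler_wpM2r.
have cv : (fun h : R => h^-1 *: ((f \o shift x) (h *: v) - f x)) @ 0^' --> l.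
  apply/cvgrPdist_le => e e0; have [r r0 rP] := H e e0.
  rewrite /prop_near1 /=; exists r => // h.
  rewrite /ball_/= sub0r normrN => hr h0; rewrite distrC [h *: v + x]addrC.
  have -> : h^-1 *: (f (x + h *: v) - f x) - l = (f (x + h *: v) - f x - h * l) / h.
    by rewrite mulrBl [h * l]mulrC mulfK// [_ / h]mulrC.
  by rewrite normrM normfV ler_pdivrMr ?normr_gt0// rP.
by split; [exact: cvgP cv|exact: cvg_lim cv].
Qed.

Context {d : nat}.
Implicit Types (f : 'rV[R]_d -> R) (x v w : 'rV[R]_d).

(** The error is uniform in the base point [y] near [x], by continuity of the partial derivative and
    the mean value inequality. This uniformity is what allows a direction to be built up one
    coordinate at a time. *)
Lemma partial_increment f i x (e : R) : class_C 1 f -> 0 < e ->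
  exists2 r : R, 0 < r & forall y (s : R), ball x r y -> `|s| < r ->
    `|f (y + s *: delta_mx ord0 i) - f y - s * partial i f x| <= e * `|s|.
Proof.
move=> fC e0; have cp : continuous (partial i f).
  exact: class_C_continuous (class_C_partial i fC).
have /cvgrPdist_le/(_ e e0) := cp x.
rewrite /prop_near1 => /nbhs_ballP[r /= r0 rP].
exists (r / 2); first by rewrite divr_gt0.
move=> y s yr sr.
pose k (t : R) := f (y + (t * s) *: delta_mx ord0 i) - (t * s) * partial i f x.
have kd (t : R) : is_derive t 1 k
    (partial i f (y + (t * s) *: delta_mx ord0 i) * s - s * partial i f x).
  have id1 := @is_derive_id R R t 1.
  have ts : is_derive t 1 (fun t : R => t * s) s.
    apply: is_derive_ext (is_derive_scalef s id1) => [u|]; first exact: mulrC.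
    exact: mulr1.
  have tp : is_derive t 1 (fun t : R => t * s * partial i f x) (s * partial i f x).
    apply: is_derive_ext (is_derive_scalef (partial i f x) ts) => [u|]; exact: mulrC.
  apply: is_derive_subf tp.
  apply: (@is_derive_compf _ _ (fun u : R => f (y + u *: delta_mx ord0 i))
    (fun t : R => t * s) t 1 s _ _ ts).
  by apply/is_derive_lineP; exact: class_C_is_derive fC.
have kb (t : R) : t \in `]0, 1[ ->
    `|partial i f (y + (t * s) *: delta_mx ord0 i) * s - s * partial i f x| <= e * `|s|.
  rewrite in_itv/= => /andP[t0 t1].
  rewrite [s * _]mulrC -mulrBl normrM ler_wpM2r// distrC; apply: rP.
  apply: (@ball_splitr _ _ y); first exact: ball_sym.
  apply: cst_in_ball => [|j]; first by rewrite divr_gt0.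
  rewrite rV_addZE mxE eqxx/= opprD addNKr normrN.
  apply: le_lt_trans sr; rewrite !normrM (gtr0_norm t0).
  have b1 : `|(j == i)%:R : R| <= 1 by case: eqP => _; rewrite ?normr1 ?normr0.
  have ts0 : 0 <= t * `|s| by rewrite mulr_ge0// ltW.
  by rewrite (le_trans (ler_piMr ts0 b1))// ler_piMl// ltW.
have := @norm_is_derive_le _ k _ 0 1 (e * `|s|) ler01 (fun t _ => kd t) kb
  (is_derive_within_continuous (fun t _ => kd t)).
rewrite subr0 mulr1 /k !mul0r mul1r scale0r addr0 subr0.
by rewrite addrAC.
Qed.

Lemma is_derive_dir0 f x : is_derive x 0 f 0.
Proof.
apply/is_deriveP => e e0; exists 1 => // h _.
by rewrite scaler0 addr0 subrr mulr0 subr0 normr0 mulr_ge0// ltW.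
Qed.

Lemma is_derive_dirD f x i (a : R) v (l : R) : class_C 1 f -> is_derive x v f l ->
  is_derive x (v + a *: delta_mx ord0 i) f (l + a * partial i f x).
Proof.
move=> fC /is_deriveP fv; apply/is_deriveP => e e0.
have e2 : 0 < e / 2 by rewrite divr_gt0.
have [r1 r10 fv1] := fv _ e2.
have a1 : 0 < 1 + `|a| by rewrite ltr_pwDl.
have ea : 0 < e / 2 / (1 + `|a|) by rewrite divr_gt0.
have [r2 r20 fp2] := @partial_increment f i x _ fC ea.
pose n := 1 + enorm v + `|a|.
have n1 : 1 <= n by rewrite /n -addrA lerDl addr_ge0 ?enorm_ge0.
have n0 : 0 < n by rewrite (lt_le_trans ltr01).
exists (Num.min r1 (r2 / n)); first by rewrite lt_min r10 divr_gt0.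
move=> h; rewrite lt_min => /andP[hr1 hr2].
have hn : `|h| * n < r2 by rewrite -ltr_pdivlMr.
rewrite scalerDr addrA scalerA.
have H1 := fv1 h hr1.
have H2 : `|f (x + h *: v + (h * a) *: delta_mx ord0 i) - f (x + h *: v) -
    h * a * partial i f x| <= e / 2 / (1 + `|a|) * `|h * a|.
  apply: fp2.
    apply: cst_in_ball => // j.
    rewrite rV_addZE opprD addNKr normrN normrM.
    apply: le_lt_trans hn; rewrite ler_wpM2l//.
    by rewrite (le_trans (coord_le_enorm v j))// /n -addrA addrCA lerDl addr_ge0.
  apply: le_lt_trans hn; rewrite normrM ler_wpM2l//.
  by rewrite /n lerDr addr_ge0 ?enorm_ge0.
have H3 : e / 2 / (1 + `|a|) * `|h * a| <= e / 2 * `|h|.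
  rewrite normrM [`|h| * _]mulrC mulrA ler_wpM2r// mulrAC ler_pdivrMr//.
  by rewrite ler_wpM2l ?(ltW e2)// lerDr.
have -> : f (x + h *: v + (h * a) *: delta_mx ord0 i) - f x -
    h * (l + a * partial i f x) =
    (f (x + h *: v) - f x - h * l) +
    (f (x + h *: v + (h * a) *: delta_mx ord0 i) - f (x + h *: v) -
       h * a * partial i f x) by ring.
rewrite (le_trans (ler_normD _ _))//.
have -> : e * `|h| = e / 2 * `|h| + e / 2 * `|h| by field.
by rewrite lerD// (le_trans H2).
Qed.

(* The library has no criterion deriving differentiability from continuous
   partial derivatives. *)
Lemma class_C1_dir f x v : class_C 1 f -> is_derive x v f (dot (grad f x) v).
Proof.
move=> fC.
have H (s : seq 'I_d) : is_derive x (\sum_(i <- s) v ord0 i *: delta_mx ord0 i) f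
    (\sum_(i <- s) v ord0 i * partial i f x).
  elim: s => [|i s IHs]; first by rewrite !big_nil; exact: is_derive_dir0.
  rewrite !big_cons addrC [X in is_derive _ _ _ X]addrC; exact: is_derive_dirD.
have := H (index_enum 'I_d); rewrite -(row_sum_delta v).
move/is_derive_eq; apply.
by apply: eq_bigr => i _; rewrite mxE mulrC.
Qed.

Lemma class_C1_dir_line f x v (s : R) : class_C 1 f ->
  is_derive s 1 (fun s : R => f (x + s *: v)) (dot (grad f (x + s *: v)) v).
Proof. by move=> fC; apply/is_derive_lineP; exact: class_C1_dir. Qed.

Lemma class_C1_increment f x y (M : R) : class_C 1 f ->
  (forall z, enorm (grad f z) <= M) -> `|f y - f x| <= M * enorm (y - x).
Proof.
move=> fC fM.
have kd (s : R) := @class_C1_dir_line f x (y - x) s fC.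
have := @norm_is_derive_le _ (fun s : R => f (x + s *: (y - x))) _ 0 1
  (M * enorm (y - x)) ler01 (fun t _ => kd t) _
  (is_derive_within_continuous (fun t _ => kd t)).
rewrite subr0 mulr1 scale0r scale1r addr0 [x + _]addrC subrK; apply=> s _.
rewrite ler_norml; apply/andP; split.
  rewrite lerNl -dotNl (le_trans (cauchy_schwarz _ _))// enormN.
  by rewrite ler_wpM2r ?enorm_ge0.
by rewrite (le_trans (cauchy_schwarz _ _))// ler_wpM2r ?enorm_ge0.
Qed.

End directional.

Lemma le1Dsqr (R : realType) (u : R) : u <= 1 + u ^+ 2.
Proof. have := sqr_ge0 (u - 1); have := sqr_ge0 u; nra. Qed.

Lemma continuous_addf (R : realType) d (f g : 'rV[R]_d -> R) : continuous f ->
  continuous g -> continuous (fun x => f x + g x).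
Proof.
move=> cf cg; have f0 : class_C 0 f by split.
have g0 : class_C 0 g by split.
exact: class_C_continuous (class_C_add f0 g0).
Qed.

Lemma continuous_sqrtf (R : realType) d (f : 'rV[R]_d -> R) : continuous f ->
  continuous (fun x => Num.sqrt (f x)).
Proof.
move=> cf x; apply: (@continuous_comp _ _ _ f Num.sqrt); first exact: cf.
exact: sqrt_continuous.
Qed.

(** * Expansion of the energy along mixtures *)

Section energy.
Context {R : realType} {d : nat}.
Local Notation leb := (lebesgue_rV R d).
Local Notation Int f := (\int[leb]_x f x).
Local Notation itg f := (leb.-integrable setT (EFin \o f)).

Record regular_energy (F : P2 R d -> R) (dF : P2 R d -> 'rV[R]_d -> R)
    (g : 'rV[R]_d -> R) (G : P2 R d -> 'rV[R]_d -> R) (LG : R) : Prop :=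
  RegularEnergy {
    energy_diff : linear_derivative F dF;
    energy_split : forall m x, dF m x = g x + G m x;
    energy_g : continuous g;
    energy_G : forall m, class_C 1 (G m);
    energy_LG : 0 <= LG;
    energy_lip : forall m x y, `|G m x - G m y| <= LG * enorm (x - y);
    energy_grad : forall m m' x y,
      ((enorm (grad (G m) x - grad (G m') y))%:E <=
       LG%:E * ((enorm (x - y))%:E + wasserstein 1 m m'))%E }.

Variables (F : P2 R d -> R) (dF : P2 R d -> 'rV[R]_d -> R)
  (g : 'rV[R]_d -> R) (G : P2 R d -> 'rV[R]_d -> R) (LG : R).
Hypothesis E : regular_energy F dF g G LG.

Lemma grad_sub (f1 f2 : 'rV[R]_d -> R) x : class_C 1 f1 -> class_C 1 f2 ->
  grad (fun y => f1 y - f2 y) x = grad f1 x - grad f2 x.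
Proof.
move=> f1C f2C; apply/rowP => i; rewrite !mxE.
apply: (@is_derive_unique _ _ (fun y => f1 y - f2 y) x (delta_mx ord0 i)).
  exact: class_C_is_derive (class_C_sub f1C f2C).
by apply: is_derive_subf; [exact: class_C_is_derive f1C|exact: class_C_is_derive f2C].
Qed.

Lemma continuous_dF m : continuous (dF m).
Proof.
have -> : dF m = (fun x => g x + G m x) by apply/funext => x; rewrite (energy_split E).
exact: continuous_addf (energy_g E) (class_C_continuous (energy_G E m)).
Qed.

(** The gradient of [G m - G m'] is bounded by [LG] times the Wasserstein distance, uniformly in the
    point; the increments from 0 to [x] are compared along the segment. *)
Lemma G_increment (m m' : P2 R d) (w : R) x : (wasserstein 1 m m' <= w%:E)%E ->
  `|(G m' x - G m' 0) - (G m x - G m 0)| <= LG * w * enorm x.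
Proof.
move=> mw.
have DC : class_C 1 (fun y => G m y - G m' y).
  by apply: class_C_sub; exact: (energy_G E).
have := @class_C1_increment _ _ _ 0 x (LG * w) DC _; rewrite subr0 => H.
rewrite distrC; have -> : G m x - G m 0 - (G m' x - G m' 0) =
  G m x - G m' x - (G m 0 - G m' 0) by ring.
apply: H => z; rewrite grad_sub; [|exact: (energy_G E)..].
rewrite -lee_fin (le_trans (energy_grad E m m' z z))// subrr enorm0 add0e EFinM.
by rewrite lee_wpmul2l// lee_fin (energy_LG E).
Qed.

Lemma dF_growth m : exists2 C : R, 0 <= C &
  forall x, `|dF m x| <= C * (1 + enorm x ^+ 2).
Proof.
have [_ /(_ m)[C HC] _] := energy_diff E; exists `|C| => // x.
by rewrite (le_trans (HC x))// ler_wpM2r ?ler_norm// addr_ge0 ?sqr_ge0.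
Qed.

Lemma itg_dF m m' f : has_density m' f -> itg (fun x => dF m x * f x).
Proof.
move=> mf; have fP := has_density_is_density mf; have f0 := density_ge0 fP.
have [C C0 HC] := dF_growth m.
apply: (@itg_le _ _ _ leb _ (fun x => C * (f x + enorm x ^+ 2 * f x))).
- apply: measurable_funM; last exact: density_measurable fP.
  exact: (continuous_mfun (@continuous_dF m)).
- move=> x; rewrite normrM (ger0_norm (f0 x)) -[X in X + _ * _]mul1r -mulrDl mulrA.
  by rewrite ler_wpM2r.
- by apply: itgZ; apply: itgD (density_itg fP) (has_density_moment mf).
Qed.

Lemma integral_dF m m' f : has_density m' f -> \int[m']_x dF m x = Int (fun x => dF m x * f x).
Proof.
move=> mf; have [mf' f0 mE] := mf.
apply: (Int_density f0 mf' mE); apply/(itg_densityP f0 mf' mE).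
  exact: (continuous_mfun (@continuous_dF m)).
exact: itg_dF mf.
Qed.

Lemma itg_enorm_density m f : has_density m f -> itg (fun x => enorm x * f x).
Proof.
move=> mf; have fP := has_density_is_density mf; have f0 := density_ge0 fP.
apply: (@itg_le _ _ _ leb _ (fun x => f x + enorm x ^+ 2 * f x)).
- by apply: measurable_funM; [exact: measurable_enorm|exact: density_measurable fP].
- move=> x; rewrite normrM (ger0_norm (f0 x)) (ger0_norm (enorm_ge0 x)).
  rewrite -[X in X + _ * _]mul1r -mulrDl ler_wpM2r//.
  exact: le1Dsqr.
- by apply: itgD (density_itg fP) (has_density_moment mf).
Qed.

Lemma itg_enorm_dist m m' f f' : has_density m f -> has_density m' f' ->
  itg (fun x => enorm x * `|f x - f' x|).
Proof.
move=> mf mf'; have := itgB (itg_enorm_density mf) (itg_enorm_density mf').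
move/itg_norm; congr (_.-integrable _ (EFin \o _)); apply/funext => x.
by rewrite -mulrBr normrM (ger0_norm (enorm_ge0 x)).
Qed.

(** The linear derivative is taken along the mixtures of [m] and [m'], whose distance to [m] is at
    most [w], the integral of [enorm x * |f x - f' x|]. Replacing it by [dF m] costs, up to a
    constant, at most [LG * w * enorm x] at each point, hence [LG * w ^+ 2] after integration
    against [f' - f]. *)
Lemma F_increment m m' f f' : has_density m f -> has_density m' f' ->
  F m' - F m <= Int (fun x => dF m x * (f' x - f x)) +
    LG * Int (fun x => enorm x * `|f x - f' x|) ^+ 2.
Proof.
move=> mf mf'; have [_ _ /(_ m m')[slope_i ->]] := energy_diff E.
set w := Int (fun x => enorm x * _); set A := Int (fun x => dF m x * _).
have w0 : 0 <= w by apply: Int_ge0 => x; rewrite mulr_ge0 ?enorm_ge0.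
have iw := itg_enorm_dist mf mf'.
have m01 : (@lebesgue_measure R [set` `[0%R, 1%R]%R] = 1)%E.
  by rewrite lebesgue_measure_itv/= lte01 oppr0 adde0.
have -> : A + LG * w ^+ 2 =
    \int[@lebesgue_measure R]_(t in `[0, 1]) (A + LG * w ^+ 2).
  by rewrite Rintegral_cst// -[X in fine X]/(lebesgue_measure [set` `[0%R, 1%R]%R]) m01 mulr1.
apply: le_Rintegral => //.
  apply: continuous_compact_integrable; first exact: segment_compact.
  by apply: continuous_subspaceT => t; exact: cst_continuous.
move=> t; rewrite /= in_itv/= => t01.
set mt := P2_mix m m' t.
rewrite (integral_dF mt mf) (integral_dF mt mf') -IntB; [|exact: itg_dF mf'|exact: itg_dF mf].
have mixd := has_density_mix t01 mf mf'.
have Wt : (wasserstein 1 m mt <= w%:E)%E.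
  apply: le_trans (wasserstein1_le_density mf mixd) _.
  rewrite EFin_Int//; apply: ge0_le_integral => //.
  - by move=> x _; rewrite lee_fin mulr_ge0 ?enorm_ge0.
  - by apply/measurable_EFinP; exact: itg_measurable (itg_enorm_dist mf mixd).
  - by apply/measurable_EFinP; exact: itg_measurable iw.
  - move=> x _; rewrite lee_fin ler_wpM2l ?enorm_ge0//.
    have -> : f x - ((1 - t) * f x + t * f' x) = t * (f x - f' x) by ring.
    by case/andP: t01 => t0 t1; rewrite normrM ger0_norm// ler_piMl.
have fP := has_density_is_density mf; have fP' := has_density_is_density mf'.
have df := density_itg fP; have df' := density_itg fP'.
have iff : itg (fun x => f' x - f x).
  exact: itgB df' df.
have ff0 : Int (fun x => f' x - f x) = 0.
  by rewrite IntB// (density_Int fP) (density_Int fP') subrr.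
have i1 : itg (fun x => dF m x * (f' x - f x)).
  have := itgB (itg_dF m mf') (itg_dF m mf).
  by congr (_.-integrable _ (EFin \o _)); apply/funext => x; rewrite mulrBr.
(* Only increments of [G] from 0 are controlled. This constant is free, since it integrates to 0
   against [f' - f]. *)
pose c := G mt 0 - G m 0.
have i2 : itg (fun x => c * (f' x - f x)) by exact: itgZ.
have i3 : itg (fun x => LG * w * (enorm x * `|f x - f' x|)) by exact: itgZ.
have -> : A + LG * w ^+ 2 = Int (fun x => dF m x * (f' x - f x) + c * (f' x - f x)
    + LG * w * (enorm x * `|f x - f' x|)).
  by rewrite IntD// ?IntD// ?IntZ// ?ff0 -/A -/w; [ring|exact: itgD].
apply: Int_le.
- by apply: itgB; [exact: itg_dF mf'|exact: itg_dF mf].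
- by apply: itgD => //; exact: itgD.
move=> x; have := G_increment x Wt.
rewrite !(energy_split E) -/mt -/c => H.
have -> : (g x + G mt x) * f' x - (g x + G mt x) * f x =
  (g x + G m x) * (f' x - f x) + c * (f' x - f x) +
  (G mt x - G mt 0 - (G m x - G m 0)) * (f' x - f x) by rewrite /c; ring.
rewrite lerD2l mulrA (le_trans (ler_norm _))// normrM distrC [`|f x - _|]distrC.
by rewrite ler_wpM2r// distrC.
Qed.

End energy.

(** * Euler-Lagrange inequality for a minimizing step *)

Section weak_gradient.
Context {R : realType} {d : nat}.
Local Notation leb := (lebesgue_rV R d).
Local Notation Int f := (\int[leb]_x f x).
Local Notation itg f := (leb.-integrable setT (EFin \o f)).
Implicit Types (u v pi : 'rV[R]_d -> R).

Lemma square_integrable_lin (a b : R) u v : square_integrable u -> square_integrable v ->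
  square_integrable (fun x => a * u x + b * v x).
Proof.
move=> /square_integrable_itg[mu iu] /square_integrable_itg[mv iv].
apply/square_integrable_itg; split.
  by apply: measurable_funD; exact: measurable_funM.
have iuv := itg_sq_mul mu mv iu iv.
have := itgD (itgD (itgZ (a ^+ 2) iu) (itgZ (2 * a * b) iuv)) (itgZ (b ^+ 2) iv).
by congr (_.-integrable _ (EFin \o _)); apply/funext => x; ring.
Qed.

Lemma weak_grad_lin (a b : R) u v w1 w2 : square_integrable u -> square_integrable v ->
  weak_grad u w1 -> weak_grad v w2 ->
  weak_grad (fun x => a * u x + b * v x) (fun x => a *: w1 x + b *: w2 x).
Proof.
move=> su sv uw vw i; have [w1i d1] := uw i; have [w2i d2] := vw i.
have E : (fun x => (a *: w1 x + b *: w2 x) ord0 i) =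
  (fun x => a * w1 x ord0 i + b * w2 x ord0 i) by apply/funext => x; rewrite !mxE.
rewrite E; split; first exact: square_integrable_lin.
move=> f ft.
have fi : test_function (partial i f).
  case: ft => fC [M fM]; have [N N0 fN] := test_function_supp (conj fC (ex_intro _ M fM)).
  apply: (supp_test_function (ltW N0)) => [k|]; first exact: class_C_partial (fC k.+1).
  by apply: supp_in_partial => //; exact: (fC 1%N).
have iL (c1 c2 : R) k1 k2 l : square_integrable k1 -> square_integrable k2 ->
    test_function l -> Int (fun x => (c1 * k1 x + c2 * k2 x) * l x) =
    c1 * Int (fun x => k1 x * l x) + c2 * Int (fun x => k2 x * l x).
  move=> s1 s2 tl; have i1 := itg_sq_test s1 tl; have i2 := itg_sq_test s2 tl.
  rewrite -IntZ// -IntZ// -IntD; [|exact: itgZ..].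
  by apply: Int_eq => x; rewrite mulrDl !mulrA.
by rewrite (iL a b u v) // (iL a b (fun x => w1 x ord0 i) (fun x => w2 x ord0 i))//
  d1// d2// !mulrN -opprD.
Qed.

Lemma weak_grad_test pi : test_function pi -> weak_grad pi (grad pi).
Proof.
move=> pit; have [M M0 pM] := test_function_supp pit; have [piC _] := pit.
have E i : (fun x => grad pi x ord0 i) = partial i pi by apply/funext => x; rewrite mxE.
move=> i; rewrite E; split.
  apply: square_integrable_csupp; last exact: supp_in_partial (piC 1%N) pM.
  exact: class_C_continuous (class_C_partial i (piC 1%N)).
move=> f [fC _].
have dm x : is_derive x (delta_mx ord0 i) (fun x => pi x * f x)
    (pi x * partial i f x + f x * partial i pi x).
  by apply: is_derive_mulf; [exact: class_C_is_derive (piC 1%N)|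
                             exact: class_C_is_derive (fC 1%N)].
have cpi := class_C_continuous (piC 0%N); have cf := class_C_continuous (fC 0%N).
have cpi' := class_C_continuous (class_C_partial i (piC 1%N)).
have cf' := class_C_continuous (class_C_partial i (fC 1%N)).
have c1 : continuous (fun x => pi x * partial i f x) by exact: continuous_mulf.
have c2 : continuous (fun x => f x * partial i pi x) by exact: continuous_mulf.
have s1 : supp_in M (fun x => pi x * partial i f x) by exact: supp_in_mull.
have s2 : supp_in M (fun x => f x * partial i pi x).
  by apply: supp_in_mulr; exact: supp_in_partial (piC 1%N) pM.
have i1 := integrable_csupp c1 s1; have i2 := integrable_csupp c2 s2.
have cd : continuous (fun x => pi x * partial i f x + f x * partial i pi x).
  exact: continuous_addf c1 c2.
have sm : supp_in M (fun x => pi x * f x) by exact: supp_in_mull.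
have sd : supp_in M (fun x => pi x * partial i f x + f x * partial i pi x).
  by move=> x Mx; rewrite s1// s2// addr0.
have := integral_partial0 dm cd sm sd; rewrite -EFin_Int; last exact: itgD.
case=> /eqP; rewrite IntD// addr_eq0 => /eqP ->.
by congr (- _); apply: Int_eq => x; rewrite mulrC.
Qed.

End weak_gradient.

(** * Inequalities for the entropy *)

Section entropy.
Context {R : realType}.

Lemma ln_leB1 (x : R) : 0 < x -> ln x <= x - 1.
Proof. by move=> x0; rewrite lerBrDl -[leRHS]lnK ?posrE// expR_ge1Dx. Qed.

Lemma ln_le (x : R) : 0 <= x -> ln x <= x.
Proof.
rewrite le_eqVlt => /predU1P[<-|x0]; first by rewrite ln0.
by rewrite (le_trans (ln_leB1 x0))// gerBl.
Qed.

Lemma entropy_ge (x c : R) : 0 <= x -> 0 < c -> x - c <= x * ln (x / c).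
Proof.
rewrite le_eqVlt => /predU1P[<-|x0] c0; first by rewrite mul0r sub0r oppr_le0 ltW.
have : ln (c / x) <= c / x - 1 by apply: ln_leB1; rewrite divr_gt0.
rewrite -[c / x]invf_div lnV ?posrE ?divr_gt0// lerNl opprB.
move=> /(ler_wpM2l (ltW x0)); rewrite mulrBr mulr1.
by rewrite invf_div [x * (c / x)]mulrCA divff ?gt_eqF// mulr1.
Qed.

(* Second-order expansion of [s ^ 2 log (s ^ 2 / c)]; the second derivative is
   bounded above, but not below, near 0. *)
Lemma entropy_taylor (y e c C : R) : 0 <= y -> 0 < c -> 0 <= y / 2 + e ->
  ln ((y + e) ^+ 2 / c) <= C ->
  (y + e) ^+ 2 * ln ((y + e) ^+ 2 / c) <=
  y ^+ 2 * ln (y ^+ 2 / c) + 2 * (y * e) * (ln (y ^+ 2 / c) + 1) + (C + 8) * e ^+ 2.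
Proof.
rewrite le_eqVlt => /predU1P[<-|y0] c0 ye Cu.
  rewrite add0r in Cu *.
  rewrite expr0n/= !mul0r mulr0 mul0r !add0r mulrC ler_wpM2r ?sqr_ge0//.
  by rewrite (le_trans Cu)// lerDl.
have u0 : 0 < y + e.
  have -> : y + e = y / 2 + e + y / 2 by field.
  by rewrite ltr_wpDl// divr_gt0.
pose a := ln ((y + e) / y).
have au : y * a <= e.
  have : a <= (y + e) / y - 1 by apply: ln_leB1; rewrite divr_gt0.
  by rewrite -(ler_pM2l y0) mulrBr mulrCA divff ?gt_eqF// !mulr1 addrAC subrr add0r.
have al : e <= (y + e) * a.
  have : ln (y / (y + e)) <= y / (y + e) - 1 by apply: ln_leB1; rewrite divr_gt0.
  rewrite -[y / _]invf_div lnV ?posrE ?divr_gt0// -/a invf_div -(ler_pM2l u0).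
  rewrite mulrBr mulrCA divff ?gt_eqF// !mulr1; lra.
have La : ln (y ^+ 2 / c) = ln ((y + e) ^+ 2 / c) - 2 * a.
  rewrite /a !ln_div ?posrE ?exprn_gt0// !lnXn//; lra.
rewrite La; move: Cu; move: (ln ((y + e) ^+ 2 / c)) => L LC.
have H : 2 * a * y ^+ 2 + 4 * a * y * e - 2 * y * e <= 8 * e ^+ 2.
  have h1 : y * (y * a) <= y * e by rewrite ler_pM2l.
  suff : a * y * e <= 2 * e ^+ 2 by nra.
  have [e0|e0] := leP 0 e; first by nra.
  suff : (y + e) * (a * y * e) <= (y + e) * (2 * e ^+ 2) by rewrite ler_pM2l.
  have : (y + e) * a * (y * e) <= e * (y * e) by rewrite ler_wnM2r// nmulr_lle0// ltW.
  nra.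
nra.
Qed.

Lemma ge0_of_quadratic (e0 X C : R) : 0 < e0 ->
  (forall e, 0 < e -> e < e0 -> 0 <= 2 * e * X + e ^+ 2 * C) -> 0 <= X.
Proof.
move=> e00 H; rewrite leNgt; apply/negP => X0.
have C1 : 0 < 1 + `|C| by rewrite ltr_pwDl.
pose e := Num.min (e0 / 2) (- X / (1 + `|C|)).
have ep : 0 < e by rewrite lt_min !divr_gt0 ?oppr_gt0.
have el : e < e0.
  by rewrite (le_lt_trans (_ : _ <= e0 / 2)) ?ge_min ?lexx// ltr_pdivrMr// ltr_pMr// ltr1n.
have eC : e * (1 + `|C|) <= - X by rewrite -ler_pdivlMr// ge_min lexx orbT.
have := H e ep el; have := ler_norm C.
have : 0 <= `|C| by [].
move: ep eC {el}; move: e (`|C|) => e c; nra.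
Qed.

Context {d : nat}.
Local Notation leb := (lebesgue_rV R d).
Local Notation Int f := (\int[leb]_x f x).
Local Notation itg f := (leb.-integrable setT (EFin \o f)).

Lemma relative_entropyE (f g : 'rV[R]_d -> R) : (forall x, 0 < g x) ->
  relative_entropy f g = (\int[leb]_x (f x * ln (f x / g x))%:E)%E.
Proof.
move=> g0; apply: eq_integral => x _; rewrite (gt_eqF (g0 x)).
by case: eqP => // ->; rewrite mul0r.
Qed.

Lemma continuous_invf (g : 'rV[R]_d -> R) : continuous g -> (forall x, 0 < g x) ->
  continuous (fun x => (g x)^-1).
Proof. by move=> cg g0 x; apply: continuousV (cg x); rewrite gt_eqF. Qed.

Lemma measurable_entropy (f g : 'rV[R]_d -> R) : measurable_fun setT f ->
  continuous g -> (forall x, 0 < g x) ->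
  measurable_fun setT (fun x => f x * ln (f x / g x)).
Proof.
move=> mf cg g0; apply: measurable_funM => //.
apply: (measurableT_comp (@measurable_ln R)); apply: measurable_funM => //.
exact: continuous_mfun (continuous_invf cg g0).
Qed.

Lemma entropy_le_itg (f g r : 'rV[R]_d -> R) : is_density f -> is_density g ->
  continuous g -> (forall x, 0 < g x) -> itg r ->
  (forall x, f x * ln (f x / g x) <= r x) -> itg (fun x => f x * ln (f x / g x)).
Proof.
move=> fP gP cg g0 ir fr.
apply: (@itg_le _ _ _ leb _ (fun x => `|r x| + (f x + g x))).
- by apply: measurable_entropy => //; exact: density_measurable fP.
- move=> x; have := entropy_ge (density_ge0 fP x) (g0 x); have := fr x.
  have := ler_norm (r x); have := normr_ge0 (r x); have := density_ge0 fP x; have := g0 x.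
  move: (f x) (g x) `|r x| (r x) (f x * ln _) => b c r1 r' a *.
  rewrite ler_norml; lra.
- by apply: itgD (itg_norm ir) (itgD (density_itg fP) (density_itg gP)).
Qed.

(** The negative part of the integrand is at most [g], by [entropy_ge], so a relative entropy below
    [+oo] leaves a positive part of finite integral. *)
Lemma entropy_lty_itg (f g : 'rV[R]_d -> R) : is_density f -> is_density g ->
  continuous g -> (forall x, 0 < g x) -> (relative_entropy f g < +oo)%E ->
  itg (fun x => f x * ln (f x / g x)).
Proof.
move=> fP gP cg g0; rewrite relative_entropyE// => H.
pose k x := f x * ln (f x / g x).
have mk : measurable_fun setT k.
  by apply: measurable_entropy => //; exact: density_measurable fP.
pose kp x := Num.max (k x) 0; pose kn x := Num.max (- k x) 0.
have mkp : measurable_fun setT kp by apply: measurable_maxr => //; exact: measurable_cst.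
have mkn : measurable_fun setT kn.
  by apply: measurable_maxr; [exact: measurableT_comp|exact: measurable_cst].
have kn0 x : 0 <= kn x by rewrite le_max lexx orbT.
have kp0 x : 0 <= kp x by rewrite le_max lexx orbT.
have ikn : itg kn.
  apply: (@itg_le _ _ _ leb _ g) => //; last exact: density_itg.
  move=> x; rewrite ger0_norm// /kn ge_max (ltW (g0 x)) andbT.
  have := entropy_ge (density_ge0 fP x) (g0 x); have := density_ge0 fP x.
  rewrite -/(k x); lra.
have ikp : itg kp.
  apply: ge0_itg_lty => //; rewrite ltey; apply/eqP => kpoo.
  move: H; rewrite integralE.
  have -> : (\int[leb]_x ((fun x => (k x)%:E)^\+ x) = +oo)%E.
    by rewrite -kpoo; apply: eq_integral => x _; rewrite funeposE/= EFin_max.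
  have -> : (\int[leb]_x ((fun x => (k x)%:E)^\- x) = (Int kn)%:E)%E.
    by rewrite EFin_Int//; apply: eq_integral => x _; rewrite funenegE/= EFin_max.
  by rewrite addye.
have := itgB ikp ikn; congr (_.-integrable _ (EFin \o _)); apply/funext => x.
by rewrite /kp /kn; case: (leP (k x) 0) => h;
   [rewrite (max_l (_ : 0 <= - k x)) ?oppr_ge0// sub0r opprK|
    rewrite (max_r (_ : - k x <= 0)) ?oppr_le0 ?ltW// subr0].
Qed.

End entropy.

(** * Normalized squares as competitors *)

Section competitor.
Context {R : realType} {d : nat}.
Local Notation leb := (lebesgue_rV R d).
Local Notation Int f := (\int[leb]_x f x).
Local Notation itg f := (leb.-integrable setT (EFin \o f)).

Lemma dot_itg (w1 w2 : 'rV[R]_d -> 'rV[R]_d) :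
  (forall i, square_integrable (fun x => w1 x ord0 i)) ->
  (forall i, square_integrable (fun x => w2 x ord0 i)) ->
  itg (fun x => dot (w1 x) (w2 x)).
Proof.
move=> s1 s2; apply: itg_sum => i.
have /square_integrable_itg[m1 i1] := s1 i.
have /square_integrable_itg[m2 i2] := s2 i.
exact: itg_sq_mul.
Qed.

Lemma fisher_information_scaled (u : 'rV[R]_d -> R) w (Z : R) : 0 < Z ->
  (forall x, 0 <= u x) -> square_integrable u -> weak_grad u w ->
  sobolev_H1 (fun x => Num.sqrt (u x ^+ 2 / Z)) /\
  fisher_information (fun x => u x ^+ 2 / Z) =
    (Z^-1 * Int (fun x => enorm (w x) ^+ 2))%:E.
Proof.
move=> Z0 u0 su uw.
(* The vanishing second term gives the function the shape required by [weak_grad_lin]. *)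
have E : (fun x => Num.sqrt (u x ^+ 2 / Z)) =
    (fun x => Num.sqrt Z^-1 * u x + 0 * 0).
  apply/funext => x.
  by rewrite mul0r addr0 sqrtrM ?sqr_ge0// sqrtr_sqr ger0_norm// mulrC.
have s0 : square_integrable (fun _ : 'rV[R]_d => 0 : R).
  by apply: (@square_integrable_csupp _ _ 0) => // x; exact: cst_continuous.
have g0 : weak_grad (fun _ : 'rV[R]_d => 0 : R) (fun=> 0).
  move=> i; split; first by under eq_fun do rewrite mxE.
  have e1 (k : 'rV[R]_d -> R) : (forall x, k x = 0) -> Int k = 0.
    by move=> k0; rewrite -[RHS](Int0 leb); exact: Int_eq.
  by move=> f _; rewrite !e1 ?oppr0// => x; rewrite ?mxE mul0r.
have wg := weak_grad_lin (Num.sqrt Z^-1) 0 su s0 uw g0.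
have wg' : weak_grad (fun x => Num.sqrt (u x ^+ 2 / Z))
  (fun x => Num.sqrt Z^-1 *: w x + 0 *: (fun=> 0 : 'rV[R]_d) x) by rewrite E.
split.
  split; last by exists (fun x => Num.sqrt Z^-1 *: w x + 0 *: (fun=> 0 : 'rV[R]_d) x).
  by rewrite E; exact: square_integrable_lin.
rewrite (fisher_informationE wg').
have iw : itg (fun x => enorm (w x) ^+ 2).
  have := dot_itg (fun i => (uw i).1) (fun i => (uw i).1).
  by congr (_.-integrable _ (EFin \o _)); apply/funext => x; rewrite sqr_enorm.
rewrite -IntZ// EFin_Int; last exact: itgZ.
apply: eq_integral => x _; rewrite scale0r addr0 !sqr_enorm dotZl dotZr mulrA -expr2.
by rewrite sqr_sqrtr// invr_ge0 ltW.
Qed.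

Lemma PH_competitor (u : 'rV[R]_d -> R) w : continuous u -> (forall x, 0 <= u x) ->
  itg (fun x => u x ^+ 2) -> 0 < Int (fun x => u x ^+ 2) ->
  itg (fun x => enorm x ^+ 2 * u x ^+ 2) -> weak_grad u w ->
  let f x := u x ^+ 2 / Int (fun x => u x ^+ 2) in
  exists m : P2 R d, PH_density m f /\
    fisher_information f =
      ((Int (fun x => u x ^+ 2))^-1 * Int (fun x => enorm (w x) ^+ 2))%:E.
Proof.
move=> cu u0 iu Z0 iu2 uw; set Z := Int (fun x => u x ^+ 2) in Z0 *.
have su : square_integrable u.
  by apply/square_integrable_itg; split => //; exact: continuous_mfun.
have [H1 fI] := fisher_information_scaled Z0 u0 su uw.
have f0 x : 0 <= u x ^+ 2 / Z by rewrite divr_ge0 ?sqr_ge0// ltW.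
have fi : itg (fun x => u x ^+ 2 / Z).
  by have := itgZ Z^-1 iu; congr (_.-integrable _ (EFin \o _)); apply/funext => x; rewrite mulrC.
have f1 : Int (fun x => u x ^+ 2 / Z) = 1.
  rewrite -[RHS](@mulVf _ Z (lt0r_neq0 Z0)) /Z -IntZ//; apply: Int_eq => x; exact: mulrC.
have fP := Int_density1 f0 fi f1.
have fm : itg (fun x => enorm x ^+ 2 * (u x ^+ 2 / Z)).
  have := itgZ Z^-1 iu2; congr (_.-integrable _ (EFin \o _)); apply/funext => x.
  by rewrite mulrC mulrA.
by exists (density_P2 fP fm); split => //; split => //; exact: density_P2P.
Qed.

End competitor.

Lemma sqr_add_le2 (R : realType) (y p e : R) : 0 < e -> e <= 1 ->
  (y + e * p) ^+ 2 <= 2 * (y ^+ 2 + p ^+ 2).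
Proof.
move=> e0 e1; have := sqr_ge0 (y - e * p).
have : (e * p) ^+ 2 <= p ^+ 2.
  by rewrite exprMn ler_piMl ?sqr_ge0// expr_le1// ltW.
move: (e * p) => z; nra.
Qed.

(** * Perturbation of the square root of a minimizer *)

Section euler_lagrange.
Context {R : realType} {d : nat}.
Local Notation leb := (lebesgue_rV R d).
Local Notation Int f := (\int[leb]_x f x).
Local Notation itg f := (leb.-integrable setT (EFin \o f)).
Variables (F : P2 R d -> R) (dF : P2 R d -> 'rV[R]_d -> R)
  (g : 'rV[R]_d -> R) (G : P2 R d -> 'rV[R]_d -> R) (LG : R).
Hypothesis E : regular_energy F dF g G LG.
Variables (sigma h : R).
Hypothesis h0 : 0 < h.
Variables (f0 f : 'rV[R]_d -> R) (m : P2 R d).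
Hypotheses (f0P : is_density f0) (cf0 : continuous f0) (f0_gt0 : forall x, 0 < f0 x).
Hypotheses (step : entropic_step F sigma h f0 m f) (cf : continuous f).

Let phi x := Num.sqrt (f x).
Let Lg x := ln (f x / f0 x).

Let mf : has_density m f. Proof. by case: step => -[]. Qed.
Let fP : is_density f. Proof. exact: has_density_is_density mf. Qed.
Let f_ge0 x : 0 <= f x. Proof. exact: density_ge0. Qed.
Let phi0 x : 0 <= phi x. Proof. exact: sqrtr_ge0. Qed.
Let phi2 x : phi x ^+ 2 = f x. Proof. exact: sqr_sqrtr. Qed.
Let cphi : continuous phi.
Proof. exact: continuous_sqrtf cf. Qed.

Let fisher_finite : exists w, weak_grad phi w /\
  fisher_information f = (Int (fun x => enorm (w x) ^+ 2))%:E /\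
  itg (fun x => enorm (w x) ^+ 2).
Proof.
case: step => -[_ [sphi [w wP]]] _; exists w; split=> //.
have iw : itg (fun x => enorm (w x) ^+ 2).
  have := dot_itg (fun i => (wP i).1) (fun i => (wP i).1).
  by congr (_.-integrable _ (EFin \o _)); apply/funext => x; rewrite sqr_enorm.
by split=> //; rewrite (fisher_informationE wP) EFin_Int.
Qed.

(** The normalized square of a bump has finite energy, and finite entropy because [f0] is bounded
    below on its support. Minimality then transfers finiteness to the entropy of [f]. *)
Let finite_competitor : exists (m' : P2 R d) f', PH_density m' f' /\
  (free_energy F sigma m' f' + h^-1%:E * relative_entropy f' f0 < +oo)%E.
Proof.
pose u := @bump R d 0 1; pose M := @bump_radius R d 0 1.
have cu : continuous u by exact: continuous_bump.
have su : supp_in M u by exact: (@supp_in_bump R d 0 1 1 ltr01 (lexx 1)).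
have tu : test_function u.
  apply: supp_test_function su => [|k]; last exact: class_C_bump.
  by rewrite addr_ge0// sumr_ge0.
have cu2 : continuous (fun x => u x ^+ 2).
  exact: (class_C_continuous (class_C_exp 2 (class_C_bump 0 0 1))).
have su2 : supp_in M (fun x => u x ^+ 2).
  by move=> x ux; rewrite su// expr0n.
have iu := integrable_csupp cu2 su2.
have Z0 : 0 < Int (fun x => u x ^+ 2).
  rewrite lt_neqAle Int_ge0 ?andbT; last by move=> x; exact: sqr_ge0.
  apply/negP => /eqP Z0.
  have := @Int_continuous_eq0 _ _ _ cu2 (fun x => sqr_ge0 _) iu.
  rewrite -Z0 lexx => /(_ isT)/(_ 0)/eqP; rewrite sqrf_eq0; apply/negP.
  rewrite /u /bump; apply: mulf_neq0; first by rewrite expf_neq0// invr_neq0// oner_neq0.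
  rewrite gt_eqF// flat_gt0// bump_arg_gt0//.
  by rewrite subrr /dot big1 ?expr1n ?ltr01// => i _; rewrite mxE mul0r.
have cen : continuous (fun x : 'rV[R]_d => enorm x ^+ 2 * u x ^+ 2).
  apply: continuous_mulf cu2; have := @class_C_continuous _ _ 0 _ (@class_C_sqdist R d 0 0).
  by under eq_fun do rewrite subr0 -sqr_enorm; exact.
have ien := integrable_csupp cen (supp_in_mulr (fun x => enorm x ^+ 2) su2).
have [m' [PH fI]] := PH_competitor cu (fun x => bump_ge0 _ _ ltr01) iu Z0 ien
  (weak_grad_test tu).
set Z := Int (fun x => u x ^+ 2) in Z0 PH fI; exists m', (fun x => u x ^+ 2 / Z); split=> //.
rewrite /free_energy fI relative_entropyE//.
have Zp : 0 < Z by [].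
have cfu : continuous (fun x => u x ^+ 2 / Z).
  by apply: continuous_mulf => // x; exact: cst_continuous.
have sfu : supp_in M (fun x => u x ^+ 2 / Z) by exact: supp_in_mull.
have [C1 C10 HC1] := @continuous_bounded_cube R d M _ cfu.
have [C2 C20 HC2] := @continuous_bounded_cube R d M _ (continuous_invf cf0 f0_gt0).
have fu0 x : 0 <= u x ^+ 2 / Z by rewrite divr_ge0 ?sqr_ge0 ?ltW.
have iL : itg (fun x => u x ^+ 2 / Z * ln (u x ^+ 2 / Z / f0 x)).
  have d1 := has_density_is_density PH.1.
  have fr x : u x ^+ 2 / Z * ln (u x ^+ 2 / Z / f0 x) <= C1 * C2 * (u x ^+ 2 / Z).
    have [xc|xc] := pselect (cube M x); last by rewrite (sfu x xc) mul0r mulr0.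
    rewrite mulrC ler_wpM2r// (le_trans (ln_le _))//.
      by rewrite mulr_ge0// invr_ge0 ltW.
    apply: ler_pM => //; first by rewrite invr_ge0 ltW.
      by rewrite (le_trans (ler_norm _))// HC1.
    by rewrite (le_trans (ler_norm _))// HC2.
  exact: (entropy_le_itg d1 f0P cf0 f0_gt0 (itgZ (C1 * C2) (integrable_csupp cfu sfu)) fr).
rewrite -(EFin_Int iL).
by rewrite -!EFinM -!EFinD ltry.
Qed.

Let H := Int (fun x => f x * Lg x).

Let entropy_itg : itg (fun x => f x * Lg x).
Proof.
apply: entropy_lty_itg => //; rewrite ltey; apply/eqP => Hoo.
have [m' [f' [PH]]] := finite_competitor; case: step => _ /(_ m' f' PH) le.
apply/negP; rewrite -leNgt; apply: le_trans le.
have [w [_ [wI _]]] := fisher_finite.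
by rewrite /free_energy wI Hoo gt0_muley ?lte_fin ?invr_gt0// -EFinM -EFinD addey.
Qed.

(** The Lagrange multiplier of the mass constraint: it records the first-order effect of dividing a
    competitor by its mass. *)
Let lam (w : 'rV[R]_d -> 'rV[R]_d) : R :=
  Int (fun x => dF m x * f x) + sigma ^+ 2 * Int (fun x => enorm (w x) ^+ 2) + h^-1 * H.

Section perturbation.
Variables (pi : 'rV[R]_d -> R) (M : R).
Hypotheses (M0 : 0 < M) (piC : forall k, class_C k pi) (spi : supp_in M pi).
Variables (w : 'rV[R]_d -> 'rV[R]_d).
Hypotheses (wP : weak_grad phi w)
  (wI : fisher_information f = (Int (fun x => enorm (w x) ^+ 2))%:E)
  (iw : itg (fun x => enorm (w x) ^+ 2)).

Let I := Int (fun x => enorm (w x) ^+ 2).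
Let A := Int (fun x => phi x * pi x).
Let B := Int (fun x => pi x ^+ 2).
Let cpi : continuous pi. Proof. exact: class_C_continuous (piC 0%N). Qed.
Let tpi : test_function pi. Proof. exact: supp_test_function (ltW M0) piC spi. Qed.

Let ics (k : 'rV[R]_d -> R) : continuous k -> itg (fun x => k x * pi x).
Proof.
move=> ck; apply: (integrable_csupp (M := M)); first exact: continuous_mulf.
exact: supp_in_mulr.
Qed.

Let iA : itg (fun x => phi x * pi x). Proof. exact: ics cphi. Qed.
Let iB : itg (fun x => pi x ^+ 2).
Proof. by have := ics cpi; congr (_.-integrable _ (EFin \o _)); apply/funext => x; rewrite expr2. Qed.

Let J := Int (fun x => dot (w x) (grad pi x)).
Let K := Int (fun x => enorm (grad pi x) ^+ 2).

Let JE : J = - Int (fun x => phi x * laplacian pi x).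
Proof.
have pt i : test_function (partial i pi).
  apply: (supp_test_function (ltW M0)) => [k|]; first exact: class_C_partial (piC k.+1).
  by apply: supp_in_partial => //; exact: (piC 1%N).
have sphi : square_integrable phi by case: step => -[_ []].
have Ei i : (fun x => w x ord0 i * grad pi x ord0 i) = (fun x => w x ord0 i * partial i pi x).
  by apply/funext => x; rewrite !mxE.
rewrite /J /dot Int_sum; last first.
  by move=> i; rewrite Ei; apply: itg_sq_test => //; exact: (wP i).1.
have -> : Int (fun x => phi x * laplacian pi x) =
    \sum_i Int (fun x => phi x * partial i (partial i pi) x).
  rewrite -Int_sum; last first.
    move=> i; apply: itg_sq_test sphi _; apply: (supp_test_function (ltW M0)) => [k|].
      exact: class_C_partial (class_C_partial i (piC k.+2)).
    apply: supp_in_partial; first exact: class_C_partial (piC 2%N).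
    by apply: supp_in_partial => //; exact: (piC 1%N).
  by apply: Int_eq => x; rewrite mulr_sumr.
rewrite -sumrN; apply: eq_bigr => i _; rewrite Ei.
by have [_ /(_ _ (pt i)) ->] := wP i; rewrite opprK.
Qed.

Variables (e C : R).
Hypotheses (e0 : 0 < e) (e1 : e <= 1) (pe : forall x, 0 <= phi x / 2 + e * pi x).
Hypothesis LC : forall x, cube M x -> ln ((phi x + e * pi x) ^+ 2 / f0 x) <= C.

Let u x := phi x + e * pi x.
Let u_half x : phi x / 2 <= u x.
Proof. by have := pe x; rewrite /u; move: (phi x) (e * pi x) => a b; lra. Qed.
Let u0 x : 0 <= u x.
Proof. by rewrite (le_trans _ (u_half x))// divr_ge0. Qed.
Let cu : continuous u.
Proof.
apply: continuous_addf cphi _; apply: continuous_mulf cpi => x; exact: cst_continuous.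
Qed.
Let uE x : u x ^+ 2 = f x + 2 * e * (phi x * pi x) + e ^+ 2 * pi x ^+ 2.
Proof. by rewrite -phi2 /u; ring. Qed.
Let iu : itg (fun x => u x ^+ 2).
Proof.
have := itgD (itgD (density_itg fP) (itgZ (2 * e) iA)) (itgZ (e ^+ 2) iB).
by congr (_.-integrable _ (EFin \o _)); apply/funext => x; rewrite uE.
Qed.
Let Z := Int (fun x => u x ^+ 2).
Let ZE : Z = 1 + 2 * e * A + e ^+ 2 * B.
Proof.
rewrite /Z (Int_eq leb uE) IntD; [|by apply: itgD (density_itg fP) (itgZ _ iA)|exact: itgZ].
by rewrite IntD; [|exact: density_itg|exact: itgZ]; rewrite !IntZ// (density_Int fP).
Qed.
(** The perturbation never removes more than half of [phi], so the mass stays above 1/4 whatever [e]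
    is. *)
Let Z4 : 4^-1 <= Z.
Proof.
have -> : 4^-1 = Int (fun x => 4^-1 * f x).
  by rewrite IntZ ?(density_Int fP) ?mulr1//; exact: density_itg.
apply: Int_le => // [|x]; first exact: itgZ (density_itg fP).
have := u_half x; have := u0 x; have := phi0 x; rewrite -(phi2 x).
move: (phi x) (u x) => a b; nra.
Qed.
Let Z0 : 0 < Z. Proof. by rewrite (lt_le_trans _ Z4). Qed.

Let fe x := u x ^+ 2 / Z.
Let feE x : fe x - f x = Z^-1 * (2 * e * (phi x * pi x) + e ^+ 2 * pi x ^+ 2 - (Z - 1) * f x).
Proof. by rewrite /fe uE; field; rewrite gt_eqF. Qed.

Let cen : continuous (fun x : 'rV[R]_d => enorm x ^+ 2).
Proof. by move=> x; apply: continuous_mulf x; exact: continuous_enorm. Qed.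

Let iue : itg (fun x => enorm x ^+ 2 * u x ^+ 2).
Proof.
have i1 := has_density_moment mf.
have i2 : itg (fun x => enorm x ^+ 2 * phi x * pi x).
  by apply: ics; exact: continuous_mulf.
have i3 : itg (fun x => enorm x ^+ 2 * pi x * pi x).
  by apply: ics; exact: continuous_mulf.
have := itgD (itgD i1 (itgZ (2 * e) i2)) (itgZ (e ^+ 2) i3).
by congr (_.-integrable _ (EFin \o _)); apply/funext => x; rewrite uE; ring.
Qed.

Let wu x := 1 *: w x + e *: grad pi x.

Let uw : weak_grad u wu.
Proof.
have su : square_integrable phi by case: step => -[_ []].
have sp : square_integrable pi by apply: square_integrable_csupp spi.
have := weak_grad_lin 1 e su sp wP (weak_grad_test tpi).
by congr weak_grad; apply/funext => x; rewrite /u mul1r.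
Qed.

Let IuE : Int (fun x => enorm (wu x) ^+ 2) = I + 2 * e * J + e ^+ 2 * K.
Proof.
have wt := weak_grad_test tpi.
have i1 : itg (fun x => dot (w x) (grad pi x)).
  exact: dot_itg (fun i => (wP i).1) (fun i => (wt i).1).
have i2 : itg (fun x => enorm (grad pi x) ^+ 2).
  have := dot_itg (fun i => (wt i).1) (fun i => (wt i).1).
  by congr (_.-integrable _ (EFin \o _)); apply/funext => x; rewrite sqr_enorm.
rewrite -(IntZ (2 * e) i1) -(IntZ (e ^+ 2) i2) -(IntD iw (itgZ _ i1)).
rewrite -(IntD (itgD iw (itgZ _ i1)) (itgZ _ i2)); apply: Int_eq => x.
rewrite !sqr_enorm /wu scale1r !dotDl !dotDr !dotZl !dotZr (dotC (grad pi x) (w x)).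
ring.
Qed.

Let P := Int (fun x => phi x * pi x * Lg x).

(** The function [phi * Lg], equal to [2 * phi * ln (phi / sqrt f0)], lies between
    [2 * (phi - sqrt f0)] and [2 * f / sqrt f0]. It is thus locally bounded even around zeros of
    [phi], which are not excluded at this stage. *)
Lemma itg_sqrt_entropy : itg (fun x => phi x * pi x * Lg x).
Proof.
have cs : continuous (fun x => Num.sqrt (f0 x)).
  exact: continuous_sqrtf cf0.
have s0 x : 0 < Num.sqrt (f0 x) by rewrite sqrtr_gt0.
pose k x := 2 * (f x * (Num.sqrt (f0 x))^-1 + Num.sqrt (f0 x)).
have ck : continuous k.
  apply: continuous_mulf; first by move=> x; exact: cst_continuous.
  exact: continuous_addf (continuous_mulf cf (continuous_invf cs s0)) cs.
have k0 x : 0 <= k x by rewrite mulr_ge0// addr_ge0 ?(ltW (s0 x))// divr_ge0// ltW.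
apply: (@itg_le _ _ _ leb _ (fun x => `|k x * pi x|)); last exact: itg_norm (ics ck).
  apply: (measurable_funM (continuous_mfun (continuous_mulf cphi cpi))).
  apply: (measurableT_comp (@measurable_ln R)); apply: measurable_funM.
    exact: continuous_mfun.
  exact: continuous_mfun (continuous_invf cf0 f0_gt0).
move=> x; rewrite mulrAC normrM [leRHS]normrM ler_wpM2r// (ger0_norm (k0 x)).
have LgE : phi x * Lg x = 2 * (phi x * ln (phi x / Num.sqrt (f0 x))).
  have [p00|p00] := eqVneq (phi x) 0; first by rewrite p00 !mul0r mulr0.
  have pp : 0 < phi x by rewrite lt_def p00 phi0.
  rewrite mulrCA; congr (_ * _); rewrite /Lg -phi2 -{1}(sqr_sqrtr (ltW (f0_gt0 x))).
  by rewrite -expr_div_n lnXn ?divr_gt0// mulr_natl.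
have h2 := entropy_ge (phi0 x) (s0 x).
have h1 : phi x * ln (phi x / Num.sqrt (f0 x)) <= f x * (Num.sqrt (f0 x))^-1.
  rewrite -(phi2 x) expr2 -mulrA ler_wpM2l// ln_le// divr_ge0// ltW//.
have h3 : 0 <= f x * (Num.sqrt (f0 x))^-1 by rewrite divr_ge0// ltW.
rewrite LgE /k; move: h1 h2 h3 (s0 x) (phi0 x).
move: (phi x) (Num.sqrt (f0 x)) (phi x * ln _) (f x * _) => y c b a *.
by rewrite ler_norml; lra.
Qed.

Let iP := itg_sqrt_entropy.
Let He := Int (fun x => fe x * ln (fe x / f0 x)).

Let feP : is_density fe.
Proof.
have [m' [[[]]]] := PH_competitor cu u0 iu Z0 iue uw.
by move=> ? ? ? _ _; apply: (@has_density_is_density _ _ m').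
Qed.

Let r x := Z^-1 * (f x * Lg x + 2 * e * (phi x * pi x * Lg x) + 2 * e * (phi x * pi x) +
  (C + 8) * e ^+ 2 * pi x ^+ 2 - ln Z * u x ^+ 2).

Let ir1 : itg (fun x => f x * Lg x + 2 * e * (phi x * pi x * Lg x)).
Proof. exact: itgD entropy_itg (itgZ (2 * e) iP). Qed.
Let ir2 : itg (fun x => f x * Lg x + 2 * e * (phi x * pi x * Lg x) + 2 * e * (phi x * pi x)).
Proof. exact: itgD ir1 (itgZ (2 * e) iA). Qed.
Let ir3 : itg (fun x => f x * Lg x + 2 * e * (phi x * pi x * Lg x) + 2 * e * (phi x * pi x) +
  (C + 8) * e ^+ 2 * pi x ^+ 2).
Proof. exact: itgD ir2 (itgZ ((C + 8) * e ^+ 2) iB). Qed.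
Let ir4 : itg (fun x => f x * Lg x + 2 * e * (phi x * pi x * Lg x) + 2 * e * (phi x * pi x) +
  (C + 8) * e ^+ 2 * pi x ^+ 2 - ln Z * u x ^+ 2).
Proof. exact: itgB ir3 (itgZ (ln Z) iu). Qed.
Let ir : itg r. Proof. exact: itgZ ir4. Qed.

(** The term in [ln Z] comes from the normalization by the mass. On the cube the rest is
    [entropy_taylor]; outside nothing is perturbed. *)
Let fe_le_r x : fe x * ln (fe x / f0 x) <= r x.
Proof.
rewrite /r ler_pdivlMl// mulrA [Z * _]mulrC {1}/fe divfK ?gt_eqF//.
have -> : u x ^+ 2 * ln (fe x / f0 x) = u x ^+ 2 * ln (u x ^+ 2 / f0 x) - ln Z * u x ^+ 2.
  have [ux0|ux0] := eqVneq (u x) 0; first by rewrite ux0 expr0n/= !mul0r mulr0 subr0.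
  have up : 0 < u x by rewrite lt_def ux0 u0.
  have -> : fe x / f0 x = (u x ^+ 2 / f0 x) / Z by rewrite /fe mulrAC.
  by rewrite (ln_div (x := u x ^+ 2 / f0 x)) ?posrE ?divr_gt0 ?exprn_gt0// mulrBr [ln Z * _]mulrC.
rewrite lerD2r.
have [xM|xM] := pselect (cube M x).
  have := entropy_taylor (phi0 x) (f0_gt0 x) (pe x) (LC xM).
  rewrite phi2 -/(Lg x) -/(u x) => /le_trans; apply.
  by rewrite le_eqVlt; apply/orP; left; apply/eqP; ring.
by rewrite /u (spi xM) expr0n/= !mulr0 !mul0r mulr0 !addr0 phi2.
Qed.

Let iHe : itg (fun x => fe x * ln (fe x / f0 x)).
Proof. exact: entropy_le_itg feP f0P cf0 f0_gt0 ir fe_le_r. Qed.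

Let He_le : Z * He <= H + 2 * e * P + (C + 7) * e ^+ 2 * B.
Proof.
have : He <= Int r by apply: Int_le.
rewrite /r IntZ; last exact: ir4.
rewrite (IntB ir3 (itgZ (ln Z) iu)) (IntD ir2 (itgZ ((C + 8) * e ^+ 2) iB)).
rewrite (IntD ir1 (itgZ (2 * e) iA)) (IntD entropy_itg (itgZ (2 * e) iP)).
rewrite (IntZ (ln Z) iu) (IntZ (2 * e) iP) (IntZ (2 * e) iA) (IntZ ((C + 8) * e ^+ 2) iB).
rewrite -/H -/P -/A -/B -/Z ler_pdivlMl// => /le_trans; apply.
(* The normalization contributes [- Z * ln Z <= - (Z - 1)], which cancels the term [2 * e * A] and
   lowers [C + 8] to [C + 7]. *)
have := entropy_ge (ltW Z0) ltr01; rewrite divr1 mulrC.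
move: (ln Z * Z) => z; rewrite ZE; move: (H) (P) (A) (B) => *; lra.
Qed.

Let D0 := Int (fun x => dF m x * f x).
Let D1 := Int (fun x => dF m x * phi x * pi x).
Let D2 := Int (fun x => dF m x * pi x * pi x).
Let cdF := continuous_dF E (m := m).
Let iD0 : itg (fun x => dF m x * f x). Proof. exact: (itg_dF E m mf). Qed.
Let iD1 : itg (fun x => dF m x * phi x * pi x).
Proof. exact: ics (continuous_mulf cdF cphi). Qed.
Let iD2 : itg (fun x => dF m x * pi x * pi x).
Proof. exact: ics (continuous_mulf cdF cpi). Qed.

Let SE : Z * Int (fun x => dF m x * (fe x - f x)) =
  2 * e * D1 + e ^+ 2 * D2 - (Z - 1) * D0.
Proof.
have i1 := itgD (itgZ (2 * e) iD1) (itgZ (e ^+ 2) iD2).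
have i2 := itgB i1 (itgZ (Z - 1) iD0).
rewrite -(IntZ (2 * e) iD1) -(IntZ (e ^+ 2) iD2) -(IntZ (Z - 1) iD0).
rewrite -(IntD (itgZ (2 * e) iD1) (itgZ (e ^+ 2) iD2)) -(IntB i1 (itgZ (Z - 1) iD0)).
rewrite (_ : Int (fun x => dF m x * (fe x - f x)) = Int (fun x => Z^-1 *
  (2 * e * (dF m x * phi x * pi x) + e ^+ 2 * (dF m x * pi x * pi x) -
   (Z - 1) * (dF m x * f x)))); last first.
  by apply: Int_eq => x; rewrite feE; ring.
by rewrite IntZ// mulrA divff ?gt_eqF// mul1r.
Qed.

Let a := 2 * `|A| + B.
Let Om := Int (fun x => enorm x * (2 * `|phi x * pi x|) + enorm x * pi x ^+ 2 +
  a * (enorm x * f x)).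
Let B0 : 0 <= B. Proof. by apply: Int_ge0 => x; exact: sqr_ge0. Qed.
Let iOm : itg (fun x => enorm x * (2 * `|phi x * pi x|) + enorm x * pi x ^+ 2 +
  a * (enorm x * f x)).
Proof.
have c1 : continuous (fun x => 2 * (enorm x * phi x)).
  apply: continuous_mulf; first by move=> x; exact: cst_continuous.
  by apply: continuous_mulf => //; exact: continuous_enorm.
have c2 : continuous (fun x => enorm x * pi x).
  by apply: continuous_mulf => //; exact: continuous_enorm.
have := itgD (itgD (itg_norm (ics c1)) (ics c2)) (itgZ a (itg_enorm_density mf)).
congr (_.-integrable _ (EFin \o _)); apply/funext => x.
rewrite !normrM (ger0_norm (enorm_ge0 x)) (ger0_norm (phi0 x)) ger0_norm//; ring.
Qed.
Let Om0 : 0 <= Om.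
Proof.
have a0 : 0 <= a by rewrite addr_ge0// mulr_ge0.
apply: Int_ge0 => x; have en := enorm_ge0 x.
apply: addr_ge0; last by apply: mulr_ge0 => //; exact: mulr_ge0.
have p2 := mulr_ge0 en (sqr_ge0 (pi x)); apply: (addr_ge0 _ p2).
by apply: (mulr_ge0 en); exact: mulr_ge0.
Qed.

Let omega := Int (fun x => enorm x * `|f x - fe x|).
Let omega_le (m' : P2 R d) : has_density m' fe -> Z * omega <= e * Om.
Proof.
move=> mfe; have io := itg_enorm_dist mf mfe.
rewrite -(IntZ Z io) -(IntZ e iOm); apply: (Int_le (itgZ Z io) (itgZ e iOm)).
move=> x; rewrite mulrCA distrC feE normrM (gtr0_norm (x := Z^-1)) ?invr_gt0//.
rewrite [Z * _]mulrA divff ?gt_eqF// mul1r.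
have -> : e * (enorm x * (2 * `|phi x * pi x|) + enorm x * pi x ^+ 2 + a * (enorm x * f x)) =
  enorm x * (2 * e * `|phi x * pi x| + e * pi x ^+ 2 + e * a * f x) by ring.
rewrite ler_wpM2l ?enorm_ge0//.
have Z1 : `|Z - 1| <= e * a.
  have -> : Z - 1 = e * (2 * A + e * B) by rewrite ZE; ring.
  rewrite normrM (gtr0_norm e0) ler_pM2l// (le_trans (ler_normD _ _))//.
  rewrite normrM (gtr0_norm (_ : 0 < 2 :> R))// /a lerD2l normrM gtr0_norm// ger0_norm//.
  by rewrite ler_piMl.
rewrite (le_trans (ler_normB _ _))// lerD//; last first.
  by rewrite normrM (ger0_norm (f_ge0 x)) ler_wpM2r.
rewrite (le_trans (ler_normD _ _))// lerD//.
  by rewrite normrM gtr0_norm// mulr_gt0.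
have q0 : 0 <= e ^+ 2 * pi x ^+ 2 by rewrite mulr_ge0 ?sqr_ge0.
by rewrite (ger0_norm q0) ler_wpM2r ?sqr_ge0// expr2 ler_piMl// ltW.
Qed.

(** Minimality against the normalized square of [phi + e * pi], multiplied by its mass [Z]. The
    first-order terms are gathered in the factor of [2 * e]; the remainders of the energy, the
    Fisher information, the entropy and the mass make up the factor of [e ^+ 2]. *)
Lemma perturbation_ineq : 0 <= 2 * e * (Int (fun x => phi x * pi x *
      (dF m x + h^-1 * Lg x - lam w)) - sigma ^+ 2 * Int (fun x => phi x * laplacian pi x)) +
  e ^+ 2 * (D2 + 4 * LG * Om ^+ 2 + sigma ^+ 2 * K + h^-1 * (C + 7) * B - B * lam w).
Proof.
have XE : Int (fun x => phi x * pi x * (dF m x + h^-1 * Lg x - lam w)) =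
    D1 + h^-1 * P - lam w * A.
  rewrite -(IntZ h^-1 iP) -(IntZ (lam w) iA).
  rewrite -(IntD iD1 (itgZ h^-1 iP)) -(IntB (itgD iD1 (itgZ h^-1 iP)) (itgZ (lam w) iA)).
  by apply: Int_eq => x; ring.
rewrite XE -[X in _ - sigma ^+ 2 * X]opprK -JE.
have [m' [PH fI]] := PH_competitor cu u0 iu Z0 iue uw.
have := step.2 m' fe PH.
rewrite /free_energy wI -/I fI IuE -/Z !relative_entropyE//.
rewrite -(EFin_Int entropy_itg) -(EFin_Int iHe) -/H -/He -!EFinM -!EFinD lee_fin => min.
have Fi := F_increment E mf PH.1; rewrite -/omega in Fi.
have om0 : 0 <= omega by apply: Int_ge0 => x; rewrite mulr_ge0 ?enorm_ge0.
have om := omega_le PH.1.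
have om2 : Z * omega ^+ 2 <= 4 * e ^+ 2 * Om ^+ 2.
  (* Both factors of [omega ^+ 2] are estimated through [Z * omega], which is of order [e]; the
     second one costs a factor 4 because [Z >= 1/4]. *)
  have e1' : omega <= 4 * (Z * omega).
    by rewrite mulrA -[leLHS]mul1r ler_wpM2r// -ler_pdivrMl// mulr1.
  have := ler_pM (mulr_ge0 (ltW Z0) om0) om0 om (le_trans e1' (ler_wpM2l (ler0n _ 4) om)).
  by move/le_trans; rewrite -mulrA -expr2; apply; rewrite le_eqVlt; apply/orP; left; apply/eqP; ring.
have := SE; move: (Int (fun x => dF m x * (fe x - f x))) Fi => S Fi SE'.
have LOm : LG * (Z * omega ^+ 2) <= LG * (4 * e ^+ 2 * Om ^+ 2).
  by rewrite ler_wpM2l// (energy_LG E).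
have hHe : h^-1 * (Z * He) <= h^-1 * (H + 2 * e * P + (C + 7) * e ^+ 2 * B).
  by rewrite ler_wpM2l// invr_ge0 ltW.
have Fi' : Z * (F m' - F m) <= Z * (S + LG * omega ^+ 2) by rewrite ler_pM2l.
have min' : Z * (F m + sigma ^+ 2 * I + h^-1 * H) <=
    Z * (F m') + sigma ^+ 2 * (I + 2 * e * J + e ^+ 2 * K) + h^-1 * (Z * He).
  rewrite -(ler_pM2l Z0) in min; apply: le_trans min _; rewrite le_eqVlt.
  by apply/orP; left; apply/eqP; move: (h^-1) => hi; field; rewrite gt_eqF.
have -> : lam w = D0 + sigma ^+ 2 * I + h^-1 * H by [].
move: Fi' min' LOm hHe SE'; rewrite ZE.
move: (F m') (F m) (omega ^+ 2) (Om ^+ 2) (sigma ^+ 2) (h^-1) => F' F0 o2 O2 s2 hi.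
move: (He) (H) (D0) (D1) (D2) (I) (J) (K) (P) (A) (B) => He' H' d0 d1 d2 i j k p a' b.
move: (e) (C) (LG) => e' c L.
move=> H1 H2 H3 H4 H5; lra.
Qed.

End perturbation.

(** Only an inequality holds, for perturbations that remove at most half of [phi] at some size [e0]:
    as long as [phi] may vanish, the sign of [pi] cannot always be reversed. Nonnegative [pi] are
    always admissible, which is enough to derive positivity. *)
Theorem euler_lagrange : exists l : R, forall pi : 'rV[R]_d -> R, test_function pi ->
  (exists2 e0 : R, 0 < e0 & forall x, 0 <= phi x / 2 + e0 * pi x) ->
  sigma ^+ 2 * Int (fun x => phi x * laplacian pi x) <=
  Int (fun x => phi x * pi x * (dF m x + h^-1 * Lg x - l)).
Proof.
have [w [wP [wI iw]]] := fisher_finite; exists (lam w) => pi tpi [e0 e00 pe].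
have [M M0 spi] := test_function_supp tpi; have [piC _] := tpi.
have cpi : continuous pi := class_C_continuous (piC 0%N).
have ck : continuous (fun x => (2 * (phi x ^+ 2 + pi x ^+ 2)) * (f0 x)^-1).
  apply: continuous_mulf (continuous_invf cf0 f0_gt0).
  apply: continuous_mulf; first by move=> x; exact: cst_continuous.
  by apply: continuous_addf => x; apply: continuous_mulf x.
have [C C0 HC] := @continuous_bounded_cube R d M _ ck.
rewrite -subr_ge0.
have m0 : 0 < Num.min e0 1 by rewrite lt_min e00 ltr01.
apply: (ge0_of_quadratic m0) => e ep; rewrite lt_min => /andP[ee0 /ltW e1].
apply: (perturbation_ineq M0 piC spi wP wI iw ep e1 (C := C)).
  (* Sizes smaller than [e0] are admissible too, by convex combination with [phi / 2 >= 0]. *)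
  move=> x; have -> : phi x / 2 + e * pi x = (1 - e / e0) * (phi x / 2) +
      (e / e0) * (phi x / 2 + e0 * pi x) by field; rewrite gt_eqF.
  rewrite addr_ge0// mulr_ge0 ?divr_ge0 ?(ltW ep) ?(ltW e00)//.
  by rewrite subr_ge0 ler_pdivrMr// mul1r ltW.
move=> x xM; rewrite (le_trans (ln_le _)) ?divr_ge0 ?sqr_ge0 ?(ltW (f0_gt0 x))//.
apply: le_trans (le_trans (ler_norm _) (HC x xM)).
rewrite ler_wpM2r ?invr_ge0 ?(ltW (f0_gt0 x))//.
exact: sqr_add_le2.
Qed.

End euler_lagrange.

(** * Equation of a minimizing step *)

Section laplacian.
Context {R : realType} {d : nat}.
Local Notation leb := (lebesgue_rV R d).
Local Notation Int f := (\int[leb]_x f x).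
Local Notation itg f := (leb.-integrable setT (EFin \o f)).
Implicit Types (f g S phi k : 'rV[R]_d -> R).

Lemma partialE i f df : (forall x, is_derive x (delta_mx ord0 i) f (df x)) ->
  partial i f = df.
Proof. by move=> fd; apply/funext => x; have [_] := fd x. Qed.

Lemma class_C_lin n (a b : R) f g : class_C n f -> class_C n g ->
  class_C n (fun x => a * f x + b * g x).
Proof. by move=> fC gC; apply: class_C_add; exact: class_C_scale. Qed.

Lemma partial_lin i (a b : R) f g : class_C 1 f -> class_C 1 g ->
  partial i (fun x => a * f x + b * g x) = (fun x => a * partial i f x + b * partial i g x).
Proof.
move=> fC gC; apply: partialE => x.
exact: (is_derive_addf (is_derive_scalef a (class_C_is_derive i x fC))
  (is_derive_scalef b (class_C_is_derive i x gC))).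
Qed.

Lemma laplacian_lin (a b : R) f g x : class_C 2 f -> class_C 2 g ->
  laplacian (fun x => a * f x + b * g x) x = a * laplacian f x + b * laplacian g x.
Proof.
move=> fC gC; rewrite /laplacian !mulr_sumr -big_split; apply: eq_bigr => i _.
rewrite (partial_lin i a b (class_CW fC) (class_CW gC)).
by rewrite (partial_lin i a b (class_C_partial i fC) (class_C_partial i gC)).
Qed.

(** The equation is tested against bumps only, which is all that the arguments with weighted means
    require. *)
Definition weak_laplacian phi k : Prop := forall x0 r, 0 < r ->
  Int (fun y => phi y * laplacian (bump x0 r) y) = Int (fun y => k y * bump x0 r y).

Lemma weak_laplacianZ (a : R) phi k : continuous phi -> continuous k ->
  weak_laplacian phi k ->
  weak_laplacian (fun x => a * phi x) (fun x => a * k x).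
Proof.
move=> cphi ck pk x0 r r0.
rewrite -[RHS](Int_eq leb (fun y => mulrA a (k y) (bump x0 r y))).
rewrite -[LHS](Int_eq leb (fun y => mulrA a (phi y) (laplacian (bump x0 r) y))).
by rewrite (IntZ a (itg_bump x0 ck r0)) (IntZ a (itg_lap_bump x0 cphi r0)) pk.
Qed.

(** By Green's identity, [phi - S] satisfies the weak equation with right-hand side
    [k - laplacian S], and [viscosity_max] applies at its local maximum. *)
Lemma touching_above phi k S x0 (rho : R) : continuous phi -> continuous k ->
  class_C 2 S -> weak_laplacian phi k -> 0 < rho ->
  (forall y, ball x0 rho y -> phi y - S y <= phi x0 - S x0) ->
  k x0 <= laplacian S x0.
Proof.
move=> cphi ck SC pk rho0 mx.
have cS := class_C_continuous SC; have cl := class_C2_laplacian_continuous SC.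
have cN (f : 'rV[R]_d -> R) : continuous f -> continuous (fun x => - f x).
  by move=> cf x; apply: continuousN; exact: cf.
have c1 := continuous_addf cphi (cN _ cS); have c2 := continuous_addf ck (cN _ cl).
rewrite -subr_le0.
apply: (@viscosity_max _ _ (fun x => phi x - S x) (fun x => k x - laplacian S x) x0 rho) => //.
move=> r r0 _; rewrite le_eqVlt; apply/orP; left; apply/eqP.
have sb : supp_in (bump_radius x0 r) (bump x0 r) by exact: supp_in_bump.
have := green SC (class_C_bump 2 x0 r) sb => gr.
rewrite (Int_eq leb (fun y => mulrBl (bump x0 r y) (k y) (laplacian S y))).
rewrite (Int_eq leb (fun y => mulrBl (laplacian (bump x0 r) y) (phi y) (S y))).
rewrite (IntB (itg_bump x0 ck r0) (itg_bump x0 cl r0)).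
rewrite (IntB (itg_lap_bump x0 cphi r0) (itg_lap_bump x0 cS r0)).
by rewrite -pk// gr.
Qed.

Lemma touching_below phi k S x0 (rho : R) : continuous phi -> continuous k ->
  class_C 2 S -> weak_laplacian phi k -> 0 < rho ->
  (forall y, ball x0 rho y -> phi x0 - S x0 <= phi y - S y) ->
  laplacian S x0 <= k x0.
Proof.
move=> cphi ck SC pk rho0 mn.
have cZ (f : 'rV[R]_d -> R) : continuous f -> continuous (fun x => -1 * f x).
  by move=> cf; apply: continuous_mulf => // x; exact: cst_continuous.
have SC' : class_C 2 (fun x => -1 * S x + 0 * S x) by exact: class_C_lin.
have LE : laplacian (fun x => -1 * S x + 0 * S x) x0 = - laplacian S x0.
  by rewrite laplacian_lin// mulN1r mul0r addr0.
rewrite -lerN2 -LE -[leLHS]mulN1r.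
have := @touching_above _ _ _ x0 rho (cZ _ cphi) (cZ _ ck) SC'
  (weak_laplacianZ (-1) cphi ck pk) rho0.
apply=> y /mn; move: (phi y) (S y) (phi x0) (S x0).
move=> a b c e; rewrite -lerN2 !opprB !mulN1r !mul0r !addr0 !opprK.
by rewrite [- a + b]addrC [- c + e]addrC.
Qed.

End laplacian.

(** * Positivity, equation and boundedness of a minimizer *)

Section step.
Context {R : realType} {d : nat}.
Local Notation leb := (lebesgue_rV R d).
Local Notation Int f := (\int[leb]_x f x).
Local Notation itg f := (leb.-integrable setT (EFin \o f)).
Variables (F : P2 R d -> R) (dF : P2 R d -> 'rV[R]_d -> R)
  (g : 'rV[R]_d -> R) (G : P2 R d -> 'rV[R]_d -> R) (LG : R).
Hypothesis E : regular_energy F dF g G LG.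
Variables (sigma h : R).
Hypotheses (sigma0 : 0 < sigma) (h0 : 0 < h).
Variables (f0 f : 'rV[R]_d -> R) (m : P2 R d).
Hypotheses (f0P : is_density f0) (cf0 : continuous f0) (f0_gt0 : forall x, 0 < f0 x).
Hypotheses (step : entropic_step F sigma h f0 m f) (cf : continuous f).

Let phi x := Num.sqrt (f x).
Let phi_0 x := Num.sqrt (f0 x).

Let mf : has_density m f. Proof. by case: step => -[]. Qed.
Let fP : is_density f. Proof. exact: has_density_is_density mf. Qed.
Let f_ge0 x : 0 <= f x. Proof. exact: density_ge0. Qed.
Let phi0 x : 0 <= phi x. Proof. exact: sqrtr_ge0. Qed.
Let phi2 x : phi x ^+ 2 = f x. Proof. exact: sqr_sqrtr. Qed.
Let cphi : continuous phi. Proof. exact: continuous_sqrtf cf. Qed.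
Let phi_0_gt0 x : 0 < phi_0 x. Proof. by rewrite sqrtr_gt0. Qed.
Let s20 : 0 < sigma ^+ 2. Proof. exact: exprn_gt0. Qed.
Let hV0 : 0 <= h^-1. Proof. by rewrite invr_ge0 ltW. Qed.

Let test_bump x0 r : 0 < r -> test_function (@bump R d x0 r).
Proof.
move=> r0; have rad : 0 <= bump_radius x0 r by rewrite addr_ge0 ?sumr_ge0// ltW.
apply: (supp_test_function rad) => [k|]; first exact: class_C_bump.
exact: supp_in_bump.
Qed.

Let itg_rhs (l : R) x0 r : 0 < r ->
  itg (fun x => phi x * bump x0 r x * (dF m x + h^-1 * ln (f x / f0 x) - l)).
Proof.
move=> r0.
have rad : 0 < bump_radius x0 r by rewrite ltr_wpDl ?sumr_ge0.
have cb : continuous (bump x0 r) by exact: continuous_bump.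
have i1 := itg_bump x0 (continuous_mulf (@continuous_dF _ _ _ _ _ _ _ E m) cphi) r0.
have i2 := itg_bump x0 cphi r0.
have i3 := itg_sqrt_entropy cf0 f0_gt0 step cf (fun k => class_C_bump k x0 r)
  (supp_in_bump r0 (lexx r)).
have := itgB (itgD i1 (itgZ h^-1 i3)) (itgZ l i2).
by congr (_.-integrable _ (EFin \o _)); apply/funext => x; rewrite -/(phi x); ring.
Qed.

(** The Euler-Lagrange inequality for bumps bounds the weak Laplacian of [phi] by a multiple of
    [phi] on every cube, since [dF m] and [ln (f / f0)] are bounded above there. If [phi] had a
    zero, the strong minimum principle would make it vanish everywhere, against the unit mass. *)
Lemma step_gt0 x : 0 < f x.
Proof.
rewrite lt_def f_ge0 andbT; apply/negP => /eqP fx0.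
have px0 : phi x = 0 by rewrite /phi fx0 sqrtr0.
suff z y : phi y = 0.
  have := density_Int fP; rewrite (Int_eq leb (g := fun=> 0)).
    by rewrite Int0 => /eqP; rewrite eq_sym oner_eq0.
  by move=> y; rewrite -phi2 z expr0n.
(* Large enough for the ball of radius [rho / 2] around [x] to contain [y]. *)
pose rho := 2 * (enorm (y - x) + 1).
have rho0 : 0 < rho by rewrite mulr_gt0// ltr_wpDl ?enorm_ge0.
have [l EL] := euler_lagrange E h0 f0P cf0 f0_gt0 step cf.
pose M := bump_radius x rho.
have [C1 C10 HC1] := continuous_bounded_cube M (@continuous_dF _ _ _ _ _ _ _ E m).
have [C2 C20 HC2] := continuous_bounded_cube M (continuous_mulf cf (continuous_invf cf0 f0_gt0)).
pose C := (C1 + h^-1 * C2 + `|l|) / sigma ^+ 2.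
have C0 : 0 < C.
  by rewrite divr_gt0// ltr_wpDr// ltr_wpDr// mulr_ge0// ltW.
apply: (strong_minimum cphi phi0 px0 C0 rho0).
  move=> r r0 rr; have e1 : exists2 e0 : R, 0 < e0 &
      forall y, 0 <= phi y / 2 + e0 * bump x r y.
    by exists 1 => // z; rewrite mul1r addr_ge0 ?bump_ge0// divr_ge0.
  rewrite -(ler_pM2l s20); apply: le_trans (EL _ (test_bump x r0) e1) _.
  rewrite mulrA (_ : sigma ^+ 2 * C = C1 + h^-1 * C2 + `|l|); last first.
    by rewrite /C mulrC divfK ?gt_eqF.
  have ib := itg_bump x cphi r0.
  rewrite -(IntZ _ ib); apply: Int_le; [exact: itg_rhs|exact: itgZ|].
  move=> z; rewrite -/(phi z).
  have pb0 : 0 <= phi z * bump x r z by rewrite mulr_ge0 ?bump_ge0.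
  have [zM|zM] := pselect (cube M z); last first.
    by rewrite (supp_in_bump r0 (ltW rr) zM) !mulr0 mul0r.
  rewrite mulrC ler_wpM2r//.
  have d1 : dF m z <= C1 by rewrite (le_trans (ler_norm _))// HC1.
  have d2 : ln (f z / f0 z) <= C2.
    rewrite (le_trans (ln_le _)) ?divr_ge0 ?(ltW (f0_gt0 z))//.
    by rewrite (le_trans (ler_norm _))// HC2.
  have := ler_wpM2l hV0 d2; have := ler_norm (- l); rewrite normrN.
  move: d1; move: (dF m z) (h^-1 * ln _) (h^-1 * C2) (`|l|) => *; lra.
have -> : rho / 2 = enorm (y - x) + 1 by rewrite /rho; field.
by rewrite -sqr_enorm ltrXn2r// ?nnegrE ?addr_ge0 ?enorm_ge0 ?ltrDl.
Qed.

Let phi_gt0 x : 0 < phi x. Proof. by rewrite sqrtr_gt0 step_gt0. Qed.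

Let lnE x : ln (f x / f0 x) = 2 * ln (phi x / phi_0 x).
Proof.
have q0 : 0 < phi x / phi_0 x by rewrite divr_gt0.
have -> : f x / f0 x = (phi x / phi_0 x) ^+ 2.
  by rewrite expr_div_n phi2 sqr_sqrtr// ltW.
by rewrite lnXn// mulr_natl.
Qed.

(** Being positive and continuous, [phi] is bounded below on the support of a bump, so both signs of
    the bump are admissible and the two inequalities give an equality. *)
Lemma step_equation : exists l : R, forall x0 r, 0 < r ->
  sigma ^+ 2 * Int (fun x => phi x * laplacian (bump x0 r) x) =
  Int (fun x => phi x * bump x0 r x * (dF m x + h^-1 * ln (f x / f0 x) - l)).
Proof.
have [l EL] := euler_lagrange E h0 f0P cf0 f0_gt0 step cf.
exists l => x0 r r0; apply: le_anti; apply/andP; split.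
  apply: (EL _ (test_bump x0 r0)); exists 1 => // z.
  by rewrite mul1r addr_ge0 ?bump_ge0// divr_ge0.
pose M := bump_radius x0 r.
have [C1 C10 HC1] := continuous_bounded_cube M (continuous_invf cphi phi_gt0).
have [C2 C20 HC2] := continuous_bounded_cube M (@continuous_bump R d x0 r).
have bE : (fun x => - 1 * bump x0 r x + 0 * bump x0 r x) = (fun x => - bump x0 r x).
  by apply/funext => x; rewrite mulN1r mul0r addr0.
have tb : test_function (fun x => - bump x0 r x).
  have rad : 0 <= bump_radius x0 r by rewrite addr_ge0 ?sumr_ge0// ltW.
  apply: (supp_test_function rad) => [k|]; first exact: class_C_opp (class_C_bump k x0 r).
  by move=> x xM; rewrite (supp_in_bump r0 (lexx r) xM) oppr0.
have e1 : Int (fun x => phi x * laplacian (fun x => - bump x0 r x) x) =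
    - Int (fun x => phi x * laplacian (bump x0 r) x).
  rewrite -(IntN (itg_lap_bump x0 cphi r0)); apply: Int_eq => x.
  by rewrite -bE laplacian_lin ?mul0r ?addr0 ?mulN1r ?mulrN//; exact: class_C_bump.
have e2 : Int (fun x => phi x * - bump x0 r x * (dF m x + h^-1 * ln (f x / f0 x) - l)) =
    - Int (fun x => phi x * bump x0 r x * (dF m x + h^-1 * ln (f x / f0 x) - l)).
  by rewrite -(IntN (itg_rhs l x0 r0)); apply: Int_eq => x; rewrite mulrN mulNr.
suff H : exists2 e0 : R, 0 < e0 & forall x, 0 <= phi x / 2 + e0 * - bump x0 r x.
  by rewrite -lerN2 -mulrN -e1 -e2; exact: EL tb H.
exists (2 * C1 * C2)^-1; first by rewrite invr_gt0 !mulr_gt0.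
move=> x; have [xM|xM] := pselect (cube M x); last first.
  by rewrite (supp_in_bump r0 (lexx r) xM) oppr0 mulr0 addr0 divr_ge0.
have p1 : 1 <= C1 * phi x.
  rewrite -(mulVf (lt0r_neq0 (phi_gt0 x))) ler_wpM2r//.
  by rewrite (le_trans (ler_norm _))// HC1.
have b1 : bump x0 r x <= C2 by rewrite (le_trans (ler_norm _))// HC2.
rewrite mulrN subr_ge0 ler_pdivrMl ?mulr_gt0//.
have -> : 2 * C1 * C2 * (phi x / 2) = C2 * (C1 * phi x) by field.
by rewrite (le_trans b1)// ler_peMr// ltW.
Qed.

Lemma step_weak_laplacian : exists l : R, weak_laplacian phi
  (fun x => (sigma ^+ 2 / 2)^-1 *
     (phi x * (h^-1 * ln (phi x / phi_0 x) + (dF m x - l) / 2))).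
Proof.
have [l EL] := step_equation; exists l => x0 r r0.
apply: (mulfI (lt0r_neq0 s20)); rewrite EL//.
have -> : Int (fun y => (sigma ^+ 2 / 2)^-1 * (phi y * (h^-1 * ln (phi y / phi_0 y) +
    (dF m y - l) / 2)) * bump x0 r y) = Int (fun x => (sigma ^+ 2)^-1 * (phi x *
    bump x0 r x * (dF m x + h^-1 * ln (f x / f0 x) - l))).
  by apply: Int_eq => x; rewrite lnE; field; rewrite !gt_eqF.
by rewrite (IntZ _ (itg_rhs l x0 r0)) mulrA divff ?gt_eqF// mul1r.
Qed.

(** Since [phi * ln (phi / phi_0) >= phi - phi_0] and [phi_0] is bounded, the equation bounds the
    weak Laplacian of [phi] below by a multiple of [- (1 + phi)]; [sup_bound] applies because
    [phi ^+ 2] has integral 1. *)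
Lemma step_bounded (Cd C0 : R) : (forall x, - Cd <= dF m x) -> (forall x, f0 x <= C0) ->
  exists B : R, forall x, f x <= B.
Proof.
move=> dFl f0l; have [l EL] := step_equation.
pose K := (`|Cd| + `|l| + h^-1 * (2 * Num.sqrt C0) + 1) / sigma ^+ 2.
have K1 : 0 < `|Cd| + `|l| + h^-1 * (2 * Num.sqrt C0) + 1.
  by rewrite ltr_wpDl// !addr_ge0// mulr_ge0// mulr_ge0// sqrtr_ge0.
have K0 : 0 < K by rewrite divr_gt0.
have [B B0 HB] := @sup_bound R d K 1 K0.
have p2 : (fun y => phi y ^+ 2) = f by apply/funext => y; rewrite phi2.
exists (B ^+ 2) => x; rewrite -phi2 ler_sqr ?nnegrE ?(ltW B0)//.
apply: HB => //; rewrite ?p2; first exact: density_itg.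
  by rewrite (density_Int fP).
move=> x0 r r0 _; rewrite -(ler_pM2l s20) EL//.
have c1 : continuous (fun y => 1 + phi y).
  by apply: continuous_addf => // z; exact: cst_continuous.
have ib := itg_bump x0 c1 r0.
rewrite mulrN mulrA (_ : sigma ^+ 2 * K = `|Cd| + `|l| + h^-1 * (2 * Num.sqrt C0) + 1);
  last by rewrite /K mulrC divfK ?gt_eqF.
rewrite -(IntZ _ ib) -(IntN (itgZ _ ib)); apply: Int_le; [exact: itgN (itgZ _ ib)|exact: itg_rhs|].
move=> z; have b0 : 0 <= bump x0 r z by rewrite bump_ge0.
rewrite -/(phi z) (mulrAC (phi z)) mulrA -mulNr ler_wpM2r// lnE.
have e1 := entropy_ge (phi0 z) (phi_0_gt0 z).
have s0 : phi_0 z <= Num.sqrt C0 by rewrite ler_wsqrtr.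
have e2 : - Num.sqrt C0 <= phi z * ln (phi z / phi_0 z).
  by have := phi0 z; move: e1 s0; move: (phi z) (phi_0 z) (phi z * ln _) => *; lra.
have e3 := ler_wpM2l hV0 e2.
have d1 : phi z * (- `|Cd| - `|l|) <= phi z * (dF m z - l).
  rewrite ler_wpM2l//; have := dFl z; have := ler_norm Cd; have := ler_norm l.
  move: (dF m z) (`|Cd|) (`|l|) => *; lra.
have q0 : 0 <= h^-1 * Num.sqrt C0 by rewrite mulr_ge0// sqrtr_ge0.
rewrite [leRHS](_ : _ = phi z * (dF m z - l) + 2 * (h^-1 * (phi z * ln (phi z / phi_0 z))));
  last by ring.
have q1 := mulr_ge0 (phi0 z) q0.
have := normr_ge0 Cd; have := normr_ge0 l; have := phi0 z.
move: d1 e3 q0 q1; rewrite mulrN.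
rewrite (_ : h^-1 * (2 * Num.sqrt C0) = 2 * (h^-1 * Num.sqrt C0)); last by ring.
move: (h^-1 * (phi z * _)) (h^-1 * Num.sqrt C0) (phi z * (dF m z - l)) => a b e.
move: (phi z) (`|Cd|) (`|l|) => y u v *; nra.
Qed.

End step.

(** * Polynomial weights *)

Section weight.
Context {R : realType} {d : nat}.
Implicit Types (x : 'rV[R]_d) (k : nat).

Definition bracket x : R := 1 + dot x x.
Definition decay k x : R := (bracket x)^-1 ^+ k.

Lemma bracket_ge1 x : 1 <= bracket x.
Proof. by rewrite lerDl dot_ge0. Qed.

Lemma bracket_gt0 x : 0 < bracket x.
Proof. exact: lt_le_trans ltr01 (bracket_ge1 x). Qed.

Lemma bracketV_le1 x : (bracket x)^-1 <= 1.
Proof. by rewrite invf_le1 ?bracket_gt0 ?bracket_ge1. Qed.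

Lemma bracketV_gt0 x : 0 < (bracket x)^-1.
Proof. by rewrite invr_gt0 bracket_gt0. Qed.

Lemma decay_gt0 k x : 0 < decay k x.
Proof. by rewrite exprn_gt0// bracketV_gt0. Qed.

Lemma decayS k x : decay k.+1 x = (bracket x)^-1 * decay k x.
Proof. exact: exprS. Qed.

Lemma decay_leS k x : decay k.+1 x <= decay k x.
Proof. by rewrite decayS ler_piMl ?bracketV_le1// ltW// decay_gt0. Qed.

Lemma decay_le1 k x : decay k x <= 1.
Proof. by rewrite exprn_ile1 ?bracketV_le1// ltW// bracketV_gt0. Qed.

Lemma dot_decayS k x : dot x x * decay k.+1 x <= decay k x.
Proof.
rewrite decayS mulrA ler_piMl ?(ltW (decay_gt0 k x))//.
by rewrite ler_pdivrMr ?bracket_gt0// mul1r lerDr.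
Qed.

Lemma enorm_le_bracket x : enorm x <= bracket x.
Proof. by rewrite (le_trans (le1Dsqr (enorm x)))// sqr_enorm. Qed.

Lemma is_derive_bracket i x : is_derive x (delta_mx ord0 i) bracket (2 * x ord0 i).
Proof.
have := is_derive_addf (is_derive_cstf 1 x (delta_mx ord0 i)) (is_derive_sqdist i 0 x).
apply: is_derive_ext => [y|]; first by rewrite subr0.
by rewrite mxE subr0 add0r.
Qed.

Lemma class_C_bracket n : class_C n bracket.
Proof.
have := class_C_add (class_C_cst n 1) (class_C_sqdist n (0 : 'rV[R]_d)).
by under eq_fun do rewrite subr0; exact.
Qed.

Lemma continuous_bracket : continuous bracket.
Proof. exact: class_C_continuous (class_C_bracket 0). Qed.

Lemma is_derive_decay k i x : is_derive x (delta_mx ord0 i) (decay k)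
  (- (2 * k%:R) * (x ord0 i * decay k.+1 x)).
Proof.
have b0 := lt0r_neq0 (bracket_gt0 x).
have := is_derive_powf k (is_derive_invf b0 (is_derive_bracket i x)).
apply: is_derive_ext => // {b0}.
case: k => [|k]; first by rewrite mulr0 oppr0 !mul0r.
rewrite /decay /= !exprS; move: (bracket x) (bracket_gt0 x) => b b0.
by field; rewrite gt_eqF.
Qed.

Lemma continuous_decay k : continuous (decay k).
Proof.
have cV := continuous_invf continuous_bracket bracket_gt0.
elim: k => [|k IHk]; first by move=> x; rewrite /decay; exact: cst_continuous.
have -> : decay k.+1 = (fun x => (bracket x)^-1 * decay k x).
  by apply/funext => x; exact: decayS.
exact: continuous_mulf.
Qed.

Lemma class_C_decay n k : class_C n (decay k).
Proof.
elim: n k => [|n IHn] k; first by split=> //; exact: continuous_decay.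
apply: (@class_CS _ _ n (decay k) (fun i x => - (2 * k%:R) * (x ord0 i * decay k.+1 x))
  (@continuous_decay k) (fun i x => is_derive_decay k i x)) => i.
exact: class_C_scale (class_C_mul (class_C_coord n i) (IHn k.+1)).
Qed.

Lemma partial_decay k i : partial i (decay k) =
  (fun x => - (2 * k%:R) * (x ord0 i * decay k.+1 x)).
Proof. by apply: partialE => x; exact: is_derive_decay. Qed.

Lemma laplacian_decay k x : laplacian (decay k) x =
  - (2 * k%:R) * (d%:R * decay k.+1 x - 2 * k.+1%:R * (dot x x * decay k.+2 x)).
Proof.
have E (i : 'I_d) : partial i (partial i (decay k)) x = - (2 * k%:R) *
    (decay k.+1 x - 2 * k.+1%:R * (x ord0 i * x ord0 i * decay k.+2 x)).
  rewrite partial_decay; have := is_derive_scalef (- (2 * k%:R)) (is_derive_mulf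
    (is_derive_coord i i x) (is_derive_decay k.+1 i x)).
  by move=> [_ e]; rewrite [LHS]e eqxx /=; ring.
rewrite /laplacian (eq_bigr _ (fun i _ => E i)) -mulr_sumr sumrB sumr_const card_ord.
rewrite (_ : \sum_i _ = 2 * k.+1%:R * (dot x x * decay k.+2 x)) ?mulr_natl//.
by rewrite /dot mulr_suml mulr_sumr.
Qed.

(** The weight controls its own Laplacian. Its multiples that grow fast enough exponentially in time
    are therefore supersolutions as soon as the coefficient is bounded below. *)
Lemma laplacian_decay_le k x : `|laplacian (decay k) x| <=
  2 * k%:R * (d%:R + 2 * k.+1%:R) * decay k x.
Proof.
rewrite laplacian_decay mulNr normrN normrM [in leLHS]ger0_norm ?mulr_ge0//.
rewrite -[leRHS]mulrA ler_wpM2l ?mulr_ge0// (mulrDl d%:R (2 * k.+1%:R)).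
rewrite (le_trans (ler_normB _ _))//.
have d0 := ltW (decay_gt0 k.+1 x).
apply: lerD.
  by rewrite ger0_norm ?mulr_ge0// ler_wpM2l// decay_leS.
have d2 : 0 <= dot x x * decay k.+2 x by rewrite mulr_ge0 ?dot_ge0// ltW// decay_gt0.
have d3 : 0 <= 2 * k.+1%:R * (dot x x * decay k.+2 x) by apply: mulr_ge0 d2; exact: mulr_ge0.
rewrite (ger0_norm d3) ler_wpM2l ?mulr_ge0//.
by rewrite (le_trans (dot_decayS _ _))// decay_leS.
Qed.

End weight.

(** * Integrability of the weights *)

Section decay_integrable.
Context {R : realType}.
Local Notation mu := (@lebesgue_measure R).

Let u (s : R) : R := (1 + s ^+ 2)^-1.
Let u0 s : 0 <= u s. Proof. by rewrite invr_ge0 addr_ge0 ?sqr_ge0. Qed.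
Let cu : continuous u. Proof. exact: continuous_oneDsqrV. Qed.

Let int_u : (\int[mu]_s (u s)%:E < +oo)%E.
Proof.
rewrite (ge0_symfun_integralT u0 cu); last by move=> s /=; rewrite /u sqrrN.
have -> : [set x : R | 0 <= x] = [set` `[0%R, +oo[%R].
  by apply/seteqP; split => x /=; rewrite in_itv/= andbT.
have := @integral0y_oneDsqr R => H.
rewrite [X in (_ * X)%E](_ : _ = (pi / 2)%:E); first by rewrite -EFinM ltry.
by rewrite -H.
Qed.

Lemma itg_prod_inv d : (lebesgue_rV R d).-integrable setT
  (EFin \o (fun x => \prod_i (1 + x ord0 i ^+ 2)^-1)).
Proof.
have cp n : continuous (fun x : 'rV[R]_n => \prod_i (1 + x ord0 i ^+ 2)^-1).
  have c1 (i : 'I_n) : class_C 0 (fun x : 'rV[R]_n => (1 + x ord0 i ^+ 2)^-1).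
    split=> // x; apply: (@continuous_comp _ _ _ (fun x : 'rV[R]_n => x ord0 i) u).
      exact: coord_continuous.
    exact: cu.
  exact: class_C_continuous (class_C_prod _ c1).
have p0 n (x : 'rV[R]_n) : 0 <= \prod_i (1 + x ord0 i ^+ 2)^-1.
  by apply: prodr_ge0 => i _; exact: u0.
apply: ge0_itg_lty => //; first exact: continuous_mfun.
elim: d => [|n IHn].
  rewrite /= integral_dirac//; last by apply/measurable_EFinP; exact: continuous_mfun.
  by rewrite diracT mul1e ltry.
rewrite ge0_integral_rVS; last 2 first.
- by apply/measurable_EFinP; exact: continuous_mfun.
- by move=> x; rewrite lee_fin.
have E z : \prod_(i < n.+1) (1 + (cons_rV_leb z) ord0 i ^+ 2)^-1 =
    u z.1 * \prod_i (1 + z.2 ord0 i ^+ 2)^-1 :> R.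
  rewrite (@big_split_ord _ _ _ 1 n) big_ord1 /= cons_rV0; congr (_ * _).
  by apply: eq_bigr => i _; rewrite cons_rVr.
have mE : measurable_fun setT (fun z : measurableTypeR R * 'rV[R]_n =>
    (u z.1 * \prod_i (1 + z.2 ord0 i ^+ 2)^-1)%:E).
  apply/measurable_EFinP; apply: measurable_funM.
    apply: measurableT_comp measurable_fst; exact: continuous_measurable_fun.
  apply: (measurableT_comp (continuous_mfun (cp n)) measurable_snd).
under eq_integral do rewrite E.
rewrite fubini_tonelli1//; last by move=> z; rewrite lee_fin mulr_ge0.
rewrite /fubini_F /=.
have mp : measurable_fun setT (fun x : 'rV[R]_n => (\prod_i (1 + x ord0 i ^+ 2)^-1)%:E).
  by apply/measurable_EFinP; exact: continuous_mfun.
set I := (\int[lebesgue_rV R n]_x (\prod_i (1 + x ord0 i ^+ 2)^-1)%:E)%E in IHn.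
have I0 : (0 <= I)%E by apply: integral_ge0 => x _; rewrite lee_fin.
have mu' : measurable_fun setT (fun s : R => (u s)%:E).
  by apply/measurable_EFinP; exact: continuous_measurable_fun.
have -> : (\int[mu]_s \int[lebesgue_rV R n]_y (u s * \prod_i (1 + y ord0 i ^+ 2)^-1)%:E =
    \int[mu]_s ((u s)%:E * I))%E.
  apply: eq_integral => s _; rewrite -ge0_integralZl//.
  - by move=> x _; rewrite lee_fin.
  - by rewrite lee_fin.
rewrite ge0_integralZr//; last by move=> s _; rewrite lee_fin.
by rewrite lte_mul_pinfty// ?ge0_fin_numE// integral_ge0// => s _; rewrite lee_fin.
Qed.

(** Each of [d] factors [(1 + |x|^2)^-1] is at most [(1 + x_i^2)^-1] for its own coordinate, so the
    weight is dominated by a product of integrable functions of one variable. *)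
Lemma itg_decay d k : (d <= k)%N ->
  (lebesgue_rV R d).-integrable setT (EFin \o @decay R d k).
Proof.
move=> dk; apply: (@itg_le _ _ _ (lebesgue_rV R d) _ (fun x => \prod_i (1 + x ord0 i ^+ 2)^-1)).
- by apply: continuous_mfun; exact: continuous_decay.
- move=> x; rewrite (ger0_norm (ltW (decay_gt0 k x))).
  apply: (@le_trans _ _ (decay d x)).
    rewrite /decay -(subnKC dk) exprD ler_piMr ?exprn_ge0 ?(ltW (bracketV_gt0 x))//.
    by rewrite exprn_ile1 ?bracketV_le1// ltW// bracketV_gt0.
  have <- : \prod_(i < d) (bracket x)^-1 = decay d x by rewrite prodr_const card_ord.
  apply: ler_prod => i _.
  rewrite (ltW (bracketV_gt0 x)) lef_pV2 ?posrE ?bracket_gt0//.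
    by rewrite lerD2l coord_le_dot.
  by rewrite (lt_le_trans ltr01)// lerDl sqr_ge0.
- exact: itg_prod_inv.
Qed.

End decay_integrable.

(** * Quadratic growth along rays and Gaussian decay *)

Section growth.
Context {R : realType} {d : nat}.
Implicit Types (f : 'rV[R]_d -> R) (x : 'rV[R]_d).

Let taylor_aux f x (k : R) : class_C 1 f ->
  forall s : R, is_derive s 1 (fun s : R => f (s *: x) - (s * dot (grad f 0) x + k * s ^+ 2 / 2))
    (dot (grad f (s *: x)) x - (dot (grad f 0) x + k * s)).
Proof.
move=> fC s; have id1 := @is_derive_id R R s 1.
have h1 := class_C1_dir_line 0 x s fC; rewrite add0r in h1.
have h2 := is_derive_scalef (dot (grad f 0) x) id1.
have h3 := is_derive_scalef (k / 2) (is_derive_powf 2 id1).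
have := is_derive_subf h1 (is_derive_addf h2 h3).
apply: is_derive_ext => [t|]; first by rewrite add0r; field.
by rewrite /= expr1; field.
Qed.

Lemma taylor_lower f x (k : R) : class_C 1 f ->
  (forall s, 0 < s -> s < 1 -> k * s <= dot (grad f (s *: x)) x - dot (grad f 0) x) ->
  f 0 + dot (grad f 0) x + k / 2 <= f x.
Proof.
move=> fC H; have D := taylor_aux x k fC.
have := ge0_is_derive_le ler01 (fun s _ => D s) _
  (is_derive_within_continuous (fun s _ => D s)).
rewrite scale0r scale1r mul0r expr0n/= mulr0 mul0r addr0 subr0 mul1r expr1n mulr1.
rewrite lerBrDr addrA; apply=> s; rewrite in_itv/= => /andP[s0 s1].
by rewrite opprD addrA subr_ge0 H.
Qed.

Lemma taylor_upper f x (k : R) : class_C 1 f ->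
  (forall s, 0 < s -> s < 1 -> dot (grad f (s *: x)) x - dot (grad f 0) x <= k * s) ->
  f x <= f 0 + dot (grad f 0) x + k / 2.
Proof.
move=> fC H; have D s := is_derive_oppf (taylor_aux x k fC s).
have := ge0_is_derive_le ler01 (fun s _ => D s) _
  (is_derive_within_continuous (fun s _ => D s)).
rewrite scale0r scale1r mul0r expr0n/= mulr0 mul0r addr0 subr0 mul1r expr1n mulr1.
rewrite lerN2 lerBlDr addrA; apply=> s; rewrite in_itv/= => /andP[s0 s1].
by rewrite oppr_ge0 opprD addrA subr_le0 H.
Qed.

Lemma hess_increment f x (a b : R) : class_C 2 f ->
  (forall y, a <= dot (x *m hess f y) x <= b) -> forall s, 0 < s ->
  a * s <= dot (grad f (s *: x)) x - dot (grad f 0) x <= b * s.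
Proof.
move=> fC H s s0.
have D (t : R) : is_derive t 1 (fun t : R => dot (grad f (t *: x)) x)
    (dot (x *m hess f (t *: x)) x).
  have h (i : 'I_d) : is_derive t 1 (fun t : R => grad f (t *: x) ord0 i * x ord0 i)
      (dot (grad (partial i f) (t *: x)) x * x ord0 i).
    have := is_derive_scalef (x ord0 i) (class_C1_dir_line 0 x t (class_C_partial i fC)).
    apply: is_derive_ext => [u|]; last by rewrite add0r mulrC.
    by rewrite add0r mulrC mxE.
  have := is_derive_sumf (index_enum 'I_d) h.
  apply: is_derive_ext => //; rewrite /dot.
  transitivity (\sum_i \sum_j (partial j (partial i f) (t *: x) * x ord0 j * x ord0 i)).
    by apply: eq_bigr => i _; rewrite mulr_suml; apply: eq_bigr => j _; rewrite mxE.
  rewrite exchange_big; apply: eq_bigr => j _; rewrite mxE mulr_suml.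
  by apply: eq_bigr => i _; rewrite !mxE; ring.
have id1 (t : R) := @is_derive_id R R t 1.
have D1 (c t : R) := is_derive_subf (D t) (is_derive_scalef c (id1 t)).
have D2 (c t : R) := is_derive_oppf (D1 c t).
have := ge0_is_derive_le (ltW s0) (fun t _ => D1 a t) _
  (is_derive_within_continuous (fun t _ => D1 a t)).
have := ge0_is_derive_le (ltW s0) (fun t _ => D2 b t) _
  (is_derive_within_continuous (fun t _ => D2 b t)).
rewrite !scale0r !mulr0 !subr0 => h1 h2; apply/andP; split.
  rewrite lerBrDr -lerBrDl; apply: h2 => t _.
  by rewrite mulr1 subr_ge0; case/andP: (H (t *: x)).
rewrite lerBlDr -lerBlDl -lerN2; apply: h1 => t _.
by rewrite mulr1 oppr_ge0 subr_le0; case/andP: (H (t *: x)).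
Qed.

Lemma linear_le_sqr (A k u : R) : 0 < k -> A * u <= k * u ^+ 2 + A ^+ 2 / k.
Proof.
move=> k0; rewrite -(ler_pM2l k0) mulrDr [k * (A ^+ 2 / k)]mulrC divfK ?gt_eqF//.
have := sqr_ge0 (k * u - A / 2); have := sqr_ge0 A; nra.
Qed.

Lemma expR_decay (a : R) k : 0 < a -> exists2 K : R, 0 < K &
  forall x, expR (- (a * dot x x)) <= K * decay k x.
Proof.
(* The constant comes from [expR y >= (y / k.+1%:R) ^+ k] with [y = a * bracket x]; dividing by
   [k.+1] rather than [k] covers [k = 0]. *)
move=> a0; exists (expR a * (k.+1%:R / a) ^+ k).
  by rewrite mulr_gt0 ?expR_gt0// exprn_gt0// divr_gt0.
move=> x; have b0 := bracket_gt0 x; set b := bracket x in b0 *.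
have -> : - (a * dot x x) = a - a * b by rewrite /b /bracket; ring.
rewrite expRD -mulrA ler_pM2l ?expR_gt0//.
have k0 : 0 < k.+1%:R :> R by [].
have e1 : a * b / k.+1%:R <= expR (a * b / k.+1%:R).
  by rewrite (le_trans _ (expR_ge1Dx _))// lerDr.
have q0 : 0 < a * b / k.+1%:R by rewrite divr_gt0// mulr_gt0.
have e2 : (a * b / k.+1%:R) ^+ k <= expR (a * b).
  apply: (@le_trans _ _ (expR (a * b / k.+1%:R) ^+ k)).
    by rewrite lerXn2r// nnegrE ?expR_ge0// ltW.
  rewrite -expRM_natl ler_expR mulrCA ler_piMr ?mulr_ge0 ?ltW//.
  by rewrite ltr_pdivrMr// mul1r ltr_nat.
rewrite expRN -exprMn /decay.
have -> : (k.+1%:R / a * (bracket x)^-1) = (a * b / k.+1%:R)^-1.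
  by rewrite -/b; field; rewrite !gt_eqF//= addrC -natr1.
by rewrite exprVn lef_pV2 ?posrE ?expR_gt0 ?exprn_gt0.
Qed.

End growth.

(** * Square root of the solution of the dynamics *)

Section class_C_inverse.
Context {R : realType} {d : nat}.
Implicit Types f : 'rV[R]_d -> R.

Lemma class_C_invf n f : class_C n f -> (forall x, 0 < f x) ->
  class_C n (fun x => (f x)^-1).
Proof.
elim: n f => [|n IHn] f fC f0.
  by split=> //; apply: continuous_invf f0; exact: class_C_continuous fC.
apply: (@class_CS _ _ n _ (fun i x => - (partial i f x * ((f x)^-1 * (f x)^-1)))).
- by apply: continuous_invf f0; exact: class_C_continuous fC.
- move=> i x; have := is_derive_invf (lt0r_neq0 (f0 x)) (class_C_is_derive i x fC).
  by apply: is_derive_ext => //; rewrite expr2 invfM.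
- move=> i; have iC := IHn f (class_CW fC) f0.
  exact: class_C_opp (class_C_mul (class_C_partial i fC) (class_C_mul iC iC)).
Qed.

Lemma class_C_sqrtf n f : class_C n f -> (forall x, 0 < f x) ->
  class_C n (fun x => Num.sqrt (f x)).
Proof.
elim: n f => [|n IHn] f fC f0.
  by split=> //; apply: continuous_sqrtf; exact: class_C_continuous fC.
apply: (@class_CS _ _ n _ (fun i x => partial i f x * (2^-1 * (Num.sqrt (f x))^-1))).
- by apply: continuous_sqrtf; exact: class_C_continuous fC.
- move=> i x; have := is_derive_sqrtf (f0 x) (class_C_is_derive i x fC).
  by apply: is_derive_ext => //; rewrite invfM.
- move=> i; apply: class_C_mul (class_C_partial i fC) _.
  apply: class_C_scale; apply: class_C_invf; first exact: IHn (class_CW fC) f0.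
  by move=> x; rewrite sqrtr_gt0.
Qed.

End class_C_inverse.

Section parabolic.
Context {R : realType} {d : nat}.
Implicit Types u : R -> 'rV[R]_d -> R.

Lemma open_pos_time : open [set z : R * 'rV[R]_d | 0 < z.1].
Proof.
have -> : [set z : R * 'rV[R]_d | 0 < z.1] = fst @^-1` [set s : R | 0 < s] by [].
by apply: open_comp => [z _|]; [exact: cvg_fst|exact: open_gt].
Qed.

Lemma parabolic_continuous n u t x : parabolic_C n u -> 0 < t ->
  {for (t, x), continuous (fun z => u z.1 z.2)}.
Proof.
move=> uC t0; have uc : {within [set z : R * 'rV[R]_d | 0 < z.1],
    continuous (fun z => u z.1 z.2)} by case: n uC => [|n] [].
rewrite continuous_open_subspace in uc; last exact: open_pos_time.
by apply: uc; rewrite inE.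
Qed.

Lemma slice_continuous u t : (forall x, {for (t, x), continuous (fun z => u z.1 z.2)}) ->
  continuous (u t).
Proof.
move=> uc x; apply: (@continuous_comp _ _ _ (fun x => (t, x)) (fun z => u z.1 z.2) x).
  exact: continuous_pairr.
exact: uc.
Qed.

Lemma time_slice_continuous u t x : {for (t, x), continuous (fun z => u z.1 z.2)} ->
  {for t, continuous (fun s => u s x)}.
Proof.
move=> uc.
apply: (@continuous_comp _ _ _ (fun s : R => (s, x)) (fun z => u z.1 z.2) t) => //.
exact: continuous_pairl.
Qed.

Lemma parabolic_partial n u i : parabolic_C n.+1 u -> parabolic_C n (fun t => partial i (u t)).
Proof. by case: n => [|n] [_]; [move=> [/(_ i)[]]|move=> [/(_ i)[]]]. Qed.

Lemma parabolic_class_C n u t : parabolic_C n u -> 0 < t -> class_C n (u t).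
Proof.
elim: n u => [|n IHn] u uC t0.
  by split=> //; apply: slice_continuous => x; exact: parabolic_continuous uC t0.
split; first by apply: slice_continuous => x; exact: parabolic_continuous uC t0.
move=> i; split; last exact: (IHn _ (parabolic_partial i uC) t0).
by move=> x; case: n uC {IHn} => [|n] [_] [/(_ i)[ud _] _]; exact: ud.
Qed.

End parabolic.

Section sqrt_dynamics.
Context {R : realType} {d : nat}.
Variables (F : P2 R d -> R) (dF : P2 R d -> 'rV[R]_d -> R)
  (g : 'rV[R]_d -> R) (G : P2 R d -> 'rV[R]_d -> R) (LG : R).
Hypothesis E : regular_energy F dF g G LG.
Variables (sigma : R) (p0 : 'rV[R]_d -> R) (p : R -> 'rV[R]_d -> R).
Hypothesis p0_gt0 : forall x, 0 < p0 x.
Hypothesis pP : mean_field_schrodinger dF sigma p0 p.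

Let c := sigma ^+ 2 / 2.
Let psi t x := Num.sqrt (p t x).

Let pC : parabolic_C 3 p. Proof. by case: pP. Qed.
Let p_gt0 t x : 0 <= t -> 0 < p t x.
Proof.
case: pP => _ _ pE pt; rewrite le_eqVlt => /predU1P[<-|t0]; first by rewrite pE.
by have [] := pt t t0.
Qed.

Lemma psi_gt0 t x : 0 <= t -> 0 < psi t x.
Proof. by move=> t0; rewrite sqrtr_gt0 p_gt0. Qed.

Lemma psi_class_C2 t : 0 < t -> class_C 2 (psi t).
Proof.
move=> t0; apply: class_C_sqrtf => [|x]; last exact: p_gt0 (ltW t0).
by apply: class_CW; exact: parabolic_class_C pC t0.
Qed.

Let sqrt_cont t x : 0 < t -> {for (t, x), continuous (fun z => psi z.1 z.2)}.
Proof.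
move=> t0; apply: (@continuous_comp _ _ _ (fun z => p z.1 z.2) Num.sqrt).
  exact: parabolic_continuous pC t0.
exact: sqrt_continuous.
Qed.

Let inv_sqrt_cont t x : 0 < t -> {for (t, x), continuous (fun z => (psi z.1 z.2)^-1)}.
Proof.
move=> t0; apply: (@continuousV _ _ (fun z => psi z.1 z.2)); last exact: sqrt_cont.
by rewrite gt_eqF// psi_gt0// ltW.
Qed.

Definition sqrt_time_derivative t x : R := derive1 (fun s => p s x) t * (2^-1 * (psi t x)^-1).

Lemma is_derive_psi (t : R) x : 0 < t -> is_derive t 1 (fun s => psi s x) (sqrt_time_derivative t x).
Proof.
move=> t0; case: pC => _ [_ [pd _]].
have h : is_derive t 1 (fun s => p s x) (derive1 (fun s => p s x) t).
  by split; [exact: pd|rewrite derive1E].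
have := is_derive_sqrtf (p_gt0 x (ltW t0)) h.
by apply: is_derive_ext => //; rewrite /sqrt_time_derivative invfM.
Qed.

Lemma sqrt_time_derivative_continuous t x : 0 < t ->
  {for (t, x), continuous (fun z => sqrt_time_derivative z.1 z.2)}.
Proof.
move=> t0; case: pC => _ [_ [_ pC']].
apply: (@continuousM _ _ (fun z => derive1 (fun s => p s z.2) z.1)
  (fun z => 2^-1 * (psi z.1 z.2)^-1)).
  exact: (@parabolic_continuous R d 1 (fun t x => derive1 (fun s => p s x) t) t x pC' t0).
apply: (@continuousM _ _ (fun=> 2^-1) (fun z => (psi z.1 z.2)^-1)).
  exact: cst_continuous.
exact: inv_sqrt_cont.
Qed.

Let laplacian_psiE t x : 0 < t -> laplacian (psi t) x = \sum_i
  (partial i (partial i (p t)) x * (2^-1 * (psi t x)^-1) -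
   partial i (p t) x ^+ 2 * (4^-1 * (psi t x)^-1 ^+ 3)).
Proof.
move=> t0; apply: eq_bigr => i _.
have ptC := parabolic_class_C pC t0.
have e1 y : is_derive y (delta_mx ord0 i) (psi t) (partial i (p t) y * (2^-1 * (psi t y)^-1)).
  have := is_derive_sqrtf (p_gt0 y (ltW t0)) (class_C_is_derive i y ptC).
  by apply: is_derive_ext => //; rewrite invfM.
rewrite (partialE e1).
have n0 : psi t x != 0 by rewrite gt_eqF// psi_gt0// ltW.
have h2 := is_derive_scalef 2^-1 (is_derive_invf n0 (e1 x)).
have h3 := is_derive_mulf (class_C_is_derive i x (class_C_partial i ptC)) h2.
by case: h3 => _ e; rewrite [LHS]e; field.
Qed.

Lemma laplacian_psi_continuous t x : 0 < t ->
  {for t, continuous (fun s => laplacian (psi s) x)}.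
Proof.
move=> t0.
pose k s := \sum_i (partial i (partial i (p s)) x * (2^-1 * (psi s x)^-1) -
   partial i (p s) x ^+ 2 * (4^-1 * (psi s x)^-1 ^+ 3)).
have ck : {for t, continuous k}.
  have cM (f1 f2 : R -> R) : {for t, continuous f1} -> {for t, continuous f2} ->
      {for t, continuous (fun s => f1 s * f2 s)} by move=> *; exact: continuousM.
  have cc (a : R) : {for t, continuous (fun=> a : R)} by exact: cst_continuous.
  have cv := @time_slice_continuous R d (fun t x => (psi t x)^-1) t x (@inv_sqrt_cont t x t0).
  have cS (s : seq 'I_d) (K : 'I_d -> R -> R) : (forall i, {for t, continuous (K i)}) ->
      {for t, continuous (fun u => \sum_(i <- s) K i u)}.
    move=> cK; rewrite /prop_for /continuous_at; elim: s => [|i s IHs].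
      by under eq_fun do rewrite big_nil; rewrite big_nil; exact: cvg_cst.
    under eq_fun do rewrite big_cons; rewrite big_cons.
    by apply: cvgD IHs; exact: cK.
  apply: cS => i.
  apply: (@continuousB _ _ _ (fun s => partial i (partial i (p s)) x * (2^-1 * (psi s x)^-1))
    (fun s => partial i (p s) x ^+ 2 * (4^-1 * (psi s x)^-1 ^+ 3))).
    apply: (cM); last exact: (cM _ _ (cc _) cv).
    exact: (@time_slice_continuous R d (fun t => partial i (partial i (p t))) t x
      (parabolic_continuous (parabolic_partial i (parabolic_partial i pC)) t0)).
  have c1 := @time_slice_continuous R d (fun t => partial i (p t)) t x
    (parabolic_continuous (parabolic_partial i pC) t0).
  by apply: (cM _ _ (cM _ _ c1 c1)); apply: (cM _ _ (cc _)); exact: cM _ _ cv (cM _ _ cv cv).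
rewrite /prop_for /continuous_at laplacian_psiE// -/(k t).
apply: cvg_trans ck; apply: near_eq_cvg; near=> s; rewrite laplacian_psiE//.
by near: s; exact: lt_nbhsr.
Unshelve. all: by end_near.
Qed.

(** With [ln p = 2 * ln psi], the Laplacian and the squared gradient of [ln p] combine into
    [sigma ^+ 2 * laplacian psi / psi]: the gradient terms cancel, so the equation of the square
    root is linear up to the dependence of its coefficients on the law. *)
Lemma psi_pde : exists (m : R -> P2 R d) (l : R -> R), forall t, 0 < t ->
  has_density (m t) (p t) /\ forall x, sqrt_time_derivative t x =
    c * laplacian (psi t) x - (g x + G (m t) x - G (m t) 0) / 2 * psi t x + l t * psi t x.
Proof.
have H t : exists ml : P2 R d * R, 0 < t -> has_density ml.1 (p t) /\
    forall x, sqrt_time_derivative t x = c * laplacian (psi t) x -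
      (g x + G ml.1 x - G ml.1 0) / 2 * psi t x + ml.2 * psi t x.
  have [t0|t0] := ltP 0 t; last first.
    (* Nothing is claimed at nonpositive times; the measure at time 1 serves as a dummy value. *)
    case: pP => _ _ _ /(_ 1 ltr01)[_ [m _]]; by exists (m, 0).
  case: pP => _ _ _ /(_ t t0)[_ [m [lam [[md _] _ pde]]]].
  exists (m, (lam - G m 0) / 2) => _; split=> // x /=.
  have psx := psi_gt0 x (ltW t0); have n0 := lt0r_neq0 psx.
  have ptC := psi_class_C2 t0.
  pose ps i y := partial i (psi t) y.
  have lE : (fun y => ln (p t y)) = (fun y => 2 * ln (psi t y)).
    apply/funext => y; rewrite -(sqr_sqrtr (ltW (p_gt0 y (ltW t0)))) lnXn ?sqrtr_gt0//.
      by rewrite mulr_natl.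
    exact: p_gt0 (ltW t0).
  have e1 i y : is_derive y (delta_mx ord0 i) (fun y => ln (p t y)) (2 * (ps i y * (psi t y)^-1)).
    rewrite lE; have := is_derive_lnf (psi_gt0 y (ltW t0)) (class_C_is_derive i y ptC).
    exact: is_derive_scalef.
  have e2 i : partial i (partial i (fun y => ln (p t y))) x =
      2 * (partial i (partial i (psi t)) x / psi t x - (ps i x / psi t x) ^+ 2).
    rewrite (partialE (e1 i)).
    have h2 := is_derive_invf n0 (class_C_is_derive i x ptC).
    have h3 := is_derive_scalef 2 (is_derive_mulf
      (class_C_is_derive i x (class_C_partial i ptC)) h2).
    by case: h3 => _ e; rewrite [LHS]e /ps; field.
  have e3 : enorm (grad (fun y => ln (p t y)) x) ^+ 2 = 4 * \sum_i (ps i x / psi t x) ^+ 2.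
    rewrite sqr_enorm /dot mulr_sumr; apply: eq_bigr => i _.
    by rewrite mxE (partialE (e1 i)); ring.
  have e4 : laplacian (fun y => ln (p t y)) x =
      2 * (laplacian (psi t) x / psi t x) - 2 * \sum_i (ps i x / psi t x) ^+ 2.
    transitivity (\sum_i 2 * (partial i (partial i (psi t)) x / psi t x -
        (ps i x / psi t x) ^+ 2)); first by apply: eq_bigr => i _; exact: e2.
    by rewrite -mulr_sumr sumrB mulrBr mulr_suml.
  rewrite /sqrt_time_derivative pde /free_energy_derivative e3 e4 (energy_split E).
  have -> : p t x = psi t x ^+ 2 by rewrite sqr_sqrtr// ltW// p_gt0// ltW.
  rewrite /c; move: n0; move: (psi t x) (laplacian (psi t) x) (\sum_i _) => u L S n0.
  by field.
have [ml mlP] := choice H.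
by exists (fun t => (ml t).1), (fun t => (ml t).2).
Qed.

(** The multiplier comes from a choice and carries no regularity by itself. At [x = 0] the terms in
    [G] cancel, so the equation there expresses [l t] through continuous functions of time. *)
Lemma psi_multiplier_continuous (m : R -> P2 R d) (l : R -> R) :
  (forall t, 0 < t -> forall x, sqrt_time_derivative t x =
    c * laplacian (psi t) x - (g x + G (m t) x - G (m t) 0) / 2 * psi t x + l t * psi t x) ->
  forall t, 0 < t -> {for t, continuous l}.
Proof.
move=> pde t t0.
pose k s := (sqrt_time_derivative s 0 - c * laplacian (psi s) 0) * (psi s 0)^-1 + g 0 / 2.
have lE s : 0 < s -> l s = k s.
  move=> s0; rewrite /k pde// addrK; have := lt0r_neq0 (psi_gt0 0 (ltW s0)).
  by move: (laplacian _ _) (psi s 0) => L u u0; field.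
have ck : {for t, continuous k}.
  apply: (@continuousD _ _ _ (fun s => (sqrt_time_derivative s 0 - c * laplacian (psi s) 0) *
    (psi s 0)^-1) (fun=> g 0 / 2)); last exact: cst_continuous.
  apply: (@continuousM _ _ (fun s => sqrt_time_derivative s 0 - c * laplacian (psi s) 0)
    (fun s => (psi s 0)^-1)); last first.
    exact: (@time_slice_continuous R d (fun t x => (psi t x)^-1) t 0 (@inv_sqrt_cont t 0 t0)).
  apply: (@continuousB _ _ _ (fun s => sqrt_time_derivative s 0)
    (fun s => c * laplacian (psi s) 0)).
    exact: (@time_slice_continuous R d sqrt_time_derivative t 0 (sqrt_time_derivative_continuous t0)).
  apply: (@continuousM _ _ (fun=> c) (fun s => laplacian (psi s) 0)).
    exact: cst_continuous.
  exact: laplacian_psi_continuous.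
rewrite /prop_for /continuous_at lE//.
apply: cvg_trans ck; apply: near_eq_cvg; near=> s; rewrite -lE//.
by near: s; exact: lt_nbhsr.
Unshelve. all: by end_near.
Qed.

End sqrt_dynamics.

(** * Removing the time-dependent multiplier *)

Lemma continuous_pair (T U V : topologicalType) (f : T -> U) (g : T -> V) (x : T) :
  {for x, continuous f} -> {for x, continuous g} ->
  {for x, continuous (fun z => (f z, g z))}.
Proof. by move=> cf cg; exact: cvg_pair cf cg. Qed.

Lemma laplacian_scale (R : realType) d (a : R) (f : 'rV[R]_d -> R) x : class_C 2 f ->
  laplacian (fun x => a * f x) x = a * laplacian f x.
Proof.
move=> fC; rewrite /laplacian mulr_sumr; apply: eq_bigr => i _.
have e1 y := is_derive_scalef a (class_C_is_derive i y (class_CW fC)).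
have e2 y := is_derive_scalef a (class_C_is_derive i y (class_C_partial i fC)).
by rewrite (partialE e1) (partialE e2).
Qed.

Lemma is_derive_near_eq (R : realType) (f g : R -> R) (t df e : R) : 0 < e ->
  (forall s, `|s - t| < e -> f s = g s) -> is_derive t 1 f df -> is_derive t 1 g df.
Proof.
move=> e0 fg /is_deriveP fd; apply/is_deriveP => e' e'0; have [r r0 H] := fd e' e'0.
exists (Num.min r e); first by rewrite lt_min r0.
move=> h; rewrite lt_min => /andP[hr he]; rewrite -!fg ?H//; first by rewrite subrr normr0.
by rewrite addrC addKr [h%:A]mulr1.
Qed.

Section time_continuity.
Context {R : realType} {d : nat}.
Local Notation leb := (lebesgue_rV R d).
Local Notation Int f := (\int[leb]_x f x).
Local Notation itg f := (leb.-integrable setT (EFin \o f)).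
Implicit Types (u : R -> 'rV[R]_d -> R).

(** The pairs of times and points for which [u] varies by at least [e] form a compact set. If it is
    not empty, [|s - t|] has a positive minimum on it. *)
Lemma strip_modulus u (a b M e : R) : continuous (fun z : R * 'rV[R]_d => u z.1 z.2) ->
  0 < e -> exists2 dlt : R, 0 < dlt & forall s t y, a <= s <= b -> a <= t <= b ->
    cube M y -> `|s - t| < dlt -> `|u s y - u t y| < e.
Proof.
move=> uc e0.
pose K : set ((R * R) * 'rV[R]_d) := (`[a, b]%classic `*` `[a, b]%classic) `*` cube M.
pose D (z : (R * R) * 'rV[R]_d) : R := `|u z.1.1 z.2 - u z.1.2 z.2|.
have c1 : continuous (fun z : (R * R) * 'rV[R]_d => z.1.1).
  by move=> z; apply: (@continuous_comp _ _ _ fst fst); exact: cvg_fst.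
have c2 : continuous (fun z : (R * R) * 'rV[R]_d => z.1.2).
  by move=> z; apply: (@continuous_comp _ _ _ fst snd); [exact: cvg_fst|exact: cvg_snd].
have c11 : continuous (fun z : (R * R) * 'rV[R]_d => (z.1.1, z.2)).
  move=> z; apply: (@continuous_pair _ _ _ (fun z => z.1.1) snd z); [exact: c1|exact: cvg_snd].
have c12 : continuous (fun z : (R * R) * 'rV[R]_d => (z.1.2, z.2)).
  move=> z; apply: (@continuous_pair _ _ _ (fun z => z.1.2) snd z); [exact: c2|exact: cvg_snd].
have cD : continuous D.
  move=> z; apply: cvg_norm; apply: cvgB.
    apply: (@continuous_comp _ _ _ (fun z : (R * R) * 'rV[R]_d => (z.1.1, z.2))
      (fun z => u z.1 z.2)); [exact: c11|exact: uc].
  apply: (@continuous_comp _ _ _ (fun z : (R * R) * 'rV[R]_d => (z.1.2, z.2))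
    (fun z => u z.1 z.2)); [exact: c12|exact: uc].
have cK : compact K.
  by apply: compact_setX; [apply: compact_setX; exact: segment_compact|exact: compact_cube].
pose Ke := K `&` [set z | e <= D z].
have cKe : compact Ke.
  apply: compact_closedI cK _.
  have -> : [set z | e <= D z] = D @^-1` [set s | e <= s] by [].
  by apply: closed_comp; [move=> z _; exact: cD|exact: closed_ge].
have [Ke0|Ke0] := pselect (Ke !=set0); last first.
  exists 1 => // s t y sab tab yM _; rewrite ltNge; apply/negP => De.
  by apply: Ke0; exists ((s, t), y).
have cd : {within Ke, continuous (fun z : (R * R) * 'rV[R]_d => `|z.1.1 - z.1.2|)}.
  by apply: continuous_subspaceT => z; apply: cvg_norm; apply: cvgB; [exact: c1|exact: c2].
have [[[s0 t0] y0]] := compact_EVT_min Ke0 cKe cd.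
rewrite inE => -[_ /= De] mn.
exists `|s0 - t0|.
  rewrite normr_gt0 subr_eq0; apply/negP => /eqP st; move: De.
  by rewrite /D/= st subrr normr0 leNgt e0.
move=> s t y sab tab yM st; rewrite ltNge; apply/negP => H.
have := mn ((s, t), y); rewrite inE /= => /(_ _); rewrite leNgt st => /(_ _) F.
by have : false by apply: F.
Qed.

Lemma Int_time_continuous u (pi : 'rV[R]_d -> R) (M : R) :
  continuous (fun z : R * 'rV[R]_d => u z.1 z.2) -> continuous pi -> supp_in M pi ->
  (forall x, 0 <= pi x) -> continuous (fun t => Int (fun x => u t x * pi x)).
Proof.
move=> uc cpi spi pi0 t.
have cu s : continuous (u s) by apply: slice_continuous => x; exact: uc.
have iu s : itg (fun x => u s x * pi x).
  by apply: (integrable_csupp (M := M)); [exact: continuous_mulf|exact: supp_in_mulr].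
have ipi := integrable_csupp cpi spi.
have I0 : 0 <= Int pi by exact: Int_ge0.
have I1 : 0 < 1 + Int pi by rewrite ltr_pwDl.
apply/cvgrPdist_lt => e e0.
have [dlt d0 H] := strip_modulus (t - 1) (t + 1) M uc (divr_gt0 e0 I1).
have m0 : 0 < Num.min dlt 1 by rewrite lt_min d0 ltr01.
have cid : {for t, continuous (id : R -> R)} by exact: cvg_id.
move/cvgrPdist_lt : cid => /(_ _ m0) nst.
near=> s; have st : `|t - s| < Num.min dlt 1 by near: s; exact: nst.
move: st; rewrite lt_min => /andP[st s1].
rewrite -(IntB (iu t) (iu s)); apply: le_lt_trans (Int_norm (itgB (iu t) (iu s))) _.
apply: (@le_lt_trans _ _ (e / (1 + Int pi) * Int pi)); last first.
  by rewrite mulrAC ltr_pdivrMr// ltr_pM2l// ltrDr.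
rewrite -(IntZ _ ipi); apply: Int_le; [exact: itg_norm (itgB (iu t) (iu s))|exact: itgZ|].
move=> x; rewrite -mulrBl normrM (ger0_norm (pi0 x)).
have [xM|xM] := pselect (cube M x); last by rewrite spi// !mulr0.
rewrite ler_wpM2r// ltW// H//; first by rewrite lerDl lerBlDr lerDl ler01.
move: s1; rewrite ltr_norml => /andP[]; lra.
Unshelve. all: by end_near.
Qed.

End time_continuity.

(** * Normalization by a mean against a bump *)

Section multiplier.
Context {R : realType} {d : nat}.
Local Notation leb := (lebesgue_rV R d).
Local Notation Int f := (\int[leb]_x f x).
Local Notation itg f := (leb.-integrable setT (EFin \o f)).
Local Notation mu := (@lebesgue_measure R).

(** Continuity is asked at all real times, so that the initial time is included and maxima over
    compact sets exist; the equation is asked on the open interval only. Solutions are put in this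
    form by freezing time outside an interval. *)
Record parabolic_solution (c T A : R) (psi dpsi a : R -> 'rV[R]_d -> R) (l : R -> R) :
    Prop := ParabolicSolution {
  sol_continuous : continuous (fun z : R * 'rV[R]_d => psi z.1 z.2);
  sol_gt0 : forall t x, 0 <= t -> 0 < psi t x;
  sol_class_C2 : forall t, 0 < t -> t < T -> class_C 2 (psi t);
  sol_derive : forall (t : R) x, 0 < t -> t < T -> is_derive t 1 (psi^~ x) (dpsi t x);
  sol_derive_continuous : forall t x, 0 < t -> t < T ->
    {for (t, x), continuous (fun z => dpsi z.1 z.2)};
  sol_equation : forall t x, 0 < t -> t < T ->
    dpsi t x = c * laplacian (psi t) x - a t x * psi t x + l t * psi t x;
  sol_coef_bound : forall t x, 0 < t -> t < T -> `|a t x| <= A * bracket x }.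

Variables (c T A : R) (psi dpsi a : R -> 'rV[R]_d -> R) (l : R -> R).
Hypothesis S : parabolic_solution c T A psi dpsi a l.
Hypothesis T0 : 0 < T.
Hypothesis cl : forall t, 0 < t -> t < T -> {for t, continuous l}.

Let pi := @bump R d 0 1.
Let M := @bump_radius R d 0 1.
Let cpi : continuous pi. Proof. exact: continuous_bump. Qed.
Let spi : supp_in M pi. Proof. exact: (@supp_in_bump R d 0 1 1 ltr01 (lexx 1)). Qed.
Let pi0 x : 0 <= pi x. Proof. exact: bump_ge0. Qed.
Let cpsi (t : R) : continuous (psi t).
Proof. by apply: slice_continuous => x; exact: (sol_continuous S). Qed.

Let P t := Int (fun x => psi t x * pi x).
Let dP t := Int (fun x => dpsi t x * pi x).

Let cP : continuous P.
Proof. exact: Int_time_continuous (sol_continuous S) cpi spi pi0. Qed.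

Let P_gt0 t : 0 <= t -> 0 < P t.
Proof.
move=> t0; rewrite lt_neqAle Int_ge0 ?andbT; last first.
  by move=> x; rewrite mulr_ge0// ltW// (sol_gt0 S).
apply/negP => /eqP P0.
have ck : continuous (fun x => psi t x * pi x) by exact: continuous_mulf.
have sk : supp_in M (fun x => psi t x * pi x) by exact: supp_in_mulr.
have k0 y : 0 <= psi t y * pi y by rewrite mulr_ge0// ltW// (sol_gt0 S).
have Ple : Int (fun x => psi t x * pi x) <= 0 by rewrite -/(P t) -P0.
have /eqP := Int_continuous_eq0 ck k0 (integrable_csupp ck sk) Ple 0.
apply/negP; rewrite mulf_neq0//.
  by rewrite gt_eqF// (sol_gt0 S).
rewrite /pi /bump; apply: mulf_neq0; first by rewrite expf_neq0// invr_neq0// oner_neq0.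
rewrite gt_eqF// flat_gt0// bump_arg_gt0//.
by rewrite subrr /dot big1 ?expr1n ?ltr01// => i _; rewrite mxE mul0r.
Qed.

Let is_derive_P (t : R) : 0 < t -> t < T -> is_derive t 1 P (dP t).
Proof.
move=> t0 tT.
have [t1 [t2 [t10 t1t tt2 t2T]]] : exists t1 t2 : R, [/\ 0 < t1, t1 < t, t < t2 & t2 < T].
  by exists (t / 2), ((t + T) / 2); split; lra.
have cs s y : t1 <= s <= t2 -> {for (s, y), continuous (fun z => dpsi z.1 z.2 * pi z.2)}.
  move=> /andP[s1 s2].
  apply: (@continuousM _ _ (fun z => dpsi z.1 z.2) (fun z => pi z.2)).
    by apply: (sol_derive_continuous S); [exact: lt_le_trans s1|exact: le_lt_trans t2T].
  by apply: (@continuous_comp _ _ _ snd pi); [exact: cvg_snd|exact: cpi].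
have [C C0 HC] := @bounded_strip R d (fun s y => dpsi s y * pi y) t1 t2 M
  (ltW (lt_trans t1t tt2)) cs.
apply: (@is_derive_Int R d (fun s y => psi s y * pi y) (fun s y => dpsi s y * pi y) t1 t2 t M C).
- by rewrite in_itv/= t1t tt2.
- move=> s y; rewrite in_itv/= => /andP[s1 s2].
  have := is_derive_scalef (pi y) (sol_derive S y (lt_trans t10 s1) (lt_trans s2 t2T)).
  by apply: is_derive_ext => [z|]; rewrite mulrC.
- by move=> s _; exact: continuous_mulf.
- by move=> s _; exact: supp_in_mulr.
- move=> s y; rewrite in_itv/= => /andP[s1 s2].
  have [yM|yM] := pselect (cube M y).
    by rewrite indicE mem_set// mulr1 HC// !ltW.
  by rewrite spi// mulr0 normr0 mulr_ge0// ltW.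
Qed.

(** No integrability of [l] near time 0 is available. After Green's identity, [dP - l * P] involves
    [psi] but none of its derivatives, so [r] stays bounded; it takes the place of [l] in the
    integrating factor. *)
Let r t := (dP t - l t * P t) / P t.

Let r_continuous (t : R) : 0 < t -> t < T -> {for t, continuous r}.
Proof.
move=> t0 tT.
have [t1 [t2 [t10 t1t tt2 t2T]]] : exists t1 t2 : R, [/\ 0 < t1, t1 < t, t < t2 & t2 < T].
  by exists (t / 2), ((t + T) / 2); split; lra.
pose cl12 (s : R) := Num.max t1 (Num.min s t2).
have t12 : t1 <= t2 by rewrite ltW// (lt_trans t1t).
have cl1 s : t1 <= cl12 s by rewrite le_max lexx.
have cl2 s : cl12 s <= t2 by rewrite ge_max t12 ge_min lexx orbT.
have ccl : continuous cl12.
  move=> s; apply: (@continuous_max _ _ (fun=> t1) (fun s => Num.min s t2)).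
    exact: cst_continuous.
  by apply: (@continuous_min _ _ id (fun=> t2)); [exact: cvg_id|exact: cst_continuous].
have cu : continuous (fun z : R * 'rV[R]_d => dpsi (cl12 z.1) z.2).
  move=> [s y]; apply: (@continuous_comp _ _ _ (fun z : R * 'rV[R]_d => (cl12 z.1, z.2))
    (fun z => dpsi z.1 z.2)).
    apply: (@continuous_pair _ _ _ (fun z => cl12 z.1) snd); last exact: cvg_snd.
    by apply: (@continuous_comp _ _ _ fst cl12); [exact: cvg_fst|exact: ccl].
  by apply: (sol_derive_continuous S); [exact: lt_le_trans (cl1 s)|exact: le_lt_trans (cl2 s) _].
have cdP : {for t, continuous dP}.
  have := @Int_time_continuous _ _ (fun s y => dpsi (cl12 s) y) pi M cu cpi spi pi0 t.
  have clE s : t1 < s -> s < t2 -> cl12 s = s.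
    by move=> s1 s2; rewrite /cl12 (min_l (ltW s2)) (max_r (ltW s1)).
  rewrite /prop_for /continuous_at clE// => H; apply: cvg_trans H; apply: near_eq_cvg.
  near=> s; rewrite clE//; near: s; [exact: lt_nbhsr|exact: lt_nbhsl].
have Pt : P t != 0 by rewrite gt_eqF// P_gt0// ltW.
apply: (@continuousM _ _ (fun t => dP t - l t * P t) (fun t => (P t)^-1)); last first.
  by apply: continuousV => //; exact: cP.
apply: (@continuousB _ _ _ dP (fun t => l t * P t)) => //.
by apply: (@continuousM _ _ l P); [exact: cl|exact: cP].
Unshelve. all: by end_near.
Qed.

Let dPE (t : R) : 0 < t -> t < T ->
  itg (fun x => psi t x * (c * laplacian pi x - a t x * pi x)) /\
  dP t - l t * P t = Int (fun x => psi t x * (c * laplacian pi x - a t x * pi x)).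
Proof.
move=> t0 tT; have pC := sol_class_C2 S t0 tT; have piC := @class_C_bump R d 2 0 1.
have cN (f : 'rV[R]_d -> R) : continuous f -> continuous (fun x => f x * pi x).
  by move=> cf; exact: continuous_mulf.
have ip (f : 'rV[R]_d -> R) : continuous f -> itg (fun x => f x * pi x).
  by move=> cf; apply: (integrable_csupp (M := M)) (cN _ cf) _; exact: supp_in_mulr.
have i1 := ip _ (class_C2_laplacian_continuous pC).
have i2 := ip _ (@cpsi t).
have i3 : itg (fun x => dpsi t x * pi x).
  apply: ip; apply: slice_continuous => x; exact: (sol_derive_continuous S).
have i4 : itg (fun x => psi t x * laplacian pi x).
  apply: (integrable_csupp (M := M)).
    exact: continuous_mulf (@cpsi t) (class_C2_laplacian_continuous piC).
  by apply: supp_in_mulr; exact: supp_in_laplacian.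
have i5 : itg (fun x => psi t x * (a t x * pi x)).
  have := itgB (itgD (itgZ c i1) (itgZ (l t) i2)) i3.
  congr (_.-integrable _ (EFin \o _)); apply/funext => x.
  by rewrite (sol_equation S x t0 tT); ring.
have gr := green pC piC spi; rewrite -/pi in gr.
split.
  have := itgB (itgZ c i4) i5.
  by congr (_.-integrable _ (EFin \o _)); apply/funext => x; ring.
transitivity (c * Int (fun x => psi t x * laplacian pi x) - Int (fun x => psi t x * (a t x * pi x))).
  rewrite gr -(IntZ c i1) -(IntZ (l t) i2) -(IntB i3 (itgZ (l t) i2)).
  rewrite -(IntB (itgZ c i1) i5); apply: Int_eq => x.
  by rewrite (sol_equation S x t0 tT); ring.
by rewrite -(IntZ c i4) -(IntB (itgZ c i4) i5); apply: Int_eq => x; ring.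
Qed.

Let r_bounded : exists2 C : R, 0 < C & forall t, 0 < t -> t < T -> `|r t| <= C.
Proof.
have cs (s : R) (y : 'rV[R]_d) : 0 <= s <= T -> {for (s, y), continuous (fun z => psi z.1 z.2)}.
  by move=> _; exact: (sol_continuous S).
have [C1 C10 HC1] := @bounded_strip R d psi 0 T M (ltW T0) cs.
have piC := @class_C_bump R d 2 0 1.
have cb : continuous (fun x => `|c| * `|laplacian pi x| + A * bracket x * pi x).
  apply: continuous_addf.
    apply: continuous_mulf; first by move=> x; exact: cst_continuous.
    have cl2 := class_C2_laplacian_continuous piC.
    move=> x; apply: (@continuous_comp _ _ _ (laplacian pi) Num.norm); first exact: cl2.
    exact: norm_continuous.
  apply: continuous_mulf => //; apply: continuous_mulf continuous_bracket.
  by move=> x; exact: cst_continuous.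
have sb : supp_in M (fun x => `|c| * `|laplacian pi x| + A * bracket x * pi x).
  move=> x xM; rewrite spi// (supp_in_laplacian piC spi xM) normr0 !mulr0 addr0//.
have ib := integrable_csupp cb sb; set B := Int (fun x => `|c| * `|laplacian pi x| + A * bracket x * pi x).
have [tm tmT Pm] : exists2 t, t \in `[0, T]%classic & forall s, s \in `[0, T]%classic -> P t <= P s.
  apply: compact_EVT_min; [|exact: segment_compact|exact: continuous_subspaceT].
  by exists 0; rewrite /= in_itv/= lexx ltW.
have Pm0 : 0 < P tm by apply: P_gt0; move: tmT; rewrite inE/= in_itv/= => /andP[].
exists (`|C1 * B| / P tm + 1); first by rewrite ltr_wpDl// divr_ge0// ltW.
move=> t t0 tT; have [ik dE] := dPE t0 tT.
rewrite /r dE normrM normfV (gtr0_norm (P_gt0 (ltW t0))).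
apply: (@le_trans _ _ (`|C1 * B| / P tm)); last by rewrite lerDl.
have tin : t \in `[0, T]%classic by rewrite inE/= in_itv/= !ltW.
have PP := Pm _ tin.
apply: ler_pM => //; [by rewrite invr_ge0 ltW// P_gt0// ltW| |by rewrite lef_pV2 ?posrE// P_gt0// ltW].
apply: le_trans _ (ler_norm _).
have bd x : `|psi t x * (c * laplacian pi x - a t x * pi x)| <=
    C1 * (`|c| * `|laplacian pi x| + A * bracket x * pi x).
  have [xM|xM] := pselect (cube M x); last first.
    rewrite (sb x xM) spi// (supp_in_laplacian piC spi xM) !mulr0 subr0 mulr0 normr0//.
  rewrite normrM ler_pM//; first by rewrite HC1// !ltW.
  have pn : `|a t x * pi x| <= A * bracket x * pi x.
    by rewrite normrM [X in _ * X]ger0_norm// ler_wpM2r// (sol_coef_bound S).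
  by apply: le_trans (ler_normB _ _) _; rewrite normrM lerD2l.
rewrite (le_trans (Int_norm ik))// -(IntZ C1 ib); apply: Int_le; last exact: bd.
  exact: itg_norm.
exact: itgZ.
Qed.

Let rt := r \_ `]0, T[.

Let rtE s : 0 < s -> s < T -> rt s = r s.
Proof. by move=> s0 sT; rewrite /rt patchE mem_set//= in_itv/= s0. Qed.

Let rt_bounded : exists2 C : R, 0 < C & forall t, `|rt t| <= C.
Proof.
have [C C0 HC] := r_bounded; exists C => // t; rewrite /rt patchE; case: ifPn => [|_].
  by rewrite inE/= in_itv/= => /andP[]; exact: HC.
by rewrite normr0 ltW.
Qed.

Let measurable_rt : measurable_fun setT rt.
Proof.
apply/(measurable_restrictT _ _).1 => //.
apply: open_continuous_measurable_fun; first exact: itv_open.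
by move=> t; rewrite inE/= in_itv/= => /andP[]; exact: r_continuous.
Qed.

Let integrable_rt (u : R) : mu.-integrable [set` `[0%R, u]%R] (EFin \o rt).
Proof.
have [C C0 HC] := rt_bounded.
have iC : mu.-integrable [set` `[0%R, u]%R] (EFin \o (fun=> C)).
  apply: continuous_compact_integrable; first exact: segment_compact.
  by apply: continuous_subspaceT => t; exact: cst_continuous.
apply: (le_integrable _ _ _ iC) => //.
- by apply/measurable_EFinP; exact: measurable_funTS.
- by move=> x _ /=; rewrite lee_fin (le_trans (HC x))// ler_norm.
Qed.

Let Rt t := \int[mu]_(s in [set` `[0%R, t]%R]) rt s.

Let is_derive_Rt (t : R) : 0 < t -> t < T -> is_derive t 1 Rt (r t).
Proof.
move=> t0 tT; have crt : {for t, continuous rt}.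
  rewrite /prop_for /continuous_at rtE//.
  apply: cvg_trans (r_continuous t0 tT); apply: near_eq_cvg; near=> s; rewrite rtE//.
    by near: s; exact: lt_nbhsr.
  by near: s; exact: lt_nbhsl.
have [dR dE] := continuous_FTC1_closed tT (integrable_rt T) t0 crt.
by split=> //; rewrite -derive1E dE rtE.
Unshelve. all: by end_near.
Qed.

Let Rt0 : Rt 0 = 0.
Proof. by rewrite /Rt set_itv1 Rintegral_set1. Qed.

Let Rt_continuous (t : R) : 0 <= t -> t < T -> {for t, continuous Rt}.
Proof.
rewrite le_eqVlt => /predU1P[<-|t0] tT; last first.
  exact: is_derive_continuous1 (is_derive_Rt t0 tT).
by rewrite /prop_for /continuous_at Rt0; exact: parameterized_integral_cvg_left T0 (integrable_rt T).
Qed.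

(** Since [P' = (l + r) * P], this function solves [nu' = l * nu], and it is continuous and positive
    up to time 0 whatever the behaviour of [l] there. *)
Let nu t := P t * expR (- Rt t).

Let nu_gt0 t : 0 <= t -> 0 < nu t.
Proof. by move=> t0; rewrite mulr_gt0 ?P_gt0 ?expR_gt0. Qed.

Let nu_continuous (t : R) : 0 <= t -> t < T -> {for t, continuous nu}.
Proof.
move=> t0 tT; apply: (@continuousM _ _ P (fun t => expR (- Rt t))); first exact: cP.
apply: (@continuous_comp _ _ _ (fun t => - Rt t) expR); last exact: continuous_expR.
by apply: continuousN; exact: Rt_continuous.
Qed.

Let is_derive_nu (t : R) : 0 < t -> t < T -> is_derive t 1 nu (l t * nu t).
Proof.
move=> t0 tT; have h1 := is_derive_P t0 tT.
have h2 := is_derive_expf (is_derive_oppf (is_derive_Rt t0 tT)).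
have := is_derive_mulf h1 h2; apply: is_derive_ext => //.
have n0 := lt0r_neq0 (P_gt0 (ltW t0)).
by rewrite /nu /r; move: (dP t) (l t) (expR _) (P t) n0 => u v w z n0; field.
Qed.

(** The factor is [n = nu 0 / nu], equal to 1 at time 0. Continuity of [nu] is known on [[0, T[],
    whence the restriction to [T1 < T]; outside [[0, T1]] time is frozen by [clp]. *)
Lemma remove_multiplier (T1 : R) : 0 < T1 -> T1 < T ->
  exists (psih dpsih : R -> 'rV[R]_d -> R) (n : R -> R) (nlo nhi : R),
    [/\ parabolic_solution c T1 A psih dpsih a (fun=> 0), psih 0 = psi 0, 0 < nlo &
      forall t, 0 <= t -> t <= T1 -> nlo <= n t <= nhi /\ forall x, psih t x = n t * psi t x].
Proof.
move=> T10 T1T.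
pose clp (s : R) := Num.max 0 (Num.min s T1).
have cl1 s : 0 <= clp s by rewrite le_max lexx.
have cl2 s : clp s <= T1 by rewrite ge_max (ltW T10) ge_min lexx orbT.
have clpE s : 0 <= s -> s <= T1 -> clp s = s.
  by move=> s1 s2; rewrite /clp (min_l s2) (max_r s1).
have ccl : continuous clp.
  move=> s; apply: (@continuous_max _ _ (fun=> 0) (fun s => Num.min s T1)).
    exact: cst_continuous.
  by apply: (@continuous_min _ _ id (fun=> T1)); [exact: cvg_id|exact: cst_continuous].
pose n s := nu 0 * (nu (clp s))^-1.
have n0 s : 0 < n s by rewrite mulr_gt0 ?nu_gt0// invr_gt0 nu_gt0.
have cn : continuous n.
  move=> s; apply: (@continuousM _ _ (fun=> nu 0) (fun s => (nu (clp s))^-1)).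
    exact: cst_continuous.
  apply: (@continuousV _ _ (fun s => nu (clp s))); first by rewrite gt_eqF// nu_gt0.
  apply: (@continuous_comp _ _ _ clp nu); first exact: ccl.
  by apply: nu_continuous => //; exact: le_lt_trans (cl2 s) T1T.
have nE s : 0 <= s -> s <= T1 -> n s = nu 0 / nu s by move=> s0 s1; rewrite /n clpE.
have ne0 : ([set` `[0%R, T1]%R] : set R) !=set0 by exists 0; rewrite /= in_itv/= lexx ltW.
have [t1 _ n1] := compact_EVT_min ne0 (@segment_compact _ 0 T1) (continuous_subspaceT cn).
have [t2 _ n2] := compact_EVT_max ne0 (@segment_compact _ 0 T1) (continuous_subspaceT cn).
exists (fun t x => n t * psi (clp t) x), (fun t x => n t * (dpsi t x - l t * psi t x)), n,
  (n t1), (n t2); split; [|  |exact: n0|].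
- have near_in (t : R) : 0 < t -> t < T1 -> 0 < Num.min t (T1 - t).
    by move=> t0 tT1; rewrite lt_min t0 subr_gt0.
  have near_itv (t s : R) : 0 < t -> t < T1 -> `|s - t| < Num.min t (T1 - t) ->
      0 <= s /\ s <= T1.
    move=> t0 tT1; rewrite lt_min => /andP[]; rewrite !ltr_norml => /andP[a1 _] /andP[_ a2].
    by split; lra.
  have near_nE (t s : R) : 0 < t -> t < T1 -> `|s - t| < Num.min t (T1 - t) ->
      n s = nu 0 * (nu s)^-1.
    by move=> t0 tT1 /(near_itv t s t0 tT1)[s0 s1]; exact: nE.
  have near_psi (t s : R) x : 0 < t -> t < T1 -> `|s - t| < Num.min t (T1 - t) ->
      n s * psi s x = n s * psi (clp s) x.
    by move=> t0 tT1 /(near_itv t s t0 tT1)[s0 s1]; rewrite clpE.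
  have nd (t : R) : 0 < t -> t < T1 -> is_derive t 1 n (- l t * n t).
    move=> t0 tT1; have tT := lt_trans tT1 T1T; have u0 := lt0r_neq0 (nu_gt0 (ltW t0)).
    have h := is_derive_scalef (nu 0) (is_derive_invf u0 (is_derive_nu t0 tT)).
    apply: (is_derive_near_eq (near_in t t0 tT1) (fun s H => esym (near_nE t s t0 tT1 H))).
    apply: is_derive_ext h => //; rewrite nE ?ltW//.
    by move: (nu 0) (nu t) u0 (l t) => v w w0 z; field.
  split.
  + move=> z; apply: (@continuousM _ _ (fun z => n z.1) (fun z => psi (clp z.1) z.2)).
      by apply: (@continuous_comp _ _ _ fst n); [exact: cvg_fst|exact: cn].
    apply: (@continuous_comp _ _ _ (fun z : R * 'rV[R]_d => (clp z.1, z.2))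
      (fun z => psi z.1 z.2)); last exact: (sol_continuous S).
    apply: (@continuous_pair _ _ _ (fun z => clp z.1) snd); last exact: cvg_snd.
    by apply: (@continuous_comp _ _ _ fst clp); [exact: cvg_fst|exact: ccl].
  + by move=> t x _; rewrite mulr_gt0// (sol_gt0 S).
  + move=> t t0 tT1; apply: class_C_scale; rewrite clpE ?ltW//.
    by apply: (sol_class_C2 S) => //; exact: lt_trans T1T.
  + move=> t x t0 tT1; have tT := lt_trans tT1 T1T.
    have := is_derive_mulf (nd t t0 tT1) (sol_derive S x t0 tT).
    move/is_derive_ext => /(_ _ (n t * (dpsi t x - l t * psi t x)) (fun=> erefl)) h.
    apply: (is_derive_near_eq (near_in t t0 tT1) (fun s H => near_psi t s x t0 tT1 H)).
    by apply: h; ring.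
  + move=> t x t0 tT1; have tT := lt_trans tT1 T1T.
    apply: (@continuousM _ _ (fun z => n z.1) (fun z => dpsi z.1 z.2 - l z.1 * psi z.1 z.2)).
      by apply: (@continuous_comp _ _ _ fst n); [exact: cvg_fst|exact: cn].
    apply: (@continuousB _ _ _ (fun z => dpsi z.1 z.2) (fun z => l z.1 * psi z.1 z.2)).
      exact: (sol_derive_continuous S).
    apply: (@continuousM _ _ (fun z => l z.1) (fun z => psi z.1 z.2)).
      by apply: (@continuous_comp _ _ _ fst l); [exact: cvg_fst|exact: cl].
    exact: (sol_continuous S).
  + move=> t x t0 tT1; have tT := lt_trans tT1 T1T.
    rewrite (sol_equation S x t0 tT) clpE ?ltW//.
    have pC := sol_class_C2 S t0 tT.
    by rewrite (laplacian_scale (n t) x pC); ring.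
  + by move=> t x t0 tT1; apply: (sol_coef_bound S) => //; exact: lt_trans T1T.
- apply/funext => x; rewrite nE ?(ltW T10)// clpE ?(ltW T10)// divff ?mul1r//.
  by rewrite gt_eqF// nu_gt0.
- move=> t t0 tT1; have tin : t \in `[0, T1]%classic by rewrite inE/= in_itv/= t0.
  split=> [|x]; last by rewrite clpE.
  by apply/andP; split; [exact: n1|exact: n2].
Qed.

End multiplier.

(** * Decay of the solution by a comparison principle *)

Section truncation.
Context {R : realType}.
Implicit Types w h : R.

(* A convex C^2 truncation, quadratic at infinity, so that it is integrable
   along a square integrable function. *)
Definition trunc w : R := Num.max w 0 ^+ 2 ^+ 2 * (1 + Num.max w 0 ^+ 2)^-1.
Definition trunc1 w : R :=
  2 * (Num.max w 0 ^+ 3 * (2 + Num.max w 0 ^+ 2) * (1 + Num.max w 0 ^+ 2)^-1 ^+ 2).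
Definition trunc2 w : R := 2 * ((6 * Num.max w 0 ^+ 2 + 3 * Num.max w 0 ^+ 4 +
  Num.max w 0 ^+ 6) * (1 + Num.max w 0 ^+ 2)^-1 ^+ 3).

Let d_gt0 (m : R) : 0 < 1 + m ^+ 2.
Proof. by rewrite ltr_pwDl// sqr_ge0. Qed.

Lemma max0_ge0 w : 0 <= Num.max w 0. Proof. by rewrite le_max lexx orbT. Qed.

Lemma is_derive_max2 w : is_derive w 1 (fun w => Num.max w 0 ^+ 2) (2 * Num.max w 0).
Proof.
apply/is_deriveP => e e0; exists e => // h he; rewrite [h%:A]mulr1.
have H : `|Num.max (w + h) 0 ^+ 2 - Num.max w 0 ^+ 2 - h * (2 * Num.max w 0)| <= h ^+ 2.
  rewrite ler_norml; case: (leP w 0) => w0; case: (leP (w + h) 0) => h0; apply/andP; split; nra.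
by rewrite (le_trans H)// -real_normK ?num_real// expr2 ler_wpM2r// ltW.
Qed.

Lemma is_derive_max3 w : is_derive w 1 (fun w => Num.max w 0 ^+ 3) (3 * Num.max w 0 ^+ 2).
Proof.
apply/is_deriveP => e e0.
have m0 := max0_ge0 w; set m := Num.max w 0 in m0 *.
have m1 : 0 < 3 * m + 1 by rewrite ltr_wpDl// mulr_ge0.
exists (Num.min 1 (e / (3 * m + 1))); first by rewrite lt_min ltr01 divr_gt0.
move=> h; rewrite [h%:A]mulr1 lt_min => /andP[h1]; rewrite ltr_pdivlMr// => he.
have H : `|Num.max (w + h) 0 ^+ 3 - m ^+ 3 - h * (3 * m ^+ 2)| <= h ^+ 2 * (3 * m + `|h|).
  have hn := normr_ge0 h; have := ler_norm h; have := ler_norm (- h); rewrite normrN.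
  rewrite /m; move: (`|h|) hn => b b0 hb1 hb2 {m m0 m1 he h1}; rewrite ler_norml.
  case: (leP w 0) => w0; case: (leP (w + h) 0) => h0.
  - have : 0 <= h ^+ 2 * b by rewrite mulr_ge0 ?sqr_ge0.
    by rewrite !expr0n/= !mulr0 !subr0 add0r oppr_le0 andbb.
  - have wh : w + h <= h by lra.
    have p3 : (w + h) ^+ 3 <= h ^+ 3 by rewrite lerXn2r ?nnegrE; lra.
    have p3' : 0 <= (w + h) ^+ 3 by rewrite exprn_ge0// ltW.
    have : h ^+ 3 <= h ^+ 2 * b by rewrite exprSr ler_wpM2l ?sqr_ge0.
    have : 0 <= h ^+ 2 * b by rewrite mulr_ge0 ?sqr_ge0.
    rewrite !expr0n/= !mulr0 !subr0 add0r => *; apply/andP; split; lra.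
  - have k0 : w <= - h by lra.
    have s1 : w ^+ 2 * - h <= w * (- h) ^+ 2.
      have q : 0 <= w * - h * (- h - w).
        by rewrite mulr_ge0 ?subr_ge0// mulr_ge0 ?(ltW w0)//; lra.
      rewrite -subr_ge0; have -> : w * (- h) ^+ 2 - w ^+ 2 * - h = w * - h * (- h - w) by ring.
      exact: q.
    have s2 : w ^+ 3 <= w ^+ 2 * - h by rewrite exprSr ler_wpM2l ?sqr_ge0.
    have s3 : 0 <= w ^+ 3 by rewrite exprn_ge0// ltW.
    have s4 : 0 <= h ^+ 2 * b by rewrite mulr_ge0 ?sqr_ge0.
    move: s1 s2 s3 s4; rewrite sqrrN expr0n/=; set x := w ^+ 3; set y := w ^+ 2.
    move=> *; apply/andP; split; nra.
  - have : h ^+ 3 <= h ^+ 2 * b by rewrite exprSr ler_wpM2l ?sqr_ge0.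
    have : - h ^+ 3 <= h ^+ 2 * b.
      by rewrite -mulN1r exprSr mulrCA mulN1r ler_wpM2l ?sqr_ge0.
    have -> : (w + h) ^+ 3 - w ^+ 3 - h * (3 * w ^+ 2) = h ^+ 2 * (3 * w) + h ^+ 3 by ring.
    rewrite mulrDr; have : 0 <= h ^+ 2 * (3 * w).
      by rewrite mulr_ge0 ?sqr_ge0// mulr_ge0// ltW.
    move: (h ^+ 2 * _) (h ^+ 2 * b) (h ^+ 3) => *; apply/andP; split; lra.
rewrite (le_trans H)// -real_normK ?num_real// expr2 -mulrA [leRHS]mulrC ler_wpM2l//.
by rewrite (le_trans _ (ltW he))// ler_wpM2l// lerD2l ltW.
Qed.

Lemma is_derive_trunc w : is_derive w 1 trunc (trunc1 w).
Proof.
have n0 := lt0r_neq0 (d_gt0 (Num.max w 0)).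
have h1 := is_derive_powf 2 (is_derive_max2 w).
have h2 := @is_derive_invf R R (fun w => 1 + Num.max w 0 ^+ 2) w 1 _ n0
  (is_derive_addf (is_derive_cstf 1 w 1) (is_derive_max2 w)).
have := is_derive_mulf h1 h2; apply: is_derive_ext => //.
by rewrite /trunc1 /=; move: (Num.max w 0) n0 => m n0; field.
Qed.

Lemma is_derive_trunc1 w : is_derive w 1 trunc1 (trunc2 w).
Proof.
have n0 := lt0r_neq0 (d_gt0 (Num.max w 0)).
have h2 := is_derive_powf 2 (@is_derive_invf R R (fun w => 1 + Num.max w 0 ^+ 2) w 1 _ n0
  (is_derive_addf (is_derive_cstf 1 w 1) (is_derive_max2 w))).
have h3 := is_derive_addf (is_derive_cstf 2 w 1) (is_derive_max2 w).
have := is_derive_scalef 2 (is_derive_mulf (is_derive_mulf (is_derive_max3 w) h3) h2).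
apply: is_derive_ext => //.
by rewrite /trunc2 /=; move: (Num.max w 0) n0 => m n0; field.
Qed.

Lemma trunc_continuous : continuous trunc.
Proof. by move=> w; exact: is_derive_continuous1 (is_derive_trunc w). Qed.

Lemma trunc1_continuous : continuous trunc1.
Proof. by move=> w; exact: is_derive_continuous1 (is_derive_trunc1 w). Qed.

Lemma trunc2_continuous : continuous trunc2.
Proof.
have cm : continuous (fun w => Num.max w 0).
  by move=> w; apply: (@continuous_max _ _ id (fun=> 0)); [exact: cvg_id|exact: cst_continuous].
have cX n : continuous (fun w => Num.max w 0 ^+ n).
  elim: n => [|n IHn]; first by move=> w; exact: cst_continuous.
  move=> w; rewrite /continuous_at exprS; under eq_fun do rewrite exprS.
  by apply: cvgM; [exact: cm|exact: IHn].
have cc (k : R) : continuous (fun _ : R => k) by move=> w; exact: cst_continuous.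
have cD (f1 f2 : R -> R) : continuous f1 -> continuous f2 -> continuous (fun w => f1 w + f2 w).
  by move=> c1 c2 w; apply: cvgD; [exact: c1|exact: c2].
have cM (f1 f2 : R -> R) : continuous f1 -> continuous f2 -> continuous (fun w => f1 w * f2 w).
  by move=> c1 c2 w; apply: cvgM; [exact: c1|exact: c2].
have cV : continuous (fun w => (1 + Num.max w 0 ^+ 2)^-1).
  move=> w; apply: (@continuousV _ _ (fun w => 1 + Num.max w 0 ^+ 2)).
    by rewrite gt_eqF// d_gt0.
  exact: cD (cc 1) (cX 2%N) w.
apply: (cM _ _ (cc 2)); apply: (cM).
  apply: (cD _ _ _ (cX 6%N)).
  by apply: (cD); apply: (cM).
exact: cM _ _ cV (cM _ _ cV cV).
Qed.

Let dV_ge0 (m : R) : 0 <= (1 + m ^+ 2)^-1.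
Proof. by rewrite invr_ge0 ltW. Qed.

Lemma trunc1_ge0 w : 0 <= trunc1 w.
Proof.
have m0 := max0_ge0 w.
by rewrite !mulr_ge0 ?exprn_ge0// addr_ge0// sqr_ge0.
Qed.

Lemma trunc2_ge0 w : 0 <= trunc2 w.
Proof.
have m0 := max0_ge0 w.
by rewrite !mulr_ge0 ?exprn_ge0// !addr_ge0 ?mulr_ge0 ?exprn_ge0.
Qed.

Lemma trunc_ge0 w : 0 <= trunc w.
Proof. by rewrite mulr_ge0 ?sqr_ge0. Qed.

Lemma trunc_gt0 w : 0 < w -> 0 < trunc w.
Proof.
move=> w0; rewrite /trunc (max_l (ltW w0)).
by rewrite mulr_gt0// ?invr_gt0// !exprn_gt0.
Qed.

Lemma trunc_le0 w : w <= 0 -> trunc w = 0.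
Proof. by move=> w0; rewrite /trunc (max_r w0) !expr0n/= mul0r. Qed.

Lemma trunc_le w (u : R) : w <= u -> 0 <= u -> trunc w <= u ^+ 2.
Proof.
move=> wu u0; have m0 := max0_ge0 w.
have mu : Num.max w 0 <= u by rewrite ge_max wu.
have m2 : Num.max w 0 ^+ 2 <= u ^+ 2 by rewrite lerXn2r ?nnegrE.
rewrite /trunc (le_trans _ m2)// ler_pdivrMr// expr2 ler_wpM2l ?sqr_ge0// lerDr//.
Qed.

(** This bound lets the zeroth-order term be absorbed in the Gronwall argument for the integral of
    [trunc w]. *)
Lemma trunc1_mul w : trunc1 w * w <= 4 * trunc w.
Proof.
have [w0|w0] := leP w 0.
  rewrite (trunc_le0 w0) mulr0 /trunc1 (max_r w0) expr0n/= !mul0r mulr0 mul0r//.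
rewrite /trunc1 /trunc (max_l (ltW w0)); have dw := d_gt0 w.
have -> : 2 * (w ^+ 3 * (2 + w ^+ 2) * (1 + w ^+ 2)^-1 ^+ 2) * w =
    (2 * w ^+ 2 ^+ 2 * (1 + w ^+ 2)^-1) * ((2 + w ^+ 2) / (1 + w ^+ 2)).
  by field; rewrite gt_eqF.
have -> : 4 * (w ^+ 2 ^+ 2 * (1 + w ^+ 2)^-1) = (2 * w ^+ 2 ^+ 2 * (1 + w ^+ 2)^-1) * 2 by ring.
have p0 : 0 <= 2 * w ^+ 2 ^+ 2 * (1 + w ^+ 2)^-1.
  by apply: mulr_ge0 => //; apply: mulr_ge0 => //; exact: sqr_ge0.
apply: (ler_wpM2l p0).
by rewrite ler_pdivrMr//; have := sqr_ge0 w; lra.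
Qed.

End truncation.

(** * Laplacians of sums and of compositions *)

Section composition.
Context {R : realType} {d : nat}.

Lemma laplacian_add_scale (a : R) (f g : 'rV[R]_d -> R) x : class_C 2 f -> class_C 2 g ->
  laplacian (fun x => f x + a * g x) x = laplacian f x + a * laplacian g x.
Proof.
move=> fC gC; rewrite /laplacian mulr_sumr -big_split; apply: eq_bigr => i _.
have e1 y := is_derive_addf (class_C_is_derive i y (class_CW fC))
  (is_derive_scalef a (class_C_is_derive i y (class_CW gC))).
have e2 y := is_derive_addf (class_C_is_derive i y (class_C_partial i fC))
  (is_derive_scalef a (class_C_is_derive i y (class_C_partial i gC))).
by rewrite (partialE e1) (partialE e2).
Qed.

Lemma laplacian_sub_scale (a : R) (f g : 'rV[R]_d -> R) x : class_C 2 f -> class_C 2 g ->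
  laplacian (fun x => f x - a * g x) x = laplacian f x - a * laplacian g x.
Proof.
move=> fC gC; rewrite /laplacian mulr_sumr -sumrB; apply: eq_bigr => i _.
have e1 y := is_derive_subf (class_C_is_derive i y (class_CW fC))
  (is_derive_scalef a (class_C_is_derive i y (class_CW gC))).
have e2 y := is_derive_subf (class_C_is_derive i y (class_C_partial i fC))
  (is_derive_scalef a (class_C_is_derive i y (class_C_partial i gC))).
by rewrite (partialE e1) (partialE e2).
Qed.

Lemma continuous_compf (b : R -> R) (w : 'rV[R]_d -> R) : continuous b -> continuous w -> continuous (fun x => b (w x)).
Proof. by move=> cb cw x; apply: (@continuous_comp _ _ _ w b); [exact: cw|exact: cb]. Qed.

Lemma class_C2_comp (b b1 b2 : R -> R) (w : 'rV[R]_d -> R) : (forall s : R, is_derive s 1 b (b1 s)) ->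
  (forall s : R, is_derive s 1 b1 (b2 s)) -> continuous b2 -> class_C 2 w ->
  class_C 2 (fun x => b (w x)) /\ forall x, laplacian (fun x => b (w x)) x =
    b1 (w x) * laplacian w x + b2 (w x) * \sum_i partial i w x ^+ 2.
Proof.
move=> bd b1d cb2 wC; have cw := class_C_continuous wC.
have cb : continuous b by move=> s; exact: is_derive_continuous1 (bd s).
have cb1 : continuous b1 by move=> s; exact: is_derive_continuous1 (b1d s).
have e1 i x := is_derive_compf (bd (w x)) (class_C_is_derive i x wC).
have e2 i j x := is_derive_mulf (is_derive_compf (b1d (w x)) (class_C_is_derive j x wC))
  (class_C_is_derive j x (class_C_partial i wC)).
have c0 u : continuous u -> class_C 0 (u : 'rV[R]_d -> R) by split.
split.
  apply: (class_CS (continuous_compf cb cw) e1) => i.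
  have cp k : continuous (partial k w) := class_C_continuous (class_C_partial k wC).
  apply: (class_CS _ (fun j x => e2 i j x)).
    exact: continuous_mulf (continuous_compf cb1 cw) (cp i).
  move=> j; apply: class_C_add.
    apply: class_C_mul; first exact: c0 (continuous_compf cb1 cw).
    exact: class_C_partial j (class_C_partial i wC).
  apply: class_C_mul; first exact: c0 (cp i).
  apply: class_C_mul; last exact: c0 (cp j).
  exact: c0 (continuous_compf cb2 cw).
move=> x; rewrite /laplacian !mulr_sumr -big_split; apply: eq_bigr => i _.
by rewrite (partialE (e1 i)) (partialE (e2 i i)) /=; ring.
Qed.

End composition.

(** * Comparison of a solution with a polynomial weight *)

Lemma comparison_arith (R : realType) (c e L1 L2 D P a Ca Ck : R) :
  c * (e * L2) <= c * (e * (Ck * D)) -> - Ca * (e * D) <= a * (e * D) ->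
  c * L1 - a * P - (Ca + c * Ck) * (e * D) <= c * (L1 - e * L2) - a * (P - e * D).
Proof. nra. Qed.

Section comparison.
Context {R : realType} {d : nat}.
Local Notation leb := (lebesgue_rV R d).
Local Notation Int f := (\int[leb]_x f x).
Local Notation itg f := (leb.-integrable setT (EFin \o f)).

(** The factor removes the normalization of [bump] and leaves dilations of a fixed profile, whose
    Laplacian is of order [r^-2]. *)
Definition cutoff (r : R) (x : 'rV[R]_d) : R := r ^+ d * bump 0 r x.

Lemma cutoffE r x : 0 < r -> cutoff r x = flat 0 (bump_arg 0 r x).
Proof.
move=> r0; rewrite /cutoff /bump mulrA -exprMn divff ?gt_eqF// expr1n mul1r//.
Qed.

Lemma laplacian_cutoff_le : exists2 C : R, 0 < C & forall r x, 0 < r ->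
  `|laplacian (cutoff r) x| <= C * r^-1 ^+ 2.
Proof.
have [M2 HM2] := @flat_bounded R 2; have [M3 HM3] := @flat_bounded R 3.
have [M4 HM4] := @flat_bounded R 4.
have p (j : nat) (N : R) : (forall u, flat j u <= N) -> 0 <= N.
  by move=> H; rewrite (le_trans (flat_ge0 j 0))// H.
have m2 := p _ _ HM2; have m3 := p _ _ HM3; have m4 := p _ _ HM4.
have N0 : 0 <= 4 * (M4 + 2 * M3) + 2 * d%:R * M2.
  apply: addr_ge0; last by apply: mulr_ge0 => //; exact: mulr_ge0.
  by apply: mulr_ge0 => //; apply: addr_ge0 => //; exact: mulr_ge0.
exists (4 * (M4 + 2 * M3) + 2 * d%:R * M2 + 1); first by rewrite ltr_wpDl.
move=> r x r0; rewrite /cutoff laplacian_scale; last exact: class_C_bump.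
rewrite laplacian_bump /lap_bump mulrA -exprMn divff ?gt_eqF// expr1n mul1r.
set q := bump_arg 0 r x; set D := dot (x - 0) (x - 0).
have i0 : 0 < r^-1 by rewrite invr_gt0.
have [D1|D1] := ltP D (r ^+ 2); last first.
  have q0 : q <= 0 by exact: bump_arg_le0.
  by rewrite !flat_le0// !mulr0 subrr mul0r subr0 normr0 mulr_ge0 ?sqr_ge0// addr_ge0.
have rD : r^-1 ^+ 4 * D <= r^-1 ^+ 2.
  rewrite (_ : 4 = 2 + 2)%N// exprD -mulrA ler_piMr ?sqr_ge0//.
  by rewrite exprVn ler_pdivrMl ?exprn_gt0// mulr1 ltW.
have D0 : 0 <= D by exact: dot_ge0.
have rD0 : 0 <= r^-1 ^+ 4 * D by rewrite mulr_ge0 ?exprn_ge0// ltW.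
have r2 : 0 <= r^-1 ^+ 2 by exact: sqr_ge0.
have := HM2 q; have := HM3 q; have := HM4 q.
have := flat_ge0 2 q; have := flat_ge0 3 q; have := flat_ge0 4 q.
have -> : 4 * r^-1 ^+ 4 * D = 4 * (r^-1 ^+ 4 * D) by ring.
have d0 : 0 <= d%:R :> R by [].
move: d0 rD rD0 r2; move: (d%:R : R) (r^-1 ^+ 4 * D) (r^-1 ^+ 2).
move: (flat 2 q) (flat 3 q) (flat 4 q) => f2 f3 f4 n u v n0 uv u0 v0 f40 f30 f20 h4 h3 h2.
have a1 : f4 * u <= M4 * v by rewrite ler_pM.
have a2 : f3 * u <= M3 * v by rewrite ler_pM.
have a3 : n * v * f2 <= n * v * M2 by rewrite ler_wpM2l// mulr_ge0.
have b1 := mulr_ge0 f40 u0; have b2 := mulr_ge0 f30 u0.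
have b3 : 0 <= n * v * f2 by rewrite !mulr_ge0.
rewrite ler_norml; apply/andP; split; nra.
Qed.

Variables (c T A : R) (psi dpsi a : R -> 'rV[R]_d -> R).
Hypothesis S : parabolic_solution c T A psi dpsi a (fun=> 0).
Variables (Ca M0 K : R) (k : nat).
Hypotheses (T0 : 0 < T) (c0 : 0 < c) (Ca0 : 0 <= Ca) (K0 : 0 < K).
Hypothesis a_ge : forall t x, 0 < t -> t < T -> - Ca <= a t x.
Hypothesis psi_sq : forall t, 0 < t -> t < T ->
  itg (fun x => psi t x ^+ 2) /\ Int (fun x => psi t x ^+ 2) <= M0.
Hypothesis psi_init : forall x, psi 0 x <= K * decay k x.

Let Ck : R := 2 * k%:R * (d%:R + 2 * k.+1%:R).
Let C := Ca + c * Ck.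
Let Ck0 : 0 <= Ck. Proof. by rewrite !mulr_ge0// addr_ge0// mulr_ge0. Qed.

Let B t (x : 'rV[R]_d) := K * expR (C * t) * decay k x.
Let w t x := psi t x - B t x.
Let dw t x := dpsi t x - C * B t x.

Let is_derive_B (t : R) x : is_derive t 1 (B^~ x) (C * B t x).
Proof.
have id1 := @is_derive_id R R t 1.
have := is_derive_scalef (K * decay k x) (is_derive_expf (is_derive_scalef C id1)).
by apply: is_derive_ext => [s|]; rewrite /B; ring.
Qed.

Let cB : continuous (fun z : R * 'rV[R]_d => B z.1 z.2).
Proof.
move=> z; apply: (@continuousM _ _ (fun z : R * 'rV[R]_d => K * expR (C * z.1)) (fun z => decay k z.2)).
  apply: (@continuousM _ _ (fun=> K) (fun z : R * 'rV[R]_d => expR (C * z.1))).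
    exact: cst_continuous.
  apply: (@continuous_comp _ _ _ (fun z : R * 'rV[R]_d => C * z.1) expR).
    apply: (@continuousM _ _ (fun=> C) fst); [exact: cst_continuous|exact: cvg_fst].
  exact: continuous_expR.
by apply: (@continuous_comp _ _ _ snd (decay k)); [exact: cvg_snd|exact: continuous_decay].
Qed.

Let cw : continuous (fun z : R * 'rV[R]_d => w z.1 z.2).
Proof.
move=> z; apply: (@continuousB _ _ _ (fun z => psi z.1 z.2) (fun z => B z.1 z.2)).
  exact: (sol_continuous S).
exact: cB.
Qed.

Let w_class_C2 t : 0 < t -> t < T -> class_C 2 (w t).
Proof.
move=> t0 tT; apply: class_C_sub; first exact: (sol_class_C2 S).
exact: class_C_scale (class_C_decay 2 k).
Qed.

(** The barrier [B] is a supersolution because its rate [C] adds the constant [Ca], from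
    [a >= - Ca], and [c] times the constant of [laplacian_decay_le]. *)
Let w_equation t x : 0 < t -> t < T -> dw t x <= c * laplacian (w t) x - a t x * w t x.
Proof.
move=> t0 tT.
have lw : laplacian (w t) x = laplacian (psi t) x - K * expR (C * t) * laplacian (decay k) x.
  exact: laplacian_sub_scale (sol_class_C2 S t0 tT) (class_C_decay 2 k).
rewrite lw /dw (sol_equation S x t0 tT) mul0r addr0 /w.
have E0 : 0 < K * expR (C * t) by rewrite mulr_gt0// expR_gt0.
have W0 := decay_gt0 k x.
have L : laplacian (decay k) x <= Ck * decay k x.
  by rewrite (le_trans (ler_norm _))// laplacian_decay_le.
rewrite /B; move: (K * expR _) E0 => e e0.
have h1 : c * (e * laplacian (decay k) x) <= c * (e * (Ck * decay k x)).
  by rewrite ler_wpM2l ?(ltW c0)// ler_wpM2l// ltW.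
have h2 : - Ca * (e * decay k x) <= a t x * (e * decay k x).
  by rewrite ler_wpM2r ?a_ge// mulr_ge0// ltW.
exact: comparison_arith h1 h2.
Qed.

Section cutoff_estimate.
Variable r : R.
Hypothesis r0 : 0 < r.

Let eta := cutoff r.
Let M := @bump_radius R d 0 r.
Let eta0 x : 0 <= eta x. Proof. by rewrite /eta cutoffE// flat_ge0. Qed.
Let etaC : class_C 2 eta. Proof. exact: class_C_scale (class_C_bump 2 0 r). Qed.
Let ceta : continuous eta. Proof. exact: class_C_continuous etaC. Qed.
Let seta : supp_in M eta.
Proof. by move=> x xM; rewrite /eta /cutoff (supp_in_bump r0 (lexx r) xM) mulr0. Qed.

Let y t := Int (fun x => trunc (w t x) * eta x).

Let ct : continuous (fun z : R * 'rV[R]_d => trunc (w z.1 z.2)).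
Proof.
move=> z; apply: (@continuous_comp _ _ _ (fun z => w z.1 z.2) trunc); first exact: cw.
exact: trunc_continuous.
Qed.

Let cy : continuous y.
Proof. exact: (@Int_time_continuous _ _ (fun t x => trunc (w t x)) _ _ ct ceta seta eta0). Qed.

Let du t x := trunc1 (w t x) * dw t x * eta x.

Let is_derive_y (t : R) : 0 < t -> t < T -> is_derive t 1 y (Int (du t)).
Proof.
move=> t0 tT.
have [t1 [t2 [t10 t1t tt2 t2T]]] : exists t1 t2 : R, [/\ 0 < t1, t1 < t, t < t2 & t2 < T].
  by exists (t / 2), ((t + T) / 2); split; lra.
have cs s x : t1 <= s <= t2 -> {for (s, x), continuous (fun z => du z.1 z.2)}.
  move=> /andP[s1 s2].
  apply: (@continuousM _ _ (fun z => trunc1 (w z.1 z.2) * dw z.1 z.2) (fun z => eta z.2)).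
    apply: (@continuousM _ _ (fun z => trunc1 (w z.1 z.2)) (fun z => dw z.1 z.2)).
      apply: (@continuous_comp _ _ _ (fun z => w z.1 z.2) trunc1); first exact: cw.
      exact: trunc1_continuous.
    apply: (@continuousB _ _ _ (fun z => dpsi z.1 z.2) (fun z => C * B z.1 z.2)).
      by apply: (sol_derive_continuous S); [exact: lt_le_trans s1|exact: le_lt_trans t2T].
    apply: (@continuousM _ _ (fun=> C) (fun z => B z.1 z.2)); first exact: cst_continuous.
    exact: cB.
  by apply: (@continuous_comp _ _ _ snd eta); [exact: cvg_snd|exact: ceta].
have [C1 C10 HC] := bounded_strip M (ltW (lt_trans t1t tt2)) cs.
apply: (@is_derive_Int R d (fun s x => trunc (w s x) * eta x) du t1 t2 t M C1).
- by rewrite in_itv/= t1t tt2.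
- move=> s x; rewrite in_itv/= => /andP[s1 s2].
  have h := is_derive_subf (sol_derive S x (lt_trans t10 s1) (lt_trans s2 t2T)) (is_derive_B s x).
  have := is_derive_scalef (eta x) (@is_derive_compf _ _ trunc (fun s => w s x) s 1 _ _
    (is_derive_trunc (w s x)) h).
  by apply: is_derive_ext => [z|]; rewrite mulrC.
- move=> s _; apply: continuous_mulf => //.
  by apply: (@slice_continuous _ _ (fun s x => trunc (w s x))) => x; exact: ct.
- by move=> s _; exact: supp_in_mulr.
- move=> s x; rewrite in_itv/= => /andP[s1 s2].
  have [xM|xM] := pselect (cube M x).
    by rewrite indicE mem_set// mulr1 HC// !ltW.
  by rewrite /du seta// mulr0 normr0 mulr_ge0// ltW.
Qed.

(** Convexity of [trunc] discards the gradient term, and [trunc1 w * w <= 4 * trunc w] handles the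
    zeroth-order one. The Laplacian is moved to the cutoff, and [trunc w <= psi ^+ 2] bounds what
    remains by [c * Ce * M0]. *)
Let dy_le (Ce t : R) : (forall x, `|laplacian eta x| <= Ce) -> 0 < t -> t < T ->
  Int (du t) <= 4 * Ca * y t + c * Ce * M0.
Proof.
move=> HCe t0 tT; have wC := w_class_C2 t0 tT.
have [tC tL] := class_C2_comp is_derive_trunc is_derive_trunc1 trunc2_continuous wC.
have cwt := class_C_continuous wC.
have ctt := class_C_continuous tC.
have i1 : itg (fun x => trunc (w t x) * eta x).
  by apply: (integrable_csupp (M := M)); [exact: continuous_mulf|exact: supp_in_mulr].
have i2 : itg (fun x => laplacian (fun x => trunc (w t x)) x * eta x).
  apply: (integrable_csupp (M := M)); last exact: supp_in_mulr.
  exact: continuous_mulf (class_C2_laplacian_continuous tC) ceta.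
have cdw : continuous (dw t).
  apply: (@slice_continuous _ _ dw) => x.
  apply: (@continuousB _ _ _ (fun z => dpsi z.1 z.2) (fun z => C * B z.1 z.2)).
    exact: (sol_derive_continuous S).
  apply: (@continuousM _ _ (fun=> C) (fun z => B z.1 z.2)); first exact: cst_continuous.
  exact: cB.
have i3 : itg (du t).
  apply: (integrable_csupp (M := M)); last exact: supp_in_mulr.
  apply: continuous_mulf ceta; apply: continuous_mulf cdw.
  exact: continuous_compf trunc1_continuous cwt.
have [isq sqM] := psi_sq t0 tT.
have tle x : trunc (w t x) <= psi t x ^+ 2.
  apply: trunc_le; last by rewrite ltW// (sol_gt0 S)// ltW.
  rewrite /w lerBlDr lerDl /B; rewrite !mulr_ge0 ?expR_ge0 ?(ltW K0)//.
  by rewrite ltW// decay_gt0.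
have i4 : itg (fun x => trunc (w t x)).
  apply: (itg_le _ _ isq); first exact: continuous_mfun.
  by move=> x; rewrite ger0_norm ?trunc_ge0.
have Ce0 : 0 <= Ce by rewrite (le_trans (normr_ge0 _) (HCe 0)).
apply: (@le_trans _ _ (Int (fun x => 4 * Ca * (trunc (w t x) * eta x) +
    c * (laplacian (fun x => trunc (w t x)) x * eta x)))).
  apply: Int_le => //; first by apply: itgD; exact: itgZ.
  move=> x; rewrite /du.
  have -> : 4 * Ca * (trunc (w t x) * eta x) + c * (laplacian (fun x => trunc (w t x)) x * eta x) =
    (Ca * (4 * trunc (w t x)) + c * laplacian (fun x => trunc (w t x)) x) * eta x by ring.
  rewrite ler_wpM2r//; have := tL x; set Lt := laplacian (fun x => trunc (w t x)) x => ->.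
  have h1 := ler_wpM2l (trunc1_ge0 (w t x)) (w_equation x t0 tT).
  have h2 : - (a t x * (trunc1 (w t x) * w t x)) <= Ca * (trunc1 (w t x) * w t x).
    rewrite -mulNr ler_wpM2r//; last by rewrite lerNl a_ge.
    have [w0|w0] := leP (w t x) 0; last by rewrite mulr_ge0 ?trunc1_ge0// ltW.
    by rewrite /trunc1 (max_r w0) expr0n/= !mul0r mulr0 mul0r.
  have h3 := ler_wpM2l Ca0 (trunc1_mul (w t x)).
  have h4 : 0 <= c * (trunc2 (w t x) * \sum_i partial i (w t) x ^+ 2).
    apply: mulr_ge0 (ltW c0) (mulr_ge0 (trunc2_ge0 _) _).
    by apply: sumr_ge0 => i _; exact: sqr_ge0.
  have -> : c * (trunc1 (w t x) * laplacian (w t) x + trunc2 (w t x) * \sum_i partial i (w t) x ^+ 2)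
    = trunc1 (w t x) * (c * laplacian (w t) x) + c * (trunc2 (w t x) * \sum_i partial i (w t) x ^+ 2).
    by ring.
  have e1 : trunc1 (w t x) * (c * laplacian (w t) x - a t x * w t x) =
    trunc1 (w t x) * (c * laplacian (w t) x) - a t x * (trunc1 (w t x) * w t x) by ring.
  rewrite e1 in h1; move: h1 h2 h3 h4 {e1}.
  move: (trunc1 (w t x) * dw t x) (trunc1 (w t x) * (c * _)) (c * (trunc2 _ * _)).
  move: (a t x * _) (Ca * (trunc1 _ * _)) (Ca * (4 * _)) => *; lra.
rewrite (IntD (itgZ (4 * Ca) i1) (itgZ c i2)) (IntZ (4 * Ca) i1) (IntZ c i2) -/(y t) lerD2l.
rewrite -mulrA ler_wpM2l ?(ltW c0)// -(green tC etaC seta).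
apply: (@le_trans _ _ (Int (fun x => Ce * trunc (w t x)))).
  apply: Int_le; [|exact: itgZ|].
    apply: (integrable_csupp (M := M)); last by apply: supp_in_mulr; exact: supp_in_laplacian.
    exact: continuous_mulf ctt (class_C2_laplacian_continuous etaC).
  by move=> x; rewrite mulrC ler_wpM2r ?trunc_ge0// (le_trans (ler_norm _)).
rewrite (IntZ Ce i4) ler_wpM2l// (le_trans _ sqM)//; exact: Int_le.
Qed.

Let y_le (Ce t : R) : (forall x, `|laplacian eta x| <= Ce) -> 0 < t -> t < T ->
  y t <= expR (4 * Ca * t) * (c * Ce * M0 * t).
Proof.
move=> HCe t0 tT; set D := c * Ce * M0.
have Ce0 : 0 <= Ce by rewrite (le_trans (normr_ge0 _) (HCe 0)).
have M00 : 0 <= M0.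
  by have [_] := psi_sq t0 tT; apply: le_trans; apply: Int_ge0 => x; exact: sqr_ge0.
have D0 : 0 <= D by rewrite !mulr_ge0// ltW.
have itvP0 (s : R) : s \in `]0, t[ -> 0 < s by rewrite in_itv/= => /andP[].
have itvPT (s : R) : s \in `]0, t[ -> s < T.
  by rewrite in_itv/= => /andP[_ st]; exact: lt_trans tT.
pose Y s := D * s - y s * expR (- (4 * Ca) * s).
have id1 (s : R) := @is_derive_id R R s 1.
have dY (s : R) : 0 < s -> s < T -> is_derive s 1 Y
    (D * 1 - (y s * (expR (- (4 * Ca) * s) * (- (4 * Ca) * 1)) +
      expR (- (4 * Ca) * s) * Int (du s))).
  move=> s0 sT; apply: (is_derive_subf (is_derive_scalef D (id1 s))).
  exact: (is_derive_mulf (is_derive_y s0 sT) (is_derive_expf (is_derive_scalef _ (id1 s)))).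
have dY' (s : R) (H : s \in `]0, t[) := dY s (itvP0 s H) (itvPT s H).
have H := @ge0_is_derive_le _ Y _ 0 t (ltW t0) dY'.
have Y0 : Y 0 = 0.
  rewrite /Y mulr0 sub0r; rewrite (_ : y 0 = 0) ?mul0r ?oppr0//.
  rewrite -[RHS](Int0 leb); apply: Int_eq => x.
  rewrite trunc_le0 ?mul0r// /w /B mulr0 expR0 mulr1 subr_le0//.
have : Y 0 <= Y t.
  apply: H => [s|].
    rewrite in_itv/= => /andP[s0 st]; have sT := lt_trans st tT.
    have dl := dy_le HCe s0 sT; have e0 := expR_ge0 (- (4 * Ca) * s).
    have e1 : expR (- (4 * Ca) * s) <= 1.
      by rewrite -expR0 ler_expR mulNr oppr_le0 !mulr_ge0// ltW.
    have := ler_wpM2l e0 dl; have := ler_wpM2r D0 e1; rewrite -/D.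
    move: (expR _) (Int (du s)) (y s) => e I v; nra.
  apply: continuous_subspaceT => s; apply: (@continuousB _ _ _ (fun s => D * s)
    (fun s => y s * expR (- (4 * Ca) * s))).
    by apply: (@continuousM _ _ (fun=> D) id); [exact: cst_continuous|exact: cvg_id].
  apply: (@continuousM _ _ y (fun s => expR (- (4 * Ca) * s))); first exact: cy.
  apply: (@continuous_comp _ _ _ (fun s => - (4 * Ca) * s) expR); last exact: continuous_expR.
  by apply: (@continuousM _ _ (fun=> - (4 * Ca)) id); [exact: cst_continuous|exact: cvg_id].
rewrite Y0 /Y subr_ge0 mulNr expRN ler_pdivrMr ?expR_gt0//.
by rewrite mulrC.
Qed.

Lemma cutoff_estimate (Ce t : R) : (forall x, `|laplacian (cutoff r) x| <= Ce) -> 0 < t -> t < T ->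
  itg (fun x => trunc (w t x) * cutoff r x) /\
  Int (fun x => trunc (w t x) * cutoff r x) <= expR (4 * Ca * t) * (c * Ce * M0 * t).
Proof.
move=> HCe t0 tT; split; last exact: y_le.
apply: (integrable_csupp (M := M)); last exact: supp_in_mulr.
apply: continuous_mulf ceta.
by apply: (@slice_continuous _ _ (fun s x => trunc (w s x))) => x; exact: ct.
Qed.

End cutoff_estimate.

(** No decay of [psi] at infinity is known beforehand, only a bound on the integral of its square,
    so the pointwise maximum principle is replaced by an integral estimate. The integral of
    [trunc (w t)] against the cutoff is of order [r^-2], whereas it stays away from 0 if [w t] is
    positive somewhere. *)
Lemma solution_decay t x : 0 <= t -> t < T -> psi t x <= K * expR (C * t) * decay k x.
Proof.
rewrite le_eqVlt => /predU1P[<- _|t0 tT]; first by rewrite mulr0 expR0 mulr1.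
rewrite -subr_le0 -/(B t x) -/(w t x) leNgt; apply/negP => w0.
have [Cl Cl0 HCl] := laplacian_cutoff_le.
have cb : continuous (fun x => trunc (w t x)).
  apply: continuous_compf; first exact: trunc_continuous.
  by apply: (@slice_continuous _ _ w) => z; exact: cw.
have b0 := trunc_gt0 w0; set b := trunc (w t x) in b0.
have /nbhs_ballP[e /= e0 He] : nbhs x [set z | b / 2 < trunc (w t z)].
  by apply: (cvgr_gt _ (cb x)); rewrite -/b ltr_pdivrMr// ltr_pMr// ltr1n.
have [Cd Cd0 HCd] := continuous_bounded_cube (bump_radius x e)
  (class_C_continuous (class_C_sqdist 0 (0 : 'rV[R]_d))).
have f0 : 0 < flat 0 (2^-1 : R) by rewrite flat_gt0.
pose L := b / 2 * flat 0 (2^-1 : R) * (2 * e) ^+ d.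
have L0 : 0 < L.
  rewrite /L; apply: mulr_gt0; last by rewrite exprn_gt0// mulr_gt0.
  by apply: mulr_gt0 => //; rewrite divr_gt0.
have M00 : 0 <= M0.
  by have [_] := psi_sq t0 tT; apply: le_trans; apply: Int_ge0 => z; exact: sqr_ge0.
pose D := expR (4 * Ca * t) * (c * Cl * M0 * t).
have D0 : 0 <= D by rewrite mulr_ge0 ?expR_ge0// !mulr_ge0// ltW.
(* Large enough for the cutoff to be at least [flat 0 (1 / 2)] near [x], and for the bound
   [D / r ^+ 2] to fall below [L]. *)
pose r := 1 + 2 * Cd + D / L.
have DL : 0 <= D / L by rewrite divr_ge0// ltW.
have r1 : 1 <= r by rewrite /r -addrA lerDl addr_ge0// mulr_ge0// ltW.
have r0 : 0 < r by exact: lt_le_trans r1.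
have r2 : r <= r ^+ 2 by rewrite expr2 ler_peMl// ltW.
have HCe z : `|laplacian (cutoff r) z| <= Cl * r^-1 ^+ 2 by exact: HCl.
have [ic Hc] := cutoff_estimate r0 HCe t0 tT.
have : L <= Int (fun z => trunc (w t z) * cutoff r z).
  apply: (@Int_ball_ge R d _ x e _ e0 _ ic) => //.
  - by rewrite mulr_ge0 ?flat_ge0// divr_ge0// ltW.
  - by move=> z; rewrite mulr_ge0 ?trunc_ge0// cutoffE// flat_ge0.
  - move=> z xz; apply: ler_pM; [by rewrite divr_ge0// ltW|exact: flat_ge0|
      exact: ltW (He z xz)|].
    have zc : cube (bump_radius x e) z.
      move=> i; have := ball_coord xz i; rewrite /bump_radius => h.
      have := ler_normB (x ord0 i) (x ord0 i - z ord0 i); rewrite subKr => /le_trans; apply.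
      rewrite lerD ?(ltW h)//.
      by rewrite (bigD1 i)//= lerDl sumr_ge0.
    rewrite cutoffE//; have q2 : 2^-1 <= bump_arg 0 r z.
      rewrite /bump_arg lerBrDr -lerBrDl.
      have zd : dot (z - 0) (z - 0) <= Cd by rewrite (le_trans (ler_norm _))// HCd.
      rewrite exprVn ler_pdivrMl ?exprn_gt0// (le_trans zd)//.
      have : 2 * Cd <= r ^+ 2 by apply: le_trans r2; rewrite /r; move: (D / L) DL => *; lra.
      by move=> *; lra.
    rewrite /flat invr_gt0 ltr0n (lt_le_trans _ q2) ?invr_gt0// !expr0 !mul1r.
    by rewrite ler_expR lerN2 lef_pV2 ?posrE// (lt_le_trans _ q2) ?invr_gt0.
move=> /le_trans/(_ Hc); apply/negP; rewrite -ltNge.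
have -> : expR (4 * Ca * t) * (c * (Cl * r^-1 ^+ 2) * M0 * t) = D / r ^+ 2.
  by rewrite /D exprVn; ring.
rewrite ltr_pdivrMr ?exprn_gt0// mulrC -ltr_pdivrMr//.
apply: lt_le_trans r2; rewrite /r; move: (D / L) DL => *; lra.
Qed.

End comparison.

(** * Barriers for the scheme *)

Section barriers.
Context {R : realType} {d : nat}.
Implicit Types (f g S : 'rV[R]_d -> R) (x y : 'rV[R]_d).

Lemma not_cube_dot (M : R) x : 0 <= M -> ~ cube M x -> M ^+ 2 <= dot x x.
Proof.
move=> M0 /existsNP[i /negP]; rewrite -ltNge => Mx.
apply: le_trans (coord_le_dot x i).
by rewrite -[leRHS]real_normK ?num_real// lerXn2r ?nnegrE// ltW.
Qed.

(** The quotient [f / g] attains over the cube a maximum that exceeds 1; outside it is at most 1, so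
    the maximum is global. The conclusion avoids division, in the form used by the touching
    lemmas. *)
Lemma max_ratio f g (M : R) y0 : continuous f -> continuous g -> (forall x, 0 < g x) ->
  (forall y, ~ cube M y -> f y <= g y) -> g y0 < f y0 ->
  exists x, g x < f x /\ forall y, f y * g x <= f x * g y.
Proof.
move=> cf cg g0 out fg.
have y0M : cube M y0 by apply: contrapT => /out; rewrite leNgt fg.
have cr : continuous (fun x => f x * (g x)^-1) by exact: continuous_mulf (continuous_invf cg g0).
have [x] := compact_EVT_max (ex_intro _ y0 y0M) (@compact_cube R d M) (continuous_subspaceT cr).
rewrite inE => xM H.
have gx : g x < f x.
  have := H y0; rewrite inE => /(_ y0M) h.
  by rewrite -(mul1r (g x)) -ltr_pdivlMr// (lt_le_trans _ h)// ltr_pdivlMr// mul1r.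
exists x; split=> // y; have [yM|yM] := pselect (cube M y).
  have := H y; rewrite inE => /(_ yM).
  by rewrite ler_pdivrMr// mulrAC ler_pdivlMr.
apply: (@le_trans _ _ (g y * g x)); first by rewrite ler_pM2r// out.
by rewrite mulrC ler_pM2r// ltW.
Qed.

Lemma laplacian_bracket x : laplacian (@bracket R d) x = 2 * d%:R.
Proof.
rewrite /laplacian (eq_bigr (fun=> 2)); first by rewrite sumr_const card_ord mulr_natr.
move=> i _; rewrite (partialE (is_derive_bracket i)).
have := is_derive_scalef 2 (is_derive_coord i i x).
by rewrite eqxx mulr1 => -[_ e]; rewrite [LHS]e.
Qed.

Definition gauss (A : R) x : R := expR (- A * dot x x).

Lemma gauss_gt0 A x : 0 < gauss A x. Proof. exact: expR_gt0. Qed.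

Lemma is_derive_gauss A i x : is_derive x (delta_mx ord0 i) (gauss A)
  (- (2 * A) * (x ord0 i * gauss A x)).
Proof.
have h := is_derive_expf (is_derive_scalef (- A) (is_derive_sqdist i 0 x)).
apply: is_derive_ext h => [y|]; rewrite ?subr0// mxE subr0 /gauss; ring.
Qed.

Lemma continuous_gauss A : continuous (gauss A).
Proof.
move=> x; apply: (@continuous_comp _ _ _ (fun x => - A * dot x x) expR); last exact: continuous_expR.
have cd : continuous (fun x : 'rV[R]_d => dot x x).
  have := class_C_continuous (class_C_sqdist 0 (0 : 'rV[R]_d)).
  by under eq_fun do rewrite subr0; exact.
by apply: continuous_mulf x => // x; exact: cst_continuous.
Qed.

Lemma class_C_gauss n A : class_C n (gauss A).
Proof.
elim: n => [|n IHn]; first by split=> //; exact: continuous_gauss.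
apply: (@class_CS _ _ n (gauss A) (fun i x => - (2 * A) * (x ord0 i * gauss A x))
  (@continuous_gauss A) (fun i x => is_derive_gauss A i x)) => i.
exact: class_C_scale (class_C_mul (class_C_coord n i) IHn).
Qed.

Lemma laplacian_gauss A x : laplacian (gauss A) x =
  (4 * A ^+ 2 * dot x x - 2 * A * d%:R) * gauss A x.
Proof.
rewrite /laplacian.
transitivity (\sum_(i < d) (4 * A ^+ 2 * (x ord0 i * x ord0 i) * gauss A x - 2 * A * gauss A x)).
  apply: eq_bigr => i _; rewrite (partialE (is_derive_gauss A i)).
  have := is_derive_scalef (- (2 * A)) (is_derive_mulf
    (is_derive_coord i i x) (is_derive_gauss A i x)).
  by move=> [_ e]; rewrite [LHS]e eqxx /=; ring.
rewrite sumrB sumr_const card_ord -mulr_natr /dot mulr_sumr mulrBl mulr_suml; congr (_ - _).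
ring.
Qed.

(** The bound in [scheme_bounded] is qualitative and depends on the index: it serves to localize
    maxima before any uniform estimate is known. *)
Record scheme_solution (c h : R) (phi b : nat -> 'rV[R]_d -> R) : Prop := SchemeSolution {
  scheme_continuous : forall i, continuous (phi i);
  scheme_gt0 : forall i x, 0 < phi i x;
  scheme_bounded : forall i, exists B : R, forall x, phi i x <= B;
  scheme_coef_continuous : forall i, continuous (b i.+1);
  scheme_equation : forall i, weak_laplacian (phi i.+1) (fun x => c^-1 *
    (phi i.+1 x * (h^-1 * ln (phi i.+1 x / phi i x) + b i.+1 x))) }.

Variables (c h : R) (phi b : nat -> 'rV[R]_d -> R).
Hypotheses (c0 : 0 < c) (h0 : 0 < h).
Hypothesis P : scheme_solution c h phi b.

Let ck i : continuous (fun x => c^-1 *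
  (phi i.+1 x * (h^-1 * ln (phi i.+1 x / phi i x) + b i.+1 x))).
Proof.
have cc (k : R) : continuous (fun _ : 'rV[R]_d => k) by move=> x; exact: cst_continuous.
have p0 := scheme_gt0 P; have cp := scheme_continuous P.
apply: (continuous_mulf (cc _)); apply: (continuous_mulf (cp _)).
apply: continuous_addf; last exact: (scheme_coef_continuous P).
apply: (continuous_mulf (cc _)) => x.
apply: (@continuous_comp _ _ _ (fun x => phi i.+1 x * (phi i x)^-1) (@ln R)).
  exact: continuous_mulf (continuous_invf (cp i) (p0 i)) x.
by apply: continuous_ln; rewrite divr_gt0.
Qed.

(** The multiple of [S] by [phi i.+1 x / S x] touches [phi i.+1] from above at [x]; dividing the
    resulting inequality by this factor leaves [S x] in front. *)
Lemma scheme_touching_above i S x : class_C 2 S -> 0 < S x ->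
  (forall y, phi i.+1 y * S x <= phi i.+1 x * S y) ->
  S x * (h^-1 * ln (phi i.+1 x / phi i x) + b i.+1 x) <= c * laplacian S x.
Proof.
move=> SC S0 H; have p0 := scheme_gt0 P i.+1 x.
pose rho := phi i.+1 x / S x; have r0 : 0 < rho by rewrite divr_gt0.
have := touching_above (S := fun y => rho * S y) (scheme_continuous P (i := i.+1)) (@ck i)
  (class_C_scale rho SC) (scheme_equation P i) ltr01.
move=> /(_ x); rewrite (laplacian_scale rho x SC) => /(_ _) T.
rewrite -(ler_pM2l (mulr_gt0 (_ : 0 < c^-1) r0)) ?invr_gt0//.
rewrite [leRHS](_ : _ = rho * laplacian S x); last by field; rewrite gt_eqF.
rewrite [leLHS](_ : _ = c^-1 * (phi i.+1 x * (h^-1 * ln (phi i.+1 x / phi i x) + b i.+1 x))).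
  apply: T => y _; rewrite /rho divfK ?gt_eqF// subrr subr_le0 mulrAC ler_pdivlMr//.
by rewrite /rho; move: (_ + _) => z; field; rewrite !gt_eqF.
Qed.

Lemma scheme_touching_below i S x : class_C 2 S -> 0 < S x ->
  (forall y, S y * phi i.+1 x <= S x * phi i.+1 y) ->
  c * laplacian S x <= S x * (h^-1 * ln (phi i.+1 x / phi i x) + b i.+1 x).
Proof.
move=> SC S0 H; have p0 := scheme_gt0 P i.+1 x.
pose rho := phi i.+1 x / S x; have r0 : 0 < rho by rewrite divr_gt0.
have := touching_below (S := fun y => rho * S y) (scheme_continuous P (i := i.+1)) (@ck i)
  (class_C_scale rho SC) (scheme_equation P i) ltr01.
move=> /(_ x); rewrite (laplacian_scale rho x SC) => /(_ _) T.
rewrite -(ler_pM2l (mulr_gt0 (_ : 0 < c^-1) r0)) ?invr_gt0//.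
rewrite [leLHS](_ : _ = rho * laplacian S x); last by field; rewrite gt_eqF.
rewrite [leRHS](_ : _ = c^-1 * (phi i.+1 x * (h^-1 * ln (phi i.+1 x / phi i x) + b i.+1 x))).
  apply: T => y _; rewrite /rho divfK ?gt_eqF// subrr subr_ge0 mulrAC ler_pdivrMr//.
  by rewrite mulrC [leRHS]mulrC.
by rewrite /rho; move: (_ + _) => z; field; rewrite !gt_eqF.
Qed.

(** Induction on the index. A small multiple of [bracket] is added to the barrier so that the
    quotient attains its maximum although [phi i.+1] is only known to be bounded. There the discrete
    logarithmic derivative is at least [C] by the induction hypothesis, which the bounds on the
    coefficient and on the Laplacian of the barrier exclude. *)
Lemma scheme_upper_barrier (Cb K : R) k : 0 <= Cb -> 0 < K ->
  (forall i x, - Cb <= b i.+1 x) -> (forall x, phi 0%N x <= K * decay k x) ->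
  let C := Cb + c * (2 * k%:R * (d%:R + 2 * k.+1%:R) + 2 * d%:R) + 1 in
  forall i x, phi i x <= K * expR (C * (i%:R * h)) * decay k x.
Proof.
move=> Cb0 K0 bl p0 C; set Ck := 2 * k%:R * (d%:R + 2 * k.+1%:R) in C *.
elim=> [|i IHi] x; first by rewrite mul0r mulr0 expR0 mulr1.
pose E := K * expR (C * (i.+1%:R * h)).
have E0 : 0 < E by rewrite mulr_gt0 ?expR_gt0.
have [B HB] := scheme_bounded P i.+1.
rewrite -/E; apply/ler_addgt0Pr => e' e'0.
(* Chosen so that the added term equals the prescribed [e'] at [x]. *)
have e0 : 0 < e' / bracket x by rewrite divr_gt0 ?bracket_gt0.
set e := e' / bracket x in e0.
have -> : e' = e * bracket x by rewrite /e divfK// gt_eqF// bracket_gt0.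
pose S y := E * decay k y + e * bracket y.
rewrite -/(S x) leNgt; apply/negP => Sx.
have SC : class_C 2 S by apply: class_C_lin; [exact: class_C_decay|exact: class_C_bracket].
have S0 y : 0 < S y by rewrite addr_gt0// mulr_gt0 ?decay_gt0 ?bracket_gt0.
pose M := 1 + `|B| / e.
have M1 : 1 <= M by rewrite lerDl divr_ge0// ltW.
have out y : ~ cube M y -> phi i.+1 y <= S y.
  move=> /(not_cube_dot (le_trans ler01 M1)) yM.
  rewrite (le_trans (HB y))// (le_trans (ler_norm _))// /S.
  apply: (@le_trans _ _ (e * bracket y)); last by rewrite lerDr mulr_ge0// ltW// decay_gt0.
  rewrite mulrC -ler_pdivrMr// (@le_trans _ _ M)//; first by rewrite lerDr.
  rewrite (@le_trans _ _ (M ^+ 2))//; first by rewrite expr2 ler_peMr// (le_trans ler01).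
  by rewrite (le_trans yM)// lerDr.
have [z [Sz H]] := max_ratio (scheme_continuous P (i := i.+1)) (class_C_continuous SC) S0 out Sx.
have := scheme_touching_above SC (S0 z) H.
apply/negP; rewrite -ltNge.
have Ck0 : 0 <= Ck.
  by rewrite /Ck; apply: mulr_ge0; [exact: mulr_ge0|apply: addr_ge0 => //; exact: mulr_ge0].
have lS : laplacian S z <= (Ck + 2 * d%:R) * S z.
  rewrite laplacian_lin; [|exact: class_C_decay|exact: class_C_bracket].
  rewrite laplacian_bracket /S (mulrDl Ck) (mulrDr Ck) (mulrDr (2 * d%:R)).
  have h1 : E * laplacian (decay k) z <= Ck * (E * decay k z).
    rewrite mulrCA ler_wpM2l ?(ltW E0)//.
    by rewrite (le_trans (ler_norm _))// laplacian_decay_le.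
  have h2 : e * (2 * d%:R) <= 2 * d%:R * (e * bracket z).
    by rewrite [leRHS]mulrCA ler_wpM2l ?(ltW e0)// ler_peMr// bracket_ge1.
  have h3 : 0 <= Ck * (e * bracket z).
    by rewrite mulr_ge0// mulr_ge0 ?(ltW e0) ?(ltW (bracket_gt0 z)).
  have h4 : 0 <= 2 * d%:R * (E * decay k z).
    by apply: mulr_ge0; [exact: mulr_ge0|rewrite mulr_ge0 ?(ltW E0)// ltW// decay_gt0].
  move: h1 h2 h3 h4; move: (E * laplacian _ _) (Ck * (E * _)) (e * (2 * _)) (2 * d%:R * (e * _)).
  by move: (Ck * (e * _)) (2 * d%:R * (E * _)) => *; lra.
have lnC : C <= h^-1 * ln (phi i.+1 z / phi i z).
  rewrite ler_pdivlMl// -ler_expR lnK ?posrE ?divr_gt0 ?(scheme_gt0 P)//.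
  rewrite ler_pdivlMr ?(scheme_gt0 P)//.
  apply: (@le_trans _ _ (E * decay k z)); last first.
    by rewrite (le_trans _ (ltW Sz))// /S lerDl mulr_ge0 ?(ltW e0)// ltW// bracket_gt0.
  rewrite (_ : E * decay k z = expR (h * C) * (K * expR (C * (i%:R * h)) * decay k z)).
    by rewrite ler_pM2l ?expR_gt0.
  rewrite /E -natr1 (_ : C * _ = h * C + C * (i%:R * h)); last by ring.
  by rewrite expRD; ring.
apply: le_lt_trans (ler_wpM2l (ltW c0) lS) _.
rewrite mulrA [_ * S z]mulrC ltr_pM2l//.
have := bl i z; move: lnC; rewrite /C; move: (h^-1 * _) (b i.+1 z) (c * _) => *; lra.
Qed.

(** The barrier is a Gaussian minus a small constant, hence negative at infinity. The condition
    [Cu <= 4 * c * A ^+ 2] lets the factor [4 * A ^+ 2 * |x|^2] in the Laplacian of the Gaussian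
    compensate the quadratic growth of the coefficient. *)
Lemma scheme_lower_barrier (Cu c1 A : R) : 0 <= Cu -> 0 < c1 -> 0 < A -> Cu <= 4 * c * A ^+ 2 ->
  (forall i x, b i.+1 x <= Cu * bracket x) -> (forall x, c1 * gauss A x <= phi 0%N x) ->
  let D := Cu + 6 * c * A * d%:R + 1 in
  forall i x, expR (- D * (i%:R * h)) * (c1 * gauss A x) <= phi i x.
Proof.
move=> Cu0 c10 A0 CuA bu p0 D.
(* Where the Laplacian of the Gaussian is negative, [|x|^2] is below [d / (2 A)] and the Gaussian
   above [expR (- d / 2)]; for [e <= e0] the subtracted constant is then at most half of it. *)
pose e0 := c1 * expR (- d%:R / 2) / 2.
have e00 : 0 < e0 by rewrite divr_gt0// mulr_gt0// expR_gt0.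
suff H e : 0 < e -> e <= e0 ->
    forall i x, expR (- D * (i%:R * h)) * (c1 * gauss A x - e) <= phi i x.
  move=> i x; set E := expR _; have E0 : 0 < E by exact: expR_gt0.
  rewrite leNgt; apply/negP => lt.
  pose gap := c1 * gauss A x - phi i x / E.
  have gap0 : 0 < gap by rewrite subr_gt0 ltr_pdivrMr// mulrC.
  have m0 : 0 < Num.min e0 (gap / 2) by rewrite lt_min e00 divr_gt0.
  have m1 : Num.min e0 (gap / 2) <= e0 by rewrite ge_min lexx.
  have := H _ m0 m1 i x; rewrite -/E mulrC -ler_pdivlMr//.
  have m2 : Num.min e0 (gap / 2) <= gap / 2 by rewrite ge_min lexx orbT.
  move: m2 gap0; rewrite /gap; move: (c1 * gauss A x) (phi i x / E) (Num.min _ _) => *; lra.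
move=> ep ee0; elim=> [|i IHi] x.
  rewrite mul0r mulr0 expR0 mul1r (le_trans _ (p0 x))// gerBl ltW//.
pose E := expR (- D * (i.+1%:R * h)); have E0 : 0 < E by exact: expR_gt0.
pose S y := E * c1 * gauss A y + (- (E * e)) * 1.
have SE y : S y = E * (c1 * gauss A y - e) by rewrite /S; ring.
rewrite -/E -SE leNgt; apply/negP => Sx.
have SC : class_C 2 S by apply: class_C_lin; [exact: class_C_gauss|exact: class_C_cst].
pose M := 1 + c1 / (e * A).
have eA : 0 < e * A by rewrite mulr_gt0.
have M1 : 1 <= M by rewrite lerDl divr_ge0// ltW.
have out y : ~ cube M y -> S y <= phi i.+1 y.
  move=> /(not_cube_dot (le_trans ler01 M1)) yM.
  rewrite (@le_trans _ _ 0) ?(ltW (scheme_gt0 P _ _))// SE pmulr_rle0// subr_le0.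
  rewrite /gauss mulNr expRN ler_pdivrMr ?expR_gt0//.
  apply: (@le_trans _ _ (e * (1 + A * dot y y))); last by rewrite ler_pM2l// expR_ge1Dx.
  apply: (@le_trans _ _ (e * (A * M ^+ 2))); last first.
    by rewrite ler_pM2l// (@le_trans _ _ (A * dot y y)) ?ler_pM2l// lerDr.
  rewrite mulrA -ler_pdivrMl// [_^-1 * _]mulrC (@le_trans _ _ M)//; first by rewrite lerDr.
  by rewrite expr2 ler_peMr// (le_trans ler01).
have [z [Sz H]] := max_ratio (class_C_continuous SC) (scheme_continuous P (i := i.+1))
  (scheme_gt0 P i.+1) out Sx.
have S0 : 0 < S z by exact: lt_trans (scheme_gt0 P _ _) Sz.
have := scheme_touching_below SC S0 H.
apply/negP; rewrite -ltNge.
pose Q := E * c1 * gauss A z.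
have Q0 : 0 < Q by rewrite !mulr_gt0// gauss_gt0.
have QS : S z <= Q by rewrite /S gerDl mulr1 oppr_le0 ltW// mulr_gt0.
have lS : laplacian S z = (4 * A ^+ 2 * dot z z - 2 * A * d%:R) * Q.
  rewrite laplacian_lin; [|exact: class_C_gauss|exact: class_C_cst].
  have -> : laplacian (fun _ : 'rV[R]_d => 1) z = 0.
    have pc (i0 : 'I_d) (k : R) : partial i0 (fun _ : 'rV[R]_d => k) = fun=> 0.
      by apply: partialE => y; exact: is_derive_cstf.
    by rewrite /laplacian big1// => i0 _; rewrite !pc.
  by rewrite mulr0 addr0 laplacian_gauss /Q; ring.
have lnC : h^-1 * ln (phi i.+1 z / phi i z) <= - D.
  rewrite ler_pdivrMl// -ler_expR lnK ?posrE ?divr_gt0 ?(scheme_gt0 P)//.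
  rewrite ler_pdivrMr ?(scheme_gt0 P)// (le_trans (ltW Sz))//.
  rewrite (_ : S z = expR (h * - D) * (expR (- D * (i%:R * h)) * (c1 * gauss A z - e))).
    by rewrite ler_pM2l ?expR_gt0.
  rewrite SE /E -natr1 (_ : - D * (_ * h) = h * - D + - D * (i%:R * h)); last by ring.
  by rewrite expRD mulrA.
rewrite lS; have bz := bu i z.
have dz := dot_ge0 z; rewrite /bracket in bz.
apply: (@le_lt_trans _ _ (S z * (- D + Cu * (1 + dot z z)))).
  by rewrite ler_pM2l// lerD.
have d0 : 0 <= d%:R :> R by [].
have cA : 0 < c * A by rewrite mulr_gt0.
have CuD : Cu * dot z z <= 4 * c * A ^+ 2 * dot z z by rewrite ler_wpM2r.
have cAd : 0 <= c * A * d%:R by rewrite mulr_ge0// ltW.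
have CuD' : - D + Cu * (1 + dot z z) < 4 * c * A ^+ 2 * dot z z - 6 * (c * A * d%:R).
  have -> : D = Cu + 6 * (c * A * d%:R) + 1 by rewrite /D; ring.
  by rewrite mulrDr mulr1; move: CuD; move: (Cu * dot z z) (_ * dot z z) (c * A * _) => *; lra.
(* The Gaussian part [Q] of the barrier exceeds [S z]. Where its Laplacian is nonnegative this goes
   in the right direction; elsewhere [Q <= 2 * S z] is used, and the constant 6 in [D] leaves room
   for the factor 2. *)
case: (leP (2 * A * d%:R) (4 * A ^+ 2 * dot z z)) => hc.
  have h1 : (4 * A ^+ 2 * dot z z - 2 * A * d%:R) * S z <=
      (4 * A ^+ 2 * dot z z - 2 * A * d%:R) * Q by rewrite ler_wpM2l// subr_ge0.
  apply: lt_le_trans (ler_wpM2l (ltW c0) h1).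
  rewrite mulrA [_ * S z]mulrC ltr_pM2l// (lt_le_trans CuD')//.
  rewrite mulrBr lerB//; first by rewrite !mulrA [c * 4]mulrC.
  have -> : c * (2 * A * d%:R) = 2 * (c * A * d%:R) by ring.
  by rewrite ler_wpM2r// ler_nat.
have Q2 : Q <= 2 * S z.
  have -> : 2 * S z = E * (2 * (c1 * gauss A z - e)) by rewrite SE; ring.
  rewrite /Q -mulrA ler_pM2l//.
  have ge : expR (- d%:R / 2) <= gauss A z.
    rewrite ler_expR !mulNr lerN2 ler_pdivlMr//.
    have : 2 * A * (2 * A * dot z z) < 2 * A * d%:R.
      by rewrite (_ : 2 * A * (2 * A * dot z z) = 4 * A ^+ 2 * dot z z)//; ring.
    rewrite ltr_pM2l ?mulr_gt0// => /ltW; apply: le_trans.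
    by rewrite le_eqVlt; apply/orP; left; apply/eqP; ring.
  have := ler_wpM2l (ltW c10) ge; move: ee0; rewrite /e0.
  by move: (c1 * expR _) (c1 * gauss A z) => *; lra.
have h2 : - (2 * A * d%:R) * (2 * S z) <= (4 * A ^+ 2 * dot z z - 2 * A * d%:R) * Q.
  have Ad : 0 <= 2 * A * d%:R by rewrite !mulr_ge0// ltW.
  apply: (@le_trans _ _ (- (2 * A * d%:R) * Q)).
    by rewrite !mulNr lerN2 ler_wpM2l.
  by rewrite ler_wpM2r ?(ltW Q0)// lerDr mulr_ge0// mulr_ge0// sqr_ge0.
apply: lt_le_trans (ler_wpM2l (ltW c0) h2).
have -> : c * (- (2 * A * d%:R) * (2 * S z)) = S z * (- (4 * (c * A * d%:R))) by ring.
rewrite ltr_pM2l// (lt_le_trans CuD')//.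
have : 4 * c * A ^+ 2 * dot z z <= 2 * (c * A * d%:R).
  have := ler_wpM2l (ltW c0) (ltW hc).
  rewrite (_ : c * (4 * _ * _) = 4 * c * A ^+ 2 * dot z z); last by ring.
  by rewrite (_ : c * (2 * _ * _) = 2 * (c * A * d%:R)); last by ring.
by move: (_ * dot z z) (c * A * _) => *; lra.
Qed.

End barriers.

(** * Doubling of the time variable *)

Section max_family.
Context {R : realType} {d : nat}.

Lemma max_family (f : nat -> R * 'rV[R]_d -> R) (K : set (R * 'rV[R]_d)) n :
  (forall i, continuous (f i)) -> compact K -> K !=set0 ->
  exists i z, [/\ (i <= n)%N, K z & forall j w, (j <= n)%N -> K w -> f j w <= f i z].
Proof.
move=> cf cK K0; elim: n => [|n [i [z [ni Kz H]]]].
  have [z] := compact_EVT_max K0 cK (continuous_subspaceT (cf 0%N)).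
  rewrite inE => Kz H; exists 0%N, z; split=> // j w; rewrite leqn0 => /eqP -> Kw.
  by apply: H; rewrite inE.
have [z'] := compact_EVT_max K0 cK (continuous_subspaceT (cf n.+1)).
rewrite inE => Kz' H'.
have [le|lt] := leP (f n.+1 z') (f i z).
  exists i, z; split=> //; first exact: leqW.
  move=> j w; rewrite leq_eqVlt => /predU1P[->|jn] Kw; last exact: H.
  by apply: le_trans le; apply: H'; rewrite inE.
exists n.+1, z'; split=> // j w; rewrite leq_eqVlt => /predU1P[->|jn] Kw.
  by apply: H'; rewrite inE.
by apply: ltW; apply: le_lt_trans lt; exact: H.
Qed.

End max_family.

(** At a maximum point, [p] and [w] are the values of [psi] and of the weight, [Lp] and [Lw] their
    Laplacians, [th] the time slope of the penalty and [l] the discrete logarithmic derivative. The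
    hypotheses express maximality in space, in time and in the index, and the bound on the
    difference of the coefficients; [th] cancels. *)
Lemma doubling_arith (R : realType) (c Lp Lw p z w a Kz th th' Cz l b nb : R) :
  c * (Lp - z * Lw) <= (p - z * w) * (l + b) ->
  (p - z * w) * th <= c * Lp - a * p - Kz * z * w ->
  (p - z * w) * l <= (p - z * w) * (th - Cz) ->
  (p - z * w) * (b - a) <= (p - z * w) * nb ->
  0 <= (p - z * w) * (nb - Cz) + z * (c * Lw - (a + Kz) * w).
Proof. nra. Qed.

Lemma doubling_arith_upper (R : realType) (c Lp Lw p z w a Kz th Cz l b nb : R) :
  (p + z * w) * (l + b) <= c * (Lp + z * Lw) ->
  c * Lp - a * p + Kz * z * w <= - ((p + z * w) * th) ->
  (p + z * w) * - (th - Cz) <= (p + z * w) * l ->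
  (p + z * w) * (a - b) <= (p + z * w) * nb ->
  0 <= (p + z * w) * (nb - Cz) + z * (c * Lw - (a + Kz) * w).
Proof. nra. Qed.

Section doubling.
Context {R : realType} {d : nat}.
Implicit Types (x y : 'rV[R]_d) (t s : R).

Variables (c T A : R) (psi dpsi a : R -> 'rV[R]_d -> R).
Hypothesis S : parabolic_solution c T A psi dpsi a (fun=> 0).
Variables (h : R) (phi b : nat -> 'rV[R]_d -> R).
Hypotheses (c0 : 0 < c) (h0 : 0 < h) (P : scheme_solution c h phi b).
Variables (T' K0 Cs eps Kz tau delta Cz M : R) (n : nat).
Hypotheses (T'0 : 0 < T') (T'T : T' < T) (K0_gt0 : 0 < K0) (Cs0 : 0 <= Cs) (eps0 : 0 < eps)
  (Kz0 : 0 <= Kz) (tau0 : 0 < tau) (delta0 : 0 < delta) (Cz0 : 0 <= Cz) (M0 : 0 <= M).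
Hypothesis nT : n%:R * h <= T'.

Let W : 'rV[R]_d -> R := decay d.
Let z t := eps * expR (Kz * t).
Let W0 x : 0 < W x. Proof. exact: decay_gt0. Qed.
Let z0 t : 0 < z t. Proof. by rewrite mulr_gt0// expR_gt0. Qed.
Let z_le s t : s <= t -> z s <= z t.
Proof. by move=> st; rewrite ler_pM2l// ler_expR ler_wpM2l. Qed.
Let z_ge_eps t : 0 <= t -> eps <= z t.
Proof. by move=> t0; rewrite ler_peMr ?(ltW eps0)// ge1_expR// mulr_ge0. Qed.

Hypothesis z_le1 : forall t, 0 <= t -> t <= T' -> z t <= 1.
Hypothesis init : phi 0%N = psi 0.
Hypothesis phi_le : forall i x, (i <= n)%N -> phi i x <= K0 * decay d.+1 x.
Hypothesis psi_le : forall t x, 0 <= t -> t <= T' -> psi t x <= K0 * decay d.+1 x.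
(** Says that [z W] is a strict supersolution, with room for a perturbation of the coefficient of
    size [3 * Cs * z t * enorm x] acting on a function below [psi + W]. *)
Hypothesis rate : forall t x, 0 < t -> t <= T' ->
  3 * Cs * enorm x * psi t x + 3 * Cs * enorm x * W x + c * laplacian W x <
  (a t x + Kz) * W x.
Hypothesis far : forall x, ~ cube M x -> K0 * decay d.+1 x <= eps * W x.
Hypothesis near_Cz : forall x, cube M x -> 2 * Cs * K0 * enorm x < Cz.
Hypothesis penalty_lower : forall i t x, (i <= n)%N -> 0 <= t -> t <= T' -> cube M x ->
  psi t x <= phi i x * expR (tau ^+ 2 / delta).
Hypothesis penalty_upper : K0 <= eps * expR (tau ^+ 2 / delta).
Hypothesis modulus : forall s t x, 0 <= s -> s <= T' -> 0 <= t -> t <= T' ->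
  `|t - s| <= 2 * tau -> `|psi t x - psi s x| <= eps * W x.
Hypothesis stability : forall i t (dlt : R), (0 < i <= n)%N -> 0 < t -> t <= T' -> 0 <= dlt ->
  (forall x, `|phi i x - psi t x| <= dlt * W x) ->
  forall x, `|b i x - a t x| <= Cs * dlt * enorm x.
Hypothesis previous : forall j x, (0 < j < n)%N ->
  `|phi j x - psi (j%:R * h) x| <= 2 * z (j%:R * h) * W x.

(** A penalty below [tau ^+ 2 / delta] forces [t > i h], by the shift [tau]. The term [h * (i h)]
    corrects the discretization of the square, so that consecutive penalties differ by exactly [h]
    times the time slope. The last index, where closeness is not yet known, carries the extra cost
    [h * Cz]. *)
Definition penalty (i : nat) (t : R) : R :=
  ((t - tau - i%:R * h) ^+ 2 + h * (i%:R * h)) / delta + (i == n)%:R * (h * Cz).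

Let penalty_ge i t : (t - tau - i%:R * h) ^+ 2 / delta <= penalty i t.
Proof.
have dV : 0 <= delta^-1 by rewrite invr_ge0 ltW.
have hz : 0 <= h * Cz by rewrite mulr_ge0// ltW.
have -> : penalty i t = (t - tau - i%:R * h) ^+ 2 / delta +
  (h * (i%:R * h) / delta + (i == n)%:R * (h * Cz)) by rewrite /penalty; ring.
by rewrite lerDl addr_ge0// mulr_ge0// mulr_ge0 ?(ltW h0)// mulr_ge0// ltW.
Qed.

Let penalty_ge0 i t : 0 <= penalty i t.
Proof. by rewrite (le_trans _ (penalty_ge i t))// divr_ge0 ?sqr_ge0// ltW. Qed.

Let slope i t : R := 2 * (t - tau - i%:R * h) / delta.

Let penaltyS i t : (i < n)%N -> penalty i t - penalty i.+1 t =
  h * (slope i.+1 t - (i.+1 == n)%:R * Cz).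
Proof.
move=> ni; rewrite /penalty /slope (ltn_eqF ni) /= mulr0n -natr1.
by move: (_ == n)%:R => e; field; rewrite gt_eqF.
Qed.

Let is_derive_penalty i (t : R) : is_derive t 1 (penalty i) (slope i t).
Proof.
have id1 := @is_derive_id R R t 1.
have k1 (k : R) := is_derive_cstf k t (1 : R).
have h1 := is_derive_powf 2 (is_derive_subf (is_derive_subf id1 (k1 tau)) (k1 (i%:R * h))).
have h2 := is_derive_scalef delta^-1 (is_derive_addf h1 (k1 (h * (i%:R * h)))).
have := is_derive_addf h2 (k1 ((i == n)%:R * (h * Cz))).
apply: is_derive_ext => [s|]; first by rewrite /penalty [_ / delta]mulrC.
by rewrite /slope /= expr1; ring.
Qed.

Let continuous_penalty i : continuous (penalty i).
Proof. by move=> t; exact: is_derive_continuous1 (is_derive_penalty i t). Qed.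

Let localized i t : penalty i t < tau ^+ 2 / delta -> i%:R * h < t /\ t - i%:R * h <= 2 * tau.
Proof.
move/(le_lt_trans (penalty_ge i t)); rewrite ltr_pM2r ?invr_gt0// => H.
have : `|t - tau - i%:R * h| < tau.
  by rewrite -ltr_sqr ?nnegrE ?(ltW tau0)// real_normK ?num_real.
by rewrite ltr_norml => /andP[h1 h2]; split; lra.
Qed.

Let K : set (R * 'rV[R]_d) := [set` `[0%R, T']%R] `*` cube M.
Let cK : compact K.
Proof. by apply: compact_setX; [exact: segment_compact|exact: compact_cube]. Qed.

Let cpsi : continuous (fun w : R * 'rV[R]_d => psi w.1 w.2).
Proof. exact: (sol_continuous S). Qed.
Let cz : continuous (fun w : R * 'rV[R]_d => z w.1 * W w.2).
Proof.
move=> w; apply: (@continuousM _ _ (fun w : R * 'rV[R]_d => z w.1) (fun w => W w.2)).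
  apply: (@continuousM _ _ (fun=> eps) (fun w : R * 'rV[R]_d => expR (Kz * w.1))).
    exact: cst_continuous.
  apply: (@continuous_comp _ _ _ (fun w : R * 'rV[R]_d => Kz * w.1) expR).
    apply: (@continuousM _ _ (fun=> Kz) fst); [exact: cst_continuous|exact: cvg_fst].
  exact: continuous_expR.
by apply: (@continuous_comp _ _ _ snd W); [exact: cvg_snd|exact: continuous_decay].
Qed.
Let cphi i : continuous (fun w : R * 'rV[R]_d => phi i w.2).
Proof.
move=> w; apply: (@continuous_comp _ _ _ snd (phi i)); first exact: cvg_snd.
exact: (scheme_continuous P).
Qed.
Let cpen i : continuous (fun w : R * 'rV[R]_d => expR (- penalty i w.1)).
Proof.
move=> w; apply: (@continuous_comp _ _ _ (fun w => - penalty i w.1) expR); last exact: continuous_expR.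
apply: (@continuousN _ _ _ (fun w => penalty i w.1)).
by apply: (@continuous_comp _ _ _ fst (penalty i)); [exact: cvg_fst|exact: continuous_penalty].
Qed.

Let is_derive_z (t : R) : is_derive t 1 z (Kz * z t).
Proof.
have := is_derive_scalef eps (is_derive_expf (is_derive_scalef Kz (@is_derive_id R R t 1))).
by apply: is_derive_ext => [s|]; rewrite /z //; ring.
Qed.

(* [V] is the value of the barrier [psi - z W] or [psi + z W] at the maximum
   point. *)
Let endgame i t x (V : R) : (0 < i <= n)%N -> i%:R * h < t -> t <= T' ->
  t - i%:R * h <= 2 * tau -> cube M x -> 0 < V -> V <= psi t x + z t * W x ->
  0 <= V * (`|b i x - a t x| - (i == n)%:R * Cz) +
    z t * (c * laplacian W x - (a t x + Kz) * W x) -> False.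
Proof.
move=> /andP[i0 ni] it tT' itau xM V0 Vle; apply/negP; rewrite -ltNge.
have ih0 : 0 <= i%:R * h by rewrite mulr_ge0// ltW.
have t0 : 0 < t by exact: le_lt_trans it.
have r := rate x t0 tT'.
have e0 : 0 <= 3 * Cs * enorm x by rewrite !mulr_ge0 ?enorm_ge0.
have q0 : 0 <= psi t x by rewrite ltW// (sol_gt0 S)// ltW.
have zt := z0 t; have w0 := W0 x.
(* At the last index only the crude bound [2 * K0] on the distance is available, and the term in
   [Cz] outweighs it. At earlier indices [previous] and [modulus] bound the distance by [3 * z t],
   which [rate] allows. *)
have [ein|ein] := eqVneq i n.
  have st : `|b i x - a t x| <= Cs * (2 * K0) * enorm x.
    apply: stability => //; [by rewrite i0|by rewrite mulr_ge0// ltW|move=> y].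
    have p1 := phi_le y ni; have p2 := psi_le y (ltW t0) tT'.
    have p3 := scheme_gt0 P i y; have p4 := sol_gt0 S y (ltW t0).
    have p5 : K0 * decay d.+1 y <= K0 * W y by rewrite ler_pM2l// decay_leS.
    by move: p1 p2 p3 p4 p5; rewrite /= ler_norml; move: (phi i y) (psi t y) (K0 * _) => *;
       apply/andP; split; lra.
  have nz := near_Cz xM; rewrite mul1r.
  have h1 : V * (`|b i x - a t x| - Cz) < 0.
    by rewrite nmulr_llt0// subr_lt0 (le_lt_trans st)//; lra.
  have h2 : z t * (c * laplacian W x - (a t x + Kz) * W x) <= 0.
    rewrite pmulr_rle0// subr_le0.
    have u1 := mulr_ge0 e0 q0; have u2 := mulr_ge0 e0 (ltW w0).
    by move: r u1 u2; move: (_ * psi t x) (3 * Cs * enorm x * W x) => *; lra.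
  by move: h1 h2; move: (V * _) (z t * _) => *; lra.
rewrite mul0r subr0.
have st : `|b i x - a t x| <= Cs * (3 * z t) * enorm x.
  apply: stability => //; [by rewrite i0|by rewrite mulr_ge0// ltW|move=> y].
  have p1 := previous y (_ : (0 < i < n)%N); rewrite i0 ltn_neqAle ein ni in p1.
  have {}p1 := p1 isT.
  have iT' : i%:R * h <= T' by exact: le_trans (ltW it) tT'.
  have p2 := modulus y ih0 iT' (ltW t0) tT'.
  rewrite ger0_norm ?subr_ge0 ?(ltW it)// in p2; have {}p2 := p2 itau.
  have p3 : z (i%:R * h) * W y <= z t * W y by rewrite ler_pM2r// z_le// ltW.
  have p4 : eps * W y <= z t * W y by rewrite ler_pM2r// z_ge_eps// ltW.
  move: p1 p2 p3 p4; rewrite -!mulrA !ler_norml.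
  move: (phi i y) (psi (i%:R * h) y) (psi t y) (z (i%:R * h) * W y) (eps * W y) (z t * W y).
  by move=> u v w e f g /andP[? ?] /andP[? ?] ? ?; apply/andP; split; lra.
have h1 : V * `|b i x - a t x| <= z t * (3 * Cs * enorm x * psi t x + 3 * Cs * enorm x * W x).
  apply: (@le_trans _ _ ((psi t x + W x) * (Cs * (3 * z t) * enorm x))).
    apply: ler_pM => //; first exact: ltW.
    apply: le_trans Vle _; rewrite lerD2l ler_piMl ?(ltW w0)//.
    by apply: z_le1 => //; exact: ltW.
  by rewrite le_eqVlt; apply/orP; left; apply/eqP; ring.
apply: (@le_lt_trans _ _ (z t * (3 * Cs * enorm x * psi t x + 3 * Cs * enorm x * W x +
   c * laplacian W x - (a t x + Kz) * W x))).
  by rewrite -addrA [leRHS]mulrDr lerD2r.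
by rewrite pmulr_rlt0// subr_lt0.
Qed.

(** The quotient [(psi - z W) exp (- penalty) / phi] is maximized over indices, times and points. If
    it exceeds 1, the maximum lies at a time later than [j h], and the initial condition excludes
    [j = 0]. Comparison with the previous index, with earlier times and with other points gives
    three inequalities whose combination is refuted by [endgame]. *)
Lemma doubling_lower t x i : (i <= n)%N -> 0 <= t -> t <= T' ->
  psi t x - z t * W x <= phi i x * expR (penalty i t).
Proof.
move=> ni t0 tT'; rewrite leNgt; apply/negP => lt.
pose s w : R := psi w.1 w.2 - z w.1 * W w.2.
have out t1 x1 : 0 <= t1 -> t1 <= T' -> ~ cube M x1 -> s (t1, x1) <= 0.
  move=> t10 t1T' /far fx; rewrite subr_le0 (le_trans (psi_le _ t10 t1T'))// (le_trans fx)//=.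
  by rewrite ler_pM2r// z_ge_eps.
have xM : cube M x.
  apply: contrapT => /(out t x t0 tT'); apply/negP; rewrite -ltNge.
  by apply: lt_trans lt; rewrite mulr_gt0 ?expR_gt0// (scheme_gt0 P).
pose f j w := s w * expR (- penalty j w.1) * (phi j w.2)^-1.
have cs : continuous s.
  move=> w; apply: (@continuousB _ _ _ (fun w => psi w.1 w.2) (fun w => z w.1 * W w.2)).
    exact: cpsi.
  exact: cz.
have cf j : continuous (f j).
  move=> w; apply: (@continuousM _ _ (fun w => s w * expR (- penalty j w.1)) (fun w => (phi j w.2)^-1)).
    by apply: (@continuousM _ _ s (fun w => expR (- penalty j w.1))); [exact: cs|exact: cpen].
  by apply: (@continuousV _ _ (fun w => phi j w.2)); [rewrite gt_eqF// (scheme_gt0 P)|exact: cphi].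
have Kne : K !=set0 by exists (t, x); split=> //=; rewrite in_itv/= t0.
have [j [[t1 x1] [nj [/= ]]]] := max_family n cf cK Kne.
rewrite in_itv/= => /andP[t10 t1T'] x1M mx.
have p0 k y := scheme_gt0 P k y.
have f1 : 1 < f j (t1, x1).
  apply: lt_le_trans (mx i (t, x) ni _); last by split=> //=; rewrite in_itv/= t0.
  by rewrite /f ltr_pdivlMr// mul1r /= expRN ltr_pdivlMr ?expR_gt0.
have s1 : phi j x1 * expR (penalty j t1) < s (t1, x1).
  by move: f1; rewrite /f ltr_pdivlMr// mul1r /= expRN ltr_pdivlMr ?expR_gt0.
have s0 : 0 < s (t1, x1) by apply: lt_trans s1; rewrite mulr_gt0 ?expR_gt0.
have [jt jtau] : j%:R * h < t1 /\ t1 - j%:R * h <= 2 * tau.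
  apply: localized; rewrite -ltr_expR -(ltr_pM2l (p0 j x1)) (lt_le_trans s1)//.
  apply: le_trans (penalty_lower nj t10 t1T' x1M).
  by rewrite /s gerBl mulr_ge0 ?ltW.
have jh0 : 0 <= j%:R * h by rewrite mulr_ge0// ltW.
have t1p : 0 < t1 by exact: le_lt_trans jt.
have mx2 k t2 x2 : (k <= n)%N -> 0 <= t2 -> t2 <= T' -> f k (t2, x2) <= f j (t1, x1).
  move=> nk t20 t2T'; have [x2M|x2M] := pselect (cube M x2).
    by apply: mx => //; split=> //=; rewrite in_itv/= t20.
  apply: le_trans (ltW (lt_trans ltr01 f1)).
  by rewrite /f /= mulr_le0_ge0 ?invr_ge0 ?(ltW (p0 _ _))// mulr_le0_ge0 ?expR_ge0// out.
(* At index 0 the time is at most [2 * tau], so [psi] differs from its initial value by at most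
   [eps * W], which [z W] covers. *)
have j0 : (0 < j)%N.
  rewrite lt0n; apply/negP => /eqP jE; move: jt jtau s1; rewrite jE mul0r subr0 => _ tt.
  have := modulus x1 (lexx 0) (ltW T'0) t10 t1T'; rewrite subr0 ger0_norm// => /(_ tt).
  rewrite init ler_norml => /andP[_ m1]; apply/negP; rewrite -leNgt.
  apply: (@le_trans _ _ (psi 0 x1)).
    rewrite /s /= lerBlDr; apply: le_trans (_ : _ <= psi 0 x1 + eps * W x1) _.
      by move: m1; move: (psi t1 x1) (psi 0 x1) (eps * _) => *; lra.
    by rewrite lerD2l ler_pM2r// z_ge_eps.
  by rewrite ler_peMr ?ge1_expR// ltW// (sol_gt0 S).
case: j j0 nj jt jtau jh0 mx mx2 f1 s1 => // j _ nj jt jtau jh0 mx mx2 f1 s1.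
set th := slope j.+1 t1.
have e0 k u : 0 < expR (- penalty k u) by exact: expR_gt0.
have ln_le' : h^-1 * ln (phi j.+1 x1 / phi j x1) <= th - (j.+1 == n)%:R * Cz.
  rewrite ler_pdivrMl// -penaltyS// -ler_expR lnK ?posrE ?divr_gt0// ler_pdivrMr//.
  have := mx2 j t1 x1 (ltnW nj) t10 t1T'; rewrite /f /= ler_pdivrMr//.
  rewrite mulrAC ler_pdivlMr// -!mulrA ler_pM2l// !expRN [_^-1 * _]mulrC ler_pdivrMr ?expR_gt0//.
  rewrite mulrAC [_^-1 * _]mulrC mulrAC ler_pdivlMr ?expR_gt0// => le.
  by rewrite expRD expRN -mulrA [_ * phi j x1]mulrC mulrA ler_pdivlMr ?expR_gt0// mulrC [leRHS]mulrC.
have dt : s (t1, x1) * th <= dpsi t1 x1 - Kz * z t1 * W x1.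
  have t1T : t1 < T by exact: le_lt_trans T'T.
  have d1 := is_derive_subf (sol_derive S x1 t1p t1T) (is_derive_scalef (W x1) (is_derive_z t1)).
  have d2 := is_derive_mulf d1 (is_derive_expf (is_derive_oppf (is_derive_penalty j.+1 t1))).
  have := is_derive_max_left t1p d2 _; rewrite subrr => /(_ _).
  rewrite -/th (_ : _ + _ = (dpsi t1 x1 - Kz * z t1 * W x1 - s (t1, x1) * th) *
    expR (- penalty j.+1 t1)); last by rewrite /s /=; ring.
  rewrite pmulr_lge0// subr_ge0; apply=> u u0 ut.
  have := mx2 j.+1 u x1 nj (ltW u0) (le_trans ut t1T'); rewrite /f /s /= ler_pM2r ?invr_gt0//.
  by rewrite [W x1 * z u]mulrC [W x1 * z t1]mulrC.
have sC : class_C 2 (fun y => psi t1 y - z t1 * W y).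
  apply: class_C_sub; last exact: class_C_scale (class_C_decay 2 d).
  by apply: (sol_class_C2 S) => //; exact: le_lt_trans T'T.
have := @scheme_touching_below _ _ _ _ _ _ c0 P j _ x1 sC s0.
have mxx y : (psi t1 y - z t1 * W y) * phi j.+1 x1 <= (psi t1 x1 - z t1 * W x1) * phi j.+1 y.
  have := mx2 j.+1 t1 y nj t10 t1T'; rewrite /f /s /= ler_pdivrMr// [leRHS]mulrAC ler_pdivlMr//.
  by rewrite mulrAC [leRHS]mulrAC ler_pM2r.
move=> /(_ mxx); rewrite laplacian_sub_scale; last exact: class_C_decay.
  move=> sp; apply: (endgame (i := j.+1) (t := t1) (x := x1) _ jt t1T' jtau x1M s0) => //.
    by rewrite /s /= lerD2l (le_trans (_ : _ <= 0))// ?oppr_le0 ?mulr_ge0// ltW.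
  have eq := sol_equation S x1 t1p (le_lt_trans t1T' T'T).
  have nb := ler_norm (b j.+1 x1 - a t1 x1).
  have l1 := ler_wpM2l (ltW s0) ln_le'; have l2 := ler_wpM2l (ltW s0) nb.
  move: sp dt l1 l2; rewrite eq mul0r addr0 /s /= => sp dt l1 l2.
  exact: doubling_arith sp dt l1 l2.
by apply: (sol_class_C2 S) => //; exact: le_lt_trans T'T.
Qed.

(** As for the lower bound, with the quotient [phi exp (- penalty) / (psi + z W)]. The localization
    in time now comes from [penalty_upper], the denominator being at least [eps * W]. *)
Lemma doubling_upper t x i : (i <= n)%N -> 0 <= t -> t <= T' ->
  phi i x * expR (- penalty i t) <= psi t x + z t * W x.
Proof.
move=> ni t0 tT'; rewrite leNgt; apply/negP => lt.
pose s w : R := psi w.1 w.2 + z w.1 * W w.2.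
have p0 k y := scheme_gt0 P k y.
have spos t1 x1 : 0 <= t1 -> 0 < s (t1, x1).
  by move=> t10; rewrite addr_gt0 ?(sol_gt0 S)// mulr_gt0.
have em k u : expR (- penalty k u) <= 1 by rewrite -expR0 ler_expR oppr_le0.
have out k t1 x1 : (k <= n)%N -> 0 <= t1 -> t1 <= T' -> ~ cube M x1 ->
    phi k x1 * expR (- penalty k t1) <= s (t1, x1).
  move=> nk t10 t1T' /far fx; apply: (@le_trans _ _ (phi k x1)).
    by rewrite ler_piMr// ltW.
  rewrite (le_trans (phi_le _ nk))// (le_trans fx)// (@le_trans _ _ (z t1 * W x1))//.
    by rewrite ler_pM2r// z_ge_eps.
  by rewrite /s /= lerDr ltW// (sol_gt0 S).
have xM : cube M x by apply: contrapT => /(out i t x ni t0 tT'); rewrite leNgt lt.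
(* Negative times are replaced by 0 in [psi], so that the denominator is positive and the quotient
   continuous at all times. *)
pose mx0 (u : R) : R := Num.max 0 u.
pose f j w := phi j w.2 * expR (- penalty j w.1) * (psi (mx0 w.1) w.2 + z w.1 * W w.2)^-1.
have cmax : continuous mx0.
  by move=> u; apply: (@continuous_max _ _ (fun=> 0) id); [exact: cst_continuous|exact: cvg_id].
have cpm : continuous (fun w : R * 'rV[R]_d => psi (mx0 w.1) w.2).
  move=> w; apply: (@continuous_comp _ _ _ (fun w : R * 'rV[R]_d => (mx0 w.1, w.2))
    (fun z => psi z.1 z.2)); last exact: cpsi.
  apply: (@continuous_pair _ _ _ (fun z => mx0 z.1) snd); last exact: cvg_snd.
  by apply: (@continuous_comp _ _ _ fst mx0); [exact: cvg_fst|exact: cmax].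
have cs : continuous (fun w : R * 'rV[R]_d => psi (mx0 w.1) w.2 + z w.1 * W w.2).
  move=> w; rewrite (_ : (fun w => _) = (fun w => psi (mx0 w.1) w.2) \- (fun w => - (z w.1 * W w.2))).
    apply: (@continuousB _ _ _ (fun w => psi (mx0 w.1) w.2) (fun w => - (z w.1 * W w.2))).
      exact: cpm.
    by apply: (@continuousN _ _ _ (fun w => z w.1 * W w.2)); exact: cz.
  by apply/funext => v /=; rewrite opprK.
have cf j : continuous (f j).
  move=> w; apply: (@continuousM _ _ (fun w => phi j w.2 * expR (- penalty j w.1))
    (fun w => (psi (mx0 w.1) w.2 + z w.1 * W w.2)^-1)).
    apply: (@continuousM _ _ (fun w => phi j w.2) (fun w => expR (- penalty j w.1))).
      exact: cphi.
    exact: cpen.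
  apply: (@continuousV _ _ (fun w => psi (mx0 w.1) w.2 + z w.1 * W w.2)); last exact: cs.
  rewrite gt_eqF//; apply: addr_gt0; last exact: mulr_gt0.
  by apply: (sol_gt0 S); rewrite /mx0 le_max lexx.
have fE k t1 x1 : 0 <= t1 -> f k (t1, x1) = phi k x1 * expR (- penalty k t1) / s (t1, x1).
  by move=> t10; rewrite /f /s /= /mx0 (max_r t10).
have Kne : K !=set0 by exists (t, x); split=> //=; rewrite in_itv/= t0.
have [j [[t1 x1] [nj [/= ]]]] := max_family n cf cK Kne.
rewrite in_itv/= => /andP[t10 t1T'] x1M mx.
have s0 := spos t1 x1 t10.
have f1 : 1 < f j (t1, x1).
  apply: lt_le_trans (mx i (t, x) ni _); last by split=> //=; rewrite in_itv/= t0.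
  by rewrite fE// ltr_pdivlMr ?spos// mul1r.
have s1 : s (t1, x1) < phi j x1 * expR (- penalty j t1).
  by move: f1; rewrite fE// ltr_pdivlMr// mul1r.
have [jt jtau] : j%:R * h < t1 /\ t1 - j%:R * h <= 2 * tau.
  apply: localized; rewrite -ltr_expR -(ltr_pM2l eps0) (lt_le_trans _ penalty_upper)//.
  rewrite -ltr_pdivlMr ?expR_gt0// -expRN -(ltr_pM2r (W0 x1)).
  apply: (@le_lt_trans _ _ (s (t1, x1))).
    rewrite (@le_trans _ _ (z t1 * W x1))//; first by rewrite ler_pM2r// z_ge_eps.
    by rewrite /s /= lerDr ltW// (sol_gt0 S).
  rewrite (lt_le_trans s1)// mulrAC ler_pM2r ?expR_gt0// (le_trans (phi_le _ nj))//.
  by rewrite ler_pM2l// decay_leS.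
have jh0 : 0 <= j%:R * h by rewrite mulr_ge0// ltW.
have t1p : 0 < t1 by exact: le_lt_trans jt.
have mx2 k t2 x2 : (k <= n)%N -> 0 <= t2 -> t2 <= T' -> f k (t2, x2) <= f j (t1, x1).
  move=> nk t20 t2T'; have [x2M|x2M] := pselect (cube M x2).
    by apply: mx => //; split=> //=; rewrite in_itv/= t20.
  by apply: le_trans (ltW f1); rewrite fE// ler_pdivrMr ?spos// mul1r out.
have j0 : (0 < j)%N.
  rewrite lt0n; apply/negP => /eqP jE; move: jt jtau s1; rewrite jE mul0r subr0 => _ tt.
  have := modulus x1 (lexx 0) (ltW T'0) t10 t1T'; rewrite subr0 ger0_norm// => /(_ tt).
  rewrite init ler_norml => /andP[m1 _]; apply/negP; rewrite -leNgt.
  apply: (@le_trans _ _ (psi 0 x1)).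
    by rewrite ler_piMr// ltW// (sol_gt0 S).
  apply: (@le_trans _ _ (psi t1 x1 + eps * W x1)).
    by move: m1; move: (psi t1 x1) (psi 0 x1) (eps * _) => *; lra.
  by rewrite /s /= lerD2l ler_pM2r// z_ge_eps.
case: j j0 nj jt jtau jh0 mx mx2 f1 s1 => // j _ nj jt jtau jh0 mx mx2 f1 s1.
set th := slope j.+1 t1.
have e0 k u : 0 < expR (- penalty k u) by exact: expR_gt0.
have ln_ge' : - (th - (j.+1 == n)%:R * Cz) <= h^-1 * ln (phi j.+1 x1 / phi j x1).
  rewrite ler_pdivlMl// mulrN -penaltyS// opprB -ler_expR lnK ?posrE ?divr_gt0// ler_pdivlMr//.
  have := mx2 j t1 x1 (ltnW nj) t10 t1T'; rewrite !fE// ler_pM2r ?invr_gt0// => le.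
  have := expR_gt0 (penalty j.+1 t1) => ep.
  by rewrite expRD -mulrA -ler_pdivlMl// -expRN mulrC [leRHS]mulrC.
have dt : dpsi t1 x1 + Kz * z t1 * W x1 <= - (s (t1, x1) * th).
  have t1T : t1 < T by exact: le_lt_trans T'T.
  have d1 := is_derive_addf (sol_derive S x1 t1p t1T) (is_derive_scalef (W x1) (is_derive_z t1)).
  have d2 := is_derive_subf
    (is_derive_scalef (s (t1, x1)) (is_derive_expf (is_derive_oppf (is_derive_penalty j.+1 t1))))
    (is_derive_scalef (expR (- penalty j.+1 t1)) d1).
  have V u : psi u x1 + W x1 * z u = s (u, x1) by rewrite /s /= [W _ * _]mulrC.
  have := is_derive_max_left t1p d2 _; rewrite subrr.
  have -> : s (t1, x1) * (expR (- penalty j.+1 t1) * - slope j.+1 t1) -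
       expR (- penalty j.+1 t1) * (dpsi t1 x1 + W x1 * (Kz * z t1)) =
     (- (s (t1, x1) * th) - (dpsi t1 x1 + Kz * z t1 * W x1)) * expR (- penalty j.+1 t1).
    by rewrite -/th; ring.
  rewrite pmulr_lge0// subr_ge0; apply=> u u0 ut.
  have := mx2 j.+1 u x1 nj (ltW u0) (le_trans ut t1T'); rewrite !fE ?(ltW u0)//.
  rewrite ler_pdivrMr ?spos ?(ltW u0)// mulrAC ler_pdivlMr// -!mulrA ler_pM2l// => le.
  rewrite (V u) (V t1); move: le.
  by move: (expR _) (s (t1, x1)) (expR _) (s (u, x1)) => e1 u1 e2 u2 *; lra.
have t1T : t1 < T by exact: le_lt_trans T'T.
have pC := sol_class_C2 S t1p t1T; have wC := @class_C_decay R d 2 d.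
have sC : class_C 2 (fun y => psi t1 y + z t1 * W y).
  exact: class_C_add pC (class_C_scale (z t1) wC).
have := @scheme_touching_above _ _ _ _ _ _ c0 P j _ x1 sC s0.
have mxx y : phi j.+1 y * (psi t1 x1 + z t1 * W x1) <= phi j.+1 x1 * (psi t1 y + z t1 * W y).
  have := mx2 j.+1 t1 y nj t10 t1T'; rewrite !fE// ler_pdivrMr ?spos//.
  rewrite [leRHS]mulrAC ler_pdivlMr// mulrAC [leRHS]mulrAC ler_pM2r//.
move=> /(_ mxx); rewrite (laplacian_add_scale _ _ pC wC) => sp.
apply: (endgame (i := j.+1) (t := t1) (x := x1) _ jt t1T' jtau x1M s0) => //.
have eq := sol_equation S x1 t1p t1T.
have nb := ler_norm (a t1 x1 - b j.+1 x1); rewrite distrC in nb.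
have l1 := ler_wpM2l (ltW s0) ln_ge'; have l2 := ler_wpM2l (ltW s0) nb.
move: sp dt l1 l2; rewrite eq mul0r addr0 /s /= => sp dt l1 l2.
exact: doubling_arith_upper sp dt l1 l2.
Qed.

Hypothesis nT_tau : n%:R * h + tau <= T'.
Hypothesis modulus4 : forall s t x, 0 <= s -> s <= T' -> 0 <= t -> t <= T' ->
  `|t - s| <= 2 * tau -> `|psi t x - psi s x| <= eps / 4 * W x.
Hypothesis rate_tau : expR (Kz * tau) <= 5 / 4.
Hypothesis small_step : K0 * (expR (h * (T' / delta + Cz)) - 1) <= eps / 4.

(** Both bounds are taken at the time [n h + tau], where the square in the penalty vanishes and the
    rest is of order [h]. The losses due to the modulus of [psi], to the growth of [z] over [tau]
    and to the penalty fit into the factor 2. *)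
Lemma doubling_close x : `|phi n x - psi (n%:R * h) x| <= 2 * z (n%:R * h) * W x.
Proof.
have nh0 : 0 <= n%:R * h by rewrite mulr_ge0// ltW.
have t0 : 0 <= n%:R * h + tau by rewrite addr_ge0// ltW.
have lo := doubling_lower x (leqnn n) t0 nT_tau.
have up := doubling_upper x (leqnn n) t0 nT_tau.
have := modulus4 x nh0 nT t0 nT_tau; rewrite addrAC subrr add0r (gtr0_norm tau0).
have -> : tau <= 2 * tau by rewrite ler_peMl ?(ltW tau0)// ler1n.
move=> /(_ isT); rewrite ler_norml => /andP[m1 m2].
have pen : penalty n (n%:R * h + tau) <= h * (T' / delta + Cz).
  rewrite /penalty eqxx mul1r addrK subrr expr0n/= add0r mulrDr lerD2r -mulrA.
  by rewrite ler_pM2l// ler_pM2r// invr_gt0.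
have pn := penalty_ge0 n (n%:R * h + tau).
have w0 := W0 x; have p0 := scheme_gt0 P n x; have zn := z_ge_eps nh0.
have ph : phi n x <= K0 * W x.
  by rewrite (le_trans (phi_le x (leqnn n)))// ler_pM2l// decay_leS.
set E := expR (penalty n _) in lo.
have E1 : 1 <= E by exact: ge1_expR.
have EW : phi n x * (E - 1) <= eps / 4 * W x.
  apply: (@le_trans _ _ (K0 * W x * (E - 1))); first by rewrite ler_wpM2r// subr_ge0.
  rewrite mulrAC ler_pM2r// (le_trans _ small_step)// ler_pM2l// lerD2r ler_expR//.
have up' : phi n x - phi n x * (E - 1) <= phi n x * expR (- penalty n (n%:R * h + tau)).
  rewrite expRN -/E -[X in X - _]mulr1 -mulrBr ler_pM2l// -(@ler_pM2r _ E) ?(lt_le_trans ltr01)//.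
  rewrite mulVf ?gt_eqF ?(lt_le_trans ltr01)//; have := sqr_ge0 (E - 1); nra.
have zt : z (n%:R * h + tau) * W x <= 5 / 4 * (z (n%:R * h) * W x).
  rewrite mulrA ler_pM2r// /z mulrDr expRD mulrA mulrC ler_pM2r//; last exact: z0.
have zw : eps * W x <= z (n%:R * h) * W x by rewrite ler_pM2r.
move: lo up up' EW zt zw m1 m2.
move: (z (n%:R * h + tau)) (z (n%:R * h)) (W x) => z1 z2 w.
move: (psi _ x) (psi _ x) (phi n x) (expR (- _)) (E) => *.
by rewrite ler_norml; apply/andP; split; lra.
Qed.

End doubling.

(** * Convergence of schemes to the limit equation *)

Lemma dot_cube (R : realType) d (M : R) (x : 'rV[R]_d) : 0 <= M -> cube M x ->
  dot x x <= d%:R * M ^+ 2.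
Proof.
move=> M0 xM; rewrite -sqr_enorm -[leRHS]sqr_sqrtr ?mulr_ge0 ?sqr_ge0//.
by rewrite lerXn2r ?nnegrE ?enorm_ge0 ?sqrtr_ge0// enorm_cube.
Qed.

Lemma expRB1_le (R : realType) (y : R) : 0 <= y -> y <= 1 / 2 -> expR y - 1 <= 2 * y.
Proof.
move=> y0 y1; have h1 := expR_ge1Dx (- y); have e0 := expR_gt0 y.
have h2 : expR y * (1 - y) <= 1.
  rewrite expRN in h1.
  by rewrite -[leRHS](mulfV (lt0r_neq0 e0)) ler_pM2l.
nra.
Qed.

Lemma decay_far (R : realType) d (K e M : R) (x : 'rV[R]_d) : 0 <= K -> 0 < e ->
  1 + K / e <= M -> ~ cube M x -> K * decay d.+1 x <= e * decay d x.
Proof.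
move=> K0 e0 KM xM; have Ke : 0 <= K / e by rewrite divr_ge0// ltW.
have M1 : 1 <= M by rewrite (le_trans _ KM)// lerDl.
have := not_cube_dot (le_trans ler01 M1) xM => Mx.
rewrite decayS mulrA ler_pM2r ?decay_gt0// ler_pdivrMr ?bracket_gt0//.
rewrite mulrC -ler_pdivrMr// /bracket; apply: (@le_trans _ _ (M ^+ 2)).
  apply: (@le_trans _ _ M); first by move: KM; lra.
  by rewrite expr2 ler_peMl// (le_trans ler01).
by rewrite (le_trans Mx)// lerDr.
Qed.

Section convergence.
Context {R : realType} {d : nat}.
Implicit Types (x y : 'rV[R]_d) (t s : R).

Variables (c T A : R) (psi dpsi a : R -> 'rV[R]_d -> R).
Hypothesis S : parabolic_solution c T A psi dpsi a (fun=> 0).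
Variables (T0 T' K0 Cs a1 a2 A2 c2 : R).
Hypotheses (c0 : 0 < c) (T0_ge0 : 0 <= T0) (T0T' : T0 < T') (T'T : T' < T) (K0_gt0 : 0 < K0)
  (Cs0 : 0 <= Cs) (a10 : 0 < a1) (a20 : 0 <= a2) (A20 : 0 <= A2) (c20 : 0 < c2).
Hypothesis a_ge : forall t x, 0 < t -> t <= T' -> a1 * dot x x - a2 <= a t x.
Hypothesis psi_le : forall t x, 0 <= t -> t <= T' -> psi t x <= K0 * decay d.+1 x.

(** On a large cube this is uniform continuity, the weight being bounded below there; outside, both
    values are below [K0 * decay d.+1], which is small compared with [decay d]. *)
Lemma solution_modulus (e : R) : 0 < e -> exists2 dlt : R, 0 < dlt & forall s t x,
  0 <= s -> s <= T' -> 0 <= t -> t <= T' -> `|s - t| < dlt ->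
  `|psi s x - psi t x| <= e * decay d x.
Proof.
move=> e0; pose M := 1 + K0 / e.
have M0 : 0 <= M by rewrite addr_ge0// divr_ge0// ltW.
pose w : R := ((1 + d%:R * M ^+ 2)^-1) ^+ d.
have D0 : 0 <= d%:R * M ^+ 2 by rewrite mulr_ge0// sqr_ge0.
have b0 : 0 < 1 + d%:R * M ^+ 2 by rewrite ltr_wpDr.
have w0 : 0 < w by rewrite exprn_gt0// invr_gt0.
have wW x : cube M x -> w <= decay d x.
  move=> xM; rewrite lerXn2r ?nnegrE ?invr_ge0 ?(ltW b0) ?(ltW (bracket_gt0 _))//.
  by rewrite lef_pV2 ?posrE ?bracket_gt0// lerD2l dot_cube.
have [dlt dlt0 H] := @strip_modulus R d psi 0 T' M (e * w) (sol_continuous S) (mulr_gt0 e0 w0).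
exists dlt => // s t x s0 sT t0 tT st; have [xM|xM] := pselect (cube M x).
  have s1 : 0 <= s <= T' by rewrite s0.
  have t1 : 0 <= t <= T' by rewrite t0.
  by rewrite (le_trans (ltW (H s t x s1 t1 xM st)))// ler_pM2l// wW.
have f := decay_far (ltW K0_gt0) e0 (lexx _) xM.
have p1 := psi_le x s0 sT; have p2 := psi_le x t0 tT.
have p3 := sol_gt0 S x s0; have p4 := sol_gt0 S x t0.
by rewrite ler_norml; apply/andP; split; lra.
Qed.

(** The parameters are fixed in the order [eps], cube, [tau], [delta], and the smallness of [h]
    comes last. Strong induction on the index then supplies the closeness at earlier indices that
    the doubling demands. *)
Lemma scheme_convergence (e : R) : 0 < e -> exists2 h0 : R, 0 < h0 &
  forall (h : R) (phi b : nat -> 'rV[R]_d -> R), 0 < h -> h < h0 ->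
  scheme_solution c h phi b -> phi 0%N = psi 0 ->
  (forall i x, i%:R * h <= T' -> phi i x <= K0 * decay d.+1 x) ->
  (forall i x, i%:R * h <= T' -> c2 * gauss A2 x <= phi i x) ->
  (forall i t (dlt : R), (0 < i)%N -> i%:R * h <= T' -> 0 < t -> t <= T' -> 0 <= dlt ->
    (forall x, `|phi i x - psi t x| <= dlt * decay d x) ->
    forall x, `|b i x - a t x| <= Cs * dlt * enorm x) ->
  forall n x, n%:R * h <= T0 -> `|phi n x - psi (n%:R * h) x| <= e * decay d x.
Proof.
move=> e0; set W : 'rV[R]_d -> R := decay d.
have T'0 : 0 < T' by exact: le_lt_trans T0T'.
pose Ck : R := 2 * d%:R * (d%:R + 2 * d.+1%:R).
have Ck0 : 0 <= Ck by rewrite !mulr_ge0// addr_ge0// mulr_ge0.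
(* The terms compensate, in [rate], the constant part of the confinement, [enorm y * psi],
   [enorm y * W] and the Laplacian of [W]; the third one is Young's inequality against
   [a1 * dot y y]. The final 1 makes [rate] strict. *)
pose Kz : R := a2 + 3 * Cs * K0 + (3 * Cs) ^+ 2 / a1 + c * Ck + 1.
have Kz1 : 1 <= Kz.
  by rewrite lerDr !addr_ge0// ?mulr_ge0// ?invr_ge0 ?sqr_ge0// ltW.
have Kz0 : 0 <= Kz by exact: le_trans Kz1.
pose E := expR (Kz * T').
have E0 : 0 < E by exact: expR_gt0.
(* Since [E] bounds the growth of [z] up to [T'], this gives both [z <= 1] and [2 * z <= e] on the
   whole interval. *)
pose eps := Num.min (e / (2 * E)) E^-1.
have eps0 : 0 < eps by rewrite lt_min divr_gt0 ?mulr_gt0//= invr_gt0.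
have epsE : eps * E <= 1 by rewrite -ler_pdivlMr// div1r ge_min lexx orbT.
have epse : 2 * (eps * E) <= e.
  by rewrite mulrCA -ler_pdivlMr ?mulr_gt0// ge_min lexx.
pose M := 1 + K0 / eps.
have M0 : 0 <= M by rewrite addr_ge0// divr_ge0// ltW.
have D0 : 0 <= d%:R * M ^+ 2 by rewrite mulr_ge0// sqr_ge0.
pose Cz := 2 * Cs * K0 * Num.sqrt (d%:R * M ^+ 2) + 1.
have Cz0 : 0 <= Cz by rewrite addr_ge0// !mulr_ge0 ?sqrtr_ge0// ltW.
have e4 : 0 < eps / 4 by rewrite divr_gt0.
have [dlt dlt0 mod4] := solution_modulus e4.
(* The three bounds give the modulus of [psi] over a time [2 * tau], the growth
   [expR (Kz * tau) <= 5 / 4], and room for [n h + tau <= T']. *)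
pose tau := Num.min (dlt / 3) (Num.min ((5 * Kz)^-1) (T' - T0)).
have Kzp : 0 < Kz by exact: lt_le_trans Kz1.
have tau0 : 0 < tau.
  have h1 : 0 < dlt / 3 by rewrite divr_gt0.
  have h2 : 0 < (5 * Kz)^-1 by rewrite invr_gt0 mulr_gt0.
  by rewrite !lt_min h1 h2 subr_gt0 T0T'.
have tau1 : 2 * tau < dlt.
  have : tau <= dlt / 3 by rewrite ge_min lexx.
  by move: dlt0; lra.
have tau2 : Kz * tau <= 1 / 5.
  have : tau <= (5 * Kz)^-1 by rewrite !ge_min lexx orbT.
  rewrite (_ : 1 / 5 = Kz * (5 * Kz)^-1) ?ler_pM2l//.
  by field; rewrite gt_eqF.
have tau3 : T0 + tau <= T'.
  have : tau <= T' - T0 by rewrite !ge_min lexx !orbT.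
  by lra.
pose m := c2 * expR (- A2 * (d%:R * M ^+ 2)).
have m0 : 0 < m by rewrite mulr_gt0// expR_gt0.
(* Makes [expR (tau ^+ 2 / delta)] exceed [K0 / eps], as [penalty_upper] requires, and [K0 / m], as
   [penalty_lower] requires, where [m] bounds the scheme below on the cube. *)
pose Q := K0 / eps + K0 / m.
have K0e : 0 < K0 / eps by rewrite divr_gt0.
have K0m : 0 < K0 / m by rewrite divr_gt0.
have Q0 : 0 < Q by rewrite addr_gt0.
pose delta := tau ^+ 2 / Q.
have delta0 : 0 < delta by rewrite divr_gt0// exprn_gt0.
have dQ : tau ^+ 2 / delta = Q.
  by rewrite /delta invf_div mulrA mulrAC divff ?mul1r// expf_neq0// gt_eqF.
have expQ : K0 / eps + K0 / m <= expR Q.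
  by apply: le_trans (expR_ge1Dx _); rewrite lerDr.
pose B := T' / delta + Cz.
have B0 : 0 < B by rewrite ltr_wpDr// divr_gt0.
pose h0 := Num.min ((2 * B)^-1) (eps / (8 * K0 * B)).
exists h0; first by rewrite lt_min invr_gt0 mulr_gt0//= divr_gt0// !mulr_gt0.
move=> h phi b hp hh0 P init phi_le phi_ge stab.
have hB1 : h * B <= 1 / 2.
  have : h <= (2 * B)^-1 by rewrite (le_trans (ltW hh0))// ge_min lexx.
  by rewrite invfM -ler_pdivrMr ?invr_gt0// invrK div1r.
have hB2 : 8 * K0 * (h * B) <= eps.
  have : h <= eps / (8 * K0 * B) by rewrite (le_trans (ltW hh0))// ge_min lexx orbT.
  by rewrite ler_pdivlMr ?mulr_gt0// mulrCA.
have zmono s t : s <= t -> eps * expR (Kz * s) <= eps * expR (Kz * t).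
  by move=> st; rewrite ler_pM2l// ler_expR ler_wpM2l.
have close n : n%:R * h <= T0 -> forall x,
    `|phi n x - psi (n%:R * h) x| <= 2 * (eps * expR (Kz * (n%:R * h))) * W x.
  elim/ltn_ind: n => n IHn nT0 x.
  have nT' : n%:R * h <= T' by rewrite (le_trans nT0)// ltW.
  have iT' i : (i <= n)%N -> i%:R * h <= T'.
    by move=> ni; rewrite (le_trans _ nT')// ler_wpM2r ?(ltW hp)// ler_nat.
  apply: (@doubling_close R d c T A psi dpsi a S h phi b c0 hp P T' K0 Cs eps Kz tau delta Cz M n) => //.
  - move=> t t0 tT'; rewrite (le_trans _ epsE)//; exact: zmono.
  - by move=> i y ni; apply: phi_le; exact: iT'.
  - move=> t y t0 tT'.
    have w0 := decay_gt0 d y; have n0 := enorm_ge0 y.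
    have l1 := laplacian_decay_le d y.
    have p1 : 3 * Cs * enorm y * psi t y <= 3 * Cs * K0 * W y.
      apply: (@le_trans _ _ (3 * Cs * (bracket y * (K0 * decay d.+1 y)))).
        rewrite -(mulrA (3 * Cs)) ler_wpM2l ?mulr_ge0// ler_pM ?enorm_ge0 ?enorm_le_bracket//.
          by rewrite ltW// (sol_gt0 S)// ltW.
        by rewrite psi_le// ltW.
      by rewrite decayS [K0 * _]mulrCA mulVKf ?gt_eqF ?bracket_gt0// mulrA.
    have p2 := linear_le_sqr (3 * Cs) (enorm y) a10; rewrite sqr_enorm in p2.
    have p3 := a_ge y t0 tT'.
    have p4 : c * laplacian W y <= c * Ck * W y.
      by rewrite -mulrA ler_pM2l// (le_trans (ler_norm _)).
    have p5 : 3 * Cs * enorm y <= a t y + a2 + (3 * Cs) ^+ 2 / a1.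
      by move: p2 p3; move: (_ * dot y y) (3 * Cs * _) (_ / a1) => *; lra.
    have p6 := ler_wpM2r (ltW w0) p5.
    move: w0 p1 p4 p6; rewrite /Kz -/(W y).
    move: (3 * Cs * enorm y * psi t y) (3 * Cs * enorm y) (3 * Cs * K0) ((3 * Cs) ^+ 2 / a1).
    by move: (c * laplacian W y) (c * Ck) (a t y) (W y) => *; nra.
  - by move=> y /(decay_far (ltW K0_gt0) eps0 (lexx _)).
  - move=> y yM; rewrite /Cz ltr_pwDr//; apply: ler_wpM2l (enorm_cube M0 yM).
    by rewrite !mulr_ge0// ltW.
  - move=> i t y ni t0 tT' yM; rewrite dQ.
    have mphi : m <= phi i y.
      apply: le_trans (phi_ge i y (iT' i ni)); rewrite ler_pM2l// /gauss ler_expR !mulNr lerN2.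
      by rewrite ler_wpM2l// dot_cube.
    apply: (@le_trans _ _ (m * (K0 / m))).
      rewrite mulrC divfK ?gt_eqF// (le_trans (psi_le y t0 tT'))//.
      by rewrite ler_piMr ?(ltW K0_gt0)// decay_le1.
    apply: ler_pM => //; [exact: ltW|exact: ltW|].
    by apply: le_trans expQ; rewrite lerDr ltW.
  - rewrite dQ mulrC -ler_pdivrMr//; apply: le_trans expQ; by rewrite lerDl ltW.
  - move=> s t y s0 sT' t0 tT' st; apply: (@le_trans _ _ (eps / 4 * W y)).
      by apply: mod4 => //; exact: le_lt_trans tau1.
    by rewrite ler_pM2r ?decay_gt0// ler_pdivrMr// ler_peMr ?(ltW eps0)// ler1n.
  - move=> i t dl /andP[i0 ni] t0 tT' dl0 H; apply: stab => //; exact: iT'.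
  - move=> j y /andP[j0 jn]; apply: IHn => //; rewrite (le_trans _ nT0)//.
    by rewrite ler_wpM2r ?(ltW hp)// ler_nat ltnW.
  - by rewrite (le_trans _ tau3)// lerD2r.
  - move=> s t y s0 sT' t0 tT' st; apply: mod4 => //; exact: le_lt_trans tau1.
  - have : expR (Kz * tau) * (1 - Kz * tau) <= 1.
      have := expR_ge1Dx (- (Kz * tau)); rewrite expRN => h1.
      by rewrite -[leRHS](mulfV (lt0r_neq0 (expR_gt0 (Kz * tau)))) ler_pM2l ?expR_gt0.
    by move: tau2 (expR_gt0 (Kz * tau)); move: (Kz * tau) (expR _) => u v *; nra.
  - have hB0 : 0 <= h * B by rewrite mulr_ge0// ltW.
    have := expRB1_le hB0 hB1; rewrite -(ler_pM2l K0_gt0) => h1.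
    apply: (le_trans h1); move: hB2; move: (h * B) => u; lra.
move=> n x nT0; apply: le_trans (close n nT0 x) _.
rewrite ler_pM2r ?decay_gt0// (le_trans _ epse)// ler_pM2l//.
by apply: zmono; rewrite (le_trans nT0)// ltW.
Qed.

End convergence.

(** * Quadratic growth *)

Section quadratic.
Context {R : realType} {d : nat}.
Implicit Types (f : 'rV[R]_d -> R) (x y : 'rV[R]_d).

Lemma abs_dot_le x y : `|dot x y| <= enorm x * enorm y.
Proof.
rewrite ler_norml cauchy_schwarz andbT lerNl -dotNl -(enormN x).
exact: cauchy_schwarz.
Qed.

(** The number [w] stands for the increment of a Lipschitz perturbation. Its linear growth, like
    that of the first-order Taylor term, is absorbed by half of the quadratic term. *)
Lemma quadratic_bounds f (kl kh L : R) : class_C 1 f -> 0 < kl ->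
  (forall x s, 0 < s -> kl * dot x x * s <= dot (grad f (s *: x)) x - dot (grad f 0) x <=
     kh * dot x x * s) ->
  exists2 C : R, 0 <= C & forall x (w : R), `|w| <= L * enorm x ->
    kl / 4 * dot x x - C <= f x + w /\ f x + w <= C * bracket x.
Proof.
move=> fC kl0 H; pose N := enorm (grad f 0).
pose D := (N + L) ^+ 2 / (kl / 4).
have k4 : 0 < kl / 4 by rewrite divr_gt0.
have D0 : 0 <= D by rewrite divr_ge0 ?sqr_ge0// ltW.
exists (`|f 0| + D + `|N + L| + `|kh|); first by rewrite !addr_ge0.
move=> x w wL.
have h1 := @taylor_lower R d f x (kl * dot x x) fC (fun s s0 _ => proj1 (andP (H x s s0))).
have h2 := @taylor_upper R d f x (kh * dot x x) fC (fun s s0 _ => proj2 (andP (H x s s0))).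
have := abs_dot_le (grad f 0) x; rewrite -/N ler_norml => /andP[h3 h4].
have h5 := linear_le_sqr (N + L) (enorm x) k4; rewrite sqr_enorm -/D in h5.
move: wL; rewrite ler_norml => /andP[h6 h7].
have h8 : `|f 0| <= `|f 0| * bracket x by rewrite ler_peMr ?bracket_ge1.
have h9 : (N + L) * enorm x <= `|N + L| * bracket x.
  apply: (@le_trans _ _ (`|N + L| * enorm x)).
    by rewrite ler_wpM2r ?enorm_ge0 ?ler_norm.
  by rewrite ler_wpM2l ?enorm_le_bracket.
have h10 : kh * dot x x / 2 <= `|kh| * bracket x.
  rewrite -mulrA; apply: (@le_trans _ _ (`|kh| * (dot x x / 2))).
    by rewrite ler_wpM2r ?ler_norm// divr_ge0// dot_ge0.
  by rewrite ler_wpM2l// /bracket; have := @dot_ge0 _ _ x; move: (dot x x) => u; lra.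
have h11 : 0 <= D * bracket x by rewrite mulr_ge0// ltW// bracket_gt0.
have h12 := ler_norm (f 0).
have h13 : - `|f 0| <= f 0 by rewrite lerNl -normrN ler_norm.
split.
  move: h1 h3 h5 h6 (normr_ge0 (N + L)) (normr_ge0 kh) h13 => {h2 h4 h7 h8 h9 h10 h11 h12 H}.
  by move: (dot x x) (enorm x) (dot _ x) (`|f 0|) (`|N + L|) (`|kh|) => *; lra.
move: h2 h4 h7 h8 h9 h10 h11 h12 => {h1 h3 h5 h6 h13 H}.
by move: (dot x x) (enorm x) (dot _ x) (`|f 0|) (`|N + L|) (`|kh|) (bracket x) => *; lra.
Qed.

Lemma quadratic_bounds_hess f (kl kh L : R) : class_C 2 f -> 0 < kl ->
  (forall x v : 'rV[R]_d, kl * enorm v ^+ 2 <= dot (v *m hess f x) v <= kh * enorm v ^+ 2) ->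
  exists2 C : R, 0 <= C & forall x (w : R), `|w| <= L * enorm x ->
    kl / 4 * dot x x - C <= f x + w /\ f x + w <= C * bracket x.
Proof.
move=> fC kl0 H; apply: (@quadratic_bounds f kl kh L) => // [|x s s0]; first exact: class_CW.
by apply: hess_increment => // y; have := H y x; rewrite sqr_enorm.
Qed.

Lemma quadratic_bounds_monotone f (kl kh L : R) : class_C 1 f -> 0 < kl ->
  (forall x y, enorm (grad f x - grad f y) <= kh * enorm (x - y)) ->
  (forall x y, kl * enorm (x - y) ^+ 2 <= dot (grad f x - grad f y) (x - y)) ->
  exists2 C : R, 0 <= C & forall x (w : R), `|w| <= L * enorm x ->
    kl / 4 * dot x x - C <= f x + w /\ f x + w <= C * bracket x.
Proof.
move=> fC kl0 H1 H2; apply: (@quadratic_bounds f kl kh L) => // x s s0.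
have sE : enorm (s *: x) = s * enorm x.
  by rewrite /enorm dotZl dotZr mulrA -expr2 sqrtrM ?sqr_ge0// sqrtr_sqr gtr0_norm.
rewrite -dotNl -dotDl; apply/andP; split.
  have := H2 (s *: x) 0; rewrite subr0 dotZr sE exprMn sqr_enorm => h.
  by rewrite -(ler_pM2l s0); apply: le_trans h; rewrite le_eqVlt; apply/orP; left; apply/eqP; ring.
have := H1 (s *: x) 0; rewrite subr0 sE => h.
rewrite (le_trans (cauchy_schwarz _ _))// (le_trans (ler_wpM2r (enorm_ge0 x) h))//.
by rewrite -sqr_enorm le_eqVlt; apply/orP; left; apply/eqP; ring.
Qed.

Lemma sqrt_gibbs_bounds (V f : 'rV[R]_d -> R) (a C : R) k : 0 < a -> 0 <= C ->
  (forall x, f x = expR (- V x)) ->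
  (forall x, a * dot x x - C <= V x <= C * bracket x) ->
  (exists2 K : R, 0 < K & forall x, Num.sqrt (f x) <= K * decay k x) /\
  forall A, C / 2 <= A -> forall x, expR (- (C / 2)) * gauss A x <= Num.sqrt (f x).
Proof.
move=> a0 C0 fE VP.
have sE x : Num.sqrt (f x) = expR (- V x / 2).
  rewrite fE -[RHS](ger0_norm (ltW (expR_gt0 _))) -sqrtr_sqr; congr Num.sqrt.
  by rewrite -expRM_natl; congr expR; field.
split.
  have a20 : 0 < a / 2 by rewrite divr_gt0.
  have [K K0 HK] := @expR_decay R d _ k a20.
  exists (expR (C / 2) * K) => [|x]; first by rewrite mulr_gt0// expR_gt0.
  rewrite sE -mulrA; apply: (@le_trans _ _ (expR (C / 2) * expR (- (a / 2 * dot x x)))).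
    rewrite -expRD ler_expR; case/andP: (VP x) => h _.
    by move: h; move: (dot x x) (V x) => *; lra.
  by rewrite ler_pM2l ?expR_gt0.
move=> A CA x; rewrite sE /gauss -expRD ler_expR; case/andP: (VP x) => _.
have := ler_wpM2r (dot_ge0 x) CA; rewrite /bracket; move: (dot x x) (V x) => *; nra.
Qed.

End quadratic.

(** * Bounds on the coefficient of the equations *)

Section energy.
Context {R : realType} {d : nat}.
Variables (F : P2 R d -> R) (dF : P2 R d -> 'rV[R]_d -> R)
  (g : 'rV[R]_d -> R) (G : P2 R d -> 'rV[R]_d -> R) (LG : R).

Lemma lipschitz_constant_ge0 (f : 'rV[R]_d -> R) (L : R) : (0 < d)%N ->
  (forall x y, `|f x - f y| <= L * enorm (x - y)) -> 0 <= L.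
Proof.
move=> d0 H; have := le_trans (normr_ge0 _) (H (const_mx 1) 0); rewrite subr0.
have : 0 < enorm (const_mx 1 : 'rV[R]_d).
  rewrite lt_def enorm_ge0 andbT; apply/eqP => e0.
  have /rowP/(_ (Ordinal d0)) : (const_mx 1 : 'rV[R]_d) = 0.
    by apply: dot_eq0; rewrite -sqr_enorm e0 expr0n.
  by rewrite !mxE => /eqP; rewrite oner_eq0.
by move=> e0; rewrite pmulr_lge0.
Qed.

Hypothesis E : regular_energy F dF g G LG.

(** The factor 1/2 comes from passing from densities to square roots. *)
Definition coef (m : P2 R d) (x : 'rV[R]_d) : R := (g x + G m x - G m 0) / 2.

Lemma continuous_coef m : continuous (coef m).
Proof.
have c1 := continuous_addf (energy_g E) (class_C_continuous (energy_G E m)).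
have c2 : continuous (fun _ : 'rV[R]_d => - G m 0) by exact: cst_continuous.
have c3 : continuous (fun _ : 'rV[R]_d => 2^-1 : R) by exact: cst_continuous.
exact: continuous_mulf (continuous_addf c1 c2) c3.
Qed.

Lemma coef_dist m m' (w : R) x : (wasserstein 1 m m' <= w%:E)%E ->
  `|coef m x - coef m' x| <= LG / 2 * w * enorm x.
Proof.
move=> mm'; have := G_increment E x mm'; rewrite /coef -mulrBl normrM.
rewrite [in `|2^-1|]ger0_norm ?invr_ge0// => h.
rewrite [leRHS](_ : _ = LG * w * enorm x / 2); last by ring.
rewrite ler_pM2r ?invr_gt0//; apply: le_trans h; rewrite distrC le_eqVlt; apply/orP; left.
by apply/eqP; congr `|_|; ring.
Qed.

Lemma coef_bounds (kl kh : R) : class_C 2 g -> 0 < kl ->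
  (forall x v : 'rV[R]_d, kl * enorm v ^+ 2 <= dot (v *m hess g x) v <= kh * enorm v ^+ 2) ->
  exists a1 a2 Cu : R, [/\ 0 < a1, 0 <= a2, 0 <= Cu & forall m x,
    a1 * dot x x - a2 <= coef m x /\ coef m x <= Cu * bracket x].
Proof.
move=> gC kl0 H; have [C C0 HC] := quadratic_bounds_hess LG gC kl0 H.
exists (kl / 4 / 2), (C / 2), (C / 2); rewrite !divr_gt0// !divr_ge0//; split=> // m x.
have := HC x (G m x - G m 0) _; rewrite -{2}(subr0 x) => /(_ (energy_lip E m x 0)) [h1 h2].
rewrite /coef; split.
  by move: h1; move: (dot x x) (g x) (G m x) (G m 0) => *; lra.
by move: h2; move: (bracket x) (g x) (G m x) (G m 0) => *; lra.
Qed.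

Lemma dF_bounded_below (kl kh : R) m : class_C 2 g -> 0 < kl ->
  (forall x v : 'rV[R]_d, kl * enorm v ^+ 2 <= dot (v *m hess g x) v <= kh * enorm v ^+ 2) ->
  exists Cd : R, forall x, - Cd <= dF m x.
Proof.
move=> gC kl0 H; have [a1 [a2 [Cu [a10 _ _ HC]]]] := coef_bounds gC kl0 H.
exists (2 * a2 - G m 0) => x; have [h _] := HC m x; rewrite (energy_split E).
have : 0 <= a1 * dot x x by rewrite mulr_ge0 ?dot_ge0// ltW.
by move: h; rewrite /coef; move: (a1 * _) (g x) (G m x) (G m 0) => *; lra.
Qed.

End energy.

(** * Stability of the densities *)

Section density_stability.
Context {R : realType} {d : nat}.
Local Notation leb := (lebesgue_rV R d).
Local Notation Int f := (\int[leb]_x f x).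
Local Notation itg f := (leb.-integrable setT (EFin \o f)).
Implicit Types (x : 'rV[R]_d).

Definition decay_mass : R := Int (@decay R d d).

Let I0 : 0 <= decay_mass.
Proof. by apply: Int_ge0 => x; rewrite ltW// decay_gt0. Qed.

Definition close_cst (K n0 : R) : R :=
  (2 * K + K ^+ 2 / n0 ^+ 2 * (2 * K * decay_mass)) / n0 ^+ 2.

Variables (K n0 : R).
Hypotheses (K0 : 0 < K) (n00 : 0 < n0).

Lemma close_cst_ge0 : 0 <= close_cst K n0.
Proof.
have n2 : 0 <= n0 ^+ 2 by exact: sqr_ge0.
have K2 : 0 <= 2 * K by rewrite mulr_ge0// ltW.
apply: divr_ge0 => //; apply: addr_ge0 => //; apply: mulr_ge0; last exact: mulr_ge0.
by apply: divr_ge0 => //; exact: sqr_ge0.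
Qed.

Variables (f f' u v : 'rV[R]_d -> R) (nu nv dlt : R).
Hypotheses (fP : is_density f) (f'P : is_density f') (nu0 : n0 <= nu) (nv0 : n0 <= nv).
Hypotheses (uE : forall x, u x = nu * Num.sqrt (f x)) (vE : forall x, v x = nv * Num.sqrt (f' x)).
Hypotheses (u_le : forall x, u x <= K * decay d.+1 x) (v_le : forall x, v x <= K * decay d.+1 x).
Hypotheses (dlt0 : 0 <= dlt) (uv : forall x, `|u x - v x| <= dlt * decay d x).

Let nup : 0 < nu. Proof. exact: lt_le_trans nu0. Qed.
Let nvp : 0 < nv. Proof. exact: lt_le_trans nv0. Qed.
Let u0 x : 0 <= u x. Proof. by rewrite uE mulr_ge0 ?sqrtr_ge0// ltW. Qed.
Let v0 x : 0 <= v x. Proof. by rewrite vE mulr_ge0 ?sqrtr_ge0// ltW. Qed.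
Let u2 x : u x ^+ 2 = nu ^+ 2 * f x.
Proof. by rewrite uE exprMn sqr_sqrtr// density_ge0. Qed.
Let v2 x : v x ^+ 2 = nv ^+ 2 * f' x.
Proof. by rewrite vE exprMn sqr_sqrtr// density_ge0. Qed.

Let sq_le x : `|u x ^+ 2 - v x ^+ 2| <= dlt * (2 * K) * (decay d x * decay d.+1 x).
Proof.
rewrite subr_sqr normrM; have w0 := decay_gt0 d x; have w1 := decay_gt0 d.+1 x.
rewrite [leRHS](_ : _ = (dlt * decay d x) * (2 * K * decay d.+1 x)); last by ring.
apply: ler_pM => //; rewrite ger0_norm ?addr_ge0//.
by have := u_le x; have := v_le x; move: (u x) (v x) (decay d.+1 x) => *; lra.
Qed.

Let prod_le x : decay d x * decay d.+1 x <= decay d x.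
Proof. by rewrite ler_piMr ?decay_le1// ltW// decay_gt0. Qed.

(** The densities have mass 1, so [nu ^+ 2] and [nv ^+ 2] are the integrals of [u ^+ 2] and
    [v ^+ 2]. *)
Let mass_le : `|nu ^+ 2 - nv ^+ 2| <= dlt * (2 * K * decay_mass).
Proof.
have fi := density_itg fP; have f'i := density_itg f'P.
have -> : nu ^+ 2 - nv ^+ 2 = Int (fun x => nu ^+ 2 * f x - nv ^+ 2 * f' x).
  rewrite (IntB (itgZ _ fi) (itgZ _ f'i)) (IntZ _ fi) (IntZ _ f'i).
  by rewrite (density_Int fP) (density_Int f'P) !mulr1.
have di : itg (fun x => nu ^+ 2 * f x - nv ^+ 2 * f' x) by apply: itgB; exact: itgZ.
have wi := @itg_decay R d d (leqnn d).
apply: le_trans (Int_norm di) _; rewrite mulrA /decay_mass -(IntZ _ wi).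
apply: Int_le; [exact: itg_norm|exact: itgZ|move=> x].
rewrite -u2 -v2 (le_trans (sq_le x))// ler_wpM2l ?prod_le//.
by rewrite mulr_ge0// mulr_ge0// ltW.
Qed.

(** The densities are [u ^+ 2 / nu ^+ 2] and [v ^+ 2 / nv ^+ 2]. Closeness of [u] and [v] controls
    the squares and, through their integrals, the normalizing factors as well; the lower bound [n0]
    permits the division. *)
Lemma density_close x : `|f x - f' x| <= dlt * close_cst K n0 * (decay d x * decay d.+1 x).
Proof.
have w0 : 0 <= decay d x * decay d.+1 x by rewrite mulr_ge0// ltW// decay_gt0.
have n2 : 0 < n0 ^+ 2 by exact: exprn_gt0.
have nu2 : n0 ^+ 2 <= nu ^+ 2 by rewrite lerXn2r ?nnegrE// ltW.
have nv2 : n0 ^+ 2 <= nv ^+ 2 by rewrite lerXn2r ?nnegrE// ltW.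
have f0 := density_ge0 f'P x.
have f'le : f' x <= K ^+ 2 / n0 ^+ 2 * (decay d x * decay d.+1 x).
  rewrite mulrAC ler_pdivlMr// mulrC; apply: (@le_trans _ _ (v x ^+ 2)).
    by rewrite v2 ler_wpM2r.
  apply: (@le_trans _ _ ((K * decay d.+1 x) ^+ 2)).
    by rewrite lerXn2r ?nnegrE// ?mulr_ge0// ltW// ?decay_gt0.
  rewrite exprMn ler_wpM2l ?sqr_ge0// expr2 ler_wpM2r ?decay_leS// ltW//.
  exact: decay_gt0.
have key : nu ^+ 2 * (f x - f' x) = (u x ^+ 2 - v x ^+ 2) - (nu ^+ 2 - nv ^+ 2) * f' x.
  by rewrite u2 v2; ring.
have h : n0 ^+ 2 * `|f x - f' x| <= dlt * (2 * K) * (decay d x * decay d.+1 x) +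
    dlt * (2 * K * decay_mass) * (K ^+ 2 / n0 ^+ 2 * (decay d x * decay d.+1 x)).
  apply: (@le_trans _ _ (nu ^+ 2 * `|f x - f' x|)); first by rewrite ler_wpM2r.
  rewrite -[X in X * _ <= _](ger0_norm (sqr_ge0 nu)) -normrM key.
  apply: le_trans (ler_normB _ _) _; apply: lerD => //.
  by rewrite normrM (ger0_norm f0); apply: ler_pM.
rewrite -(ler_pM2l n2); apply: le_trans h _; rewrite le_eqVlt; apply/orP; left; apply/eqP.
by rewrite /close_cst; field; rewrite gt_eqF.
Qed.

(** The factor [enorm x <= bracket x] turns [decay d.+1] into [decay d], and the other weight
    [decay d] still makes the bound integrable. *)
Lemma wasserstein1_close m m' : has_density m f -> has_density m' f' ->
  (wasserstein 1 m m' <= (dlt * close_cst K n0 * decay_mass)%:E)%E.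
Proof.
move=> mf m'f'; apply: le_trans (wasserstein1_le_density mf m'f') _.
have wi := @itg_decay R d d (leqnn d); have Cc := mulr_ge0 dlt0 close_cst_ge0.
pose H x := enorm x * `|f x - f' x|; pose H' x := dlt * close_cst K n0 * decay d x.
have HH x : H x <= H' x.
  rewrite /H /H'; apply: (@le_trans _ _ (bracket x * (dlt * close_cst K n0 * (decay d x * decay d.+1 x)))).
    by apply: ler_pM; rewrite ?enorm_ge0 ?enorm_le_bracket ?density_close.
  rewrite decayS (_ : _ * _ = dlt * close_cst K n0 * (decay d x * decay d x)).
    by rewrite ler_wpM2l// ler_piMr ?decay_le1// ltW// decay_gt0.
  by field; rewrite gt_eqF// bracket_gt0.
have H0 x : 0 <= H x by rewrite mulr_ge0// enorm_ge0.
have mH : measurable_fun setT H.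
  apply: measurable_funM; first exact: measurable_enorm.
  apply: measurableT_comp => //; apply: measurable_funB; exact: density_measurable.
have Hi : itg H.
  apply: (@itg_le _ _ _ leb _ H') => //; last exact: itgZ.
  by move=> x; rewrite ger0_norm.
rewrite -[leLHS](EFin_Int Hi) lee_fin /decay_mass -(IntZ _ wi); apply: Int_le => //.
exact: itgZ.
Qed.

End density_stability.

(** * The scheme and the dynamics without multipliers *)

Section scheme_normalization.
Context {R : realType} {d : nat}.
Variables (F : P2 R d -> R) (dF : P2 R d -> 'rV[R]_d -> R)
  (g : 'rV[R]_d -> R) (G : P2 R d -> 'rV[R]_d -> R) (LG : R).
Hypothesis E : regular_energy F dF g G LG.
Variables (sigma h : R).
Hypotheses (sigma0 : 0 < sigma) (h0 : 0 < h).
Variables (p0 : 'rV[R]_d -> R) (q : nat -> 'rV[R]_d -> R).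
Hypotheses (p0P : is_density p0) (cp0 : continuous p0) (p0_gt0 : forall x, 0 < p0 x)
  (p0_le : exists B : R, forall x, p0 x <= B).
Hypothesis dF_ge : forall m, exists Cd : R, forall x, - Cd <= dF m x.
Hypothesis qP : minimizing_movement F sigma h p0 q.

(** Induction on the index: continuity, positivity and boundedness of one density are what the
    analysis of the next step requires. *)
Lemma minimizing_movement_density i :
  [/\ is_density (q i), continuous (q i), forall x, 0 < q i x & exists B : R, forall x, q i x <= B].
Proof.
have [q0 qS] := qP; elim: i => [|i [qd qc qp [B qB]]]; first by rewrite q0.
have [c1 [m st]] := qS i; have [Cd HCd] := dF_ge m; split=> //.
- by case: st => -[mf _] _; exact: has_density_is_density mf.
- exact: (step_gt0 E sigma0 h0 qd qc qp st c1).
- exact: (step_bounded E sigma0 h0 qd qc qp st c1 HCd qB).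
Qed.

(** Multiplying the square roots by [n i] adds [h^-1 * ln (n i.+1 / n i)] to the logarithmic term.
    The recursion makes this equal to [(G m 0 - l) / 2], which is the difference between
    [(dF m - l) / 2] and [coef]. *)
Lemma scheme_normalization : exists (m : nat -> P2 R d) (n : nat -> R),
  [/\ scheme_solution (sigma ^+ 2 / 2) h (fun i x => n i * Num.sqrt (q i x))
        (fun i => coef g G (m i)),
      n 0%N = 1, forall i, 0 < n i & forall i, has_density (m i.+1) (q i.+1)].
Proof.
have /choice[ml mlP] i : exists ml : P2 R d * R, has_density ml.1 (q i.+1) /\
    weak_laplacian (fun x => Num.sqrt (q i.+1 x)) (fun x => (sigma ^+ 2 / 2)^-1 *
      (Num.sqrt (q i.+1 x) * (h^-1 * ln (Num.sqrt (q i.+1 x) / Num.sqrt (q i x)) +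
        (dF ml.1 x - ml.2) / 2))).
  have [qd qc qp _] := minimizing_movement_density i.
  have [_ /(_ i)[c1 [m st]]] := qP; case: (st) => -[mf _] _.
  have [l Hl] := step_weak_laplacian E sigma0 h0 qd qc qp st c1.
  by exists (m, l).
pose kap i := (G (ml i).1 0 - (ml i).2) / 2.
pose n := fix n i := if i is j.+1 then n j * expR (h * kap j) else 1 : R.
have n_gt0 i : 0 < n i by elim: i => //= i IHi; rewrite mulr_gt0// expR_gt0.
have cq i : continuous (fun x => Num.sqrt (q i x)).
  by apply: continuous_sqrtf; case: (minimizing_movement_density i).
have q_gt0 i x : 0 < Num.sqrt (q i x).
  by rewrite sqrtr_gt0; case: (minimizing_movement_density i).
(* The measures are shifted by one index, so the one at index 0 is a dummy value. *)
exists (fun i => (ml i.-1).1), n; split=> //; last by move=> i; case: (mlP i).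
split.
- move=> i; apply: continuous_mulf; last exact: cq.
  by move=> x; exact: cst_continuous.
- by move=> i x; rewrite mulr_gt0.
- move=> i; have [_ _ _ [B HB]] := minimizing_movement_density i.
  by exists (n i * Num.sqrt B) => x; rewrite ler_pM2l// ler_wsqrtr.
- by move=> i; exact: continuous_coef E _.
move=> i; have [_ wl] := mlP i.
set c := sigma ^+ 2 / 2 in wl *; set k := (fun x => c^-1 * _) in wl.
have ck : continuous k.
  have c1 := continuous_mulf (cq i.+1) (continuous_invf (cq i) (q_gt0 i)).
  have c2 : continuous (fun x => ln (Num.sqrt (q i.+1 x) / Num.sqrt (q i x))).
    move=> x; apply: (@continuous_comp _ _ _ (fun x => Num.sqrt (q i.+1 x) * (Num.sqrt (q i x))^-1)
      (@ln R)); first exact: c1.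
    by apply: continuous_ln; rewrite divr_gt0.
  have cc (a : R) : continuous (fun _ : 'rV[R]_d => a) by move=> x; exact: cst_continuous.
  have c3 := continuous_mulf (continuous_addf (@continuous_dF _ _ _ _ _ _ _ E (ml i).1)
    (cc (- (ml i).2))) (cc 2^-1).
  exact: continuous_mulf (cc _) (continuous_mulf (cq i.+1)
    (continuous_addf (continuous_mulf (cc h^-1) c2) c3)).
have := weak_laplacianZ (n i.+1) (cq i.+1) ck wl.
congr weak_laplacian; apply/funext => x; rewrite /k /=.
have -> : ln (n i * expR (h * kap i) * Num.sqrt (q i.+1 x) / (n i * Num.sqrt (q i x))) =
    h * kap i + ln (Num.sqrt (q i.+1 x) / Num.sqrt (q i x)).
  rewrite -[X in X + _]expRK -lnM ?posrE ?expR_gt0 ?divr_gt0//; congr ln.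
  by field; rewrite !gt_eqF.
rewrite (energy_split E) /coef /kap.
by field; rewrite !gt_eqF// /c divr_gt0// exprn_gt0.
Qed.

End scheme_normalization.

Section dynamics_normalization.
Context {R : realType} {d : nat}.
Variables (F : P2 R d -> R) (dF : P2 R d -> 'rV[R]_d -> R)
  (g : 'rV[R]_d -> R) (G : P2 R d -> 'rV[R]_d -> R) (LG : R).
Hypothesis E : regular_energy F dF g G LG.
Variables (sigma : R) (p0 : 'rV[R]_d -> R) (p : R -> 'rV[R]_d -> R).
Hypothesis sigma0 : 0 < sigma.
Hypothesis p0_gt0 : forall x, 0 < p0 x.
Hypothesis pP : mean_field_schrodinger dF sigma p0 p.
Variables (a1 a2 Cu K T : R) (k : nat).
Hypotheses (a10 : 0 <= a1) (a20 : 0 <= a2) (K0 : 0 < K) (T0 : 0 < T).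
Hypothesis coefP : forall m x, a1 * dot x x - a2 <= coef g G m x /\ coef g G m x <= Cu * bracket x.
Hypothesis p0_le : forall x, Num.sqrt (p0 x) <= K * decay k x.

(** Turns continuity within [A] into continuity everywhere by composing with a map into [A]; it is
    used with the set of nonnegative times. *)
Lemma cvg_clamp (A : set (R * 'rV[R]_d)) (u : R * 'rV[R]_d -> R)
    (f : R * 'rV[R]_d -> R * 'rV[R]_d) :
  {within A, continuous u} -> continuous f -> (forall z, A (f z)) -> continuous (u \o f).
Proof.
move=> /subspace_continuousP uc cf Af z; apply: cvg_comp (uc _ (Af z)).
move=> P; rewrite /within /= => nP.
have H : nbhs z (f @^-1` (fun w => A w -> P w)) := cf z _ nP.
by apply: filterS H => w /= /(_ (Af w)).
Qed.

(** After [remove_multiplier], the comparison with the weight applies: its hypothesis on the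
    integral of the square holds because [p t] has mass 1 and the normalizing factor is at most
    [nhi]. *)
Lemma dynamics_normalization : exists (m : R -> P2 R d) (psi dpsi : R -> 'rV[R]_d -> R)
  (n : R -> R) (A n0 K1 : R),
  [/\ parabolic_solution (sigma ^+ 2 / 2) T A psi dpsi (fun t => coef g G (m t)) (fun=> 0),
      psi 0 = (fun x => Num.sqrt (p0 x)), 0 < n0 /\ 0 < K1,
      forall t, 0 < t -> has_density (m t) (p t) &
      forall t, 0 <= t -> t < T -> n0 <= n t /\
        forall x, psi t x = n t * Num.sqrt (p t x) /\ psi t x <= K1 * decay k x].
Proof.
have [m [l ml]] := psi_pde E p0_gt0 pP.
have cl := psi_multiplier_continuous p0_gt0 pP (fun t t0 => (ml t t0).2).
pose mx0 (t : R) := Num.max 0 t.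
have mx0E t : 0 <= t -> mx0 t = t by move=> t0; rewrite /mx0 (max_r t0).
have mx00 t : 0 <= mx0 t by rewrite le_max lexx.
have cmx0 : continuous mx0.
  by move=> u; apply: (@continuous_max _ _ (fun=> 0) id); [exact: cst_continuous|exact: cvg_id].
pose psi t x := Num.sqrt (p (mx0 t) x).
have psiE t : 0 <= t -> psi t = (fun x => Num.sqrt (p t x)).
  by move=> t0; rewrite /psi mx0E.
pose A := `|Cu| + a2.
(* The horizon is taken beyond [T] because [remove_multiplier] shortens it. *)
have S : parabolic_solution (sigma ^+ 2 / 2) (T + 1) A psi (sqrt_time_derivative p)
    (fun t => coef g G (m t)) l.
  split.
  - have c1 : continuous (fun z : R * 'rV[R]_d => (mx0 z.1, z.2)).
      move=> z; apply: (@continuous_pair _ _ _ (fun z => mx0 z.1) snd); last exact: cvg_snd.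
      by apply: (@continuous_comp _ _ _ fst mx0); [exact: cvg_fst|exact: cmx0].
    have [_ pc _ _] := pP; have c2 := cvg_clamp pc c1 (fun z => mx00 z.1).
    move=> z; apply: (@continuous_comp _ _ _ (fun z => p (mx0 z.1) z.2) Num.sqrt).
      exact: c2.
    exact: sqrt_continuous.
  - by move=> t x t0; rewrite psiE//; exact: (psi_gt0 p0_gt0 pP).
  - by move=> t t0 _; rewrite psiE ?(ltW t0)//; exact: (psi_class_C2 p0_gt0 pP).
  - move=> t x t0 _; apply: (is_derive_near_eq t0 _ (is_derive_psi p0_gt0 pP x t0)) => s.
    rewrite ltr_distl => /andP[+ _]; rewrite subrr => s0.
    by rewrite /psi mx0E// ltW.
  - by move=> t x t0 _; exact: (sqrt_time_derivative_continuous p0_gt0 pP).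
  - by move=> t x t0 _; rewrite psiE ?(ltW t0)//; case: (ml t t0).
  move=> t x t0 _; have [h1 h2] := coefP (m t) x.
  have h3 : 0 <= a1 * dot x x by rewrite mulr_ge0 ?dot_ge0.
  have h4 : a2 <= a2 * bracket x by rewrite ler_peMr ?bracket_ge1.
  have h5 : Cu * bracket x <= `|Cu| * bracket x.
    by rewrite ler_wpM2r ?ler_norm// ltW// bracket_gt0.
  have h6 : 0 <= `|Cu| * bracket x by rewrite mulr_ge0// ltW// bracket_gt0.
  have h7 : 0 <= a2 * bracket x by rewrite mulr_ge0// ltW// bracket_gt0.
  rewrite /A mulrDl ler_norml; move: h1 h2 h3 h4 h5 h6 h7.
  move: (coef _ _ _ _) (a1 * _) (a2 * bracket x) (Cu * _) (`|Cu| * _) => *.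
  by apply/andP; split; lra.
have T1 : 0 < T + 1 by rewrite addr_gt0.
have TT1 : T < T + 1 by rewrite ltrDl.
have [psih [dpsih [n [nlo [nhi [Sh init nlo0 nP]]]]]] :=
  remove_multiplier S T1 (fun t t0 _ => cl t t0) T0 TT1.
pose c : R := sigma ^+ 2 / 2.
have c0 : 0 < c by rewrite divr_gt0// exprn_gt0.
have init' : psih 0 = (fun x => Num.sqrt (p0 x)) by rewrite init psiE//; case: pP => _ _ ->.
have a_ge t x : 0 < t -> t < T -> - a2 <= coef g G (m t) x.
  move=> _ _; have [h1 _] := coefP (m t) x.
  by apply: le_trans h1; rewrite lerDr mulr_ge0 ?dot_ge0.
have sq t : 0 < t -> t < T ->
  (lebesgue_rV R d).-integrable setT (EFin \o (fun x => psih t x ^+ 2)) /\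
  \int[lebesgue_rV R d]_x (psih t x ^+ 2) <= nhi ^+ 2.
  move=> t0 tT; have [/andP[n1 n2] nE] := nP t (ltW t0) (ltW tT).
  have mt := (ml t t0).1; have pd := has_density_is_density mt.
  have -> : (fun x => psih t x ^+ 2) = (fun x => n t ^+ 2 * p t x).
    apply/funext => x; rewrite nE psiE ?(ltW t0)// exprMn sqr_sqrtr//.
    exact: density_ge0 pd x.
  have pi := density_itg pd; split; first exact: itgZ.
  rewrite (IntZ _ pi) (density_Int pd) mulr1.
  have n0 : 0 <= n t by apply: ltW; exact: lt_le_trans n1.
  by rewrite lerXn2r ?nnegrE// (le_trans n0).
have dec := @solution_decay R d c T A psih dpsih (fun t => coef g G (m t)) Sh a2 (nhi ^+ 2) K k.
pose C := a2 + c * (2 * k%:R * (d%:R + 2 * k.+1%:R)).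
exists m, psih, dpsih, n, A, nlo, (K * expR (C * T)); split=> //.
- by split=> //; rewrite mulr_gt0// expR_gt0.
- by move=> t t0; case: (ml t t0).
move=> t t0 tT; have [/andP[n1 n2] nE] := nP t t0 (ltW tT); split=> // x.
split; first by rewrite nE psiE.
have init0 y : psih 0 y <= K * decay k y by rewrite init'.
apply: le_trans (dec c0 a20 K0 a_ge sq init0 t x t0 tT) _.
rewrite ler_pM2r ?decay_gt0// ler_pM2l// ler_expR -/C ler_wpM2l ?(ltW tT)//.
by rewrite addr_ge0// mulr_ge0 ?(ltW c0)// !mulr_ge0// addr_ge0// mulr_ge0.
Qed.

End dynamics_normalization.

(** * Uniform convergence of the densities *)

Section uniform_convergence.
Context {R : realType} {d : nat}.
Variables (F : P2 R d -> R) (dF : P2 R d -> 'rV[R]_d -> R)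
  (g : 'rV[R]_d -> R) (G : P2 R d -> 'rV[R]_d -> R) (LG : R).
Hypothesis E : regular_energy F dF g G LG.
Variables (sigma a1 a2 Cu Kp C1 Ag : R).
Hypotheses (sigma0 : 0 < sigma) (a10 : 0 < a1) (a20 : 0 <= a2) (Cu0 : 0 <= Cu) (Kp0 : 0 < Kp)
  (C10 : 0 < C1) (Ag0 : 0 < Ag) (CuA : Cu <= 4 * (sigma ^+ 2 / 2) * Ag ^+ 2).
Hypothesis coefP : forall m x, a1 * dot x x - a2 <= coef g G m x /\ coef g G m x <= Cu * bracket x.
Hypothesis dF_ge : forall m, exists Cd : R, forall x, - Cd <= dF m x.
Variable p0 : 'rV[R]_d -> R.
Hypotheses (p0P : is_density p0) (cp0 : continuous p0) (p0_gt0 : forall x, 0 < p0 x)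
  (p0_bounded : exists B : R, forall x, p0 x <= B)
  (p0_le : forall x, Num.sqrt (p0 x) <= Kp * decay d.+1 x)
  (p0_ge : forall x, C1 * gauss Ag x <= Num.sqrt (p0 x)).
Variables (q : R -> nat -> 'rV[R]_d -> R) (p : R -> 'rV[R]_d -> R).
Hypothesis qP : forall h, 0 < h -> minimizing_movement F sigma h p0 (q h).
Hypothesis pP : mean_field_schrodinger dF sigma p0 p.

(** On the unit ball of the sup norm one has [|y|^2 <= d], so a smaller factor [nu] would force the
    density above 1 on a set of volume at least 1, against the unit mass. *)
Lemma normalization_ge (c2 nu : R) (f : 'rV[R]_d -> R) : is_density f -> 0 < c2 -> 0 < nu ->
  (forall x, c2 * gauss Ag x <= nu * Num.sqrt (f x)) -> c2 * expR (- (Ag * d%:R)) <= nu.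
Proof.
move=> fP c20 nu0 H; set e := c2 * expR _.
have e0 : 0 < e by rewrite mulr_gt0// expR_gt0.
have ball_ge y : ball (0 : 'rV[R]_d) 1 y -> (e / nu) ^+ 2 <= f y.
  move=> yB; have yd : dot y y <= d%:R.
    have yM : cube 1 y by move=> i; have := ball_coord yB i; rewrite mxE sub0r normrN => /ltW.
    by have := dot_cube ler01 yM; rewrite expr1n mulr1.
  have en0 : 0 <= e / nu by rewrite divr_ge0// ltW.
  rewrite -[leRHS]sqr_sqrtr ?(density_ge0 fP)// lerXn2r ?nnegrE ?sqrtr_ge0//.
  rewrite ler_pdivrMr// mulrC (le_trans _ (H y))// ler_pM2l// /gauss ler_expR mulNr lerN2.
  by rewrite ler_pM2l.
have := Int_ball_ge ltr01 (sqr_ge0 _) (density_itg fP) (density_ge0 fP) ball_ge.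
rewrite (density_Int fP) mulr1 => h.
rewrite -ler_sqr ?nnegrE ?(ltW e0) ?(ltW nu0)//.
move: h; rewrite expr_div_n mulrAC ler_pdivrMr ?exprn_gt0// mul1r => h.
by apply: le_trans h; rewrite ler_peMr ?sqr_ge0// exprn_ege1// ler1n.
Qed.

(** All constants are independent of [h]: the barriers enclose the normalized scheme, the unit mass
    bounds its factors below, and [density_close] converts weighted closeness of the normalized
    functions into closeness of the densities. *)
Lemma uniform_convergence (T e : R) : 0 < T -> 0 < e -> exists2 h0 : R, 0 < h0 &
  forall h t x, 0 < h -> h < h0 -> 0 <= t -> t <= T ->
  `|step_interpolation h (q h) t x - p t x| < e.
Proof.
(* Three nested horizons: the scheme is compared up to [T], the continuous time of the doubling runs
   up to [T'], and the equation of [psi] is available up to [T + 3]. *)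
move=> T0 e0; pose c : R := sigma ^+ 2 / 2; pose T' := T + 1.
have c0 : 0 < c by rewrite divr_gt0// exprn_gt0.
have TT' : T < T' by rewrite ltrDl.
have T'3 : T' < T + 3 by rewrite ltrD2l ltr1n.
have T30 : 0 < T + 3 by rewrite addr_gt0.
have T'0 : 0 <= T' by rewrite ltW// (lt_trans T0).
have [m [psi [dpsi [n [A [n0 [K1 [S init [n00 K10] mP nP]]]]]]]] :=
  dynamics_normalization E sigma0 p0_gt0 pP (ltW a10) a20 Kp0 T30 coefP p0_le.
pose Csup := a2 + c * (2 * d.+1%:R * (d%:R + 2 * d.+2%:R) + 2 * d%:R) + 1.
have Csup0 : 0 <= Csup.
  by rewrite !addr_ge0// mulr_ge0 ?(ltW c0)// addr_ge0 ?mulr_ge0// addr_ge0// mulr_ge0.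
pose D := Cu + 6 * c * Ag * d%:R + 1.
have D0 : 0 <= D by rewrite !addr_ge0// !mulr_ge0// ltW.
pose K0 := Kp * expR (Csup * T') + K1.
have K00 : 0 < K0 by rewrite addr_gt0// mulr_gt0// expR_gt0.
pose c2 := expR (- D * T') * C1.
have c20 : 0 < c2 by rewrite mulr_gt0// expR_gt0.
pose n1 := Num.min n0 (c2 * expR (- (Ag * d%:R))).
have n10 : 0 < n1 by rewrite lt_min n00 mulr_gt0// expR_gt0.
pose CC := @close_cst R d K0 n1.
have CC0 : 0 <= CC by exact: close_cst_ge0.
pose Cs := LG / 2 * (CC * @decay_mass R d).
have mass0 : 0 <= @decay_mass R d by apply: Int_ge0 => x; rewrite ltW// decay_gt0.
have Cs0 : 0 <= Cs by have := energy_LG E => h; apply: mulr_ge0; [exact: divr_ge0|exact: mulr_ge0].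
have psi_le t x : 0 <= t -> t <= T' -> psi t x <= K0 * decay d.+1 x.
  move=> t0 tT'; have [_ /(_ x)[_ h]] := nP t t0 (le_lt_trans tT' T'3).
  by rewrite (le_trans h)// ler_pM2r ?decay_gt0// lerDr mulr_ge0 ?expR_ge0// ltW.
have a_ge t x : 0 < t -> t <= T' -> a1 * dot x x - a2 <= coef g G (m t) x.
  by move=> _ _; case: (coefP (m t) x).
have n1_le t : 0 <= t -> t <= T' -> n1 <= n t.
  move=> t0 tT'; have [h _] := nP t t0 (le_lt_trans tT' T'3).
  by rewrite (le_trans _ h)// ge_min lexx.
have psiE t x : 0 <= t -> t <= T' -> psi t x = n t * Num.sqrt (p t x).
  by move=> t0 tT'; have [_ /(_ x)[]] := nP t t0 (le_lt_trans tT' T'3).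
(* The error [e1] occurs twice, for the scheme at the grid point and for the variation of [psi]
   within one step; [CC] is the price of returning to densities. *)
pose e1 := e / (2 * CC + 1).
have den0 : 0 < 2 * CC + 1 by rewrite ltr_wpDl// mulr_ge0.
have e10 : 0 < e1 by rewrite divr_gt0.
have [hm hm0 Hm] := solution_modulus S K00 psi_le e10.
have [hs hs0 Hs] := scheme_convergence S c0 (ltW T0) TT' T'3 K00 Cs0 a10 a20 (ltW Ag0) c20 a_ge psi_le e10.
exists (Num.min hm hs) => [|h t x h0]; first by rewrite lt_min hm0.
rewrite lt_min => /andP[hhm hhs] t0 tT.
have [mu [nn [P nn0 nn_gt0 muP]]] := scheme_normalization E sigma0 h0 p0P cp0 p0_gt0
  p0_bounded dF_ge (qP h0).
set phi := (fun i x => nn i * Num.sqrt (q h i x)) in P.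
set b := (fun i => coef g G (mu i)) in P.
have [q0 _] := qP h0.
have phi0 : phi 0%N = psi 0 by rewrite /phi nn0 init q0; apply/funext => y; rewrite mul1r.
have phi_le i y : i%:R * h <= T' -> phi i y <= K0 * decay d.+1 y.
  move=> iT; have b_ge j z : - a2 <= b j.+1 z.
    have [hh _] := coefP (mu j.+1) z; apply: le_trans hh.
    by rewrite lerDr mulr_ge0 ?dot_ge0// ltW.
  have p0' z : phi 0%N z <= Kp * decay d.+1 z by rewrite phi0 init.
  rewrite (le_trans (scheme_upper_barrier c0 h0 P a20 Kp0 b_ge p0' i y))//.
  rewrite ler_pM2r ?decay_gt0// -/Csup (@le_trans _ _ (Kp * expR (Csup * T')))//.
    by rewrite ler_pM2l// ler_expR ler_wpM2l.
  by rewrite lerDl ltW.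
have phi_ge i y : i%:R * h <= T' -> c2 * gauss Ag y <= phi i y.
  move=> iT; have b_le j z : b j.+1 z <= Cu * bracket z by case: (coefP (mu j.+1) z).
  have p0' z : C1 * gauss Ag z <= phi 0%N z by rewrite phi0 init.
  apply: le_trans (scheme_lower_barrier c0 h0 P Cu0 C10 Ag0 CuA b_le p0' i y).
  rewrite -/D -(mulrA (expR _)) ler_pM2r ?mulr_gt0 ?gauss_gt0// ler_expR !mulNr lerN2.
  by rewrite ler_wpM2l.
have qd i : is_density (q h i).
  by have [] := minimizing_movement_density E sigma0 h0 p0P cp0 p0_gt0 p0_bounded dF_ge (qP h0) i.
have n1_nn i : i%:R * h <= T' -> n1 <= nn i.
  move=> iT; have := normalization_ge (qd i) c20 (nn_gt0 i) (fun z => phi_ge i z iT).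
  by move=> hh; rewrite (le_trans _ hh)// ge_min lexx orbT.
have stab i s (dlt : R) : (0 < i)%N -> i%:R * h <= T' -> 0 < s -> s <= T' -> 0 <= dlt ->
    (forall y, `|phi i y - psi s y| <= dlt * decay d y) ->
    forall y, `|b i y - coef g G (m s) y| <= Cs * dlt * enorm y.
  case: i => // i _ iT s0 sT' dlt0 H y; have ms := mP s s0.
  have W := wasserstein1_close K00 n10 (qd i.+1) (has_density_is_density ms)
    (n1_nn _ iT) (n1_le _ (ltW s0) sT') (fun z => erefl (phi i.+1 z))
    (fun z => psiE s z (ltW s0) sT') (fun z => phi_le _ z iT)
    (fun z => psi_le s z (ltW s0) sT') dlt0 H (muP i) ms.
  apply: le_trans (coef_dist E y W) _; rewrite le_eqVlt; apply/orP; left; apply/eqP.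
  by rewrite /Cs -/CC; ring.
pose i := Num.truncn (t / h).
have /andP[i1 i2] : i%:R <= t / h < i.+1%:R by apply: truncn_itv; rewrite divr_ge0// ltW.
have ih : i%:R * h <= t by rewrite -ler_pdivlMr.
have ih' : t < i%:R * h + h by rewrite -[X in _ + X]mul1r -mulrDl natr1 -ltr_pdivrMr.
have ih0 : 0 <= i%:R * h by rewrite mulr_ge0// ltW.
have tT' : t <= T' by rewrite (le_trans tT)// ltW.
have iT' := le_trans ih tT'.
have close y : `|phi i y - psi t y| <= 2 * e1 * decay d y.
  have h1 := Hs h phi b h0 hhs P phi0 phi_le phi_ge stab i y (le_trans ih tT).
  have h2 : `|psi (i%:R * h) y - psi t y| <= e1 * decay d y.
    apply: Hm => //; rewrite distrC ger0_norm ?subr_ge0//.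
    by apply: lt_trans hhm; rewrite ltrBlDl.
  rewrite (le_trans (ler_distD (psi (i%:R * h) y) _ _))//.
  by move: h1 h2; move: (`|_|) (`|_|) (decay d y) => *; lra.
have pd : is_density (p t).
  move: t0; rewrite le_eqVlt => /predU1P[<-|tp]; first by have [_ _ -> _] := pP.
  exact: has_density_is_density (mP t tp).
have e20 : 0 <= 2 * e1 by rewrite mulr_ge0// ltW.
have := density_close K00 n10 (qd i) pd (n1_nn _ iT') (n1_le _ t0 tT')
  (fun z => erefl (phi i z)) (fun z => psiE t z t0 tT') (fun z => phi_le _ z iT')
  (fun z => psi_le t z t0 tT') e20 close x.
rewrite /step_interpolation -/i -/CC => h1; apply: (le_lt_trans h1).
have w1 : decay d x * decay d.+1 x <= 1.
  by rewrite -[leRHS]mulr1 ler_pM ?decay_le1// ltW// decay_gt0.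
apply: (@le_lt_trans _ _ (2 * e1 * CC)).
  by rewrite ler_piMr// mulr_ge0.
have eE : e1 * (2 * CC + 1) = e by rewrite divfK// gt_eqF.
by rewrite -[ltRHS]eE mulrAC [X in X < _]mulrC ltr_pM2l// ltrDl.
Qed.

End uniform_convergence.

Theorem theorem2p13 (R : realType) (d : nat) (d_gt0 : (0 < d)%N)
  (sigma : R) (sigma_gt0 : 0 < sigma)
  (F : P2 R d -> R) (dF : P2 R d -> 'rV[R]_d -> R)
  (F_C1 : linear_derivative F dF)
  (F_convex : P2_convex F)
  (lambda : R) (lambda_gt0 : 0 < lambda)
  (F_coercive : forall m : P2 R d, lambda * second_moment m <= F m)
  (g : 'rV[R]_d -> R) (G : P2 R d -> 'rV[R]_d -> R)
  (dF_split : forall (m : P2 R d) (x : 'rV[R]_d), dF m x = g x + G m x)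
  (g_C2 : class_C 2 g) (G_C2 : forall m : P2 R d, class_C 2 (G m))
  (kappa_lo kappa_hi : R) (kappa_lo_gt0 : 0 < kappa_lo)
  (kappa_le : kappa_lo <= kappa_hi)
  (g_hess : forall x v : 'rV[R]_d,
    kappa_lo * enorm v ^+ 2 <= dot (v *m hess g x) v <= kappa_hi * enorm v ^+ 2)
  (LG : R)
  (G_cont : forall x : 'rV[R]_d, wasserstein_continuous 1 (fun m => G m x))
  (G_lip : forall (m : P2 R d) (x y : 'rV[R]_d),
    `|G m x - G m y| <= LG * enorm (x - y))
  (gradG_lip : forall (m m' : P2 R d) (x y : 'rV[R]_d),
    ((enorm (grad (G m) x - grad (G m') y))%:E <=
     LG%:E * ((enorm (x - y))%:E + wasserstein 1 m m'))%E)
  (p0 v0 w0 : 'rV[R]_d -> R)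
  (v0_C1 : class_C 1 v0) (w0_C1 : class_C 1 w0)
  (p0E : forall x : 'rV[R]_d, p0 x = expR (- (v0 x + w0 x)))
  (p0_mass : (\int[lebesgue_rV R d]_x (p0 x)%:E = 1)%E)
  (eta_lo eta_hi : R) (eta_lo_gt0 : 0 < eta_lo)
  (v0_lip : forall x y : 'rV[R]_d,
    enorm (grad v0 x - grad v0 y) <= eta_hi * enorm (x - y))
  (v0_mono : forall x y : 'rV[R]_d,
    eta_lo * enorm (x - y) ^+ 2 <= dot (grad v0 x - grad v0 y) (x - y))
  (L0 : R)
  (w0_lip : forall x y : 'rV[R]_d,
    `|w0 x - w0 y| + enorm (grad w0 x - grad w0 y) <= L0 * enorm (x - y))
  (q : R -> nat -> 'rV[R]_d -> R)
  (qP : forall h : R, 0 < h -> minimizing_movement F sigma h p0 (q h))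
  (p : R -> 'rV[R]_d -> R)
  (pP : mean_field_schrodinger dF sigma p0 p)
  (T : R) (T_gt0 : 0 < T) :
  {uniform [set z : R * 'rV[R]_d | 0 <= z.1 <= T],
    (fun h : R => fun z => step_interpolation h (q h) z.1 z.2) @ 0^'+ -->
    (fun z : R * 'rV[R]_d => p z.1 z.2)}.
Proof.
(* Some measure is needed to deduce [0 <= LG] from the Lipschitz bound; the dynamics provides one at
   time 1. *)
have [m0 _] : exists m : P2 R d, True.
  by case: pP => _ _ _ /(_ 1 ltr01)[_ [m _]]; exists m.
have LG0 : 0 <= LG by exact: lipschitz_constant_ge0 d_gt0 (G_lip m0).
have E : regular_energy F dF g G LG.
  exact: (RegularEnergy F_C1 dF_split (class_C_continuous g_C2) (fun m => class_CW (G_C2 m))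
    LG0 G_lip gradG_lip).
have [a1 [a2 [Cu [a10 a20 Cu0 coefP]]]] := coef_bounds E g_C2 kappa_lo_gt0 g_hess.
have dF_ge m := dF_bounded_below E m g_C2 kappa_lo_gt0 g_hess.
have [C C0 HC] := quadratic_bounds_monotone L0 v0_C1 eta_lo_gt0 v0_lip v0_mono.
pose V x := v0 x + w0 x; pose C' := C + `|w0 0|.
have C'0 : 0 <= C' by rewrite addr_ge0.
have w0L x : `|w0 x - w0 0| <= L0 * enorm x.
  by have := w0_lip x 0; rewrite subr0; apply: le_trans; rewrite lerDl enorm_ge0.
have VP x : eta_lo / 4 * dot x x - C' <= V x <= C' * bracket x.
  have [h1 h2] := HC x _ (w0L x); have h3 := ler_norm (w0 0).
  have h4 : - `|w0 0| <= w0 0 by rewrite lerNl -normrN ler_norm.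
  have h5 : `|w0 0| <= `|w0 0| * bracket x by rewrite ler_peMr ?bracket_ge1.
  rewrite /V /C' mulrDl; move: h1 h2 h3 h4 h5.
  move: (w0 0) (w0 x) (v0 x) (`|w0 0|) (`|w0 0| * _) (C * _) (eta_lo / 4 * _) => *.
  by apply/andP; split; lra.
have a0 : 0 < eta_lo / 4 by rewrite divr_gt0.
have [[Kp Kp0 p0_le] p0_ge] := sqrt_gibbs_bounds d.+1 a0 C'0 p0E VP.
have c0 : 0 < sigma ^+ 2 / 2 by rewrite divr_gt0// exprn_gt0.
(* Large enough for a multiple of the Gaussian to lie below the initial square root and for its
   Laplacian to beat the coefficient in the lower barrier; the summand 1 ensures [Ag <= Ag ^+ 2]. *)
pose Ag := C' / 2 + Cu / (4 * (sigma ^+ 2 / 2)) + 1.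
have Ag1 : Cu / (4 * (sigma ^+ 2 / 2)) <= Ag.
  by rewrite /Ag -addrA addrCA lerDl addr_ge0// divr_ge0.
have Ag2 : C' / 2 <= Ag.
  by rewrite /Ag -addrA lerDl addr_ge0// divr_ge0// mulr_ge0// ltW.
have Ag3 : 1 <= Ag by rewrite lerDr addr_ge0// divr_ge0// mulr_ge0// ltW.
have CuA : Cu <= 4 * (sigma ^+ 2 / 2) * Ag ^+ 2.
  rewrite mulrC -ler_pdivrMr ?mulr_gt0// (le_trans Ag1)// expr2 ler_peMl//.
  exact: le_trans Ag3.
have p0_gt0 x : 0 < p0 x by rewrite p0E expR_gt0.
have cp0 : continuous p0.
  have -> : p0 = (fun x => expR (- V x)) by apply/funext => x; rewrite p0E.
  apply: (@continuous_compf R d (fun u => expR (- u))).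
    move=> u; apply: (@continuous_comp _ _ _ (fun u : R => - u) expR).
      by apply: (@continuousN _ _ _ id); exact: cvg_id.
    exact: continuous_expR.
  exact: continuous_addf (class_C_continuous v0_C1) (class_C_continuous w0_C1).
have p0P : is_density p0.
  split=> //; first by move=> x; exact: ltW.
  exact: continuous_mfun.
have p0B : exists B : R, forall x, p0 x <= B.
  exists (expR C') => x; rewrite p0E ler_expR; have /andP[h _] := VP x.
  have : 0 <= eta_lo / 4 * dot x x by rewrite mulr_ge0 ?dot_ge0// ltW.
  by move: h; rewrite /V; move: (_ * dot x x) (v0 x) (w0 x) => *; lra.
have conv (e : R) : 0 < e -> exists2 h0 : R, 0 < h0 & forall h t x, 0 < h -> h < h0 ->
    0 <= t -> t <= T -> `|step_interpolation h (q h) t x - p t x| < e.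
  exact: (uniform_convergence E sigma_gt0 a10 a20 Cu0 Kp0 (expR_gt0 _) (lt_le_trans ltr01 Ag3)
    CuA coefP dF_ge p0P cp0 p0_gt0 p0B p0_le (p0_ge Ag Ag2) qP pP T_gt0).
move=> P /uniform_nbhs[B []]; rewrite -entourage_ballE => -[e /= e0 eB] BP.
have [h0 h00 H] := conv e e0.
near=> h; apply: BP => -[t x] /= /andP[t0 tT]; apply: eB.
by rewrite /ball /= distrC; apply: H.
Unshelve. all: by end_near.
Qed.
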